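(* Let $(A,\mathfrak m)$ be an excellent two-dimensional normal local ring containing an algebraically closed field $k\cong A/\mathfrak m$, let $X\to\operatorname{Spec}A$ be a resolution of singularities, and let $Z$ be a $p_g$-cycle on $X$. Then for any cycle $Z'>0$ on $X$ such that $\mathcal O_X(-Z')$ is generated by global sections, $\varepsilon(Z,Z')=0$. In particular, $Z'$ is a $p_g$-cycle if and only if $Z+Z'$ is a $p_g$-cycle. When this is the case, if $f\in I_Z$ and $f'\in I_{Z'}$ are general elements, then $$I_{Z+Z'}=fI_{Z'}+f'I_Z .$$
   Context: A cycle is a divisor on $X$ supported in the exceptional divisor $E$ (the preimage of $\mathfrak m$). For a cycle $Z$, $I_Z=H^0(X,\mathcal O_X(-Z))\subset A$. $h^i(\mathcal F)=\ell_A(H^i(X,\mathcal F))$ denotes length and $p_g(A)=h^1(\mathcal O_X)$. A cycle $Z>0$ is a $p_g$-cycle if $\mathcal O_X(-Z)$ is generated by global sections and $h^1(\mathcal O_X(-Z))=p_g(A)$. For cycles $Z_1,Z_2$ with $\mathcal O_X(-Z_1),\mathcal O_X(-Z_2)$ generated, elements $f_1\in I_{Z_1}$, $f_2\in I_{Z_2}$ are called general if the sequence $0\to\mathcal O_X\to\mathcal O_X(-Z_1)\oplus\mathcal O_X(-Z_2)\to\mathcal O_X(-Z_1-Z_2)\to0$, with maps $u\mapsto(f_1u,f_2u)$ and $(a,b)\mapsto -f_2a+f_1b$, is exact; such elements exist. One sets $\varepsilon(Z_1,Z_2)=\ell_A\bigl(I_{Z_1+Z_2}/(f_1I_{Z_2}+f_2I_{Z_1})\bigr)$,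 which is independent of the choice of general elements. *)

(* Defs.v *)
From HB Require Import structures.
From mathcomp Require Import all_boot all_order all_algebra.
From mathcomp Require Import boolp classical_sets functions cardinality filter.
From mathcomp Require Import topology_structure.

Set Implicit Arguments.
Unset Strict Implicit.
Unset Printing Implicit Defensive.

Import GRing.Theory.
Local Open Scope classical_set_scope.
Local Open Scope ring_scope.

(** * Commutative algebra *)

Section Ideals.
Variable R : comUnitRingType.
Implicit Types (I J P G : set R) (s : seq R).

Definition is_ideal I : Prop :=
  [/\ I 0, forall a b, I a -> I b -> I (a + b) & forall r a, I a -> I (r * a)].

Definition is_prime P : Prop :=
  [/\ is_ideal P, ~ P 1 & forall a b, P (a * b) -> P a \/ P b].

Definition gen_ideal G : set R :=
  [set x | forall I, is_ideal I -> G `<=` I -> I x].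

Definition ideal_mul I J : set R := gen_ideal [set a * b | a in I & b in J].

Fixpoint ideal_pow I (n : nat) : set R :=
  if n is n'.+1 then ideal_mul I (ideal_pow I n') else setT.

Definition noetherian : Prop :=
  forall I, is_ideal I -> exists s, I = gen_ideal [set` s].

Definition nonunits : set R := [set a | a \isn't a GRing.unit].

(* MathComp rings are nontrivial, so this is the usual notion of local ring;
   the maximal ideal is then [nonunits]. *)
Definition is_local : Prop :=
  forall a b, nonunits a -> nonunits b -> nonunits (a + b).

Definition prime_chain (P : nat -> set R) (n : nat) : Prop :=
  (forall i, (i <= n)%N -> is_prime (P i)) /\
  (forall i, (i < n)%N -> P i `<` P i.+1).

Definition krull_dim (d : nat) : Prop :=
  (exists P : nat -> set R, prime_chain P d) /\
  (forall (P : nat -> set R) n, prime_chain P n -> (n <= d)%N).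

Definition regular_local : Prop :=
  [/\ is_local, noetherian &
      exists2 d, krull_dim d &
        exists2 s, size s = d & nonunits = gen_ideal [set` s]].

Definition saturated_chain (P : nat -> set R) (n : nat) : Prop :=
  prime_chain P n /\
  forall i Q, (i < n)%N -> is_prime Q -> ~ (P i `<` Q /\ Q `<` P i.+1).

Definition catenary : Prop :=
  forall (P P' : nat -> set R) m n, saturated_chain P m -> saturated_chain P' n ->
    P 0%N = P' 0%N -> P m = P' n -> m = n.

Definition is_subring (T : set R) : Prop :=
  [/\ T 1, forall a b, T a -> T b -> T (a - b)
         & forall a b, T a -> T b -> T (a * b)].

Definition gen_subring G : set R :=
  [set x | forall T, is_subring T -> G `<=` T -> T x].

End Ideals.

Definition finite_type_alg (A B : comUnitRingType) (h : {rmorphism A -> B}) :=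
  exists s : seq B, gen_subring (range h `|` [set` s]) = setT.

(* Localizations, completions and tensor products are used through the
   properties that determine them up to unique isomorphism. *)

Definition is_localization (B R : comUnitRingType) (P : set B)
    (h : {rmorphism B -> R}) : Prop :=
  [/\ forall s, ~ P s -> h s \is a GRing.unit,
      forall r, exists b s, ~ P s /\ h s * r = h b
    & forall b, h b = 0 -> exists2 s, ~ P s & s * b = 0].

Definition regular_at (B : comUnitRingType) (P : set B) : Prop :=
  forall (R : comUnitRingType) (h : {rmorphism B -> R}),
    is_localization P h -> regular_local R.

Definition regular_ring (B : comUnitRingType) : Prop :=
  noetherian B /\ forall P : set B, is_prime P -> regular_at P.

(* [c] exhibits [C] as the completion of [R] at its maximal ideal [m]:
   R/m^n -> C/m^n C is bijective for all n, and C is mC-adically separated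
   and complete. *)
Definition is_completion (R C : comUnitRingType) (c : {rmorphism R -> C}) :=
  let mC n := gen_ideal (c @` ideal_pow (@nonunits R) n) in
  [/\ forall n x, exists r, mC n (x - c r),
      forall n r, mC n (c r) -> ideal_pow (@nonunits R) n r,
      forall x, (forall n, mC n x) -> x = 0
    & forall u : nat -> C, (forall n, mC n (u n.+1 - u n)) ->
        exists x, forall n, mC n (x - u n)].

(* [T] is the tensor product of [B] and [C] over [R]. *)
Definition is_pushout (R B C T : comUnitRingType)
    (f : {rmorphism R -> B}) (g : {rmorphism R -> C})
    (i : {rmorphism B -> T}) (j : {rmorphism C -> T}) : Prop :=
  (forall r, i (f r) = j (g r)) /\
  forall (W : comUnitRingType) (u : {rmorphism B -> W}) (v : {rmorphism C -> W}),
    (forall r, u (f r) = v (g r)) ->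
    exists w : {rmorphism T -> W},
      [/\ forall b, w (i b) = u b, forall c, w (j c) = v c
        & forall w' : {rmorphism T -> W},
            (forall b, w' (i b) = u b) -> (forall c, w' (j c) = v c) -> w' =1 w].

(* [L] is a finite extension of the residue field of [R] at the prime
   ker psi. *)
Definition finite_residue_ext (R : comUnitRingType) (L : fieldType)
    (psi : {rmorphism R -> L}) : Prop :=
  exists (n : nat) (e : 'I_n -> L), forall l : L,
    exists (d : R) (a : 'I_n -> R),
      psi d != 0 /\ psi d * l = \sum_(i < n) psi (a i) * e i.

(* The fibres of R -> C are geometrically regular. *)
Definition geom_regular_fibres (R C : comUnitRingType)
    (c : {rmorphism R -> C}) : Prop :=
  forall (L : fieldType) (psi : {rmorphism R -> L}), finite_residue_ext psi ->
  forall (T : comUnitRingType) (i : {rmorphism C -> T}) (j : {rmorphism L -> T}),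
    is_pushout c psi i j -> regular_ring T.

Definition G_ring (A : comUnitRingType) : Prop :=
  forall (P : set A) (R C : comUnitRingType)
         (l : {rmorphism A -> R}) (c : {rmorphism R -> C}),
    is_prime P -> is_localization P l -> is_completion c ->
    geom_regular_fibres c.

Definition open_regular_locus (B : comUnitRingType) : Prop :=
  exists I : set B, forall P, is_prime P -> (regular_at P <-> ~ (I `<=` P)).

Definition J2 (A : comUnitRingType) : Prop :=
  forall (B : comUnitRingType) (h : {rmorphism A -> B}),
    finite_type_alg h -> open_regular_locus B.

Definition universally_catenary (A : comUnitRingType) : Prop :=
  forall (B : comUnitRingType) (h : {rmorphism A -> B}),
    finite_type_alg h -> catenary B.

Definition excellent (A : comUnitRingType) : Prop :=
  [/\ noetherian A, universally_catenary A, G_ring A & J2 A].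

Definition normal_domain (A : idomainType) : Prop :=
  forall z : {fraction A},
    integralOver (@tofrac A) z -> exists a : A, z = tofrac a.

(** * Length *)

(* [has_length add act N M n]: the A-module M/N has finite length n, where
   N is contained in M and both are A-submodules of V. *)
Section Length.
Variables (A : comUnitRingType) (V : Type).
Variables (add : V -> V -> V) (act : A -> V -> V).

Definition is_submodule (M : set V) : Prop :=
  [/\ M !=set0, forall u v, M u -> M v -> M (add u v)
              & forall a v, M v -> M (act a v)].

Definition submodule_chain (N M : set V) (P : nat -> set V) (n : nat) : Prop :=
  [/\ P 0%N = N, P n = M, forall i, (i <= n)%N -> is_submodule (P i)
    & forall i, (i < n)%N -> P i `<` P i.+1].

Definition has_length (N M : set V) (n : nat) : Prop :=
  (exists P, submodule_chain N M P n) /\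
  (forall P m, submodule_chain N M P m -> (m <= n)%N).

End Length.

(** * Schemes *)

(* A locally ringed space, its structure sheaf being given as the sheaf of
   sections of its etale space: a section over an open set U is a family of
   elements of the stalks, of which only the values at points of U matter.
   [ls_sect U s] is meaningful for U open only. *)
Record lrspace := LRSpace {
  ls_space :> topologicalType;
  stalk : ls_space -> comUnitRingType;
  ls_sect : set ls_space -> (forall x, stalk x) -> Prop;
  ls_ext : forall U s t, open U -> (forall x, U x -> s x = t x) ->
    ls_sect U s -> ls_sect U t;
  ls_sect1 : forall U, open U -> ls_sect U (fun=> 1);
  ls_sectB : forall U s t, open U -> ls_sect U s -> ls_sect U t ->
    ls_sect U (fun x => s x - t x);
  ls_sectM : forall U s t, open U -> ls_sect U s -> ls_sect U t ->
    ls_sect U (fun x => s x * t x);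
  ls_res : forall U V s, open U -> open V -> V `<=` U ->
    ls_sect U s -> ls_sect V s;
  ls_glue : forall U s, open U ->
    (forall x, U x -> exists V, [/\ open V, V x, V `<=` U & ls_sect V s]) ->
    ls_sect U s;
  ls_germ : forall x (a : stalk x), exists U s,
    [/\ open U, U x, ls_sect U s & s x = a];
  ls_germ0 : forall U s x, open U -> ls_sect U s -> U x -> s x = 0 ->
    exists V, [/\ open V, V x, V `<=` U & forall y, V y -> s y = 0];
  ls_local : forall x, is_local (stalk x)
}.

(* [phi] identifies the open subspace [U] of [X] with Spec B: its points with
   the primes of B, its topology with the Zariski topology, and its stalks
   with the localizations of B. Sections over opens of U are then
   automatically those of the structure sheaf of Spec B. *)
Record is_Spec (B : comUnitRingType) (X : lrspace) (U : set X)
    (phi : B -> forall x : X, stalk x) : Prop := IsSpec {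
  Spec_open : open U;
  Spec_sect : forall b, ls_sect U (phi b);
  Spec_surj : forall P : set B, is_prime P ->
    exists2 x, U x & P = [set b | nonunits (phi b x)];
  Spec_inj : forall x y, U x -> U y ->
    (forall b, nonunits (phi b x) <-> nonunits (phi b y)) -> x = y;
  Spec_top : forall V, V `<=` U ->
    (open V <-> exists T : set B, forall x, U x ->
       (V x <-> exists2 b, T b & phi b x \is a GRing.unit));
  Spec_stalk : forall x, U x -> exists2 h : {rmorphism B -> stalk x},
    (forall b, h b = phi b x) & is_localization [set b | nonunits (phi b x)] h
}.

Record scheme := Scheme {
  sch_space :> lrspace;
  sch_affine : forall x : sch_space,
    exists (B : comUnitRingType) (U : set sch_space) phi,
      U x /\ @is_Spec B sch_space U phi
}.

Record morphism (X Y : lrspace) := Morphism {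
  mor_fun :> X -> Y;
  mor_stalk : forall x, {rmorphism stalk (mor_fun x) -> stalk x};
  mor_continuous : continuous mor_fun;
  mor_local : forall x a,
    mor_stalk x a \is a GRing.unit -> a \is a GRing.unit;
  mor_sect : forall V s, open V -> ls_sect V s ->
    ls_sect (mor_fun @^-1` V) (fun x => mor_stalk x (s (mor_fun x)))
}.

Definition pullback (X Y : lrspace) (f : morphism X Y)
    (s : forall y : Y, stalk y) : forall x : X, stalk x :=
  fun x => mor_stalk f x (s (f x)).

Section Composition.
Variables (X Y Z : lrspace) (f : morphism X Y) (g : morphism Y Z).

Let h (x : X) : Z := g (f x).
Let h_stalk (x : X) : {rmorphism stalk (h x) -> stalk x} :=
  [the {rmorphism stalk (g (f x)) -> stalk x} of
     mor_stalk f x \o mor_stalk g (f x)].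

Fact comp_continuous : continuous h.
Proof.
move=> x; apply: (@continuous_comp _ _ _ f g); exact: mor_continuous.
Qed.

Fact comp_local x a : h_stalk x a \is a GRing.unit -> a \is a GRing.unit.
Proof. by move=> /= /mor_local /mor_local. Qed.

Fact comp_sect V s : open V -> ls_sect V s ->
  ls_sect (h @^-1` V) (fun x => h_stalk x (s (h x))).
Proof.
move=> oV sV; have /mor_sect := mor_sect g oV sV; apply.
by apply: open_comp => // x _; apply: mor_continuous.
Qed.

Definition mor_comp : morphism X Z :=
  Morphism comp_continuous comp_local comp_sect.

End Composition.

Section Identity.
Variable X : lrspace.

Let id_stalk (x : X) : {rmorphism stalk (id x) -> stalk x} :=
  [the {rmorphism stalk x -> stalk x} of idfun].

Fact id_continuous : continuous (@id X). Proof. by move=> x; exact: cvg_id. Qed.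

Fact id_local x a : id_stalk x a \is a GRing.unit -> a \is a GRing.unit.
Proof. by []. Qed.

Fact id_sect V s : open V -> ls_sect V s ->
  ls_sect (@id X @^-1` V) (fun x => id_stalk x (s (id x))).
Proof. by []. Qed.

Definition mor_id : morphism X X := Morphism id_continuous id_local id_sect.

End Identity.

(* The stalk maps of [f] and [g] have different types; they are compared
   through the sections they pull back. *)
Definition mor_eq (X Y : lrspace) (f g : morphism X Y) : Prop :=
  f =1 g /\
  forall V s, open V -> ls_sect V s ->
    forall x, V (f x) -> pullback f s x = pullback g s x.

Definition is_fibre_product (X Y S P : scheme) (f : morphism X S)
    (g : morphism Y S) (p1 : morphism P X) (p2 : morphism P Y) : Prop :=
  mor_eq (mor_comp p1 f) (mor_comp p2 g) /\
  forall (T : scheme) (u : morphism T X) (v : morphism T Y),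
    mor_eq (mor_comp u f) (mor_comp v g) ->
    exists w : morphism T P,
      [/\ mor_eq (mor_comp w p1) u, mor_eq (mor_comp w p2) v
        & forall w' : morphism T P, mor_eq (mor_comp w' p1) u ->
            mor_eq (mor_comp w' p2) v -> mor_eq w' w].

Definition closed_map (X Y : lrspace) (f : morphism X Y) : Prop :=
  forall C : set X, closed C -> closed (f @` C).

Definition closed_immersion (X Y : lrspace) (f : morphism X Y) : Prop :=
  [/\ injective f, closed_map f
    & forall x (a : stalk x), exists b, mor_stalk f x b = a].

Definition separated (X S : scheme) (f : morphism X S) : Prop :=
  forall (P : scheme) (p1 p2 : morphism P X) (delta : morphism X P),
    is_fibre_product f f p1 p2 ->
    mor_eq (mor_comp delta p1) (mor_id X) ->
    mor_eq (mor_comp delta p2) (mor_id X) ->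
    closed_immersion delta.

Definition universally_closed (X S : scheme) (f : morphism X S) : Prop :=
  forall (S' P : scheme) (g : morphism S' S)
         (p1 : morphism P X) (p2 : morphism P S'),
    is_fibre_product f g p1 p2 -> closed_map p2.

Definition finite_type (X S : scheme) (f : morphism X S) : Prop :=
  forall y : S, exists (B : comUnitRingType) (V : set S) phi,
    [/\ V y, @is_Spec B S V phi &
      exists (n : nat) (U : 'I_n -> set X),
        f @^-1` V = \bigcup_i U i /\
        forall i, exists (C : comUnitRingType) (h : {rmorphism B -> C}) psi,
          [/\ @is_Spec C X (U i) psi, finite_type_alg h
            & forall b x, U i x -> psi (h b) x = pullback f (phi b) x]].

Definition proper (X S : scheme) (f : morphism X S) : Prop :=
  [/\ finite_type f, separated f & universally_closed f].

Definition integral_scheme (X : scheme) : Prop :=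
  [/\ [set: X] !=set0,
      forall U V : set X, open U -> open V -> U !=set0 -> V !=set0 ->
        U `&` V !=set0
    & forall (x : X) (a : stalk x) n, a ^+ n = 0 -> a = 0].

Definition regular_scheme (X : scheme) : Prop :=
  forall x : X, regular_local (stalk x).

(* f induces an isomorphism between dense open subschemes. *)
Definition birational (X S : scheme) (f : morphism X S) : Prop :=
  exists (U : set X) (V : set S),
    [/\ open U, dense U, open V & dense V] /\
    [/\ set_bij U V f,
        forall W, open W -> W `<=` U -> open (f @` W)
      & forall x, U x -> bijective (mor_stalk f x)].

Definition is_resolution (X S : scheme) (f : morphism X S) : Prop :=
  [/\ integral_scheme X, regular_scheme X, proper f & birational f].

(** * Cohomology of sheaves of O_X-submodules of O_X *)

Section Cech.
Variables (X : lrspace) (F : set X -> (forall x : X, stalk x) -> Prop).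

(* Open covers indexed by the points, x being in U x, are cofinal among all
   open covers. *)
Definition pointed_cover (U : X -> set X) : Prop :=
  forall x, open (U x) /\ U x x.

(* Families (s x x'), x, x' in X, of functions to the stalks, such that for
   some pointed cover U the restrictions of the s x x' to the U x `&` U x'
   form a Cech 1-cocycle (resp. coboundary) of U with coefficients in F.
   The quotient of the first set by the second is the colimit over all open
   covers of the Cech cohomology groups, that is, H^1(X, F). *)
Definition cech_cocycles : set (X -> X -> forall y : X, stalk y) :=
  [set s | exists2 U, pointed_cover U &
    (forall x x', F (U x `&` U x') (s x x')) /\
    (forall x x' x'' y, U x y -> U x' y -> U x'' y ->
       s x x' y + s x' x'' y = s x x'' y)].

Definition cech_coboundaries : set (X -> X -> forall y : X, stalk y) :=
  [set s | exists2 U, pointed_cover U &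
    exists2 t : X -> forall y : X, stalk y, (forall x, F (U x) (t x)) &
      forall x x' y, U x y -> U x' y -> s x x' y = t x' y - t x y].

End Cech.

(** * Cycles on a scheme over Spec A *)

(* [pi : X -> S] is a morphism to S = Spec A, A a local ring; [phi] is the
   identification of S with Spec A. *)
Section Cycles.
Variables (A : comUnitRingType) (S : scheme)
  (phi : A -> forall s : S, stalk s) (X : scheme) (pi : morphism X S).
Implicit Types (Z : X -> nat) (f : A).

Definition fun_of (a : A) : forall x : X, stalk x := pullback pi (phi a).

(* The fibre of pi over the maximal ideal of A. *)
Definition exceptional_set : set X :=
  [set x | forall a, phi a (pi x) \is a GRing.unit -> a \is a GRing.unit].

(* A prime divisor of X is represented by its generic point. *)
Definition exceptional_prime : set X :=
  [set x | exceptional_set x /\ krull_dim (stalk x) 1].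

(* Effective cycles, i.e. cycles >= 0, given by the multiplicities of the
   exceptional prime divisors. *)
Definition is_cycle Z : Prop :=
  finite_set [set x | Z x != 0%N] /\
  forall x, Z x != 0%N -> exceptional_prime x.

Definition positive_cycle Z : Prop := is_cycle Z /\ exists x, Z x != 0%N.

Definition zero_cycle : X -> nat := fun=> 0%N.

Definition add_cycle Z1 Z2 : X -> nat := fun x => (Z1 x + Z2 x)%N.

(* The sections of O_X(-Z): those sections of O_X which vanish along each
   prime divisor E to order at least the multiplicity of E in Z. *)
Definition OmZ Z (U : set X) (s : forall x : X, stalk x) : Prop :=
  ls_sect U s /\ forall x, U x -> ideal_pow (@nonunits (stalk x)) (Z x) (s x).

Definition OmZ_stalk Z (x : X) : set (stalk x) :=
  [set a | exists U s, [/\ open U, U x, OmZ Z U s & s x = a]].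

Definition globally_generated Z : Prop :=
  forall x : X, @OmZ_stalk Z x =
    gen_ideal [set a | exists2 s, OmZ Z setT s & s x = a].

(* I_Z, as an ideal of A = H^0(X, O_X). *)
Definition I_ Z : set A := [set a | OmZ Z setT (fun_of a)].

(* h^1(O_X(-Z)) = n *)
Definition h1 Z (n : nat) : Prop :=
  has_length (fun s t x x' y => s x x' y + t x x' y)
             (fun a s x x' y => fun_of a y * s x x' y)
             (cech_coboundaries (OmZ Z)) (cech_cocycles (OmZ Z)) n.

(* p_g(A) = n *)
Definition p_g (n : nat) : Prop := h1 zero_cycle n.

Definition pg_cycle Z : Prop :=
  [/\ positive_cycle Z, globally_generated Z
    & exists2 n, p_g n & h1 Z n].

(* Exactness is expressed on stalks. *)
Definition general_elements Z1 Z2 f1 f2 : Prop :=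
  [/\ I_ Z1 f1, I_ Z2 f2 &
  forall x, let g1 := fun_of f1 x in let g2 := fun_of f2 x in
  [/\ forall u : stalk x, g1 * u = 0 -> g2 * u = 0 -> u = 0,
      forall a b : stalk x, OmZ_stalk Z1 a -> OmZ_stalk Z2 b ->
        (- g2) * a + g1 * b = 0 -> exists u, a = g1 * u /\ b = g2 * u
    & forall c : stalk x, OmZ_stalk (add_cycle Z1 Z2) c ->
        exists a b, [/\ OmZ_stalk Z1 a, OmZ_stalk Z2 b
                      & c = (- g2) * a + g1 * b]]].

(* f1 I_{Z2} + f2 I_{Z1} *)
Definition mixed_ideal Z1 Z2 f1 f2 : set A :=
  [set f1 * u + f2 * v | u in I_ Z2 & v in I_ Z1].

(* epsilon(Z1, Z2) = n: general elements exist, and all of them give n. *)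
Definition epsilon Z1 Z2 (n : nat) : Prop :=
  (exists f1 f2, general_elements Z1 Z2 f1 f2) /\
  forall f1 f2, general_elements Z1 Z2 f1 f2 ->
    has_length (fun u v : A => u + v) (fun a u : A => a * u)
      (mixed_ideal Z1 Z2 f1 f2) (I_ (add_cycle Z1 Z2)) n.

End Cycles.

(* Main.v *)
(* Put F = Frac A. Stalks of X embed into F, and H^1(O(-Y)) becomes a quotient of
   a group of 0-cochains of rational functions. Multiplication by a section g of
   O(-Z) that generates it along the exceptional curves and outside finitely many
   points has a cokernel with affine support, so g maps H^1(O) onto H^1(O(-Z)) and
   H^1(O(-Z')) onto H^1(O(-Z-Z')); for a p_g-cycle Z the first map is injective by
   equality of lengths. If (f, f') is a general pair, the exact sequence
   0 -> O -> O(-Z) + O(-Z') -> O(-Z-Z') -> 0 identifies I_{Z+Z'}/(f I_{Z'} + f' I_Z)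
   with the kernel K of H^1(O) -> H^1(O(-Z)) + H^1(O(-Z')). The same sequence shows
   that f maps ker(f' | H^1(O)) onto ker(f' | H^1(O(-Z))), while g maps the first of
   these injectively into the second; as lengths are finite, f is injective on
   ker(f' | H^1(O)), that is, K = 0. For a general pair starting with g it follows
   that g is bijective from H^1(O(-Z')) to H^1(O(-Z-Z')), whence the statement on
   p_g-cycles.

   Neither coherence theorems nor intersection numbers are used. The surjectivity
   statement rests on partitions of unity along the curves where g fails to generate;
   these exist because two closed points of such a curve are separated by sections,
   which is where the separatedness of X enters, through an explicit construction of
   the self-product of X over Spec A. *)

Require Import Defs.
From HB Require Import structures.
From mathcomp Require Import all_boot all_order all_algebra.
From mathcomp Require Import ring zify generic_quotient fraction.
From mathcomp Require Import boolp classical_sets functions cardinality filter.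
From mathcomp Require Import topology_structure.

Set Implicit Arguments.
Unset Strict Implicit.
Unset Printing Implicit Defensive.

Import GRing.Theory.
Local Open Scope classical_set_scope.
Local Open Scope ring_scope.

(** * Noetherian subrings *)

(** All rings are subsets of one ambient ring, usually F, and primes, localizations and chain
    conditions are taken relative to such a subset. Local rings at different points can then be
    compared, added and intersected without maps between them. The obstacle is a curve y along which
    the section g fails to generate O(-Z) and which meets the exceptional fibre in several points p.
    One wants rational functions close to 1 at one of these points and to 0 at the others. The rings
    [O p + g O y] involved are neither normal nor known to have a finite integral closure.
    Integrality over them is therefore replaced by bounded denominators in some a of the maximal
    ideal of A that is a unit at y, and finiteness by Krull-Akizuki arguments. The residue field
    enters twice: it is infinite, which allows general linear combinations, and it is algebraically
    closed, so that residues at p come from A. Normality identifies the stalks at non-exceptional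
    points with localizations of A; catenarity gives dimension two at the closed points of
    exceptional curves, where regularity then provides two parameters. *)

Section RelativeIdeals.
Variable B : comUnitRingType.
Implicit Types (R I J P S : set B) (x y : B).

Lemma sub1 R : is_subring R -> R 1. Proof. by case. Qed.
Lemma subB R x y : is_subring R -> R x -> R y -> R (x - y).
Proof. by case=> _ h _; apply: h. Qed.
Lemma subM R x y : is_subring R -> R x -> R y -> R (x * y).
Proof. by case=> _ _; apply. Qed.
Lemma sub0 R : is_subring R -> R 0.
Proof. by move=> h; rewrite -(subrr 1); apply: subB => //; exact: sub1. Qed.
Lemma subN R x : is_subring R -> R x -> R (- x).
Proof. by move=> h Rx; rewrite -sub0r; apply: subB => //; exact: sub0. Qed.
Lemma subD R x y : is_subring R -> R x -> R y -> R (x + y).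
Proof. by move=> h Rx Ry; rewrite -[y]opprK; apply: subB => //; exact: subN. Qed.
Lemma subX R x n : is_subring R -> R x -> R (x ^+ n).
Proof.
move=> h Rx; elim: n => [|n IH]; first exact: sub1.
by rewrite exprS; apply: subM.
Qed.
Lemma sub_sum R (I : Type) (r : seq I) (Q : pred I) (f : I -> B) :
  is_subring R -> (forall i, Q i -> R (f i)) -> R (\sum_(i <- r | Q i) f i).
Proof.
move=> h hf; apply: big_ind => //; first exact: sub0.
by move=> *; apply: subD.
Qed.
Lemma subMn R x n : is_subring R -> R x -> R (x *+ n).
Proof.
move=> h Rx; elim: n => [|n IH]; first by rewrite mulr0n; exact: sub0.
by rewrite mulrS; apply: subD.
Qed.
Lemma subringT : is_subring [set: B]. Proof. by []. Qed.

Definition is_mod R I :=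
  [/\ I 0, forall a b, I a -> I b -> I (a + b) & forall r a, R r -> I a -> I (r * a)].

Definition is_idl R I := is_mod R I /\ I `<=` R.

Definition is_rprime R P :=
  [/\ is_idl R P, ~ P 1 & forall a b, R a -> R b -> P (a * b) -> P a \/ P b].

Lemma mod0 R I : is_mod R I -> I 0. Proof. by case. Qed.
Lemma modD R I x y : is_mod R I -> I x -> I y -> I (x + y).
Proof. by case=> _ h _; apply: h. Qed.
Lemma modM R I x y : is_mod R I -> R x -> I y -> I (x * y).
Proof. by case=> _ _; apply. Qed.
Lemma modN R I x : is_subring R -> is_mod R I -> I x -> I (- x).
Proof.
move=> sR mI Ix; rewrite -mulN1r; apply: (modM mI) => //.
by apply: subN => //; apply: sub1.
Qed.
Lemma modB R I x y : is_subring R -> is_mod R I -> I x -> I y -> I (x - y).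
Proof. by move=> sR mI Ix Iy; apply: (modD mI) => //; apply: (modN sR mI). Qed.
Lemma mod_sum R I (T : Type) (r : seq T) (Q : pred T) (f : T -> B) :
  is_mod R I -> (forall i, Q i -> I (f i)) -> I (\sum_(i <- r | Q i) f i).
Proof.
move=> h hf; apply: big_ind => //; first exact: mod0 h.
by move=> *; apply: (modD h).
Qed.
Lemma modDl R I x y : is_subring R -> is_mod R I -> I x -> I (x + y) -> I y.
Proof.
move=> sR mI Ix Ixy; have := modB sR mI Ixy Ix.
by rewrite addrC addKr.
Qed.

Lemma mod_subring R : is_subring R -> is_mod R R.
Proof. by move=> h; split=> *; [exact: sub0|exact: subD|exact: subM]. Qed.

Definition sum_set I J := [set z | exists x y, [/\ I x, J y & z = x + y]].
Definition scale_set x I := [set x * y | y in I].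

Lemma sum_mod R I J : is_mod R I -> is_mod R J -> is_mod R (sum_set I J).
Proof.
move=> mI mJ; split.
- by exists 0, 0; rewrite addr0; split=> //; [exact: mod0 mI|exact: mod0 mJ].
- move=> _ _ [a [b [Ia Jb ->]]] [c [d [Ic Jd ->]]].
  exists (a + c), (b + d); split; [exact: modD mI _ _|exact: modD mJ _ _|].
  by rewrite addrACA.
- move=> r _ Rr [a [b [Ia Jb ->]]]; exists (r * a), (r * b).
  by rewrite mulrDr; split=> //; [exact: modM mI _ _|exact: modM mJ _ _].
Qed.

Lemma scale_mod R I x : is_mod R I -> is_mod R (scale_set x I).
Proof.
move=> mI; split.
- by exists 0; rewrite ?mulr0 //; exact: mod0 mI.
- move=> _ _ [a Ia <-] [b Ib <-]; exists (a + b); rewrite ?mulrDr //.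
  exact: modD mI _ _.
- move=> r _ Rr [a Ia <-]; exists (r * a); rewrite 1?mulrCA //.
  exact: modM mI _ _.
Qed.

Lemma sum_setl R I J : is_mod R J -> I `<=` sum_set I J.
Proof. by move=> mJ x Ix; exists x, 0; rewrite addr0; split=> //; exact: mod0 mJ. Qed.
Lemma sum_setr R I J : is_mod R I -> J `<=` sum_set I J.
Proof. by move=> mI x Jx; exists 0, x; rewrite add0r; split=> //; exact: mod0 mI. Qed.

Lemma setI_mod R I J : is_mod R I -> is_mod R J -> is_mod R (I `&` J).
Proof.
move=> mI mJ; split; first by split; [exact: mod0 mI|exact: mod0 mJ].
  by move=> a b [? ?] [? ?]; split; [exact: modD mI _ _|exact: modD mJ _ _].
by move=> r a Rr [? ?]; split; [exact: modM mI _ _|exact: modM mJ _ _].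
Qed.

Lemma mod_sub R R' I : R' `<=` R -> is_mod R I -> is_mod R' I.
Proof. by move=> sR [h0 hD hM]; split=> // r a /sR; exact: hM. Qed.

Lemma prime_avoiding R I S : is_subring R -> is_idl R I ->
    S 1 -> (forall a b, S a -> S b -> S (a * b)) -> S `<=` R ->
    (forall a, S a -> ~ I a) ->
  exists P, [/\ is_rprime R P, I `<=` P & forall a, S a -> ~ P a].
Proof.
move=> sR iI S1 SM SR SI.
(* The empty chain has empty union, so Zorn's lemma forces [set0] into the family; comparison with
   [I] later shows that the maximal member is not empty. *)
pose Q J := J = set0 \/ [/\ is_idl R J, I `<=` J & forall a, S a -> ~ J a].
have [F FQ Ftot|P [PQ Pmax]] := @Zorn_bigcup B Q.
  have [|/existsNP[x /not_implyP[Fx x0]]] := pselect (forall X, F X -> X = set0).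
    move=> F0; left; apply/seteqP; split=> // x [X FX Xx].
    by rewrite (F0 _ FX) in Xx.
  have Qx : [/\ is_idl R x, I `<=` x & forall a, S a -> ~ x a].
    by case: (FQ _ Fx).
  have FQ' X a : F X -> X a -> [/\ is_idl R X, I `<=` X & forall a, S a -> ~ X a].
    by move=> FX Xa; case: (FQ _ FX) => // X0; rewrite X0 in Xa.
  right; split.
  - split; last by move=> a [X FX Xa]; have [[_ +] _ _] := FQ' _ _ FX Xa; apply.
    split.
    + by exists x => //; case: Qx => [[[]]].
    + move=> a b [X FX Xa] [Y FY Yb].
      have [XY|YX] := Ftot _ _ FX FY.
        exists Y => //; have [[mY _] _ _] := FQ' _ _ FY Yb.
        by apply: (modD mY) => //; exact: XY.
      exists X => //; have [[mX _] _ _] := FQ' _ _ FX Xa.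
      by apply: (modD mX) => //; exact: YX.
    + move=> r a Rr [X FX Xa]; exists X => //.
      by have [[mX _] _ _] := FQ' _ _ FX Xa; apply: (modM mX).
  - by case: Qx => _ Ix _ a Ia; exists x => //; exact: Ix.
  - by move=> a Sa [X FX Xa]; have [_ _ +] := FQ' _ _ FX Xa; apply; first exact: Sa.
have QI : Q I by right; split.
have PI : [/\ is_idl R P, I `<=` P & forall a, S a -> ~ P a].
  case: PQ => // P0; exfalso; have := Pmax I; rewrite P0; apply; last exact: QI.
  by split=> // /(_ 0); apply; case: iI => -[].
have [iP IP SP] := PI; have [mP PR] := iP.
exists P; split=> //; split=> //; first exact: SP.
move=> a b Ra Rb Pab; apply: contrapT => /not_orP[nPa nPb].
(* By maximality, adjoining to [P] an element outside it produces an ideal meeting [S]. The product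
   of two elements of [S] so obtained, for [a] and for [b], falls back into [P]. *)
have ext c : R c -> ~ P c -> exists2 s, S s & sum_set P (scale_set c R) s.
  move=> Rc nPc; apply: contrapT => /forall2NP h.
  have mJ : is_mod R (sum_set P (scale_set c R)).
    by apply: sum_mod => //; apply: scale_mod; exact: mod_subring.
  apply: (Pmax (sum_set P (scale_set c R))); last first.
    right; split=> //.
    - split=> // _ [x [_ [Px [y Ry <-] ->]]].
      by apply: subD => //; [exact: PR|exact: subM].
    - apply: subset_trans IP _; apply: (@sum_setl R); apply: scale_mod.
      exact: mod_subring.
    - by move=> s Ss; case: (h s).
  split; first by apply: (@sum_setl R); apply: scale_mod; exact: mod_subring.
  move=> /(_ c) Pc; apply/nPc/Pc; apply: (sum_setr mP).
  by exists 1; rewrite ?mulr1 //; exact: sub1.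
have [s Ss [x [_ [Px [y Ry <-] sE]]]] := ext a Ra nPa.
have [t St [x' [_ [Px' [y' Ry' <-] tE]]]] := ext b Rb nPb.
apply: (SP (s * t)); first exact: SM.
rewrite sE tE mulrDl mulrDr.
have -> : a * y * (x' + b * y') = (a * y) * x' + (y * y') * (a * b) by ring.
apply: (modD mP); first apply: (modD mP).
- by rewrite mulrC; apply: (modM mP) => //; exact: PR.
- by rewrite mulrC; apply: (modM mP) => //; exact: subM.
- by apply: (modD mP); apply: (modM mP) => //; exact: subM.
Qed.

Lemma maximal_containing R I : is_subring R -> is_idl R I -> ~ I 1 ->
  exists2 P, is_rprime R P & I `<=` P.
Proof.
move=> sR iI I1; have [||||P [pP IP _]] := @prime_avoiding R I [set 1] sR iI => //.
- by move=> _ _ -> ->; rewrite mulr1.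
- by move=> _ ->; exact: sub1.
- by move=> _ ->.
by exists P.
Qed.

(** A prime disjoint from the powers of [a] would otherwise exist. Later this stands in for explicit
    nilpotence estimates: to bring a power of [a] into an ideal, it is enough to inspect the primes
    above it. *)
Lemma radical_power R I a : is_subring R -> is_idl R I -> R a ->
  (forall P, is_rprime R P -> I `<=` P -> P a) -> exists n, I (a ^+ n).
Proof.
move=> sR iI Ra h; apply: contrapT => /forallNP hn.
have [||||P [pP IP aP]] := @prime_avoiding R I [set a ^+ n | n in setT] sR iI => //.
- by exists 0%N.
- by move=> _ _ [n _ <-] [m _ <-]; exists (n + m)%N; rewrite ?exprD.
- by move=> _ [n _ <-]; exact: subX.
- by move=> _ [n _ <-]; exact: hn.
by apply: (aP a); [exists 1%N|exact: h].
Qed.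

Lemma rprimeX R P a n : is_subring R -> is_rprime R P -> R a -> P (a ^+ n) -> P a.
Proof.
move=> sR [_ P1 Pp] Ra; elim: n => [|n IH]; first by rewrite expr0 => /P1.
by rewrite exprS => /(Pp _ _ Ra (subX n sR Ra)) [].
Qed.

Definition rnoeth R := forall I : nat -> set B, (forall n, is_idl R (I n)) ->
  (forall n, I n `<=` I n.+1) -> exists n, forall m, (n <= m)%N -> I m `<=` I n.

Lemma chain_le (I : nat -> set B) n m :
  (forall n, I n `<=` I n.+1) -> (n <= m)%N -> I n `<=` I m.
Proof.
move=> h /subnK <-; elim: (m - n)%N => // k IH.
by rewrite addSn; apply: subset_trans IH (h _).
Qed.

Lemma chain_ge (I : nat -> set B) n m :
  (forall n, I n.+1 `<=` I n) -> (n <= m)%N -> I m `<=` I n.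
Proof.
move=> h /subnK <-; elim: (m - n)%N => // k IH.
by rewrite addSn; apply: subset_trans (h _) IH.
Qed.

Lemma rnoeth_max R (C : set (set B)) : rnoeth R -> C !=set0 ->
    (forall I, C I -> is_idl R I) ->
  exists2 I, C I & forall J, C J -> I `<=` J -> J `<=` I.
Proof.
move=> nR [I0 CI0] Ci; apply: contrapT => /forall2NP h.
have {}h (I : {I | C I}) : exists J : {I | C I}, sval I `<` sval J.
  case: I => I CI /=; case: (h I) => // /existsNP[J].
  move=> /not_implyP[CJ /not_implyP[IJ nJI]].
  by exists (exist _ J CJ).
have [f fP] := choice h.
pose u n := iter n f (exist _ I0 CI0).
have [n|n|n /(_ n.+1 (leqnSn _))] := nR (fun n => sval (u n)).
- by apply: Ci; exact: svalP.
- by have [] := fP (u n).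
- by have [] := fP (u n).
Qed.

Definition rspan R (n : nat) (v : nat -> B) :=
  [set x | exists2 c : nat -> B, (forall i, R (c i)) & x = \sum_(i < n) c i * v i].

Lemma rspan_mod R n v : is_subring R -> is_mod R (rspan R n v).
Proof.
move=> sR; split.
- exists (fun=> 0); first by move=> _; exact: sub0.
  by rewrite big1 // => i _; rewrite mul0r.
- move=> _ _ [c Rc ->] [d Rd ->]; exists (fun i => c i + d i).
    by move=> i; exact: subD.
  by rewrite -big_split; apply: eq_bigr => i _; rewrite mulrDl.
- move=> r _ Rr [c Rc ->]; exists (fun i => r * c i).
    by move=> i; exact: subM.
  by rewrite mulr_sumr; apply: eq_bigr => i _; rewrite mulrA.
Qed.

Lemma rspan_gen R n v i : is_subring R -> (i < n)%N -> rspan R n v (v i).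
Proof.
move=> sR ltin; exists (fun j => (j == i)%:R).
  by move=> j; case: eqP => _; [exact: sub1|exact: sub0].
rewrite (bigD1 (Ordinal ltin)) //= eqxx mul1r big1 ?addr0 // => j ji.
by rewrite (_ : (j == i :> nat) = false) ?mul0r //; apply/negbTE.
Qed.

Lemma rspan_le R n v I : is_mod R I -> (forall i, (i < n)%N -> I (v i)) ->
  rspan R n v `<=` I.
Proof.
move=> mI hv _ [c Rc ->]; apply: (mod_sum _ mI) => i _.
by apply: (modM mI) => //; exact: hv.
Qed.

Lemma rnoeth_fg R I : is_subring R -> rnoeth R -> is_idl R I ->
  exists n v, (forall i, I (v i)) /\ I `<=` rspan R n v.
Proof.
move=> sR nR [mI IR].
pose C J := exists n v, (forall i, I (v i)) /\ J = rspan R n v.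
have CI J : C J -> J `<=` I.
  by move=> [n [v [Iv ->]]]; apply: rspan_le.
have [||J [n [v [Iv JE]]] Jmax] := @rnoeth_max R C nR.
- exists (rspan R 0 (fun=> 0)), 0%N, (fun=> 0); split=> // i; exact: mod0 mI.
- move=> J CJ; split; last exact: subset_trans (CI _ CJ) IR.
  by case: CJ => n [v [_ ->]]; exact: rspan_mod.
exists n, v; split=> // x Ix; rewrite -JE.
pose w i := if i == n then x else v i.
have wn i : (i < n)%N -> w i = v i by move=> lt; rewrite /w ltn_eqF.
apply: (Jmax (rspan R n.+1 w)).
- by exists n.+1, w; split=> // i; rewrite /w; case: eqP.
- rewrite JE; apply: rspan_le; first exact: rspan_mod.
  by move=> i lt; rewrite -wn //; apply: rspan_gen => //; exact: ltnW.
- by have := @rspan_gen R n.+1 w n sR (ltnSn _); rewrite /w eqxx.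
Qed.

(** Such a list contains all minimal primes above [I], but its members need be neither minimal nor
    distinct. Avoidance arguments ask for no more. *)
Definition prime_list R I (ps : seq (set B)) :=
  (forall i, (i < size ps)%N -> is_rprime R (nth set0 ps i) /\ I `<=` nth set0 ps i) /\
  forall P, is_rprime R P -> I `<=` P ->
    exists2 i, (i < size ps)%N & nth set0 ps i `<=` P.

(** Noetherian induction: an ideal [J] maximal without such a list is not prime, so [a * b] lies in
    [J] with [a] and [b] outside, and the lists of [J + aR] and [J + bR] together serve [J]. *)
Lemma minimal_primes R I : is_subring R -> rnoeth R -> is_idl R I ->
  exists ps, prime_list R I ps.
Proof.
move=> sR nR iI0; apply: contrapT => nI0.
pose C J := is_idl R J /\ ~ exists ps, prime_list R J ps.
have [||J [iJ nJ] Jmax] := @rnoeth_max R C nR; first by exists I.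
  by move=> J [].
have [mJ JR] := iJ.
have [J1|J1] := pselect (J 1).
  apply: nJ; exists [::]; split=> // P [iP P1 _] JP; case: P1; exact: JP.
have [pJ|] := pselect (forall a b, R a -> R b -> J (a * b) -> J a \/ J b).
  apply: nJ; exists [:: J]; split; last by move=> P _ JP; exists 0%N.
  by case=> // _; split.
move=> /existsNP[a /existsNP[b /not_implyP[Ra /not_implyP[Rb]]]].
move=> /not_implyP[Jab /not_orP[nJa nJb]].
have ext c : R c -> ~ J c ->
    exists ps, prime_list R (sum_set J (scale_set c R)) ps.
  move=> Rc nJc; apply: contrapT => nps; apply: nJc.
  have mS : is_mod R (scale_set c R) by apply: scale_mod; exact: mod_subring.
  apply: (Jmax (sum_set J (scale_set c R))).
  - split=> //; split; first exact: sum_mod.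
    move=> _ [x [_ [Jx [y Ry <-] ->]]]; apply: subD => //; first exact: JR.
    exact: subM.
  - exact: (sum_setl mS).
  - by apply: (sum_setr mJ); exists 1; rewrite ?mulr1 //; exact: sub1.
have mS c : is_mod R (scale_set c R) by apply: scale_mod; exact: mod_subring.
have [ps [ps1 ps2]] := ext a Ra nJa; have [qs [qs1 qs2]] := ext b Rb nJb.
apply: nJ; exists (ps ++ qs); split.
  move=> i; rewrite size_cat nth_cat; case: (ltnP i (size ps)) => [lt _|le lt].
    have [? h] := ps1 _ lt; split=> //; apply: subset_trans h.
    exact: (sum_setl (mS a)).
  have [|? h] := qs1 (i - size ps)%N; first by rewrite ltn_subLR.
  by split=> //; apply: subset_trans h; exact: (sum_setl (mS b)).
move=> P pP JP; have [[mP PR] P1 Pp] := pP.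
have sumP c : P c -> sum_set J (scale_set c R) `<=` P.
  move=> Pc _ [x [_ [Jx [y Ry <-] ->]]]; apply: (modD mP); first exact: JP.
  by rewrite mulrC; apply: (modM mP).
have [Pa|Pb] := Pp _ _ Ra Rb (JP _ Jab).
  have [i lt h] := ps2 P pP (sumP _ Pa); exists i.
    by rewrite size_cat ltn_addr.
  by rewrite nth_cat lt.
have [i lt h] := qs2 P pP (sumP _ Pb); exists (size ps + i)%N.
  by rewrite size_cat ltn_add2l.
by rewrite nth_cat ltnNge leq_addr /= addKn.
Qed.

Definition rdcc R I := forall K : nat -> set B, (forall n, is_idl R (K n)) ->
  (forall n, I `<=` K n) -> (forall n, K n.+1 `<=` K n) ->
  exists n, forall m, (n <= m)%N -> K n `<=` K m.

(** When all primes above [I] are maximal, [R/I] is Artinian. In a maximal counterexample [J], which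
    is neither the whole ring nor prime, pick [a * b] in [J] with [a] and [b] outside; a chain of
    ideals K above [J] is controlled by the chains [K + aR] and [(K : a)], which lie above strictly
    larger ideals than [J]. *)
Lemma dcc_of_primes R I : is_subring R -> rnoeth R -> is_idl R I ->
  (forall P Q, is_rprime R P -> I `<=` P -> is_idl R Q -> P `<=` Q -> ~ Q 1 ->
     Q `<=` P) ->
  rdcc R I.
Proof.
move=> sR nR iI hI; apply: contrapT => nI.
pose C J := [/\ is_idl R J, I `<=` J & ~ rdcc R J].
have [||J [iJ IJ nJ] Jmax] := @rnoeth_max R C nR; first by exists I; split.
  by move=> J [].
have [mJ JR] := iJ.
have [J1|J1] := pselect (J 1).
  apply: nJ => K iK JK _; exists 0%N => m _ x K0x.
  have [mK KR] := iK m; have [_ K0R] := iK 0%N.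
  by rewrite -[x]mulr1; apply: (modM mK); [exact: K0R|exact: JK].
have [pJ|] := pselect (forall a b, R a -> R b -> J (a * b) -> J a \/ J b).
  apply: nJ => K iK JK Kdec.
  have [h|/existsNP[n nKn]] := pselect (forall n, K n 1).
    exists 0%N => m _ x K0x; have [mK KR] := iK m; have [_ K0R] := iK 0%N.
    by rewrite -[x]mulr1; apply: (modM mK); [exact: K0R|exact: h].
  exists n => m nm x Knx; apply: (JK m); apply: (hI J (K n)) => //; split.

move=> /existsNP[a /existsNP[b /not_implyP[Ra /not_implyP[Rb]]]].
move=> /not_implyP[Jab /not_orP[nJa nJb]].
have mS c : is_mod R (scale_set c R) by apply: scale_mod; exact: mod_subring.
have sum_idl L : is_idl R L -> is_idl R (sum_set L (scale_set a R)).
  move=> [mL LR]; split; first exact: sum_mod.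
  move=> _ [x [_ [Lx [y Ry <-] ->]]]; apply: subD => //; first exact: LR.
  exact: subM.
pose col L := [set r | R r /\ L (a * r)].
have col_idl L : is_idl R L -> is_idl R (col L).
  move=> [mL LR]; split; last by move=> r [].
  split.
  - by split; [exact: sub0|rewrite mulr0; exact: mod0 mL].
  - move=> x y [Rx Lx] [Ry Ly]; split; first exact: subD.
    by rewrite mulrDr; exact: modD mL _ _.
  - move=> r x Rr [Rx Lx]; split; first exact: subM.
    by rewrite mulrCA; exact: modM mL _ _.
have ext L : is_idl R L -> J `<=` L -> ~ (L `<=` J) -> rdcc R L.
  move=> iL JL nLJ; apply: contrapT => nL; apply: nLJ; apply: Jmax => //.
  by split=> //; exact: subset_trans IJ JL.
have d1 : rdcc R (sum_set J (scale_set a R)).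
  apply: ext; first exact: sum_idl.
  - exact: (sum_setl (mS a)).
  - move=> /(_ a) h; apply/nJa/h; apply: (sum_setr mJ).
    by exists 1; rewrite ?mulr1 //; exact: sub1.
have d2 : rdcc R (col J).
  apply: ext; first exact: col_idl.
  - by move=> x Jx; split; [exact: JR|apply: (modM mJ)].
  - by move=> /(_ b) h; apply/nJb/h.
apply: nJ => K iK JK Kdec.
have [n|||n hn] := d1 (fun n => sum_set (K n) (scale_set a R)).
- exact/sum_idl/iK.
- move=> n _ [x [y [Jx Sy ->]]]; exists x, y; split=> //; exact: (JK n).
- by move=> n _ [x [y [Kx Sy ->]]]; exists x, y; split=> //; exact: Kdec.
have [k|||k hk] := d2 (fun n => col (K n)); first exact/col_idl/iK.
- by move=> k x [Rx Jx]; split=> //; exact: (JK k).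
- by move=> k x [Rx Jx]; split=> //; exact: Kdec.
(* If both derived chains have stopped, so has [K]: write [x = y + a * r] with [y] in [K m]; then
   [r] lies in the earlier colon ideal, hence in the later one. *)
exists (maxn n k) => m; rewrite geq_max => /andP[nm km] x Kx.
have KS i j : (i <= j)%N -> K j `<=` K i by exact: (chain_ge Kdec).
have [y [_ [Ky [r Rr <-] xE]]] : sum_set (K m) (scale_set a R) x.
  by apply: (hn m nm); apply: (sum_setl (mS a)); apply: (KS _ _ (leq_maxl n k)).
have [mK KR] := iK m; have [mK' _] := iK (maxn n k).
suff Kar : K m (a * r) by rewrite xE; exact: modD mK _ _.
apply: (hk m km r _).2; split=> //; apply: (KS _ _ (leq_maxr n k)).
apply: (modDl sR mK' (x := y)); last by rewrite -xE.
by apply: (KS _ m) => //; rewrite geq_max nm.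
Qed.

End RelativeIdeals.

(** * Subrings of a field *)

Section SubringsOfField.
Variable F : fieldType.
Implicit Types (R I J P S T : set F) (x y a b u : F) (p q : {poly F}).

Definition polyR R : set {poly F} := [set p | forall i, R p`_i].

Definition adj R b : set F := [set p.[b] | p in polyR R].

Lemma polyR0 R : is_subring R -> polyR R 0.
Proof. by move=> sR i; rewrite coef0; exact: sub0. Qed.
Lemma polyRC R c : is_subring R -> R c -> polyR R c%:P.
Proof. by move=> sR Rc i; rewrite coefC; case: ifP => // _; exact: sub0. Qed.
Lemma polyRX R : is_subring R -> polyR R 'X.
Proof.
by move=> sR i; rewrite coefX; case: eqP => _; [exact: sub1|exact: sub0].
Qed.
Lemma polyRD R p q : is_subring R -> polyR R p -> polyR R q -> polyR R (p + q).
Proof. by move=> sR hp hq i; rewrite coefD; exact: subD. Qed.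
Lemma polyRB R p q : is_subring R -> polyR R p -> polyR R q -> polyR R (p - q).
Proof. by move=> sR hp hq i; rewrite coefB; exact: subB. Qed.
Lemma polyRM R p q : is_subring R -> polyR R p -> polyR R q -> polyR R (p * q).
Proof.
by move=> sR hp hq i; rewrite coefM; apply: sub_sum => // j _; exact: subM.
Qed.
Lemma polyRX_n R p n : is_subring R -> polyR R p -> polyR R (p ^+ n).
Proof.
move=> sR hp; elim: n => [|n IH].
  by rewrite expr0 -[1]/(1%:P); apply: polyRC => //; exact: sub1.
by rewrite exprS; exact: polyRM.
Qed.
Lemma polyR_poly R n (c : nat -> F) : is_subring R -> (forall i, R (c i)) ->
  polyR R (\poly_(i < n) c i).
Proof. by move=> sR Rc i; rewrite coef_poly; case: ifP => // _; exact: sub0. Qed.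
Lemma polyR_sub R T : R `<=` T -> polyR R `<=` polyR T.
Proof. by move=> RT p hp i; exact: RT. Qed.

Lemma adj_subring R b : is_subring R -> is_subring (adj R b).
Proof.
move=> sR; split.
- exists 1; last by rewrite hornerE.
  by rewrite -[1]/(1%:P); apply: polyRC => //; exact: sub1.
- move=> _ _ [p hp <-] [q hq <-]; exists (p - q); last by rewrite !hornerE.
  exact: polyRB.
- move=> _ _ [p hp <-] [q hq <-]; exists (p * q); last by rewrite !hornerE.
  exact: polyRM.
Qed.

Lemma adj_sub R b : is_subring R -> R `<=` adj R b.
Proof. by move=> sR c Rc; exists c%:P; [exact: polyRC|rewrite hornerE]. Qed.

Lemma adj_gen R b : is_subring R -> adj R b b.
Proof. by move=> sR; exists 'X; [exact: polyRX|rewrite hornerE]. Qed.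

Lemma horner_sub R T b p : is_subring T -> R `<=` T -> T b -> polyR R p -> T p.[b].
Proof.
move=> sT RT Tb hp; rewrite horner_coef; apply: sub_sum => // i _.
by apply: subM => //; [exact: RT|exact: subX].
Qed.

Lemma adj_min R T b : is_subring T -> R `<=` T -> T b -> adj R b `<=` T.
Proof. by move=> sT RT Tb _ [p hp <-]; exact: horner_sub hp. Qed.

(** The leading-coefficient argument is run on polynomials over [R] whose value at [b] lies in the
    given ideal, so that algebraic relations satisfied by [b] do no harm. *)
Lemma hilbert_basis R b : is_subring R -> rnoeth R -> rnoeth (adj R b).
Proof.
move=> sR nR I iI Iinc; have sA := adj_subring b sR.
(* Coefficients of degree [n], zero allowed, of the polynomials of degree at most [n] with value in
   [I m]. The family grows in both indices. *)
pose L m n := [set r | exists p, [/\ polyR R p, (size p <= n.+1)%N, p`_n = r & I m p.[b]]].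
have mI m : is_mod (adj R b) (I m) by case: (iI m).
have Linc m m' n : (m <= m')%N -> L m n `<=` L m' n.
  move=> mm' r [p [hp sp pn Ip]]; exists p; split=> //.
  exact: (chain_le Iinc mm').
have LS m n : L m n `<=` L m n.+1.
  move=> r [p [hp sp pn Ip]]; exists ('X * p); split.
  - by apply: polyRM => //; exact: polyRX.
  - have [->|p0] := eqVneq p 0; first by rewrite mulr0 size_poly0.
    by rewrite mulrC size_mulX.
  - by rewrite coefXM.
  - by rewrite hornerM hornerX; apply: (modM (mI m)) => //; exact: adj_gen.
have Lle m n n' : (n <= n')%N -> L m n `<=` L m n' by exact: chain_le.
have iL m n : is_idl R (L m n).
  split; last by move=> r [p [hp _ <- _]].
  split.
  - exists 0; split; rewrite ?size_poly0 ?coef0 ?hornerE //; first exact: polyR0.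
    exact: mod0 (mI m).
  - move=> _ _ [p [hp sp <- Ip]] [q [hq sq <- Iq]]; exists (p + q).
    split; rewrite ?coefD ?hornerD //; first exact: polyRD.
      by rewrite (leq_trans (size_polyD _ _)) // geq_max sp.
    exact: modD (mI m) _ _.
  - move=> r _ Rr [p [hp sp <- Ip]]; exists (r%:P * p).
    split; rewrite ?coefCM ?hornerM ?hornerC //.
    + by apply: polyRM => //; exact: polyRC.
    + by rewrite mul_polyC (leq_trans (size_scale_leq _ _)).
    + by apply: (modM (mI m)) => //; exact: adj_sub.
(* The diagonal stops at [N], which settles all columns from [N] on; the finitely many earlier
   columns stop one by one, which gives [M]. *)
have [n||N hN] := nR (fun n => L n n); first exact: iL.
  by move=> n; apply: subset_trans (Linc n n.+1 n (leqnSn _)) (LS _ _).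
have [M [NM hM]] : exists M, (N <= M)%N /\
    forall n, (n < N)%N -> forall m, (M <= m)%N -> L m n `<=` L M n.
  have [M0 hM0] : exists M0, forall n, (n < N)%N -> forall m, (M0 <= m)%N -> L m n `<=` L M0 n.
    elim: N {hN} => [|N [M0 IH]]; first by exists 0%N.
    have [k|k|M1 hM1] := nR (fun m => L m N); first exact: iL.
      exact: Linc.
    exists (maxn M0 M1) => n; rewrite ltnS leq_eqVlt => /predU1P[->|lt] m.
      rewrite geq_max => /andP[_ h]; apply: subset_trans (hM1 _ h) _.
      by apply: Linc; exact: leq_maxr.
    rewrite geq_max => /andP[h _]; apply: subset_trans (IH _ lt _ h) _.
    by apply: Linc; exact: leq_maxl.
  exists (maxn N M0); split; first exact: leq_maxl.
  move=> n lt m; rewrite geq_max => /andP[_ h].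
  by apply: subset_trans (hM0 _ lt _ h) _; apply: Linc; exact: leq_maxr.
have LM m n : (M <= m)%N -> L m n `<=` L M n.
  move=> Mm; case: (ltnP n N) => [lt|le]; first exact: hM.
  have Nm : (N <= maxn m n)%N by rewrite leq_max le orbT.
  apply: (@subset_trans _ (L N N)); last first.
    by apply: subset_trans (Lle _ _ _ le) (Linc _ _ _ NM).
  apply: subset_trans (hN _ Nm); apply: subset_trans (Linc _ _ _ (leq_maxl m n)) _.
  by apply: Lle; exact: leq_maxr.
exists M => m Mm x Ix; have [_ /(_ _ Ix)[p hp px]] := iI m.
rewrite -px in Ix *; have [k sp] : exists k, (size p <= k)%N by exists (size p).
elim: k p hp Ix sp {x px} => [|k IH] p hp Ix sp.
  move: sp; rewrite leqn0 size_poly_eq0 => /eqP ->; rewrite hornerE.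
  exact: mod0 (mI M).
have [q [hq sq qk Iq]] : L M k p`_k by apply: (LM m) => //; exists p.
rewrite -[p](subrK q) hornerD; apply: (modD (mI M)) => //.
apply: IH; first exact: polyRB.
  rewrite hornerD hornerN; apply: (modB sA (mI m)) => //.
  by apply: (chain_le Iinc Mm).
have sd : (size (p - q)%R <= k.+1)%N.
  by rewrite (leq_trans (size_polyD _ _)) // size_polyN geq_max sp.
move: sd; rewrite leq_eqVlt ltnS => /predU1P[sd|//].
have : lead_coef (p - q) = 0 by rewrite lead_coefE sd coefB qk subrr.
by move/eqP; rewrite lead_coef_eq0 => /eqP ->; rewrite size_poly0.
Qed.

Definition racc R I := forall K : nat -> set F, (forall n, is_idl R (K n)) ->
  (forall n, I `<=` K n) -> (forall n, K n `<=` K n.+1) ->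
  exists n, forall m, (n <= m)%N -> K m `<=` K n.

(* Krull-Akizuki: R[u]/aR[u] is a finite R-module. The descending chain
   a^n R[u] cap R + aR stabilises at some l, and then
   a^l R[u] is contained in a^(l+1) R[u] + R. *)
Lemma krull_akizuki R a u : is_subring R -> R a -> a != 0 ->
    rdcc R (scale_set a R) -> (forall l, racc R (scale_set (a ^+ l) R)) ->
    (forall m, exists n, R (a ^+ n * u ^+ m)) ->
  exists n, exists2 s : nat -> F, (forall i, R (s i)) &
    exists2 e, adj R u e & u ^+ n = \sum_(j < n) s j * u ^+ j + a * e.
Proof.
move=> sR Ra a0 dR aR hu; have sB := adj_subring u sR.
set B := adj R u in sB *; have RB : R `<=` B by exact: adj_sub.
have Bden e : B e -> exists n, R (a ^+ n * e).
  move=> [p hp <-]; rewrite horner_coef.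
  elim: (size p) => [|k [n IH]].
    by exists 0%N; rewrite big_ord0 mulr0; exact: sub0.
  have [m hm] := hu k; exists (n + m)%N; rewrite big_ord_recr /= mulrDr.
  apply: subD => //.
    by rewrite exprD mulrAC; apply: subM => //; exact: subX.
  have -> : a ^+ (n + m) * (p`_k * u ^+ k) = (a ^+ n * p`_k) * (a ^+ m * u ^+ k).
    by rewrite exprD; ring.
  by apply: subM => //; apply: subM => //; exact: subX.
have mB : is_mod R B by apply: (mod_sub RB); exact: mod_subring.
have mS x : is_mod R (scale_set x R) by apply: scale_mod; exact: mod_subring.
have mRB n : is_mod R (R `&` scale_set (a ^+ n) B).
  by apply: setI_mod; [exact: mod_subring|exact: scale_mod].
pose K n := sum_set (R `&` scale_set (a ^+ n) B) (scale_set a R).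
have sumR I J : I `<=` R -> J `<=` R -> sum_set I J `<=` R.
  by move=> IR JR _ [x [y [Ix Jy ->]]]; apply: subD => //; [exact: IR|exact: JR].
have SR x : R x -> scale_set x R `<=` R.
  by move=> Rx _ [y Ry <-]; exact: subM.
have [n|n|n|l hl] := dR K.
- split; first by apply: sum_mod.
  by apply: sumR; [move=> x []|exact: SR].
- exact: (sum_setr (mRB n)).
- move=> _ [x [y [[Rx [e Be xE]] Sy ->]]]; exists x, y; split=> //; split=> //.
  exists (a * e); last by rewrite -xE exprSr mulrA.
  by apply: subM => //; exact: RB.
(* Induction on the power of [a] that brings [a ^+ l * e] into [R]: stability of the chain at [l]
   replaces [e] by [e - a * e2] and saves one factor [a]. *)
have key n e : B e -> R (a ^+ n * (a ^+ l * e)) ->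
    exists e' r, [/\ B e', R r & a ^+ l * e = a ^+ l.+1 * e' + r].
  elim: n e => [|n IH] e Be Re.
    exists 0, (a ^+ l * e); rewrite mulr0 add0r; split=> //; first exact: sub0.
    by rewrite expr0 mul1r in Re.
  have /(hl (n + l).+2) : K l (a ^+ n.+1 * (a ^+ l * e)).
    apply: (sum_setl (mS a)); split=> //; exists (a ^+ n.+1 * e); last by ring.
    by apply: subM => //; apply: subX => //; exact: RB.
  case; first by lia.
  move=> x [_ [[Rx [e2 Be2 xE]] [r Rr <-] E]].
  have E' : a ^+ n * (a ^+ l * (e - a * e2)) = r.
    apply: (mulfI a0); rewrite -[RHS](addKr x) -E -xE !exprS exprD; ring.
  have Be1 : B (e - a * e2) by apply: subB => //; apply: subM => //; exact: RB.
  have [|e' [r' [Be' Rr' E1]]] := IH _ Be1; first by rewrite E'.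
  exists (e' + e2), r'; split=> //; first exact: subD.
  have -> : a ^+ l * e = a ^+ l * (e - a * e2) + a ^+ l.+1 * e2.
    by rewrite exprSr; ring.
  by rewrite E1; ring.
have key' j : exists er : F * F, [/\ B er.1, R er.2 & a ^+ l * u ^+ j = a ^+ l.+1 * er.1 + er.2].
  have Bu : B (u ^+ j) by apply: subX => //; exact: adj_gen.
  have [n hn] := Bden _ Bu.
  have [|e' [r [Be' Rr E]]] := key n _ Bu; last by exists (e', r).
  by rewrite mulrCA; apply: subM => //; exact: subX.
have [f fP] := choice key'; pose r j := (f j).2.
have Rr j : R (r j) by case: (fP j).
(* The remainders [r j] of the powers of [u] span an ascending chain above [a ^+ l.+1 R]. Where it
   stops, [r n] is a combination of its predecessors, and this becomes the equation for [u ^+ n]. *)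
pose N n := sum_set (rspan R n r) (R `&` scale_set (a ^+ l.+1) B).
have mN n : is_mod R (N n) by apply: sum_mod => //; exact: rspan_mod.
have [n|n|n|n hn] := aR l.+1 N.
- split=> //; apply: sumR; last by move=> x [].
  by apply: rspan_le; first exact: mod_subring.
- apply: subset_trans (sum_setr (rspan_mod n r sR)).
  move=> _ [y Ry <-]; split; first by apply: subM => //; exact: subX.
  by exists y => //; exact: RB.
- move=> _ [x [y [Sx Ry ->]]]; exists x, y; split=> //.
  apply: rspan_le Sx; first exact: rspan_mod.
  by move=> i lt; apply: rspan_gen => //; exact: ltnW.
have [_ [_ [[s Rs ->] [_ [e Be <-]] E]]] : N n (r n).
  by apply: (hn n.+1) => //; apply: (sum_setl (mRB _)); exact: rspan_gen.
exists n, s => //.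
exists ((f n).1 + e - \sum_(j < n) s j * (f j).1).
  apply: subB => //; last first.
    apply: sub_sum => // j _; apply: subM => //; first exact: RB.
    by case: (fP j).
  by apply: subD => //; case: (fP n).
apply: (mulfI (expf_neq0 l a0)); have [_ _ ->] := fP n; rewrite -/(r n) E.
have -> : \sum_(i < n) s i * r i =
    a ^+ l * (\sum_(i < n) s i * u ^+ i) - a ^+ l.+1 * \sum_(j < n) s j * (f j).1.
  rewrite !mulr_sumr -sumrB; apply: eq_bigr => i _.
  have [_ _ h] := fP i; have -> : r i = a ^+ l * u ^+ i - a ^+ l.+1 * (f i).1.
    by rewrite h addrC addKr.
  by ring.
rewrite exprSr; ring.
Qed.

(** The equation of [krull_akizuki] read as a polynomial: its coefficient of degree [k] is 1 minus a
    multiple of [a], so the reduction of [G] modulo [n] is not zero, although [G] need not be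
    monic. *)
Lemma krull_akizuki_poly R a u n : is_subring R -> R a -> a != 0 ->
    is_idl R n -> n a -> ~ n 1 ->
    rdcc R (scale_set a R) -> (forall l, racc R (scale_set (a ^+ l) R)) ->
    (forall m, exists n, R (a ^+ n * u ^+ m)) ->
  exists G, [/\ polyR R G, G.[u] = 0 & exists i, ~ n G`_i].
Proof.
move=> sR Ra a0 [mn nR] na n1 dR aR hu.
have [k [s Rs [_ [E hE <-] uE]]] := krull_akizuki sR Ra a0 dR aR hu.
exists ('X^k - \poly_(j < k) s j - a%:P * E); split.
- apply: polyRB => //; first apply: polyRB => //.
  + by apply: polyRX_n => //; exact: polyRX.
  + exact: polyR_poly.
  + by apply: polyRM => //; exact: polyRC.
- rewrite !hornerE uE horner_poly; ring.
- exists k; rewrite !coefB coefXn eqxx coef_poly ltnn subr0 coefCM => h.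
  by apply: n1; rewrite -(subrK (a * E`_k) 1); apply: (modD mn) => //;
     rewrite mulrC; apply: (modM mn).
Qed.

Definition locz R P : set F := [set x | exists b s, [/\ R b, R s, ~ P s & x = b / s]].

Lemma rprime_neq0 R P s : is_rprime R P -> ~ P s -> s != 0.
Proof. by move=> [[[P0 _ _] _] _ _] Ps; apply: contra_notN Ps => /eqP ->. Qed.

Lemma rprime_nmul R P s t : is_rprime R P -> R s -> R t -> ~ P s -> ~ P t -> ~ P (s * t).
Proof. by move=> [_ _ Pp] Rs Rt Ps Pt /(Pp _ _ Rs Rt) []. Qed.

Lemma locz_subring R P : is_subring R -> is_rprime R P -> is_subring (locz R P).
Proof.
move=> sR pP; have [_ P1 _] := pP; split.
- by exists 1, 1; rewrite divr1; split=> //; exact: sub1.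
- move=> _ _ [b [s [Rb Rs Ps ->]]] [c [t [Rc Rt Pt ->]]].
  have s0 := rprime_neq0 pP Ps; have t0 := rprime_neq0 pP Pt.
  exists (b * t - c * s), (s * t); split.
  + by apply: subB => //; exact: subM.
  + exact: subM.
  + exact: rprime_nmul pP _ _ _ _.
  + by field; rewrite s0 t0.
- move=> _ _ [b [s [Rb Rs Ps ->]]] [c [t [Rc Rt Pt ->]]].
  have s0 := rprime_neq0 pP Ps; have t0 := rprime_neq0 pP Pt.
  exists (b * c), (s * t); split; [exact: subM|exact: subM| |].
  + exact: rprime_nmul pP _ _ _ _.
  + by field; rewrite s0 t0.
Qed.

Lemma locz_sub R P : is_subring R -> is_rprime R P -> R `<=` locz R P.
Proof.
move=> sR [_ P1 _] x Rx; exists x, 1; rewrite divr1; split=> //; exact: sub1.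
Qed.

Lemma locz_inv R P s : is_subring R -> is_rprime R P -> R s -> ~ P s ->
  locz R P s^-1.
Proof.
by move=> sR pP Rs Ps; exists 1, s; rewrite div1r; split=> //; exact: sub1.
Qed.

Lemma locz_noeth R P : is_subring R -> is_rprime R P -> rnoeth R ->
  rnoeth (locz R P).
Proof.
move=> sR pP nR I iI Iinc; have RL := locz_sub sR pP.
have mI n : is_mod (locz R P) (I n) by case: (iI n).
have [n||n hn] := nR (fun n => I n `&` R).
- split; last by move=> x [].
  by apply: setI_mod; [exact: mod_sub RL (mI n)|exact: mod_subring].
- by move=> n x [Ix Rx]; split=> //; exact: Iinc.
exists n => m nm x Ix; have [_ /(_ _ Ix)[b [s [Rb Rs Ps xE]]]] := iI m.
have s0 := rprime_neq0 pP Ps.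
have [|Ib _] := hn _ nm b.
  split=> //; rewrite -(divfK s0 b) -xE mulrC; apply: (modM (mI m)) => //.
  exact: RL.
by rewrite xE mulrC; apply: (modM (mI n)) => //; exact: locz_inv.
Qed.

Definition locz_max R P : set F := [set x | exists b s, [/\ P b, R s, ~ P s & x = b / s]].

Lemma locz_max_idl R P : is_subring R -> is_rprime R P ->
  is_idl (locz R P) (locz_max R P).
Proof.
move=> sR pP; have [[mP PR] P1 _] := pP; split; last first.
  by move=> _ [b [s [Pb Rs Ps ->]]]; exists b, s; split=> //; exact: PR.
split.
- by exists 0, 1; rewrite mul0r; split=> //; [exact: mod0 mP|exact: sub1].
- move=> _ _ [b [s [Pb Rs Ps ->]]] [c [t [Pc Rt Pt ->]]].
  have s0 := rprime_neq0 pP Ps; have t0 := rprime_neq0 pP Pt.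
  exists (t * b + s * c), (s * t); split.
  + by apply: (modD mP); apply: (modM mP).
  + exact: subM.
  + exact: rprime_nmul pP _ _ _ _.
  + by field; rewrite s0 t0.
- move=> _ _ [b [s [Rb Rs Ps ->]]] [c [t [Pc Rt Pt ->]]].
  have s0 := rprime_neq0 pP Ps; have t0 := rprime_neq0 pP Pt.
  exists (b * c), (s * t); split; [exact: (modM mP)|exact: subM| |].
  + exact: rprime_nmul pP _ _ _ _.
  + by field; rewrite s0 t0.
Qed.

Lemma locz_max_R R P x : is_rprime R P -> R x -> locz_max R P x -> P x.
Proof.
move=> pP Rx [b [s [Pb Rs Ps xE]]]; have s0 := rprime_neq0 pP Ps.
have [_ _ Pp] := pP; case: (Pp x s) => //.
by rewrite xE divfK.
Qed.

(** The nonunits of [R]. Zero is listed apart because the convention [0^-1 = 0] would make it look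
    invertible. *)
Definition nmax R : set F := [set x | R x /\ (x = 0 \/ ~ R x^-1)].

Definition is_loc R := is_subring R /\ forall x y, nmax R x -> nmax R y -> nmax R (x + y).

Lemma nmax1 R : is_subring R -> ~ nmax R 1.
Proof. by move=> sR [_ [/eqP|]]; rewrite ?oner_eq0 // invr1; case; exact: sub1. Qed.

Lemma nmaxPn R x : R x -> ~ nmax R x -> x != 0 /\ R x^-1.
Proof.
move=> Rx h; split; first by apply: contra_notN h => /eqP; split=> //; left.
by apply: contrapT => nR; apply: h; split=> //; right.
Qed.

Lemma nmax_idl R : is_loc R -> is_idl R (nmax R).
Proof.
move=> [sR hD]; split; last by move=> x [].
split=> //; first by split; [exact: sub0|left].
move=> r a Rr [Ra ha]; split; first exact: subM.
case: ha => [->|nRa]; first by left; rewrite mulr0.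
have [->|r0] := eqVneq r 0; first by left; rewrite mul0r.
have [a0|a0] := eqVneq a 0; first by left; rewrite a0 mulr0.
right=> h; apply: nRa.
have -> : a^-1 = r * (r * a)^-1 by rewrite invfM mulrA divff // mul1r.
exact: subM.
Qed.

Lemma nmax_rprime R : is_loc R -> is_rprime R (nmax R).
Proof.
move=> lR; have [sR _] := lR; split; [exact: nmax_idl|exact: nmax1|].
move=> a b Ra Rb [_ h]; apply: contrapT => /not_orP[na nb].
have [a0 Ra'] := nmaxPn Ra na; have [b0 Rb'] := nmaxPn Rb nb.
case: h => [/eqP|]; first by rewrite mulf_eq0 (negbTE a0) (negbTE b0).
by rewrite invfM; case; exact: subM.
Qed.

Lemma idl_nmax R I : is_subring R -> is_idl R I -> ~ I 1 -> I `<=` nmax R.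
Proof.
move=> sR [mI IR] I1 x Ix; split; first exact: IR.
have [->|x0] := eqVneq x 0; [by left|right=> h; apply: I1].
by rewrite -(mulVf x0); apply: (modM mI).
Qed.

Lemma locz_loc R P : is_subring R -> is_rprime R P ->
  is_loc (locz R P) /\ nmax (locz R P) = locz_max R P.
Proof.
move=> sR pP; have sL := locz_subring sR pP.
have iM := locz_max_idl sR pP; have [_ P1 Pp] := pP.
have E : nmax (locz R P) = locz_max R P.
  apply/seteqP; split; last first.
    by apply: idl_nmax => // h; apply: P1; apply: (locz_max_R pP) => //; exact: sub1.
  move=> x [[b [s [Rb Rs Ps xE]]] h].
  have [Pb|Pb] := pselect (P b); first by exists b, s.
  exfalso; case: h => [x0|]; last first.
    by apply; exists s, b; split=> //; rewrite xE invf_div.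
  have := rprime_neq0 pP Pb; have := rprime_neq0 pP Ps => s0.
  by rewrite -(divfK s0 b) -xE x0 mul0r eqxx.
split=> //; split=> // x y; rewrite E; case: iM => mM _; exact: modD mM.
Qed.

Lemma local_dcc R a : is_loc R -> rnoeth R -> R a ->
    (forall P, is_rprime R P -> P a -> nmax R `<=` P) ->
  rdcc R (scale_set a R).
Proof.
move=> lR nR Ra h; have [sR _] := lR; apply: dcc_of_primes => //.
  split; first by apply: scale_mod; exact: mod_subring.
  by move=> _ [y Ry <-]; exact: subM.
move=> P Q pP aP iQ PQ Q1; apply: subset_trans (idl_nmax sR iQ Q1) _.
by apply: h => //; apply: aP; exists 1; rewrite ?mulr1 //; exact: sub1.
Qed.

Lemma rnoeth_racc R I : rnoeth R -> racc R I.
Proof. by move=> nR K iK _; exact: nR. Qed.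

(** Among the ideals [pR + xR] with [x] in [I] take a maximal one. Writing [x = p * r + u * y] puts
    it inside [pR + yR], hence makes the two equal, and substituting back shows that
    [(1 - b * u) * y] lies in [pR], where [1 - b * u] is a unit. *)
Lemma nakayama_principal R I u (p : F) : is_loc R -> rnoeth R -> nmax R u ->
    is_idl R I -> I p ->
    (forall x, I x -> exists r y, [/\ R r, I y & x = p * r + u * y]) ->
  I `<=` scale_set p R.
Proof.
move=> lR nR nu [mI IR] Ip h; have [sR _] := lR; have [Ru _] := nu.
have mS x : is_mod R (scale_set x R) by apply: scale_mod; exact: mod_subring.
pose K x := sum_set (scale_set p R) (scale_set x R).
have mK x : is_mod R (K x) by exact: sum_mod.
have Kx x : K x x.
  by apply: (sum_setr (mS _)); exists 1; rewrite ?mulr1 //; exact: sub1.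
have Kp x : K x p.
  by apply: (sum_setl (mS _)); exists 1; rewrite ?mulr1 //; exact: sub1.
have Kle x L : is_mod R L -> L p -> L x -> K x `<=` L.
  move=> mL Lp Lx _ [_ [_ [[a Ra <-] [b Rb <-] ->]]].
  by apply: (modD mL); rewrite mulrC; apply: (modM mL).
have [||_ [x Ix <-] xmax] := @rnoeth_max _ R [set K x | x in I] nR.
- by exists (K p), p.
- move=> _ [x Ix <-]; split=> //; apply: Kle; first exact: mod_subring.
    exact: IR.
  exact: IR.
have Kle' y : I y -> K x `<=` K y -> K y `<=` K x.
  by move=> Iy; apply: xmax; exists y.
have mP := mS p; have pP : scale_set p R p by exists 1; rewrite ?mulr1 //; exact: sub1.
have xP : scale_set p R x.
  have [r [y [Rr Iy xE]]] := h _ Ix.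
  have /(Kle' _ Iy)/(_ y (Kx y)) : K x `<=` K y.
    apply: Kle => //; rewrite xE; apply: (modD (mK y)); last exact: modM (mK y) _ _.
    by rewrite mulrC; apply: (modM (mK y)).
  case=> _ [_ [[a Ra <-] [b Rb <-]]] yE.
  have : ~ nmax R (1 - b * u).
    move=> n1; apply: (nmax1 sR); rewrite -(subrK (b * u) 1).
    have [mn _] := nmax_idl lR; apply: (modD mn) => //; exact: (modM mn).
  have R1 : R (1 - b * u) by apply: subB; [|exact: sub1|exact: subM].
  move=> /(nmaxPn R1)[w0 Rw].
  have yE' : y = p * ((1 - b * u)^-1 * (a + r * b)).
    apply: (mulfI w0); rewrite (mulrCA _ p) mulVKf //.
    rewrite mulrBl mul1r {1}yE xE; ring.
  exists (r + u * ((1 - b * u)^-1 * (a + r * b))); last first.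
    by rewrite [RHS]xE yE'; ring.
  apply: subD => //; apply: subM => //; apply: subM => //.
  by apply: subD => //; exact: subM.
move=> y Iy; have Kxp : K x `<=` K y.
  by apply: (subset_trans (Kle _ _ mP pP xP)) => _ [b Rb <-]; rewrite mulrC; apply: (modM (mK y)).
exact: (Kle _ _ mP pP xP) (Kle' _ Iy Kxp _ (Kx y)).
Qed.

End SubringsOfField.

(** * Partitions of unity along a curve *)

Section Semilocal.
Variable F : fieldType.
Implicit Types (R I V M : set F) (x y b u v w : F) (p q : {poly F}).

Lemma root_division R p m : is_subring R -> R m -> polyR R p ->
  exists q, polyR R q /\ p = q * ('X - m%:P) + p.[m]%:P /\ (size q <= (size p).-1)%N.
Proof.
move=> sR Rm; elim/poly_ind: p => [|p c IH] hp.
  exists 0; rewrite mul0r horner0 polyC0 addr0 size_poly0; split=> //.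
have Rp : polyR R p.
  by move=> i; have := hp i.+1; rewrite coefD coefMX coefC addr0.
have Rc : R c by have := hp 0%N; rewrite coefD coefMX coefC add0r.
have [q [hq [pE sq]]] := IH Rp.
exists (q * 'X + p.[m]%:P); split; [|split].
- apply: polyRD => //; first by apply: polyRM => //; exact: polyRX.
  by apply: polyRC => //; apply: horner_sub Rp.
- rewrite !hornerE polyCD polyCM {1}pE; ring.
- have [p0|p0] := eqVneq p 0.
    have q0 : q = 0 by apply/eqP; rewrite -size_poly_leq0 (leq_trans sq) // p0 size_poly0.
    by rewrite p0 q0 !mul0r horner0 polyC0 addr0 size_poly0.
  have sE : size (p * 'X + c%:P) = (size p).+1.
    by rewrite size_MXaddC (negbTE p0).
  rewrite sE /= size_MXaddC; case: ifP => //= _.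
  by rewrite (leq_ltn_trans sq) // prednK // size_poly_gt0.
Qed.

(** A nonzero polynomial over the domain [R/I] has finitely many roots, while the [kk i] are
    infinitely many distinct residues. Values in [I] from index [N] on allow division by the root
    [kk N], which lowers the size. *)
Lemma coef_unit_point R I (kk : nat -> F) p : is_subring R -> is_rprime R I ->
    (forall i, R (kk i)) -> (forall i j, i != j -> ~ I (kk i - kk j)) ->
    polyR R p -> (exists i, ~ I p`_i) ->
  exists i, ~ I p.[kk i].
Proof.
move=> sR pI Rk hk hp [i0 ni0]; apply: contrapT => /forallNP h0.
have [[mI IR] I1 Ip] := pI.
suff H n N q : (size q <= n)%N -> polyR R q ->
    (forall i, (N <= i)%N -> I q.[kk i]) -> forall j, I q`_j.
  apply: ni0; apply: (H (size p) 0%N) => // i _; exact: contrapT (h0 i).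
elim: n N q => [|n IH] N q sq hq h j.
  move: sq; rewrite leqn0 size_poly_eq0 => /eqP ->; rewrite coef0.
  exact: mod0 mI.
have [r [hr [qE sr]]] := root_division sR (Rk N) hq.
have Ir : forall j, I r`_j.
  apply: (IH N.+1) => //; first by rewrite (leq_trans sr) //; lia.
  move=> i Ni; have : I (r.[kk i] * (kk i - kk N)).
    have -> : r.[kk i] * (kk i - kk N) = q.[kk i] - q.[kk N].
      by rewrite {1}qE !hornerE addrK.
    by apply: (modB sR mI); apply: h => //; exact: ltnW.
  move=> /Ip[||//|]; first by apply: horner_sub hr.
    by apply: subB.
  by move/hk; rewrite gtn_eqF // => /(_ isT).
rewrite qE coefD coefC mulrBr coefB coefMX coefMC.
apply: (modD mI); last by case: ifP => _; [exact: h|exact: mod0 mI].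
apply: (modB sR mI); first by case: eqP => _ //; exact: mod0 mI.
by rewrite mulrC; apply: (modM mI).
Qed.

(* O plays the role of the local ring of a curve at its generic point, W of
   the local ring of a closed point of the curve; both are thickened. *)
Record curve_point (O : set F) (a : F) (W : set F) : Prop := CurvePoint {
  cp_loc : is_loc W;
  cp_sub : W `<=` O;
  cp_a : nmax W a;
  cp_a0 : a != 0;
  cp_den : forall x, O x -> exists n, W (a ^+ n * x);
  cp_nil : forall x, nmax W x -> exists n, scale_set a W (x ^+ n);
  cp_dcc : rdcc W (scale_set a W);
  cp_acc : forall l, racc W (scale_set (a ^+ l) W)
}.

Definition ounit (O : set F) x := [/\ O x, x != 0 & O x^-1].

(** Almost integrality over [W]: all powers of [x] share one denominator. It plays the part of
    integrality without any finiteness of the integral closure. *)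
Definition bounded_elt O a W x :=
  O x /\ exists n, forall j, W (a ^+ n * x ^+ j).

Definition bounded_ring O a W V :=
  [/\ is_subring V, W `<=` V, V `<=` O & exists n, forall x, V x -> W (a ^+ n * x)].

Section OnePoint.
Variables (O : set F) (a : F) (W : set F).
Hypotheses (sO : is_subring O) (cW : curve_point O a W).

Let sW : is_subring W. Proof. by case: (cp_loc cW). Qed.
Let Wa : W a. Proof. by case: (cp_a cW). Qed.

Lemma bounded_ring_base : bounded_ring O a W W.
Proof.
split=> //; first exact: cp_sub cW.
by exists 0%N => x Wx; rewrite expr0 mul1r.
Qed.

Lemma bounded_ring_elt V x : bounded_ring O a W V -> V x -> bounded_elt O a W x.
Proof.
move=> [sV _ VO [n hn]] Vx; split; first exact: VO.
by exists n => j; apply: hn; exact: subX.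
Qed.

Lemma bounded_ring_adj V x : bounded_ring O a W V -> bounded_elt O a W x ->
  bounded_ring O a W (adj V x).
Proof.
move=> [sV WV VO [n hn]] [Ox [m hm]]; split.
- exact: adj_subring.
- by apply: subset_trans WV _; exact: adj_sub.
- exact: adj_min.
- exists (n + m)%N => _ [p hp <-].
  rewrite horner_coef mulr_sumr; apply: sub_sum => // i _.
  have -> : a ^+ (n + m) * (p`_i * x ^+ i) = (a ^+ n * p`_i) * (a ^+ m * x ^+ i).
    by rewrite exprD; ring.
  by apply: subM => //; exact: hn.
Qed.

Lemma bounded_ring_many V n (x : nat -> F) : bounded_ring O a W V ->
    (forall i, (i < n)%N -> bounded_elt O a W (x i)) ->
  exists V', [/\ bounded_ring O a W V', V `<=` V' & forall i, (i < n)%N -> V' (x i)].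
Proof.
move=> bV; elim: n => [|n IH] hx; first by exists V; split.
have [|V' [bV' VV' hV']] := IH; first by move=> i lt; apply: hx; exact: ltnW.
have sV' : is_subring V' by case: bV'.
exists (adj V' (x n)); split.
- by apply: bounded_ring_adj => //; exact: hx.
- by apply: subset_trans VV' _; exact: adj_sub.
- move=> i; rewrite ltnS leq_eqVlt => /predU1P[->|lt]; first exact: adj_gen.
  by apply: adj_sub => //; exact: hV'.
Qed.

(** The equation puts every power of [w] into the [V]-span of finitely many powers, and these have a
    common denominator. *)
Lemma bounded_monic V w N (c : nat -> F) : bounded_ring O a W V -> O w ->
    (forall i, V (c i)) -> w ^+ N = \sum_(i < N) c i * w ^+ i ->
  bounded_elt O a W w.
Proof.
move=> [sV WV VO [n hn]] Ow Vc wE; split=> //.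
have [m hm] : exists m, forall i, (i < N)%N -> W (a ^+ m * w ^+ i).
  elim: (N) => [|k [m IH]]; first by exists 0%N.
  have [m' hm'] := cp_den cW (subX k sO Ow).
  exists (maxn m m') => i; rewrite ltnS => le.
  have ext l : (l <= maxn m m')%N -> W (a ^+ l * w ^+ i) -> W (a ^+ maxn m m' * w ^+ i).
    move=> /subnK <- h; rewrite exprD -mulrA; apply: subM => //; exact: subX.
  move: le; rewrite leq_eqVlt => /predU1P[ik|lt].
    by apply: (ext m'); [exact: leq_maxr|rewrite ik].
  by apply: (ext m); [exact: leq_maxl|exact: IH].
have span j : rspan V N (fun i => w ^+ i) (w ^+ j).
  have mS : is_mod V (rspan V N (fun i => w ^+ i)) by exact: rspan_mod.
  have wN : rspan V N (fun i => w ^+ i) (w ^+ N).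
    by rewrite wE; exists c.
  elim: j => [|j [d Vd jE]].
    have [N0|N0] := posnP N; last exact: (rspan_gen (fun i => w ^+ i) sV N0).
    by move: wN; rewrite N0.
  rewrite exprS jE mulr_sumr; apply: (mod_sum _ mS) => i _.
  rewrite mulrCA -exprS; apply: (modM mS) => //.
  have := ltn_ord i; rewrite leq_eqVlt => /predU1P[->//|lt].
  exact: (rspan_gen (fun i => w ^+ i) sV lt).
exists (n + m)%N => j; have [d Vd ->] := span j.
rewrite mulr_sumr; apply: sub_sum => // i _.
have -> : a ^+ (n + m) * (d i * w ^+ i) = (a ^+ n * d i) * (a ^+ m * w ^+ i).
  by rewrite exprD; ring.
by apply: subM; [|exact: hn|exact: hm].
Qed.

Variables (kk : nat -> F) (A0 : set F).
Hypotheses (A0W : A0 `<=` W) (sA0 : is_subring A0) (A0k : forall i, A0 (kk i))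
  (kku : forall i j, i != j -> ~ nmax W (kk i - kk j)).

Lemma bounded_mul x y : bounded_elt O a W x -> bounded_elt O a W y ->
  bounded_elt O a W (x * y).
Proof.
move=> bx by_; have bV := bounded_ring_adj (bounded_ring_adj bounded_ring_base bx) by_.
have s1 := adj_subring x sW; apply: (bounded_ring_elt bV); apply: subM.
- exact: adj_subring.
- by apply: adj_sub => //; exact: adj_gen.
- exact: adj_gen.
Qed.

(** Let [u = y / x] and let [G] vanish at [u] with nonzero reduction. A constant [m] with [G.[m]] a
    unit of [W] makes [v = u - m] a unit of [O] whose inverse is integral over [W]. The single
    element [y - m * x = x * v] then divides both [x] and [y] up to bounded factors. *)
Lemma reduce_two x y : ounit O x -> O y -> exists m,
  [/\ A0 m, ounit O (y - m * x), bounded_elt O a W (x / (y - m * x)) &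
      bounded_elt O a W (y / (y - m * x))].
Proof.
move=> [Ox x0 Ox'] Oy; pose u := y / x.
have Ou : O u by exact: subM.
have [mn _] := nmax_idl (cp_loc cW).
have [G [hG Gu hG1]] : exists G, [/\ polyR W G, G.[u] = 0 & exists i, ~ nmax W G`_i].
  apply: krull_akizuki_poly (cp_dcc cW) (cp_acc cW) _ => //.
  - exact: cp_a0 cW.
  - exact/nmax_idl/(cp_loc cW).
  - exact: cp_a cW.
  - exact: nmax1.
  - by move=> m; apply: (cp_den cW); exact: subX.
have [|i hi] := coef_unit_point (kk := kk) sW (nmax_rprime (cp_loc cW)) _ kku hG hG1.
  by move=> i; exact/A0W/A0k.
set m := kk i in hi; have Wm : W m by exact/A0W/A0k.
have [q [hq [GE _]]] := root_division sW Wm hG.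
have [G0 WG'] := nmaxPn (horner_sub sW (@subset_refl _ W) Wm hG) hi.
pose v := u - m.
have qv : q.[u] * v = - G.[m].
  by apply/eqP; rewrite -addr_eq0; apply/eqP; rewrite -[RHS]Gu {2}GE !hornerE.
have v0 : v != 0.
  by apply: contraNneq G0 => v0; rewrite -[G.[m]]opprK -qv v0 mulr0 oppr0.
have Ov : O v by apply: subB => //; exact: (cp_sub cW).
have WO := cp_sub cW.
have Oq : O q.[u] by apply: horner_sub hq.
have Ov' : O v^-1.
  have -> : v^-1 = - (q.[u] * G.[m]^-1).
    apply: (mulfI v0); rewrite divff // mulrN mulrA (mulrC v) qv mulNr opprK divff //.
  by apply: subN => //; apply: subM => //; exact: WO.
have yE : y - m * x = x * v by rewrite /v /u; field.
have xv0 : x * v != 0 by rewrite mulf_neq0.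
have bv : bounded_elt O a W v^-1.
  (* [H] is [q] expanded around [m], so [v * H.[v] = - G.[m]]. Division by [G.[m]] and by a power of
     [v] gives a monic equation for [v^-1], of degree one more than the size of [H]. *)
  pose H := q \Po ('X + m%:P).
  have Hv : H.[v] = q.[u] by rewrite horner_comp !hornerE subrK.
  have hH : polyR W H.
    rewrite /H comp_polyE => k; rewrite coef_sum; apply: sub_sum => // l _.
    rewrite coefZ; apply: subM => //; apply: polyRX_n => //.
    by apply: polyRD => //; [exact: polyRX|exact: polyRC].
  pose N := (size H).+1.
  apply: (@bounded_monic W v^-1 N (fun i => - (G.[m]^-1 * H`_(size H - i)))) => //.
  - exact: bounded_ring_base.
  - by move=> k; apply: subN => //; exact: subM.
  have -> : \sum_(k < N) - (G.[m]^-1 * H`_(size H - k)) * v^-1 ^+ k =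
      - (G.[m]^-1 * v^-1 ^+ size H * H.[v]).
    rewrite /N big_ord_recl /= subn0 nth_default // mulr0 oppr0 mul0r add0r.
    rewrite (horner_coef H) mulr_sumr -sumrN (reindex_inj rev_ord_inj) /=.
    apply: eq_bigr => k _; rewrite /bump /= add1n.
    have -> : (size H - (size H - k.+1).+1 = k)%N.
      by case: k => k /=; move: (size H) => sH; lia.
    have -> : v^-1 ^+ size H = v^-1 ^+ (size H - k.+1).+1 * v^-1 ^+ k.
      rewrite -exprD; congr (_ ^+ _).
      by case: k => k /=; move: (size H) => sH; lia.
    rewrite mulNr; congr (- _).
    set r := v^-1 ^+ _.+1; rewrite exprVn.
    by field; rewrite ?expf_neq0 ?G0 ?v0.
  rewrite Hv; have -> : q.[u] = - G.[m] * v^-1 by rewrite -qv mulfK.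
  rewrite /N exprS; move: (v^-1 ^+ size H) (G.[m]) G0 => w g g0.
  by move: (v^-1) => v'; field.
exists m; split; first exact: A0k.
- rewrite yE; split=> //; first exact: subM.
  by rewrite invfM; exact: subM.
- by rewrite yE invfM mulrA divff // mul1r.
- have -> : y / (y - m * x) = 1 + m * v^-1.
    have -> : y = x * (v + m) by rewrite /v /u; field.
    by rewrite mulrDr -/v [m * x]mulrC addrK; field; rewrite x0 v0.
  have bV := bounded_ring_adj bounded_ring_base bv.
  have sV := adj_subring v^-1 sW.
  apply: (bounded_ring_elt bV); apply: subD => //; first exact: sub1.
  by apply: subM => //; [exact: adj_sub|exact: adj_gen].
Qed.

(* A generic combination X of the x_i generates, up to integral closure, the
   fractional ideal they span. *)
Lemma reduce_many n (x : nat -> F) x0 : ounit O x0 -> (forall i, (i < n)%N -> O (x i)) ->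
  exists X, [/\ ounit O X,
    forall M, is_mod A0 M -> M x0 -> (forall i, (i < n)%N -> M (x i)) -> M X,
    bounded_elt O a W (x0 / X) &
    forall i, (i < n)%N -> bounded_elt O a W (x i / X)].
Proof.
move=> ux0; elim: n => [|n IH] Ox.
  exists x0; split=> //; case: ux0 => _ nz _; rewrite divff //.
  exact: (bounded_ring_elt bounded_ring_base (sub1 sW)).
have [|X [uX MX bX bxX]] := IH; first by move=> i lt; apply: Ox; exact: ltnW.
have [m [Am uY bXY bxY]] := reduce_two uX (Ox n (ltnSn n)).
have [_ nX _] := uX.
exists (x n - m * X); split=> //.
- move=> M mM Mx0 Mx; apply: (modB sA0 mM); first exact: Mx.
  by apply: (modM mM) => //; apply: MX => // i lt; apply: Mx; exact: ltnW.
- have -> : x0 / (x n - m * X) = (x0 / X) * (X / (x n - m * X)) by rewrite mulrA divfK.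
  exact: bounded_mul.
- move=> i; rewrite ltnS leq_eqVlt => /predU1P[->//|lt].
  have -> : x i / (x n - m * X) = (x i / X) * (X / (x n - m * X)).
    by rewrite mulrA divfK.
  by apply: bounded_mul => //; exact: bxX.
Qed.

End OnePoint.

Section ManyPoints.
Variables (O : set F) (a : F) (kk : nat -> F) (A0 : set F).
Hypotheses (lO : is_loc O) (sA0 : is_subring A0) (A0k : forall i, A0 (kk i)).

Let sO : is_subring O. Proof. by case: lO. Qed.

(** On the curve, [x] vanishes at the point of [W] and does not vanish at that of [W'], in the weak
    sense that its inverse is bounded there. *)
Definition separated_from (W W' : set F) :=
  exists x, [/\ nmax W x, ounit O x & bounded_elt O a W' x^-1].

Let pt W := [/\ curve_point O a W, A0 `<=` W &
  forall i j, i != j -> ~ nmax W (kk i - kk j)].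

Lemma sum_unit n (x : nat -> F) : (forall i, (i < n)%N -> O (x i)) ->
  ~ nmax O (\sum_(i < n) x i) -> exists2 i, (i < n)%N & ounit O (x i).
Proof.
move=> Ox h; apply: contrapT => /forall2NP nx; apply: h.
have [mn _] := nmax_idl lO; apply: (mod_sum _ mn) => i _.
apply: contrapT => ni; case: (nx i) => [|]; first by case; exact: ltn_ord.
by case; have [? ?] := nmaxPn (Ox i (ltn_ord i)) ni; split=> //; exact: Ox.
Qed.

(** [X] is a combination of the [al i] with coefficients in [A0], so it lies with them in the
    maximal ideal of [W]; at [W'] it generates, up to bounded factors, the ideal they span. As that
    ideal contains [1 - th] with [th] nilpotent in effect, [X^-1] is bounded. *)
Lemma separate W W' n (al be : nat -> F) (th : F) N :
    pt W -> pt W' -> (forall i, (i < n)%N -> nmax W (al i)) ->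
    (forall i, W' (be i)) -> nmax O th ->
    1 = \sum_(i < n) al i * be i + th -> nmax W' (th ^+ N) ->
  separated_from W W'.
Proof.
move=> [cW AW kW] [cW' AW' kW'] nal Wbe nth E nthN.
have [mnO _] := nmax_idl lO.
have WO := cp_sub cW; have WO' := cp_sub cW'.
have sW' : is_subring W' by case: (cp_loc cW').
have Oal i : (i < n)%N -> O (al i) by move=> lt; apply: WO; case: (nal i lt).
have [i0 lt0 u0] : exists2 i, (i < n)%N & ounit O (al i).
  have [||i lt [Oab nz Oab']] := @sum_unit n (fun i => al i * be i).
  - by move=> i lt; apply: subM => //; [exact: Oal|exact/WO'/Wbe].
  - move=> h; apply: (nmax1 sO); rewrite E; exact: (modD mnO).
  exists i => //; move: nz; rewrite mulf_eq0 => /norP[nz nz'].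
  split=> //; first exact: Oal.
  have -> : (al i)^-1 = be i * (al i * be i)^-1 by field; rewrite nz nz'.
  by apply: subM => //; exact/WO'/Wbe.
have [X [uX MX bX baX]] := reduce_many sO cW' AW' sA0 A0k kW' u0 Oal.
have [OX nX OX'] := uX.
have [mnW _] := nmax_idl (cp_loc cW').
exists X; split=> //.
  apply: MX; [|exact: nal|exact: nal].
  by apply: (mod_sub AW); case: (nmax_idl (cp_loc cW)).
have [V [bV WV Val]] := bounded_ring_many sO cW' (bounded_ring_base cW') baX.
have [sV _ VO _] := bV.
pose t := \sum_(i < n) al i / X * be i.
have Vt : V t.
  by apply: sub_sum => // i _; apply: subM => //; [exact: Val|exact: WV].
have tX : t * X = \sum_(i < n) al i * be i.
  by rewrite /t mulr_suml; apply: eq_bigr => i _; field.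
have Et : 1 - t * X = th by rewrite tX {1}E [_ + th]addrC addrK.
have sV0 := WV; set ga := th ^+ N in nthN.
have Wga : W' (1 - ga) by apply: subB => //; [exact: sub1|case: nthN].
have nga : ~ nmax W' (1 - ga).
  move=> h; apply: (nmax1 sW'); rewrite -(subrK ga 1); exact: (modD mnW).
have [g0 Wg'] := nmaxPn Wga nga.
pose c i := - ((1 - ga)^-1 * ((- t) ^+ (N - i) *+ 'C(N, i))).
apply: (bounded_monic sO cW' (V := V) (N := N) (c := c)) => //.
  move=> i; apply: subN => //; apply: subM => //; first exact: WV.
  by apply: subMn => //; apply: subX => //; exact: subN.
(* From [1 - t * X = th] follows [X^-1 - t = th / X]. The [N]-th power is an equation for [X^-1]
   with leading coefficient [1 - th ^+ N], a unit of [W']. *)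
have wE : (- t + X^-1) ^+ N = ga * X^-1 ^+ N.
  by rewrite -exprMn -Et; congr (_ ^+ _); field.
move: wE; rewrite exprDn big_ord_recr /= subnn expr0 mul1r binn mulr1n => wE.
have {wE} wE : (1 - ga) * X^-1 ^+ N =
    - \sum_(i < N) (- t) ^+ (N - i) * X^-1 ^+ i *+ 'C(N, i).
  by rewrite mulrBl mul1r -wE opprD addrCA subrr addr0.
apply: (mulfI g0); rewrite wE mulr_sumr -sumrN; apply: eq_bigr => i _.
by rewrite /c -mulrnAl; field.
Qed.

(** The function is [1 / (1 + z)], where [z] is highly divisible by [a] at [W'] and [z^-1] is highly
    divisible by [a] at each [W i]. *)
Lemma bump_idempotent n (W : nat -> set F) W' x K :
    (forall i, (i < n)%N -> pt (W i)) -> pt W' ->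
    (forall i, (i < n)%N -> nmax (W i) x) -> ounit O x -> bounded_elt O a W' x^-1 ->
  exists e, (forall i, (i < n)%N -> scale_set (a ^+ K) (W i) e) /\
    scale_set (a ^+ K) W' (1 - e).
Proof.
move=> hW [cW' _ _] nx [Ox x0 Ox'] [_ [M hM]].
have sW' : is_subring W' by case: (cp_loc cW').
have a0 := cp_a0 cW'; have Wa' : W' a by case: (cp_a cW').
have {hW} hW i : (i < n)%N -> curve_point O a (W i) by move=> /hW[].
have sW i : (i < n)%N -> is_subring (W i) by move=> /hW/cp_loc[].
have Wa i : (i < n)%N -> W i a by move=> /hW/cp_a[].
have [m hm] : exists m, forall i, (i < n)%N -> scale_set a (W i) (x ^+ m).
  elim: n hW sW Wa nx => [|n IH] hW sW Wa nx; first by exists 0%N.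
  have [||||m hm] := IH.
  - by move=> i lt; apply: hW; exact: ltnW.
  - by move=> i lt; apply: sW; exact: ltnW.
  - by move=> i lt; apply: Wa; exact: ltnW.
  - by move=> i lt; apply: nx; exact: ltnW.
  have [m' hm'] := cp_nil (hW n (ltnSn n)) (nx n (ltnSn n)).
  exists (m + m')%N => i; rewrite ltnS leq_eqVlt => /predU1P[->|lt].
    rewrite addnC exprD; have [y Wy <-] := hm'.
    exists (y * x ^+ m); last by rewrite mulrA.
    by apply: subM; [exact: sW|by []|apply: subX; [exact: sW|case: (nx n (ltnSn n))]].
  rewrite exprD; have [y Wy <-] := hm _ lt; have lt' := ltnW lt.
  exists (y * x ^+ m'); last by rewrite mulrA.
  by apply: subM; [exact: sW|by []|apply: subX; [exact: sW|case: (nx i lt')]].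
(* [x ^+ m] is divisible by [a] at every [W i], so the power of [x] outweighs [a ^+ (M + K.+1)]
   there by [K.+1] factors; at [W'] the factor [a ^+ M] absorbs the powers of [x^-1]. One factor
   beyond [K] makes [1 + z] and [1 + z^-1] units at the respective points even for [K = 0]. *)
pose z := a ^+ (M + K.+1) * x^-1 ^+ (m * (M + K.+1 + K.+1)).
have z0 : z != 0 by rewrite mulf_neq0 ?expf_neq0 ?invr_neq0.
have zW' : scale_set (a ^+ K.+1) W' z.
  exists (a ^+ M * x^-1 ^+ (m * (M + K.+1 + K.+1))); first exact: hM.
  by rewrite /z exprD; ring.
have zW i : (i < n)%N -> scale_set (a ^+ K.+1) (W i) z^-1.
  move=> lt; have [y Wy yE] := hm i lt.
  exists (y ^+ (M + K.+1 + K.+1)); first by apply: subX => //; exact: sW.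
  rewrite /z exprM exprVn -yE exprVn invfM invrK exprMn [a ^+ (_ + _ + _)]exprD.
  by field; rewrite ?expf_neq0 ?a0.
have split_a R y : is_subring R -> R a -> scale_set (a ^+ K.+1) R y ->
    scale_set (a ^+ K) R y.
  move=> sR Ra [c Rc <-]; exists (a * c); first exact: subM.
  by rewrite exprSr mulrA.
have unit1 R y : is_loc R -> nmax R a -> scale_set (a ^+ K.+1) R y ->
    1 + y != 0 /\ R (1 + y)^-1.
  move=> lR na [c Rc yE]; have [sR _] := lR; have [mn _] := nmax_idl lR.
  have Ra : R a by case: na.
  have ny : nmax R y.
    rewrite -yE exprS -mulrA mulrC; apply: (modM mn) => //.
    by apply: subM => //; exact: subX.
  apply: nmaxPn; first by apply: subD; [|exact: sub1|case: ny].
  move=> h; apply: (nmax1 sR); rewrite -(addrK y 1); exact: (modB sR mn).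
exists (z^-1 / (1 + z^-1)); split.
  move=> i lt; have [u0 Wu] := unit1 _ _ (cp_loc (hW i lt)) (cp_a (hW i lt)) (zW i lt).
  have [c Wc cE] := split_a _ _ (sW i lt) (Wa i lt) (zW i lt).
  by exists (c / (1 + z^-1)); [apply: subM => //; exact: sW|rewrite mulrA cE].
have [u0 Wu] := unit1 _ _ (cp_loc cW') (cp_a cW') zW'.
have [c Wc cE] := split_a _ _ sW' Wa' zW'.
exists (c / (1 + z)); first exact: subM.
have z1 : 1 + z^-1 != 0.
  have -> : 1 + z^-1 = (1 + z) / z by field.
  by rewrite mulf_neq0 ?invr_neq0.
by rewrite mulrA cE; field; rewrite z0 addrC u0.
Qed.

Lemma common_den N (W : nat -> set F) m (y : nat -> F) :
    (forall j, (j < N)%N -> curve_point O a (W j)) ->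
    (forall i, (i < m)%N -> O (y i)) ->
  exists L, forall i j, (i < m)%N -> (j < N)%N -> W j (a ^+ L * y i).
Proof.
move=> hW Oy.
have up j l l' z : (j < N)%N -> (l <= l')%N -> W j (a ^+ l * z) -> W j (a ^+ l' * z).
  move=> /hW[[sW _] _ [Wa _] _ _ _ _ _] /subnK <- h.
  by rewrite exprD -mulrA; apply: subM => //; exact: subX.
elim: m Oy => [|m IH] Oy; first by exists 0%N.
have [|L hL] := IH; first by move=> i lt; apply: Oy; exact: ltnW.
have [L' hL'] : exists L', forall j, (j < N)%N -> W j (a ^+ L' * y m).
  suff H k : (k <= N)%N -> exists L', forall j, (j < k)%N -> W j (a ^+ L' * y m).
    exact: H.
  elim: k => [|k IHk] kN; first by exists 0%N.
  have [L' hL'] := IHk (ltnW kN).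
  have [L2 hL2] := cp_den (hW k kN) (Oy m (ltnSn m)).
  exists (maxn L' L2) => j; rewrite ltnS leq_eqVlt => /predU1P[->|lt].
    by apply: up hL2 => //; exact: leq_maxr.
  by apply: up (hL' j lt); [exact: leq_trans lt (ltnW kN)|exact: leq_maxl].
exists (maxn L L') => i j; rewrite ltnS leq_eqVlt => /predU1P[->|lt] ltj.
  by apply: up (hL' j ltj) => //; exact: leq_maxr.
by apply: up (hL i j lt ltj) => //; exact: leq_maxl.
Qed.

(** Induction on the number of points. A partition for the old points glues the functions separating
    each of them from the new point into one function [X] that vanishes at all old points and has
    bounded inverse at the new one. A bump built on [X] then splits off the new summand. *)
Lemma partition_of_unity n (W : nat -> set F) : (0 < n)%N ->
    (forall i, (i < n)%N -> pt (W i)) ->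
    (forall i j, (i < n)%N -> (j < n)%N -> i != j -> separated_from (W i) (W j)) ->
  forall K, exists e : nat -> F, [/\ \sum_(i < n) e i = 1,
    forall i, (i < n)%N -> O (e i) &
    forall i j, (i < n)%N -> (j < n)%N -> i != j -> scale_set (a ^+ K) (W j) (e i)].
Proof.
case: n => // n _; elim: n => [|n IH] hW hs K.
  exists (fun=> 1); split; first by rewrite big_ord1.
    by move=> *; exact: sub1.
  by move=> [|i] [|j].
have hW' i : (i < n.+1)%N -> pt (W i) by move=> lt; apply: hW; exact: ltnW.
have {}IH := IH hW' (fun i j li lj => hs i j (ltnW li) (ltnW lj)).
have sW i : (i < n.+2)%N -> is_subring (W i) by move=> /hW[/cp_loc[]].
have nW i : (i < n.+2)%N -> is_idl (W i) (nmax (W i)).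
  by move=> /hW[/cp_loc/nmax_idl].
have Wa i : (i < n.+2)%N -> W i a by move=> /hW[/cp_a[]].
have WO i : (i < n.+2)%N -> W i `<=` O by move=> /hW[/cp_sub].
have [cr Ar kr] := hW n.+1 (ltnSn _).
have /choice[x xP] i : exists x, (i < n.+1)%N ->
    [/\ nmax (W i) x, ounit O x & bounded_elt O a (W n.+1) x^-1].
  have [lt|] := boolP (i < n.+1)%N; last by exists 0.
  by have [|x ?] := hs i n.+1 (ltnW lt) (ltnSn _); [rewrite ltn_eqF|exists x].
have cW j : (j < n.+2)%N -> curve_point O a (W j) by move=> /hW[].
have [|L hL] := @common_den n.+2 W n.+1 x cW; first by move=> i /xP[_ []].
(* [L] clears the denominators of the [x i]; the extra factor [a] puts [x i * e i] into the maximal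
   ideal at the other old points. *)
have [e [e1 Oe eW]] := IH (L + K).+1.
pose y i := x i * e i.
have eWi i : (i < n.+1)%N -> W i (e i).
  move=> lt; have lt' := ltnW lt; have si := sW i lt'.
  have -> : e i = 1 - \sum_(j < n.+1 | j != Ordinal lt) e j.
    by rewrite -e1 (bigD1 (Ordinal lt)) //= addrK.
  apply: subB => //; first exact: sub1.
  apply: sub_sum => // j ji; have [|c Wc <-] := eW j i (ltn_ord j) lt; first exact: ji.
  by apply: subM => //; apply: subX => //; exact: Wa.
have ny i j : (i < n.+1)%N -> (j < n.+1)%N -> nmax (W j) (y i).
  move=> lti ltj; have ltj' := ltnW ltj; have [mj _] := nW j ltj'.
  have sj := sW j ltj'.
  have [ij|ij] := eqVneq i j.
    rewrite /y -ij mulrC; apply: (modM _); first exact: (nW i (ltnW lti)).1.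
      exact: eWi.
    by case: (xP i lti).
  have [c Wc cE] := eW i j lti ltj ij.
  have -> : y i = (a ^+ L * x i) * (a ^+ K * c) * a.
    by rewrite /y -cE exprS exprD; ring.
  apply: (modM mj); last by case: (hW j ltj') => [[]].
  apply: subM => //; first exact: hL.
  by apply: subM => //; apply: subX => //; exact: Wa.
have [|i0 lt0 [Oe0 ne0 Oe0']] := @sum_unit n.+1 e Oe.
  by rewrite e1; exact: nmax1.
have uy0 : ounit O (y i0).
  have [_ [Ox nx Ox'] _] := xP i0 lt0; split; first exact: subM.
    by rewrite mulf_neq0.
  by rewrite invfM; exact: subM.
have Oy i : (i < n.+1)%N -> O (y i).
  by move=> lt; apply: subM => //; [case: (xP i lt) => _ []|exact: Oe].
have [X [uX MX _ bxX]] := reduce_many sO cr Ar sA0 A0k kr uy0 Oy.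
have [OX nX OX'] := uX.
have nWX j : (j < n.+1)%N -> nmax (W j) X.
  move=> lt; have lt' := ltnW lt; apply: MX; try by move=> *; exact: ny.
  by have [_ Aj _] := hW j lt'; apply: (mod_sub Aj); case: (nW j lt').
have bX : bounded_elt O a (W n.+1) X^-1.
  have [V [bV _ Vy]] := bounded_ring_many sO cr (bounded_ring_base cr) bxX.
  have [|V' [bV' VV' Vx]] := @bounded_ring_many O a (W n.+1) sO cr V n.+1 (fun i => (x i)^-1) bV.
    by move=> i /xP[].
  apply: (bounded_ring_elt bV'); have [sV' _ _ _] := bV'.
  (* That the [e i] add up to 1 turns [X^-1] into a combination of the bounded elements [y i / X]
     and [(x i)^-1]. *)
  have -> : X^-1 = \sum_(i < n.+1) y i / X * (x i)^-1.
    rewrite -[LHS]mul1r -e1 mulr_suml; apply: eq_bigr => i _.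
    by have [_ [_ nx _] _] := xP i (ltn_ord i); rewrite /y; field; rewrite nx nX.
  apply: sub_sum => // i _; apply: subM => //; first exact/VV'/Vy.
  exact: Vx.
have [|L' hL'] := @common_den n.+2 W n.+1 e cW; first exact: Oe.
(* The new summands are [e i * (1 - e')], and [L'] absorbs the denominators of the old [e i] at the
   new point. *)
have [e' [he' he1]] := bump_idempotent (K + L') hW' (hW n.+1 (ltnSn _)) nWX uX bX.
have mle j z : (j < n.+2)%N -> scale_set (a ^+ (K + L')) (W j) z -> scale_set (a ^+ K) (W j) z.
  move=> lt [c Wc <-]; exists (a ^+ L' * c); last by rewrite exprD mulrA.
  by apply: subM; [exact: sW|apply: subX; [exact: sW|exact: Wa]|].
have in_W j z : (j < n.+2)%N -> scale_set (a ^+ K) (W j) z -> W j z.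
  by move=> lt [c Wc <-]; apply: subM; [exact: sW|apply: subX; [exact: sW|exact: Wa]|].
have Oe' : O e'.
  rewrite -[e'](subKr 1); apply: subB => //; first exact: sub1.
  by apply: (WO n.+1) => //; apply: in_W => //; exact: mle.
exists (fun i => if i == n.+1 then e' else e i * (1 - e')); split.
- rewrite big_ord_recr /= eqxx.
  rewrite (eq_bigr (fun i : 'I_n.+1 => e i * (1 - e'))).
    by rewrite -mulr_suml e1 mul1r subrK.
  by move=> i _; rewrite ltn_eqF // ltn_ord.
- move=> i; rewrite ltnS leq_eqVlt; case: eqP => //= _ lt.
  by apply: subM => //; [exact: Oe|apply: subB => //; exact: sub1].
move=> i j lti ltj.
have low k : (k < n.+2)%N -> k != n.+1 -> (k < n.+1)%N.
  by move=> lt nk; rewrite (ltn_neqAle k n.+1) nk -ltnS.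
case: (eqVneq i n.+1) => [->|ni] /=; case: (eqVneq j n.+1) => [->|nj] /=.
- by rewrite ?eqxx.
- by move=> _; apply: mle => //; apply: he'; exact: low.
- move=> _; have [c Wc cE] := he1.
  exists ((a ^+ L' * e i) * c).
    by apply: subM => //; [exact: sW|apply: hL' => //; exact: low].
  by rewrite -cE exprD; ring.
- move=> ij; have [c Wc cE] := eW i j (low i lti ni) (low j ltj nj) ij.
  have sj := sW j ltj.
  exists (a ^+ L.+1 * c * (1 - e')); last by rewrite -cE !exprS exprD; ring.
  apply: subM => //; first by apply: subM => //; apply: subX => //; exact: Wa.
  apply: subB => //; first exact: sub1.
  by apply: in_W => //; apply: mle => //; apply: he'; exact: low.
Qed.

End ManyPoints.
End Semilocal.

(** * Models and their exceptional primes *)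

Definition generizes (X : topologicalType) (y x : X) := forall V, open V -> V x -> V y.

(* The local rings of X as subrings of F = Frac A. *)
Record local_model (F : fieldType) (A : set F) (X : topologicalType) (O : X -> set F)
    (eta : X) : Prop := LocalModel {
  lm_A : is_loc A;
  lm_noeth : rnoeth A;
  lm_dim : forall P Q : set F, is_rprime A P -> is_rprime A Q -> P `<=` Q ->
    (exists2 a, P a & a != 0) -> ~ (Q `<=` P) -> nmax A `<=` Q;
  lm_frac : forall x, exists a b, [/\ A a, A b, b != 0 & x = a / b];
  lm_normal : forall n (c : nat -> F) x, (forall i, A (c i)) ->
    x ^+ n = \sum_(i < n) c i * x ^+ i -> A x;
  lm_root : forall p : {poly F}, polyR A p -> p \is monic -> (1 < size p)%N ->
    exists2 a, A a & nmax A p.[a];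
  lm_units : exists kk : nat -> F, (forall i, A (kk i)) /\
    forall i j, i != j -> ~ nmax A (kk i - kk j);
  lm_AO : forall x, A `<=` O x;
  lm_loc : forall x, is_loc (O x);
  lm_Onoeth : forall x, rnoeth (O x);
  lm_open : forall x a, O x a -> exists V, [/\ open V, V x & forall y, V y -> O y a];
  lm_prime : forall x Q, is_rprime (O x) Q ->
    exists2 y, generizes y x & Q = O x `&` nmax (O y);
  lm_gen : forall x y a, generizes y x -> O x a -> O y a;
  lm_genloc : forall x y a, generizes y x -> O y a ->
    exists b s, [/\ O x b, O x s, ~ nmax (O y) s & a = b / s];
  lm_gencmp : forall x y z, generizes y x -> generizes z x ->
    O x `&` nmax (O y) `<=` nmax (O z) -> generizes y z;
  lm_T0 : forall x y : X, generizes x y -> generizes y x -> x = y;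
  lm_closed : forall C : set X, closed C -> exists s : seq X,
    forall x, C x <-> exists2 w, w \in s & generizes w x;
  lm_meet : forall C : set X, closed C -> C !=set0 -> exists2 x, C x & nmax A `<=` nmax (O x);
  lm_surj : forall P, is_rprime A P -> exists x, A `&` nmax (O x) = P;
  lm_eta : forall x : X, generizes eta x;
  lm_etaF : O eta = setT;
  lm_sep : forall y x x' : X, generizes y x -> generizes y x' -> x <> x' ->
    exists n (al be : nat -> F), [/\ forall k, O x (al k), forall k, O x' (be k),
      forall k, nmax (O x) (al k) \/ nmax (O x') (be k) &
      nmax (O y) (\sum_(k < n) al k * be k - 1)]
}.

Lemma locz_common_den (F : fieldType) (R P : set F) n (c : nat -> F) :
    is_subring R -> is_rprime R P -> (forall i, (i < n)%N -> locz R P (c i)) ->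
  exists s, [/\ R s, ~ P s & forall i, (i < n)%N -> R (s * c i)].
Proof.
move=> sR pP; elim: n => [|n IH] hc.
  by exists 1; split=> //; [exact: sub1|case: pP].
have [|s [Rs Ps hs]] := IH; first by move=> i lt; apply: hc; exact: ltnW.
have [b [t [Rb Rt Pt cE]]] := hc n (ltnSn n).
exists (s * t); split; [exact: subM|exact: rprime_nmul pP _ _ _ _|].
move=> i; rewrite ltnS leq_eqVlt => /predU1P[->|lt].
  have -> : s * t * c n = s * b by rewrite cE; field; exact: rprime_neq0 pP Pt.
  exact: subM.
by rewrite mulrAC mulrC; apply: subM => //; exact: hs.
Qed.

Section Model.
Variables (F : fieldType) (A : set F) (X : topologicalType) (O : X -> set F) (eta : X).
Hypothesis M : local_model A O eta.
Implicit Types (x y z w e : X) (a b c u v : F).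

Let lA : is_loc A. Proof. exact: lm_A M. Qed.
Let sA : is_subring A. Proof. by case: lA. Qed.
Let lO x : is_loc (O x). Proof. exact: lm_loc M x. Qed.
Let sO x : is_subring (O x). Proof. by case: (lO x). Qed.
Let nO x : is_mod (O x) (nmax (O x)). Proof. by case: (nmax_idl (lO x)). Qed.
Let nA : is_mod A (nmax A). Proof. by case: (nmax_idl lA). Qed.

Definition exceptional x := nmax A `<=` nmax (O x).

Lemma gen_refl x : generizes x x. Proof. by []. Qed.
Lemma gen_trans x y z : generizes x y -> generizes y z -> generizes x z.
Proof. by move=> xy yz V oV Vz; apply: xy => //; exact: yz. Qed.

Lemma gen_unit x y a : generizes y x -> O x a -> ~ nmax (O x) a -> ~ nmax (O y) a.
Proof.
move=> g Oa na [_ [a0|]].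
  by apply: na; split=> //; left.
by have [a0 Oa'] := nmaxPn Oa na; apply; exact: (lm_gen M) g Oa'.
Qed.

Lemma gen_nmax x y a : generizes y x -> O x a -> nmax (O y) a -> nmax (O x) a.
Proof. by move=> g Oa na; apply: contrapT => /(gen_unit g Oa). Qed.

Lemma trace_prime x y : generizes y x -> is_rprime (O x) (O x `&` nmax (O y)).
Proof.
move=> g; have [iy y1 yp] := nmax_rprime (lO y).
split.
- split; last by move=> a [].
  apply: setI_mod; first exact: mod_subring.
  by apply: (mod_sub _ (nO y)) => a; exact: (lm_gen M).
- by move=> [_ /y1].
- move=> a b Oa Ob [_ /yp]; case; try exact: (lm_gen M) g _.
    by left.
  by right.
Qed.

Lemma exc_up x y : generizes y x -> exceptional y -> exceptional x.
Proof. by move=> g Ey a na; apply: (gen_nmax g); [apply: (lm_AO M); case: na|exact: Ey]. Qed.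

Lemma A_trace_prime x : is_rprime A (A `&` nmax (O x)).
Proof.
have [ix x1 xp] := nmax_rprime (lO x); split.
- split; last by move=> a [].
  apply: setI_mod; first exact: mod_subring.
  by apply: (mod_sub _ (nO x)); exact: (lm_AO M).
- by move=> [_ /x1].
- move=> a b Aa Ab [_ /xp]; case; try exact: (lm_AO M).
    by left.
  by right.
Qed.

Lemma gen_eta x : nmax (O x) `<=` [set 0] -> x = eta.
Proof.
move=> nx; apply: (lm_T0 M); last exact: (lm_eta M).
apply: (lm_gencmp M (x := x)); [exact: gen_refl|exact: (lm_eta M)|].
move=> a [_ /nx ->]; split; first by rewrite (lm_etaF M).
by left.
Qed.

Lemma eta_nmax a : nmax (O eta) a -> a = 0.
Proof. by rewrite (lm_etaF M) => -[_ [//|[]]]. Qed.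

(* The denominator ideal of a suitable multiple of c is prime; normality
   then provides u in it with u c' a unit modulo it. *)
Lemma conductor R c : is_subring R -> rnoeth R -> A `<=` R ->
    (forall n (s : nat -> F) (x : F), (forall i, R (s i)) ->
      x ^+ n = \sum_(i < n) s i * x ^+ i -> R x) ->
    ~ R c ->
  exists r, [/\ R r, ~ R (r * c), is_rprime R [set s | R s /\ R (s * (r * c))],
    exists2 b, R (b * (r * c)) & R b /\ b != 0 &
    exists u, [/\ R u, R (u * (r * c)) & ~ R (u * (r * c) * (r * c))]].
Proof.
move=> sR nR AR normR nRc.
pose D r := [set s | R s /\ R (s * (r * c))].
have iD r : is_idl R (D r).
  split; last by move=> s [].
  split; first by split; [exact: sub0|rewrite mul0r; exact: sub0].
    by move=> s t [Rs Hs] [Rt Ht]; split; [exact: subD|rewrite mulrDl; exact: subD].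
  by move=> t s Rt [Rs Hs]; split; [exact: subM|rewrite -mulrA; exact: subM].
(* Among the multiples of [c] outside [R], one with maximal denominator ideal; as for associated
   primes, maximality makes this ideal prime. *)
have [||_ [r [Rr nRrc] <-] rmax] := @rnoeth_max _ R [set D r | r in [set r | R r /\ ~ R (r * c)]] nR.
- by exists (D 1), 1 => //; split; [exact: sub1|rewrite mul1r].
- by move=> _ [r _ <-].
have {}rmax r' : R r' -> ~ R (r' * c) -> D r `<=` D r' -> D r' `<=` D r.
  by move=> Rr' nRr'; apply: rmax; exists r'.
set k := r * c in nRrc *.
have [a [b [Aa Ab b0 cE]]] := lm_frac M c.
have Db : R (b * k).
  have -> : b * k = r * a by rewrite /k cE; field.
  by apply: subM => //; exact: AR.
exists r; split=> //.
- split; [exact: (iD r)|by move=> [_]; rewrite mul1r|].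
  move=> s t Rs Rt [_ Hst]; apply: contrapT => /not_orP[ns nt]; apply: ns; split=> //.
  apply: contrapT => ns.
  apply: nt; split=> //; rewrite -/k.
  have : D (s * r) t.
    by split=> //; rewrite -(mulrA s) -/k mulrA (mulrC t).
  move=> /(rmax (s * r)); case => //.
  + exact: subM.
  + by rewrite -mulrA.
  + move=> w [Rw Hw]; split=> //; rewrite -(mulrA s) -/k mulrCA; exact: subM.
- by exists b => //; split=> //; exact: AR.
(* If [u * k] stayed in the denominator ideal of [k] for every [u] in it, all [b * k ^+ n] would lie
   in [R], and the chain of their spans would make [k] integral over [R]. *)
apply: contrapT => /forallNP h; apply: nRrc.
have key n : R (b * k ^+ n) /\ R (b * k ^+ n * k).
  elim: n => [|n [IH1 IH2]]; first by rewrite expr0 mulr1; split=> //; exact: AR.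
  have E : b * k ^+ n.+1 = b * k ^+ n * k by rewrite exprSr mulrA.
  rewrite E; split=> //; apply: contrapT => nn; apply: (h (b * k ^+ n)).
  by split.
have [n|n|n hn] := nR (fun n => rspan R n (fun i => b * k ^+ i)).
- split; first exact: rspan_mod.
  by apply: rspan_le; [exact: mod_subring|move=> i _; case: (key i)].
- apply: rspan_le; first exact: rspan_mod.
  by move=> i lt; apply: (rspan_gen (fun i => b * k ^+ i)) => //; exact: ltnW.
have [s Rs sE] : rspan R n (fun i => b * k ^+ i) (b * k ^+ n).
  by apply: (hn n.+1) => //; exact: (rspan_gen (fun i => b * k ^+ i)).
apply: (normR n s) => //; apply: (mulfI b0); rewrite sE mulr_sumr.
by apply: eq_bigr => i _; rewrite mulrCA.
Qed.

(** For [c] outside [A], let P be the prime denominator ideal of a suitable multiple c' of [c], and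
    [u] in P with [u c'] in [A] but not in P. At a point [x] above P, c' lies in [O x] and [u] in
    its maximal ideal, which puts [u c'] into P after all. *)
Lemma global_sections c : (forall x, O x c) -> A c.
Proof.
move=> Oc; apply: contrapT => nAc.
have [r [Ar nrc pD _ [u [Au Auc nuc]]]] :=
  conductor sA (lm_noeth M) (@subset_refl _ A) (lm_normal M) nAc.
have [x xE] := lm_surj M pD.
have [_ nu] : (A `&` nmax (O x)) u by rewrite xE.
have [] : ([set s | A s /\ A (s * (r * c))] : set F) (u * (r * c)); last by [].
rewrite -xE; split=> //; rewrite mulrC; apply: (modM (nO x)) => //.
by apply: subM; [exact: sO|exact: (lm_AO M)|exact: Oc].
Qed.

Lemma locz_normal P n (c : nat -> F) (x : F) : is_rprime A P ->
  (forall i, locz A P (c i)) -> x ^+ n = \sum_(i < n) c i * x ^+ i -> locz A P x.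
Proof.
move=> pP hc xE.
have [s [As Ps hs]] := locz_common_den sA pP (fun i (_ : (i < n)%N) => hc i).
have s0 := rprime_neq0 pP Ps.
have Asx : A (s * x).
  apply: (lm_normal M (n := n) (c := fun i => if (i < n)%N then s ^+ (n - i.+1) * (s * c i) else 0)).
    move=> i; case: ifP => lt; last exact: sub0.
    by apply: subM => //; [exact: subX|exact: hs].
  rewrite exprMn xE mulr_sumr; apply: eq_bigr => i _; rewrite ltn_ord exprMn.
  have -> : s ^+ n = s ^+ (n - i.+1) * s * s ^+ i.
    by rewrite -exprSr -exprD; congr (_ ^+ _); have := ltn_ord i; lia.
  by ring.
by exists (s * x), s; split=> //; field.
Qed.

(** The argument of [global_sections], over the localization of [A] at P. The denominator prime has
    a nonzero trace Q inside P; as P is not the maximal ideal, the dimension of [A] leaves only Q =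
    P, so [x] itself lies above Q. *)
Lemma height_one_stalk x : ~ exceptional x -> x <> eta ->
  O x = locz A (A `&` nmax (O x)).
Proof.
move=> nE xeta; set P := A `&` nmax (O x).
have pP : is_rprime A P := A_trace_prime x.
have sL := locz_subring sA pP; have AL := locz_sub sA pP.
have LO : locz A P `<=` O x.
  move=> _ [b [s [Ab As Ps ->]]]; apply: subM; [exact: sO|exact: (lm_AO M)|].
  have [|ns|//] := @nmaxPn _ (O x) s; first exact: (lm_AO M).
  by apply: Ps.
apply/seteqP; split=> // c Oc; apply: contrapT => nLc.
have nL : rnoeth (locz A P) by apply: locz_noeth => //; exact: (lm_noeth M).
have [r [Lr nrc pD [b Lb [Lb' b0]] [u [Lu Luc nuc]]]] :=
  conductor sL nL AL (fun n s (z : F) => @locz_normal P n s z pP) nLc.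
set D := [set s | _] in pD.
have [[mD DL] D1 Dp] := pD.
pose Q := A `&` D.
have pQ : is_rprime A Q.
  split.
  - split; last by move=> ? [].
    by apply: setI_mod; [exact: mod_subring|exact: mod_sub AL mD].
  - by case.
  - by move=> s t As At [_ /Dp]; case; [exact: AL|exact: AL|left|right].
have DQ s : D s -> exists a t, [/\ Q a, A t, ~ P t & s = a / t].
  move=> Ds; have [a [t [Aa At Pt sE]]] := DL _ Ds; exists a, t; split=> //.
  split=> //; have -> : a = t * s by rewrite sE; field; exact: rprime_neq0 pP Pt.
  by apply: (modM mD) => //; exact: AL.
have QP : Q `<=` P.
  move=> a [Aa Da]; apply: contrapT => nPa; apply: D1.
  rewrite -(mulVf (rprime_neq0 pP nPa)); apply: (modM mD) => //.
  exact: locz_inv.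
have Q0 : exists2 a, Q a & a != 0.
  have [a [t [Qa At Pt bE]]] := DQ b (conj Lb' Lb); exists a => //.
  by apply: contraNneq b0 => a0; rewrite bE a0 mul0r.
have PQ : P `<=` Q.
  apply: contrapT => nPQ; apply: nE => a na.
  by have [] := lm_dim M pQ pP QP Q0 nPQ na.
have uD : D u by split.
have nu : nmax (O x) u.
  have [a [t [Qa At Pt ->]]] := DQ u uD; rewrite mulrC; apply: (modM (nO x)).
    by apply: LO; exact: locz_inv.
  by have [] := QP _ Qa.
suff [] : D (u * (r * c)) by [].
have [a [t [Aa At Pt E]]] := Luc; rewrite E mulrC; apply: (modM mD).
  exact: locz_inv.
suff [] : Q a by [].
apply: PQ; split=> //.
have -> : a = t * (u * (r * c)) by rewrite E; field; exact: rprime_neq0 pP Pt.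
apply: (modM (nO x)); first exact: (lm_AO M).
rewrite mulrC; apply: (modM (nO x)) => //.
by apply: subM; [exact: sO|exact: LO|].
Qed.

(** The trace of [y] on [A] is nonzero and contained in that of [x], which is not maximal; by
    dimension they agree. Since [O x] is the localization there, the maximal ideals agree as
    well. *)
Lemma nonexc_trace x y : ~ exceptional x -> generizes y x -> y <> eta -> y = x.
Proof.
move=> nE g yeta; have nEy : ~ exceptional y by move=> /(exc_up g).
have xeta : x <> eta by move=> xe; apply: yeta; apply: (lm_T0 M); [rewrite -xe|exact: (lm_eta M)].
apply: (lm_T0 M) => //.
apply: (lm_gencmp M (x := x)) => //.
move=> a [_ na].
have PyPx : A `&` nmax (O y) `<=` A `&` nmax (O x).
  by move=> b [Ab nb]; split=> //; apply: (gen_nmax g) => //; exact: (lm_AO M).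
have Py0 : exists2 b, (A `&` nmax (O y)) b & b != 0.
  apply: contrapT => h; apply: yeta; apply: gen_eta => b nb.
  apply: contrapT => /eqP b0; apply: h.
  have [d [t [Ad At t0 bE]]] := lm_frac M b; exists d; last first.
    by apply: contraNneq b0 => d0; rewrite bE d0 mul0r.
  split=> //; have -> : d = t * b by rewrite bE; field.
  by apply: (modM (nO y)) => //; exact: (lm_AO M).
have PxPy : A `&` nmax (O x) `<=` A `&` nmax (O y).
  apply: contrapT => nP; apply: nE => b nb.
  by have [] := lm_dim M (A_trace_prime y) (A_trace_prime x) PyPx Py0 nP nb.
have [Ox _] := na; rewrite (height_one_stalk nE xeta) in Ox.
have [b [t [Ab At Pt aE]]] := Ox.
have pP := A_trace_prime x; have t0 := rprime_neq0 pP Pt.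
have nb : nmax (O x) b.
  by have -> : b = t * a; [rewrite aE; field|apply: (modM (nO x)) => //; exact: (lm_AO M)].
rewrite aE mulrC; have [_ nb'] := PxPy b (conj Ab nb); apply: (modM (nO y)) => //.
apply: (lm_gen M g); have [|nt|//] := @nmaxPn _ (O x) t; first exact: (lm_AO M).
by apply: Pt.
Qed.

Lemma curve_nilpotent y g a : ~ exceptional y -> O y g -> g != 0 -> nmax (O y) a ->
  exists n, scale_set g (O y) (a ^+ n).
Proof.
move=> nE Og g0 na; have [Oa _] := na.
apply: (@radical_power _ (O y)) => //.
  split; first by apply: scale_mod; exact: mod_subring.
  by move=> _ [b Ob <-]; exact: subM.
move=> P pP gP; have [z gz PE] := lm_prime M pP.
have Pg : P g by apply: gP; exists 1; rewrite ?mulr1 //; exact: sub1.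
have zeta : z <> eta.
  move=> ze; move: Pg; rewrite PE ze => -[_ /eta_nmax g00].
  by rewrite g00 eqxx in g0.
by rewrite PE (nonexc_trace nE gz zeta).
Qed.

End Model.

(** * The exceptional fibre has dimension one *)

Section ExceptionalPrimes.
Variables (F : fieldType) (A : set F) (X : topologicalType) (O : X -> set F) (eta : X).
Hypothesis M : local_model A O eta.
Implicit Types (x y z w e : X) (a b c u v p : F).

Let lA : is_loc A. Proof. exact: lm_A M. Qed.
Let sA : is_subring A. Proof. by case: lA. Qed.
Let lO x : is_loc (O x). Proof. exact: lm_loc M x. Qed.
Let sO x : is_subring (O x). Proof. by case: (lO x). Qed.
Let nO x : is_mod (O x) (nmax (O x)). Proof. by case: (nmax_idl (lO x)). Qed.
Let nA : is_mod A (nmax A). Proof. by case: (nmax_idl lA). Qed.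
Let E := exceptional A O.

(** A nonzero generator of the maximal ideal is recorded instead of dimension one: it makes the
    Noetherian ring [O e] a discrete valuation ring. *)
Definition exc_divisor e :=
  exceptional A O e /\ exists2 p, p != 0 & nmax (O e) = scale_set p (O e).

Lemma gen_trace_sub x y z : generizes y x -> generizes z x -> generizes y z ->
  O x `&` nmax (O y) `<=` O x `&` nmax (O z).
Proof.
by move=> gy gz g a [Oa na]; split=> //; apply: (gen_nmax M g) => //; exact: (lm_gen M gz).
Qed.

Lemma trace0_eta x y : generizes y x -> O x `&` nmax (O y) `<=` [set 0] -> y = eta.
Proof.
move=> g h; apply: (gen_eta M) => a na; have [Oa _] := na.
have [b [s [Ob Os ns aE]]] := lm_genloc M g Oa.
have s0 : s != 0.
  by apply: contra_notN ns => /eqP ->; exact: mod0 (nO y).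
have : (O x `&` nmax (O y)) b.
  split=> //; have -> : b = s * a by rewrite aE; field.
  by apply: (modM (nO y)) => //; exact: (lm_gen M g).
by move=> /h /= b0; rewrite /= aE b0 mul0r.
Qed.

(** A prime Q of [O e] not containing the uniformizer [p] satisfies Q = pQ. Dividing a nonzero
    element of it by [p] again and again gives a chain of principal ideals that never stops. *)
Lemma divisor_gen e y : exc_divisor e -> generizes y e -> y = e \/ y = eta.
Proof.
move=> [_ [p p0 pE]] g; have [[[mQ QO] Q1 Qp] np] := (trace_prime M g, I).
set Q := _ `&` _ in mQ QO Q1 Qp.
have Op : O e p.
  have [//] : nmax (O e) p.
  by rewrite pE; exists 1; rewrite ?mulr1 //; exact: sub1.
have [Qpp|nQp] := pselect (Q p).
  left; apply: (lm_T0 M) => //; apply: (lm_gencmp M (x := e)) => //.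
  move=> a [_]; rewrite pE => -[b Ob <-].
  by have [] : Q (p * b) by rewrite mulrC; apply: (modM mQ).
right; apply: (trace0_eta g) => a Qa; apply: contrapT => /= /eqP a0.
have div b : Q b -> exists2 c, Q c & b = p * c.
  move=> Qb; have : nmax (O e) b by apply: (gen_nmax M g); case: Qb.
  rewrite pE => -[c Oc cE]; exists c => //.
  by move: Qb; rewrite -cE => /Qp [].
have /choice[d dP] b : exists c, Q b -> Q c /\ b = p * c.
  have [/div[c Qc ->]|] := pselect (Q b); [by exists c|by exists 0].
pose q n := iter n d a.
have Qq n : Q (q n) by elim: n => //= n IH; case: (dP _ IH).
have qE n : q n = p * q n.+1 by case: (dP _ (Qq n)).
have q0 n : q n != 0.
  by elim: n => // n IH; apply: contraNneq IH => h; rewrite qE h mulr0.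
have [n|n|n hn] := @lm_Onoeth _ _ _ _ _ M e (fun n => scale_set (q n) (O e)).
- split; first by apply: scale_mod; exact: mod_subring.
  by move=> _ [b Ob <-]; apply: subM => //; exact/QO/Qq.
- by move=> _ [b Ob <-]; rewrite (qE n); exists (p * b); [exact: subM|ring].
have [|c Oc cE] := hn n.+1 (leqnSn _) (q n.+1); first by exists 1; [exact: sub1|rewrite mulr1].
have pc : p * c = 1 by apply: (mulfI (q0 n.+1)); rewrite mulr1 mulrA [_ * p]mulrC -qE.
have : nmax (O e) 1 by rewrite pE; exists c.
exact: nmax1.
Qed.

(** Prime avoidance for modules and for the coset [c + I], over an infinite residue field. Two
    points [c + a + kk i * b] in the same [N j] differ by a unit multiple of [b], which forces [b]
    and then [c + a] into [N j]; so [n + 2] such points cannot be distributed over [n + 1]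
    modules. *)
Lemma submodule_avoidance I c n (N : nat -> set F) : is_mod A I ->
    (forall i, (i < n)%N -> is_mod A (N i)) ->
    (forall i, (i < n)%N -> exists2 a, I a & ~ N i a) ->
  exists2 a, I a & forall i, (i < n)%N -> ~ N i (c + a).
Proof.
have [kk [Ak hk]] := lm_units M.
move=> mI; elim: n => [|n IH] mN hN; first by exists 0 => //; exact: mod0 mI.
have [||a Ia ha] := IH; try by move=> i lt; first [apply: mN|apply: hN]; exact: ltnW.
have [b Ib nb] := hN n (ltnSn n).
apply: contrapT => /forall2NP h.
have bad i : exists j, (j < n.+1)%N /\ N j (c + (a + kk i * b)).
  have [|] := h (a + kk i * b).
    by case; apply: (modD mI) => //; exact: (modM mI).
  by move=> /existsNP[j /not_implyP[lt /contrapT ?]]; exists j.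
have [f fP] := choice bad.
have inj i i' : i != i' -> f i <> f i'.
  move=> ne ff; have [lt h1] := fP i; have [_ h2] := fP i'; rewrite -ff in h2.
  have mj := mN _ lt.
  have [u0 Au] := nmaxPn (subB sA (Ak i) (Ak i')) (hk i i' ne).
  have Nb : N (f i) b.
    have -> : b = (kk i - kk i')^-1 * ((c + (a + kk i * b)) - (c + (a + kk i' * b))).
      by field.
    by apply: (modM mj) => //; exact: (modB sA mj).
  move: lt; rewrite ltnS leq_eqVlt => /predU1P[fn|lt]; first by rewrite fn in Nb.
  apply: (ha _ lt); have -> : c + a = c + (a + kk i * b) - kk i * b by ring.
  by apply: (modB sA mj) => //; exact: (modM mj).
have finj : injective (fun i : 'I_n.+2 => Ordinal (fP i).1).
  move=> i i' /(congr1 val) /= ff; apply/val_inj/eqP.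
  by apply: contraPT ff => /inj.
by have := leq_card _ finj; rewrite !card_ord ltnn.
Qed.

(* h(x1, y1) is the value of a polynomial with coefficients in A, given by
   its expansion in powers of y1. *)
Lemma independent_residues x w e (x1 y1 : F) n (h : nat -> {poly F}) :
    E e -> generizes e x -> generizes w x -> generizes e w ->
    O x x1 -> nmax (O w) x1 -> ~ nmax (O e) x1 ->
    nmax (O x) y1 -> ~ nmax (O w) y1 ->
    (forall j, polyR A (h j)) -> nmax (O e) (\sum_(j < n) (h j).[x1] * y1 ^+ j) ->
  forall j, (j < n)%N -> polyR (nmax A) (h j).
Proof.
move=> Ee gex gwx gew Ox1 nwx1 nex1 nxy1 nwy1.
have Oy1 : O x y1 by case: nxy1.
have AO z : A `<=` O z by exact: (lm_AO M).
have [_ e1 ep] := nmax_rprime (lO e).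
(* At [w] the element [x1] vanishes and only the constant coefficients of the [h' j] survive. Were
   [j0] the first index with a unit there, [y1 ^+ j0] times a unit of [O x] would vanish at [w],
   although [y1] does not. *)
have const (h' : nat -> {poly F}) m : (forall j, polyR A (h' j)) ->
    nmax (O e) (\sum_(j < m) (h' j).[x1] * y1 ^+ j) ->
    forall j, (j < m)%N -> nmax A (h' j)`_0.
  move=> Ah' nh'.
  have nw : nmax (O w) (\sum_(j < m) (h' j)`_0 * y1 ^+ j).
    have -> : \sum_(j < m) (h' j)`_0 * y1 ^+ j =
        \sum_(j < m) (h' j).[x1] * y1 ^+ j -
        \sum_(j < m) ((h' j).[x1] - (h' j)`_0) * y1 ^+ j.
      by rewrite -sumrB; apply: eq_bigr => j _; ring.
    apply: (modB (sO w) (nO w)).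
      apply: (gen_nmax M gew) => //; apply: sub_sum => // j _.
      apply: subM; [exact: sO| |apply: subX; [exact: sO|exact: (lm_gen M gwx)]].
      by apply: (horner_sub (sO w) (AO w)); [exact: (lm_gen M gwx)|exact: Ah'].
    apply: (mod_sum _ (nO w)) => j _; rewrite mulrC; apply: (modM (nO w)).
      by apply: subX; [exact: sO|exact: (lm_gen M gwx)].
    have [q [hq [qE _]]] := root_division sA (sub0 sA) (Ah' j).
    rewrite {1}qE !hornerE horner_coef0 addrK ?subr0; apply: (modM (nO w)); last by rewrite ?subr0.
    by apply: (horner_sub (sO w) (AO w)) hq; exact: (lm_gen M gwx).
  clear nh'; elim: m nw => // m IH nw j; rewrite ltnS => le.
  apply: contrapT => nj.
  have [j0 [lt0 nj0 minj]] : exists j0, [/\ (j0 < m.+1)%N, ~ nmax A (h' j0)`_0 &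
      forall i, (i < j0)%N -> nmax A (h' i)`_0].
    have ex : exists i, `[< (i < m.+1)%N /\ ~ nmax A (h' i)`_0 >].
      by exists j; apply/asboolP.
    have [i /asboolP[lt ni] imin] := find_ex_minn ex.
    exists i; split=> // i' lt'; apply: contrapT => ni'.
    have /imin : `[< (i' < m.+1)%N /\ ~ nmax A (h' i')`_0 >].
      by apply/asboolP; split=> //; exact: ltn_trans lt' lt.
    by rewrite leqNgt lt'.
  apply: nj0; apply: contrapT => nu; have Ac i : A (h' i)`_0 by exact: Ah'.
  pose r := \sum_(i < m - j0) (h' (j0.+1 + i)%N)`_0 * y1 ^+ i.
  have Or : O x r.
    by apply: sub_sum => // i _; apply: subM; [exact: sO|exact: AO|exact: subX].
  have E1 : \sum_(i < m.+1) (h' i)`_0 * y1 ^+ i =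
      \sum_(i < j0) (h' i)`_0 * y1 ^+ i + y1 ^+ j0 * ((h' j0)`_0 + y1 * r).
    rewrite -(big_mkord xpredT (fun i => (h' i)`_0 * y1 ^+ i)).
    rewrite (big_cat_nat (leq0n j0) (ltnW lt0)) /=.
    rewrite big_mkord; congr (_ + _); rewrite big_ltn // mulrDr mulrC; congr (_ + _).
    rewrite /r !mulr_sumr -{1}[j0.+1]add0n big_addn big_mkord subSS.
    by apply: eq_bigr => i _; rewrite addnC addSn exprS exprD; ring.
  rewrite E1 in nw.
  have mA i : nmax A (h' i)`_0 -> nmax (O w) (h' i)`_0.
    by move=> /Ee ne; apply: (gen_nmax M gew) => //; exact: AO.
  have nw' : nmax (O w) (y1 ^+ j0 * ((h' j0)`_0 + y1 * r)).
    apply: (modDl (sO w) (nO w)) nw; apply: (mod_sum _ (nO w)) => i _.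
    rewrite mulrC; apply: (modM (nO w)); last exact/mA/minj.
    by apply: subX; [exact: sO|exact: (lm_gen M gwx)].
  have Ow : O w y1 by exact: (lm_gen M gwx).
  have [_ _ wp] := nmax_rprime (lO w).
  have Oxs : O x ((h' j0)`_0 + y1 * r) by apply: subD => //; [exact: AO|exact: subM].
  have [||/(rprimeX (sO w) (nmax_rprime (lO w)) Ow)//|nw2] := wp _ _ _ _ nw'.
  - exact: subX.
  - exact: (lm_gen M gwx).
  have nx2 := gen_nmax M gwx Oxs nw2.
  have : nmax (O x) (h' j0)`_0.
    rewrite -(addrK (y1 * r) (h' j0)`_0); apply: (modB (sO x) (nO x)) => //.
    by rewrite mulrC; apply: (modM (nO x)).
  have [c0 Ac0] := nmaxPn (Ac j0) nu.
  by move=> [_ [/eqP|]]; [rewrite (negbTE c0)|apply; exact: AO].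
have [N hN] : exists N, forall j, (j < n)%N -> (size (h j) <= N)%N.
  exists (\max_(j < n) size (h j)) => j lt.
  exact: (@leq_bigmax _ (fun j : 'I_n => size (h j)) (Ordinal lt)).
(* Constant coefficients in the maximal ideal of [A] contribute nothing at [e]. As [x1] does not
   vanish at [e], the rest may be divided by [x1], which lowers all degrees. *)
elim: N h hN => [|N IH] h hN Ah nh j lt.
  have := hN j lt; rewrite leqn0 size_poly_eq0 => /eqP -> i.
  by rewrite coef0; exact: mod0 nA.
have c0 := const h n Ah nh.
pose q i := \poly_(k < N) (h i)`_k.+1.
have qE i : (i < n)%N -> h i = q i * 'X + ((h i)`_0)%:P.
  move=> lti; apply/polyP => -[|k]; rewrite coefD coefMX coefC /= ?add0r // addr0.
  rewrite coef_poly; case: ltnP => // le; apply: nth_default.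
  by rewrite (leq_trans (hN i lti)).
have Aq i : polyR A (q i) by apply: polyR_poly => // k; exact: Ah.
have nq : nmax (O e) (\sum_(j < n) (q j).[x1] * y1 ^+ j).
  have Oe1 : O e x1 by exact: (lm_gen M gex).
  have Oey : O e y1 by exact: (lm_gen M gex).
  have [||||] // := ep x1 (\sum_(j < n) (q j).[x1] * y1 ^+ j).
    apply: sub_sum => // i _; apply: subM; [exact: sO| |exact: subX].
    by apply: (horner_sub (sO e) (AO e)) (Aq i).
  have -> : x1 * \sum_(j < n) (q j).[x1] * y1 ^+ j =
      \sum_(j < n) (h j).[x1] * y1 ^+ j - \sum_(j < n) (h j)`_0 * y1 ^+ j.
    rewrite mulr_sumr -sumrB; apply: eq_bigr => i _.
    have -> : (h i).[x1] = (q i).[x1] * x1 + (h i)`_0.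
      by rewrite {1}(qE i (ltn_ord i)) hornerMXaddC.
    by rewrite mulrDl addrK mulrA [x1 * _]mulrC.
  apply: (modB (sO e) (nO e)) => //; apply: (mod_sum _ (nO e)) => i _.
  by rewrite mulrC; apply: (modM (nO e)); [exact: subX|exact/Ee/c0].
have hq : forall i, (i < n)%N -> (size (q i) <= N)%N by move=> i _; exact: size_poly.
have := IH q hq Aq nq j lt => mq; rewrite (qE j lt) => -[|k].
  by rewrite coefD coefMX coefC add0r; exact: c0.
by rewrite coefD coefMX coefC addr0; exact: mq.
Qed.

Lemma A_nonunit x a : A a -> nmax (O x) a -> nmax A a.
Proof.
move=> Aa na; apply: contrapT => /(nmaxPn Aa)[a0 Aa'].
by case: na => _ [/eqP|]; [rewrite (negbTE a0)|apply; exact: (lm_AO M)].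
Qed.

Lemma divisor_power e p d : exc_divisor e -> p != 0 -> nmax (O e) = scale_set p (O e) ->
    O e d -> d != 0 ->
  exists n, scale_set d (O e) (p ^+ n).
Proof.
move=> De p0 pE Od d0; have np : nmax (O e) p.
  by rewrite pE; exists 1; [exact: sub1|rewrite mulr1].
have [Op _] := np; apply: (radical_power (R := O e)) => //.
  split; first by apply: scale_mod; exact: mod_subring.
  by move=> _ [b Ob <-]; exact: subM.
move=> P pP dP; have [z gz PE] := lm_prime M pP; rewrite PE.
have [->//|ze] := divisor_gen De gz.
have : P d by apply: dP; exists 1; [exact: sub1|rewrite mulr1].
by rewrite PE ze => -[_ /(eta_nmax M) d00]; rewrite d00 eqxx in d0.
Qed.

(* For a chain e, w, x choose x1 in P_w \ P_e and y1 in P_x \ P_w; their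
   residues at e are independent over A/m. Changing x1 slightly, write
   x1 = c / d with (c, d) primary to m, so that the localization of A[x1] at
   the trace of n_e is of dimension one; Krull-Akizuki then makes y1 residually
   algebraic over it. *)
Lemma exc_chain e w x : exc_divisor e -> generizes e w -> generizes w x ->
  e <> w -> w = x.
Proof.
move=> De gew gwx ew; apply: contrapT => wx.
have gex := gen_trans gew gwx; have [Ee [p p0 pE]] := De.
have AO z : A `<=` O z by exact: (lm_AO M).
have [x1 [Ox1 nwx1 nex1]] : exists x1 : F, [/\ O x x1, nmax (O w) x1 & ~ nmax (O e) x1].
  apply: contrapT => h; apply: ew; apply: (lm_T0 M) => //.
  apply: (lm_gencmp M (x := x)) => // a [Oa na]; apply: contrapT => ne.
  by apply: h; exists a.
have [y1 nxy1 nwy1] : exists2 y1 : F, nmax (O x) y1 & ~ nmax (O w) y1.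
  apply: contrapT => h; apply: wx; apply: (lm_T0 M) => //.
  apply: (lm_gencmp M (x := x)) => // a [Oa na]; apply: contrapT => ne.
  by apply: h; exists a.
have [c0 [d0 [Ac0 Ad0 d00 x1E]]] := lm_frac M x1.
have [c1 [d1 [Ac1 Ad1 d10 y1E]]] := lm_frac M y1.
have y10 : y1 != 0 by apply: contra_notN nwy1 => /eqP ->; exact: mod0 (nO w).
(* A common denominator: [d * y1] lies in [A] too, which bounds the denominators of the powers of
   [y1] in the application of Krull-Akizuki below. *)
pose d := d0 * d1; pose c := c0 * d1.
have Ad : A d by exact: subM.
have Ac : A c by exact: subM.
have dn0 : d != 0 by rewrite mulf_neq0.
have {x1E} x1E : x1 = c / d by rewrite x1E /c /d; field; rewrite d00 d10.
have Oed := AO e d Ad.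
have Oex1 : O e x1 by exact: (lm_gen M gex).
have Oey1 : O e y1 by apply: (lm_gen M gex); case: nxy1.
have [_ n1 _] := nmax_rprime (lO e).
have md : nmax A d.
  apply: contrapT => nd; apply: nex1; apply: (Ee); apply: (A_nonunit (x := w)) => //.
  by rewrite x1E; apply: subM => //; case: (nmaxPn Ad nd).
have mc1 : nmax A c1.
  apply: (A_nonunit (x := x)) => //.
  have -> : c1 = d1 * y1 by rewrite y1E; field.
  by apply: (modM (nO x)) => //; exact: AO.
have c10 : c1 != 0 by apply: contraNneq y10 => h; rewrite y1E h mul0r.
(* Adding an element of [I] to the numerator [c] changes [c / d] by a multiple of [p], hence not its
   residue at [e]. *)
pose I := A `&` scale_set (d * p) (O e).
have mI : is_mod A I.
  apply: setI_mod; first exact: mod_subring.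
  by apply: (mod_sub (AO e)); apply: scale_mod; exact: mod_subring.
have Oep : O e p.
  have [//] : nmax (O e) p by rewrite pE; exists 1; [exact: sub1|rewrite mulr1].
have [n hn] : exists n, scale_set (d * p) (O e) (p ^+ n).
  by apply: divisor_power => //; [exact: subM|rewrite mulf_neq0].
have Im b : nmax A b -> I (b ^+ n).
  move=> mb; have [Ab _] := mb; split; first exact: subX.
  have := Ee _ mb; rewrite pE => -[t Ot <-]; have [t' Ot' tE] := hn.
  by exists (t' * t ^+ n); [apply: subM => //; exact: subX|rewrite exprMn -tE mulrA].
have idA : is_idl A (scale_set d A).
  split; first by apply: scale_mod; exact: mod_subring.
  by move=> _ [b Ab <-]; exact: subM.
have [ps [pps minps]] := minimal_primes sA (lm_noeth M) idA.
(* Primes above [d] that contain the maximal ideal of [A] cannot be avoided; the zero module takes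
   their place. Since the new numerator avoids the others, a prime containing it and [d] contains
   the maximal ideal. *)
pose N i := if `[< nmax A `<=` nth set0 ps i >] then [set 0] else nth set0 ps i.
have [|i lti|al Ial hal] := @submodule_avoidance I c (size ps) N mI.
- move=> i lti; rewrite /N; case: ifP => _; last by case: (pps i lti) => [[[]]].
  by split=> // [a b -> ->|r a _ ->]; rewrite ?addr0 ?mulr0.
- rewrite /N; case: asboolP => [_|/existsNP[b /not_implyP[mb nb]]].
    by exists (c1 ^+ n); [exact: Im|move=> /eqP; rewrite expf_eq0 (negbTE c10) andbF].
  exists (b ^+ n); first exact: Im.
  by move=> /(rprimeX sA (pps i lti).1); case: mb => Ab _ /(_ Ab).
have [Aal [t Ot alE]] := Ial.
have {}minps Q : is_rprime A Q -> Q d -> Q (c + al) -> nmax A `<=` Q.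
  move=> pQ Qd Qc; have [[mQ _] _ _] := pQ.
  have [|i lti PQ] := minps Q pQ; first by move=> _ [b Ab <-]; rewrite mulrC; apply: (modM mQ).
  have := hal i lti; rewrite /N; case: asboolP => [mP _|mP ni].
    by move=> b /mP /PQ.
  have [pP dP] := pps i lti; apply: (lm_dim M pP pQ PQ); last by move/(_ _ Qc).
  by exists d => //; apply: dP; exists 1; [exact: sub1|rewrite mulr1].
pose x' := (c + al) / d.
have nx' : nmax (O e) (x' - x1).
  have -> : x' - x1 = p * t by rewrite /x' x1E -alE; field.
  by rewrite pE; exists t.
have Ox' : O e x' by rewrite -(subrK x1 x'); apply: subD => //; case: nx'.
have key m (h : nat -> {poly F}) : (forall j, polyR A (h j)) ->
    nmax (O e) (\sum_(j < m) (h j).[x'] * y1 ^+ j) ->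
    forall j, (j < m)%N -> polyR (nmax A) (h j).
  move=> Ah nh; apply: (independent_residues Ee gex gwx gew Ox1 nwx1 nex1 nxy1 nwy1) => //.
  have -> : \sum_(j < m) (h j).[x1] * y1 ^+ j = \sum_(j < m) (h j).[x'] * y1 ^+ j -
      \sum_(j < m) ((h j).[x'] - (h j).[x1]) * y1 ^+ j.
    by rewrite -sumrB; apply: eq_bigr => j _; ring.
  apply: (modB (sO e) (nO e)) => //; apply: (mod_sum _ (nO e)) => j _.
  rewrite mulrC; apply: (modM (nO e)); first exact: subX.
  have [q [hq [qE _]]] := root_division (sO e) Oex1 (polyR_sub (AO e) (Ah j)).
  rewrite {1}qE !hornerE addrK; apply: (modM (nO e)) => //.
  exact: (horner_sub (sO e) (@subset_refl _ (O e)) Ox' hq).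
pose B := adj A x'; have sB : is_subring B by exact: adj_subring.
have AB : A `<=` B by exact: adj_sub.
have BO : B `<=` O e by exact: adj_min.
have mB h : polyR (nmax A) h -> nmax (O e) h.[x'].
  move=> mh; rewrite horner_coef; apply: (mod_sum _ (nO e)) => i _.
  by rewrite mulrC; apply: (modM (nO e)); [exact: subX|exact/Ee].
pose q := B `&` nmax (O e).
have pq : is_rprime B q.
  have [_ _ ep] := nmax_rprime (lO e); split; [split|by case|].
  - by apply: setI_mod; [exact: mod_subring|exact: (mod_sub BO)].
  - by move=> a [].
  - move=> a b Ba Bb [_ /ep]; case; [exact: BO|exact: BO|by left|by right].
pose R := locz B q; have sR : is_subring R by exact: locz_subring.
have [lR nRE] := locz_loc sB pq.
have BR : B `<=` R by exact: locz_sub.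
have nR : rnoeth R by apply: locz_noeth => //; apply: hilbert_basis => //; exact: (lm_noeth M).
have [||||||G [hG G0 [i ni]]] := @krull_akizuki_poly _ R d y1 (nmax R) sR _ dn0 (nmax_idl lR).
- exact/BR/AB.
- rewrite nRE; exists d, 1; rewrite divr1; split=> //; [|exact: sub1|by case].
  by split; [exact: AB|exact: Ee].
- exact: nmax1.
(* A prime containing [d] contains [c + al = x' * d], hence the maximal ideal of [A]. By [key] with
   one term, an element of [A[x']] vanishing at [e] is a polynomial in [x'] with coefficients in
   that ideal, so the prime is maximal. *)
- apply: local_dcc => //; first exact/BR/AB.
  move=> P pP Pd; have [[mP PR] P1 Pp] := pP.
  have Pc : P (c + al).
    have -> : c + al = x' * d by rewrite /x'; field.
    by apply: (modM mP) => //; apply/BR; exact: adj_gen.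
  have mAP : nmax A `<=` P.
    suff : nmax A `<=` A `&` P by move=> h b /h[].
    apply: minps; try by split=> //; exact: subD.
    split.
    + split; last by move=> ? [].
      by apply: setI_mod; [exact: mod_subring|apply: mod_sub mP => b /AB /BR].
    + by case.
    + move=> a b Aa Ab [_ /Pp]; case; [exact/BR/AB|exact/BR/AB|by left|by right].
  rewrite nRE => _ [b [s [[Bb nb] Bs qs ->]]].
  rewrite mulrC; apply: (modM mP); first exact: locz_inv.
  have [h hA hE] := Bb; have nh : nmax (O e) (\sum_(j < 1) h.[x'] * y1 ^+ j).
    by rewrite big_ord1 expr0 mulr1 hE.
  have mh := key 1%N (fun=> h) (fun=> hA) nh 0%N isT.
  rewrite -hE horner_coef; apply: (mod_sum _ mP) => j _.
  rewrite mulrC; apply: (modM mP); last exact/mAP/mh.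
  by apply: BR; apply: subX => //; exact: adj_gen.
- by move=> l; exact: rnoeth_racc.
- move=> m; exists m; rewrite -exprMn; apply: subX => //; apply/BR/AB.
  have -> : d * y1 = d0 * c1 by rewrite y1E /d; field.
  exact: subM.
(* With denominators cleared, [G.[y1] = 0] becomes a polynomial relation over [A] between [x'] and
   [y1]. Independence of the two residues forces all coefficients of [G] into the maximal ideal,
   against the choice of [i]. *)
have [|s [Bs qs hs]] := @locz_common_den F B q (size G) (fun j => G`_j) sB pq.
  by move=> j _; exact: hG.
have /choice[h hP] j : exists h, polyR A h /\ ((j < size G)%N -> h.[x'] = s * G`_j).
  have [/hs[h Ah hE]|_] := ltnP j (size G); first by exists h.
  by exists 0; split=> //; exact: polyR0.
have nh : nmax (O e) (\sum_(j < size G) (h j).[x'] * y1 ^+ j).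
  have -> : \sum_(j < size G) (h j).[x'] * y1 ^+ j = s * G.[y1].
    rewrite horner_coef mulr_sumr; apply: eq_bigr => j _.
    by rewrite (hP j).2 // mulrA.
  by rewrite G0 mulr0; exact: mod0 (nO e).
have iG : (i < size G)%N.
  rewrite ltnNge; apply: contra_notN ni => /(nth_default 0) ->.
  by have [mR _] := nmax_idl lR; exact: mod0 mR.
apply: ni; rewrite nRE; exists (s * G`_i), s; split=> //.
- split; first exact: hs.
  rewrite -(hP i).2 //; apply: mB.
  exact: (key _ h (fun j => (hP j).1) nh).
- by field; exact: rprime_neq0 pq qs.
Qed.
End ExceptionalPrimes.

(** Krull's intersection theorem for [R/uR] and the powers of [v]. The ideals generated by [u] and
    the first [al i] stop growing; expressing [al n] through its predecessors and multiplying by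
    [v ^+ n] gives [b = s * b] modulo [u] with [s] in the maximal ideal. *)
Lemma krull_principal (F : fieldType) (R : set F) u v b : is_loc R -> rnoeth R ->
    R u -> nmax R v ->
    (forall k, exists r s, [/\ R r, R s & b = r * v ^+ k + u * s]) ->
  scale_set u R b.
Proof.
move=> lR nR Ru nv /choice[al /choice[be hb]]; have [sR _] := lR; have [Rv _] := nv.
have [mn _] := nmax_idl lR.
pose w i := if i is i'.+1 then al i' else u.
have Rw i : R (w i) by case: i => [//|i]; case: (hb i).
have mS n : is_mod R (rspan R n w) by exact: rspan_mod.
have [n|n|n hn] := nR (fun n => rspan R n.+1 w).
- by split=> //; apply: rspan_le => //; exact: mod_subring.
- by apply: rspan_le => // i lt; apply: rspan_gen => //; exact: ltnW.
have [c Rc] := hn n.+1 (leqnSn n) (w n.+1) (rspan_gen w sR (ltnSn n.+1)).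
rewrite big_ord_recl /= => alE.
have mU : is_mod R (scale_set u R) by apply: scale_mod; exact: mod_subring.
have bE : b = al n * v ^+ n + u * be n by case: (hb n).
pose s := \sum_(i < n) c i.+1 * v ^+ (n - i).
have Rs : nmax R s.
  apply: (mod_sum _ mn) => i _; apply: (modM mn) => //.
  have -> : (n - i = (n - i).-1.+1)%N by rewrite prednK // subn_gt0.
  by rewrite exprSr; apply: (modM mn) => //; exact: subX.
have dvd : scale_set u R ((1 - s) * b).
  have -> : (1 - s) * b = u * be n + (al n * v ^+ n - s * b) by rewrite mulrBl mul1r {1}bE; ring.
  apply: (modD mU); first by exists (be n) => //; case: (hb n).
  have -> : al n * v ^+ n - s * b =
      u * (c 0%N * v ^+ n) + \sum_(i < n) c i.+1 * v ^+ (n - i) * (al i * v ^+ i - b).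
    rewrite alE mulrDl mulr_suml /s mulr_suml -addrA; congr (_ + _); first by ring.
    rewrite -sumrB; apply: eq_bigr => i _; rewrite /bump /= add1n add0n.
    have -> : v ^+ n = v ^+ (n - i) * v ^+ i by rewrite -exprD subnK // ltnW.
    by ring.
  apply: (modD mU); first by exists (c 0%N * v ^+ n) => //; apply: subM => //; exact: subX.
  apply: (mod_sum _ mU) => i _; apply: (modM mU); first by apply: subM => //; exact: subX.
  have [_ Rb ->] := hb i; exists (- be i); first exact: subN.
  by ring.
have [||n1 Rn1] := @nmaxPn _ R (1 - s).
- by apply: subB; [|exact: sub1|case: Rs].
- by move=> n1; apply: (nmax1 sR); rewrite -(subrK s 1); exact: (modD mn).
by rewrite -(mulKf n1 b); apply: (modM mU).
Qed.

Lemma scale_pow (F : fieldType) (R : set F) p q k : is_subring R ->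
  scale_set p R `<=` scale_set q R -> scale_set (p ^+ k) R `<=` scale_set (q ^+ k) R.
Proof.
move=> sR h _ [b Rb <-].
have [|r Rr rE] := h p; first by exists 1; [exact: sub1|rewrite mulr1].
exists (r ^+ k * b); first by apply: subM => //; exact: subX.
by rewrite mulrA -exprMn rE.
Qed.

(** * Exceptional divisors have local equations *)

Section PrincipalPrimes.
Variables (F : fieldType) (A : set F) (X : topologicalType) (O : X -> set F) (eta : X).
Hypothesis M : local_model A O eta.
Implicit Types (x w e : X) (a b c u v p : F).

Let lA : is_loc A. Proof. exact: lm_A M. Qed.
Let sA : is_subring A. Proof. by case: lA. Qed.
Let lO x : is_loc (O x). Proof. exact: lm_loc M x. Qed.
Let sO x : is_subring (O x). Proof. by case: (lO x). Qed.
Let nO x : is_mod (O x) (nmax (O x)). Proof. by case: (nmax_idl (lO x)). Qed.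

Hypothesis reg2 : forall e x, exc_divisor A O e -> generizes e x -> e <> x ->
  (forall w, generizes e w -> generizes w x -> w = e \/ w = x) ->
  exists u v, [/\ nmax (O x) u, nmax (O x) v &
    forall n, nmax (O x) n -> exists r s, [/\ O x r, O x s & n = r * u + s * v]].

Lemma divisor_neq_eta e : exc_divisor A O e -> e <> eta.
Proof.
move=> [_ [p p0 pE]] ee; have : nmax (O e) p.
  by rewrite pE; exists 1; [exact: sub1|rewrite mulr1].
by rewrite ee => /(eta_nmax M) h; rewrite h eqxx in p0.
Qed.

(* O_x / u is a local ring with principal maximal ideal, so the image of P in
   it is principal; Nakayama's lemma lifts a generator. *)
Lemma principal_prime e x u v : exc_divisor A O e -> generizes e x ->
    nmax (O x) u -> nmax (O x) v -> ~ nmax (O e) u ->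
    (forall n, nmax (O x) n -> exists r s, [/\ O x r, O x s & n = r * u + s * v]) ->
  exists z : F, O x `&` nmax (O e) = scale_set z (O x).
Proof.
move=> De g nu nv neu gens; have pP := trace_prime M g.
set P := O x `&` _ in pP *; have [iP P1 Pp] := pP; have [mP PO] := iP.
have [Ou _] := nu; have [Ov _] := nv.
have div (y : F) : O x y -> P (u * y) -> P y.
  by move=> Oy /(Pp _ _ Ou Oy)[[_ /neu]|].
pose V k := [set b | exists r s, [/\ O x r, O x s & b = r * v ^+ k + u * s]].
have V0 b : O x b -> V 0%N b.
  move=> Ob; exists b, 0; split=> //; first exact: sub0.
  by rewrite expr0 mulr1 mulr0 addr0.
have [b Pb nub] : exists2 b, P b & ~ scale_set u (O x) b.
  apply: contrapT => h; apply: (divisor_neq_eta De); apply: (trace0_eta M g).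
  have hn : P `<=` scale_set 0 (O x).
    apply: (nakayama_principal (lO x) (@lm_Onoeth _ _ _ _ _ M x) nu iP (mod0 mP)) => y Py.
    have : scale_set u (O x) y by apply: contrapT => ny; apply: h; exists y.
    move=> [t Ot tE]; exists 0, t; split; [exact: sub0| |by rewrite mul0r add0r].
    by apply: div; rewrite ?tE.
  by move=> y /hn[t _ <-]; rewrite mul0r.
have [k0 hk0] : exists k, ~ V k b.
  apply: contrapT => /forallNP h; apply: nub.
  apply: (krull_principal (lO x) (@lm_Onoeth _ _ _ _ _ M x) Ou nv) => k.
  exact: contrapT (h k).
(* Let [k] be minimal such that some [q] in P lies outside [v^k O_x + u O_x]. Modulo [u], such a [q]
   is a unit times the power of [v] just below, and every element of P is a multiple of that power,
   hence of [q]. *)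
have ex : exists k, `[< exists2 b, P b & ~ V k b >] by exists k0; apply/asboolP; exists b.
have [k /asboolP[q Pq nq] kmin] := find_ex_minn ex.
case: k => [|k] in nq kmin; first by case: nq; apply: V0; exact: PO.
have hV (y : F) : P y -> V k y.
  move=> Py; apply: contrapT => nV.
  have /kmin : `[< exists2 b, P b & ~ V k b >] by apply/asboolP; exists y.
  by rewrite ltnn.
have [al [be [Oal Obe qE]]] := hV q Pq.
have [|al0 Oal'] := nmaxPn Oal.
  move=> /gens[r [s [Or Os alE]]]; apply: nq; exists s, (r * v ^+ k + be); split=> //.
    by apply: subD => //; apply: subM => //; exact: subX.
  by rewrite qE alE exprS; ring.
exists q; apply/seteqP; split; last first.
  by move=> _ [t Ot <-]; rewrite mulrC; apply: (modM mP).
apply: (nakayama_principal (lO x) (@lm_Onoeth _ _ _ _ _ M x) nu iP Pq) => y Py.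
have [ga [de [Oga Ode yE]]] := hV y Py.
exists (ga / al), (de - ga / al * be); split; first exact: subM.
- apply: div; first by apply: subB => //; do 2!apply: subM => //.
  have -> : u * (de - ga / al * be) = y - (ga / al) * q by rewrite yE qE; field.
  by apply: (modB (sO x) mP) => //; apply: (modM mP) => //; exact: subM.
- by rewrite {1}yE {1}qE; field.
Qed.

(** One of the two parameters at [x] does not vanish along [e]: otherwise the maximal ideal at [x]
    would lie in that of [e] and the two points would coincide. [exc_chain] supplies the condition
    in [reg2] that no point lies strictly between. *)
Lemma principal_trace e x : exc_divisor A O e -> generizes e x ->
  exists z : F, O x `&` nmax (O e) = scale_set z (O x).
Proof.
move=> De g; have [ex|ex] := pselect (e = x).
  have [_ [p p0 pE]] := De; exists p; rewrite -ex -pE; apply/seteqP; split=> [a []//|a na]; split=> //.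
  by case: na.
have [|u [v [nu nv gens]]] := reg2 De g ex.
  move=> w gew gwx; have [->|ew] := pselect (e = w); first by left.
  by right; exact: (exc_chain M De gew gwx ew).
have [neu|neu] := pselect (nmax (O e) u); last exact: principal_prime nu nv neu gens.
have [nev|nev] := pselect (nmax (O e) v); last first.
  apply: (principal_prime De g nv nu nev) => n /gens[r [s [Or Os ->]]].
  by exists s, r; split=> //; rewrite addrC.
case: ex; apply: (lm_T0 M) => //; apply: (lm_gencmp M (x := x)) => //.
move=> a [_ /gens[r [s [Or Os ->]]]].
by apply: (modD (nO e)); apply: (modM (nO e)) => //; exact: (lm_gen M g).
Qed.
End PrincipalPrimes.

(** * Cycles on a model *)

(** [S] contains the curves that carry the cycles under study, not necessarily all exceptional
    curves. Regularity of X is recorded by the uniformizers and, at points immediately below an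
    exceptional divisor, by two generators of the maximal ideal. *)
Record exceptional_data (F : fieldType) (A : set F) (X : topologicalType) (O : X -> set F)
    (eta : X) (S : seq X) (unif : X -> F) : Prop := ExceptionalData {
  ed_model : local_model A O eta;
  ed_uniq : uniq S;
  ed_exc : forall e, e \in S -> exceptional A O e;
  ed_unif0 : forall e, e \in S -> unif e != 0;
  ed_unif : forall e, e \in S -> nmax (O e) = scale_set (unif e) (O e);
  ed_reg2 : forall e x, exc_divisor A O e -> generizes e x -> e <> x ->
    (forall w, generizes e w -> generizes w x -> w = e \/ w = x) ->
    exists u v, [/\ nmax (O x) u, nmax (O x) v &
      forall n, nmax (O x) n -> exists r s, [/\ O x r, O x s & n = r * u + s * v]]
}.

Section Cycles.
Variables (F : fieldType) (A : set F) (X : topologicalType) (O : X -> set F) (eta : X).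
Variables (S : seq X) (unif : X -> F).
Hypothesis D : exceptional_data A O eta S unif.
Implicit Types (x w e : X) (a b c u v p : F) (Y : X -> nat).

Let M : local_model A O eta. Proof. exact: ed_model D. Qed.
Let lA : is_loc A. Proof. exact: lm_A M. Qed.
Let sA : is_subring A. Proof. by case: lA. Qed.
Let lO x : is_loc (O x). Proof. exact: lm_loc M x. Qed.
Let sO x : is_subring (O x). Proof. by case: (lO x). Qed.
Let nO x : is_mod (O x) (nmax (O x)). Proof. by case: (nmax_idl (lO x)). Qed.
Let AO x : A `<=` O x. Proof. exact: (lm_AO M). Qed.

(** The stalk of O(-Y) at [x] as a set of rational functions. The order condition is imposed on a
    neighbourhood, as for germs of sections; [Jmod_char] reduces it to the finitely many curves of
    [S] through [x]. *)
Definition Jmod Y x : set F := [set c | exists V, [/\ open V, V x &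
  forall y, V y -> scale_set (unif y ^+ Y y) (O y) c]].

Definition cyc Y := forall x, Y x != 0%N -> x \in S.

Definition Iglob Y : set F := [set a | forall x, Jmod Y x a].

(** Generation is tested against all submodules [N] of F, which spares naming the submodule
    generated by the global sections. *)
Definition ggen Y := forall x N, is_mod (O x) N -> Iglob Y `<=` N -> Jmod Y x `<=` N.

Definition generates Y g x := Jmod Y x `<=` scale_set g (O x).

Lemma exc_divisorS e : e \in S -> exc_divisor A O e.
Proof.
by move=> eS; split; [exact: (ed_exc D eS)|exists (unif e); [exact: (ed_unif0 D eS)|exact: (ed_unif D eS)]].
Qed.

Lemma divisor_inj e e' : e \in S -> e' \in S -> generizes e' e -> e' = e.
Proof.
move=> eS eS' /(divisor_gen M (exc_divisorS eS))[//|ee].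
by case: (divisor_neq_eta M (exc_divisorS eS') ee).
Qed.

Lemma open_avoiding (s : seq X) x : exists V, [/\ open V, V x &
  forall e, e \in s -> V e -> generizes e x].
Proof.
elim: s => [|e s [V [oV Vx hV]]]; first by exists setT; split=> //; exact: openT.
have [ge|/existsNP[W /not_implyP[oW /not_implyP[Wx nW]]]] := pselect (generizes e x).
  exists V; split=> // e'; rewrite inE => /predU1P[->//|]; exact: hV.
exists (V `&` W); split=> //; first exact: openI.
by move=> e'; rewrite inE => /predU1P[->[_ /nW]//|es [Ve _]]; exact: hV.
Qed.

Lemma Jmod_char Y x c : cyc Y -> Jmod Y x c <->
  O x c /\ forall e, e \in S -> generizes e x -> scale_set (unif e ^+ Y e) (O e) c.
Proof.
move=> cY; split=> [[V [oV Vx hV]]|[Oc hc]].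
  split; last by move=> e eS g; apply: hV; exact: g.
  have [d Od <-] := hV x Vx; apply: subM => //.
  have [xS|xS] := boolP (x \in S); last first.
    by have /negbNE/eqP -> := contraNN (@cY x) xS; rewrite expr0; exact: sub1.
  apply: subX => //; have [//] : nmax (O x) (unif x).
  by rewrite (ed_unif D xS); exists 1; [exact: sub1|rewrite mulr1].
have [V [oV Vx hV]] := lm_open M Oc; have [W [oW Wx hW]] := open_avoiding S x.
exists (V `&` W); split=> //; first exact: openI.
move=> y [Vy Wy]; have [yS|yS] := boolP (y \in S); first by apply: hc => //; exact: hW.
have /negbNE/eqP -> := contraNN (@cY y) yS; exists c; first exact: hV.
by rewrite expr0 mul1r.
Qed.

Lemma Jmod_O Y x : cyc Y -> Jmod Y x `<=` O x.
Proof. by move=> cY c /(Jmod_char _ _ cY)[]. Qed.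

Lemma Jmod_mod Y x : cyc Y -> is_mod (O x) (Jmod Y x).
Proof.
move=> cY; have hm e : is_mod (O e) (scale_set (unif e ^+ Y e) (O e)).
  by apply: scale_mod; exact: mod_subring.
split.
- by apply/Jmod_char => //; split=> [|e _ _]; [exact: sub0|exact: (mod0 (hm e))].
- move=> a b /(Jmod_char _ _ cY)[Oa ha] /(Jmod_char _ _ cY)[Ob hb].
  apply/Jmod_char => //; split; first exact: subD.
  by move=> e eS g; apply: (modD (hm e)); [exact: ha|exact: hb].
- move=> r a Or /(Jmod_char _ _ cY)[Oa ha].
  apply/Jmod_char => //; split; first exact: subM.
  by move=> e eS g; apply: (modM (hm e)); [exact: (lm_gen M g)|exact: ha].
Qed.

Lemma Jmod_open Y x c : Jmod Y x c -> exists V, [/\ open V, V x &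
  forall y, V y -> Jmod Y y c].
Proof. by move=> [V [oV Vx hV]]; exists V; split=> // y Vy; exists V. Qed.

Lemma Jmod_gen Y x y : generizes y x -> Jmod Y x `<=` Jmod Y y.
Proof. by move=> g c [V [oV Vx hV]]; exists V; split=> //; exact: g. Qed.

Lemma Jmod_nonexc Y x : cyc Y -> ~ exceptional A O x -> Jmod Y x = O x.
Proof.
move=> cY nE; apply/seteqP; split; first exact: Jmod_O.
move=> c Oc; apply/Jmod_char => //; split=> // e eS g.
by case: nE; apply: (exc_up M g); exact: (ed_exc D eS).
Qed.

Lemma Jmod0 x : Jmod (fun=> 0%N) x = O x.
Proof.
apply/seteqP; split; first exact: Jmod_O.
move=> c Oc; apply/Jmod_char => //; split=> // e eS g; exists c.
  exact: (lm_gen M g).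
by rewrite expr0 mul1r.
Qed.

Lemma Iglob_A Y : cyc Y -> Iglob Y `<=` A.
Proof. by move=> cY a Ia; apply: (global_sections M) => x; exact: (Jmod_O cY (Ia x)). Qed.

Lemma Iglob_mod Y : cyc Y -> is_mod A (Iglob Y).
Proof.
move=> cY; split=> [x|a b Ia Ib x|r a Ar Ia x]; have mJ := Jmod_mod x cY.
- exact: (mod0 mJ).
- exact: (modD mJ).
- by apply: (modM mJ) => //; exact: AO.
Qed.

(** If no curve of the support passed through the exceptional point [x], the stalk at [x] would
    contain 1 and some global section would be a unit there. Global sections lie in [A], so it would
    be a unit of [A], yet it vanishes along [e0]. *)
Lemma full_support Y x : cyc Y -> ggen Y -> (exists e, Y e != 0%N) -> exceptional A O x ->
  exists e, [/\ Y e != 0%N, e \in S & generizes e x].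
Proof.
move=> cY gY [e0 Ye0] Ex; apply: contrapT => /forallNP h.
have J1 : Jmod Y x 1.
  apply/Jmod_char => //; split=> [|e eS g]; first exact: sub1.
  have [Ye|Ye] := eqVneq (Y e) 0%N; last by case: (h e).
  by rewrite Ye expr0; exists 1; [exact: sub1|rewrite mulr1].
apply: (nmax1 (sO x)); apply: (gY x _ (nO x)) J1 => a Ia.
have Aa := Iglob_A cY Ia; apply: contrapT => na; have e0S := cY _ Ye0.
have [a0 Aa'] : a != 0 /\ A a^-1 by apply: nmaxPn => // /Ex.
have : nmax (O e0) a.
  have /(Jmod_char _ _ cY)[_ /(_ e0 e0S (@gen_refl X e0))[b Ob <-]] := Ia e0.
  rewrite (ed_unif D e0S); case: (Y e0) Ye0 => // n _.
  exists (unif e0 ^+ n * b); last by rewrite mulrA exprS.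
  apply: subM => //; apply: subX => //.
  have [//] : nmax (O e0) (unif e0).
  by rewrite (ed_unif D e0S); exists 1; [exact: sub1|rewrite mulr1].
by move=> [_ [/eqP|]]; [rewrite (negbTE a0)|apply; exact: AO].
Qed.

Lemma local_equations : exists z : X -> X -> F, forall x e, e \in S -> generizes e x ->
  O x `&` nmax (O e) = scale_set (z x e) (O x).
Proof.
have /choice[z zP] (xe : X * X) : exists z, xe.2 \in S -> generizes xe.2 xe.1 ->
    O xe.1 `&` nmax (O xe.2) = scale_set z (O xe.1).
  have [eS|] := boolP (xe.2 \in S); last by exists 0.
  have [g|] := pselect (generizes xe.2 xe.1); last by exists 0.
  by have [z zE] := principal_trace M (ed_reg2 D) (exc_divisorS eS) g; exists z.
by exists (fun x e => z (x, e)) => x e; exact: (zP (x, e)).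
Qed.

Section Equations.
Variable z : X -> X -> F.
Hypothesis zP : forall x e, e \in S -> generizes e x ->
  O x `&` nmax (O e) = scale_set (z x e) (O x).

Lemma equation_in x e : e \in S -> generizes e x -> O x (z x e) /\ nmax (O e) (z x e).
Proof.
move=> eS g; suff [] : (O x `&` nmax (O e)) (z x e) by [].
by rewrite zP //; exists 1; [exact: sub1|rewrite mulr1].
Qed.

Lemma equation_unif x e : e \in S -> generizes e x -> nmax (O e) = scale_set (z x e) (O e).
Proof.
move=> eS g; have [Oz nz] := equation_in eS g.
apply/seteqP; split; last first.
  by move=> _ [b Ob <-]; rewrite mulrC; apply: (modM (nO e)).
move=> a na; have [Oa _] := na; have [b [s [Ob Os ns aE]]] := lm_genloc M g Oa.
have s0 : s != 0 by apply: contra_notN ns => /eqP ->; exact: (mod0 (nO e)).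
have : (O x `&` nmax (O e)) b.
  split=> //; have -> : b = s * a by rewrite aE; field.
  by apply: (modM (nO e)) => //; exact: (lm_gen M g).
rewrite zP // => -[t Ot tE]; exists (t / s); last by rewrite aE -tE mulrA.
apply: subM => //; first exact: (lm_gen M g).
by have [||//] := @nmaxPn _ (O e) s; first exact: (lm_gen M g).
Qed.

Lemma equation_neq0 x e : e \in S -> generizes e x -> z x e != 0.
Proof.
move=> eS g; apply: contraNneq (ed_unif0 D eS) => z0.
have : nmax (O e) (unif e).
  by rewrite (ed_unif D eS); exists 1; [exact: sub1|rewrite mulr1].
by rewrite (equation_unif eS g) z0 => -[t _ <-]; rewrite mul0r.
Qed.

Lemma equation_unit x e e' : e \in S -> e' \in S -> generizes e x -> generizes e' x ->
  e != e' -> O e' (z x e)^-1.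
Proof.
move=> eS eS' g g' ne; have [Oz _] := equation_in eS g.
have [||//] := @nmaxPn _ (O e') (z x e); first exact: (lm_gen M g').
move=> nz; move/eqP: ne; apply; apply: divisor_inj => //.
apply: (lm_gencmp M (x := x)) => // a; rewrite zP // => -[t Ot <-].
by rewrite mulrC; apply: (modM (nO e')) => //; exact: (lm_gen M g').
Qed.

Lemma unif_pow x e k : e \in S -> generizes e x ->
  scale_set (unif e ^+ k) (O e) = scale_set (z x e ^+ k) (O e).
Proof.
move=> eS g; have E := equation_unif eS g; rewrite (ed_unif D eS) in E.
by apply/seteqP; split; apply: scale_pow => //; rewrite E.
Qed.

Lemma equation_pow x e k c : e \in S -> generizes e x -> O x c ->
  scale_set (unif e ^+ k) (O e) c -> scale_set (z x e ^+ k) (O x) c.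
Proof.
move=> eS g; rewrite (unif_pow k eS g); have z0 := equation_neq0 eS g.
elim: k c => [|k IH] c Oc [b Ob bE]; first by exists c; rewrite // expr0 mul1r.
have : (O x `&` nmax (O e)) c.
  split=> //; rewrite (equation_unif eS g) -bE.
  exists (z x e ^+ k * b); last by rewrite mulrA -exprS.
  apply: subM => //; apply: subX => //.
  by apply: (lm_gen M g); case: (equation_in eS g).
rewrite zP // => -[c' Oc' cE]; have [||d Od dE] := IH c' => //.
  by exists b => //; apply: (mulfI z0); rewrite cE -bE exprS mulrA.
by exists d => //; rewrite -cE -dE exprS mulrA.
Qed.

Definition local_gen Y x := \prod_(e <- S | `[< generizes e x >]) z x e ^+ Y e.

(** O(-Y) is invertible. Local equations of different curves through [x] are units at each other's
    generic points, so the orders along the curves can be divided out one after the other. *)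
Lemma local_genP Y x : cyc Y -> Jmod Y x = scale_set (local_gen Y x) (O x).
Proof.
move=> cY; rewrite /local_gen -big_filter.
set T := [seq _ <- _ | _].
have TS e : e \in T -> e \in S /\ generizes e x.
  by rewrite mem_filter => /andP[/asboolP].
have uT : uniq T by rewrite filter_uniq // (ed_uniq D).
have char c : Jmod Y x c <-> O x c /\ forall e, e \in T -> scale_set (unif e ^+ Y e) (O e) c.
  split.
    by move=> /(Jmod_char _ _ cY)[Oc h]; split=> // e /TS[]; exact: h.
  move=> [Oc h]; apply/Jmod_char => //; split=> // e eS g; apply: h.
  by rewrite mem_filter eS andbT; apply/asboolP.
suff H c : (O x c /\ forall e, e \in T -> scale_set (unif e ^+ Y e) (O e) c) <->
    scale_set (\prod_(e <- T) z x e ^+ Y e) (O x) c.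
  by apply/seteqP; split=> c; [move/char/H|move/H/char].
elim: T uT TS c {char} => [|e T IH] /=.
  move=> _ _ c; rewrite big_nil; split; first by move=> [Oc _]; exists c; rewrite // mul1r.
  by move=> [d Od <-]; rewrite mul1r.
move=> /andP[eT uT] TS c; have {}IH := IH uT (fun e' h => TS e' (mem_behead (s := e :: T) h)).
have [eS g] := TS e (mem_head _ _); have [Oz nz] := equation_in eS g.
rewrite big_cons; split.
  move=> [Oc h]; have := h e (mem_head _ _).
  move=> /(equation_pow eS g Oc)[d Od dE].
  have [|d' Od' d'E] := (IH d).1.
    split=> // e' e'T; have [eS' g'] := TS e' (mem_behead (s := e :: T) e'T).
    have [b Ob bE] := h e' (mem_behead (s := e :: T) e'T).
    have Oz' : O e' (z x e)^-1.
      by apply: equation_unit => //; apply: contraNneq eT => ->.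
    exists ((z x e)^-1 ^+ Y e * b); first by apply: subM => //; exact: subX.
    rewrite mulrCA bE -dE exprVn mulKf // expf_neq0 //; exact: equation_neq0.
  by exists d' => //; rewrite -mulrA d'E dE.
move=> [d Od <-]; have [|Od' h] := (IH (\prod_(j <- T) z x j ^+ Y j * d)).2; first by exists d.
rewrite -mulrA; split; first by apply: subM => //; exact: subX.
move=> e'; rewrite inE => /predU1P[->|e'T].
  by rewrite (unif_pow _ eS g); exists (\prod_(j <- T) z x j ^+ Y j * d) => //; exact: (lm_gen M g).
have [eS' g'] := TS e' (mem_behead (s := e :: T) e'T); have [b Ob bE] := h e' e'T.
exists (z x e ^+ Y e * b); last by rewrite mulrCA bE.
by apply: subM => //; apply: subX => //; exact: (lm_gen M g').
Qed.

Lemma local_gen_neq0 Y x : local_gen Y x != 0.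
Proof.
rewrite /local_gen prodf_seq_neq0; apply/allP => e eS; apply/implyP => /asboolP g.
by rewrite expf_neq0 // equation_neq0.
Qed.

Lemma local_genD Y Y' x :
  local_gen (fun x => Y x + Y' x)%N x = local_gen Y x * local_gen Y' x.
Proof.
by rewrite /local_gen -big_split; apply: eq_bigr => e _; rewrite exprD.
Qed.

End Equations.
End Cycles.

(** * Localizations and tensor products *)

(** Rings given by representatives and a congruence. Localizations, tensor products and the stalks
    of the self-product are built from such data; inverses in the quotient are then chosen
    classically. *)
Record ring_presentation := RingPresentation {
  rp_carrier :> Type;
  rp_eq : rp_carrier -> rp_carrier -> Prop;
  rp_zero : rp_carrier; rp_one : rp_carrier;
  rp_add : rp_carrier -> rp_carrier -> rp_carrier;
  rp_opp : rp_carrier -> rp_carrier;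
  rp_mul : rp_carrier -> rp_carrier -> rp_carrier;
  rp_refl : forall a, rp_eq a a;
  rp_sym : forall a b, rp_eq a b -> rp_eq b a;
  rp_trans : forall a b c, rp_eq a b -> rp_eq b c -> rp_eq a c;
  rp_addcong : forall a a' b b', rp_eq a a' -> rp_eq b b' ->
    rp_eq (rp_add a b) (rp_add a' b');
  rp_oppcong : forall a a', rp_eq a a' -> rp_eq (rp_opp a) (rp_opp a');
  rp_mulcong : forall a a' b b', rp_eq a a' -> rp_eq b b' ->
    rp_eq (rp_mul a b) (rp_mul a' b');
  rp_addA : forall a b c, rp_eq (rp_add a (rp_add b c)) (rp_add (rp_add a b) c);
  rp_addC : forall a b, rp_eq (rp_add a b) (rp_add b a);
  rp_add0 : forall a, rp_eq (rp_add rp_zero a) a;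
  rp_addN : forall a, rp_eq (rp_add (rp_opp a) a) rp_zero;
  rp_mulA : forall a b c, rp_eq (rp_mul a (rp_mul b c)) (rp_mul (rp_mul a b) c);
  rp_mulC : forall a b, rp_eq (rp_mul a b) (rp_mul b a);
  rp_mul1 : forall a, rp_eq (rp_mul rp_one a) a;
  rp_mulD : forall a b c,
    rp_eq (rp_mul (rp_add a b) c) (rp_add (rp_mul a c) (rp_mul b c));
  rp_nontrivial : ~ rp_eq rp_one rp_zero
}.

Definition quo (r : ring_presentation) : Type :=
  {C : set r | exists a, C = [set b | rp_eq a b]}.

HB.instance Definition _ (r : ring_presentation) := gen_eqMixin (quo r).
HB.instance Definition _ (r : ring_presentation) := gen_choiceMixin (quo r).

Section QuotientRing.
Variable r : ring_presentation.

Definition cls (a : r) : quo r :=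
  exist _ [set b | rp_eq a b] (ex_intro _ a erefl).

Lemma cls_eq a b : cls a = cls b <-> rp_eq a b.
Proof.
split=> [/(congr1 sval)/= /seteqP[_ /(_ b)]|ab]; first by apply; exact: rp_refl.
apply/eq_exist/seteqP; split=> c /=; first exact/rp_trans/rp_sym.
exact: rp_trans.
Qed.

Lemma cls_surj (x : quo r) : exists a, x = cls a.
Proof. by case: x => C [a Ca]; exists a; exact: eq_exist. Qed.

Definition cls_rep (x : quo r) : r := sval (cid (cls_surj x)).

Lemma cls_repK x : cls (cls_rep x) = x.
Proof. by rewrite /cls_rep; case: cid. Qed.

Lemma rep_cls a : rp_eq (cls_rep (cls a)) a.
Proof. by apply/cls_eq; rewrite cls_repK. Qed.

Let add x y := cls (rp_add (cls_rep x) (cls_rep y)).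
Let mul x y := cls (rp_mul (cls_rep x) (cls_rep y)).
Let opp x := cls (rp_opp (cls_rep x)).

Let addE a b : add (cls a) (cls b) = cls (rp_add a b).
Proof. by apply/cls_eq/rp_addcong; exact: rep_cls. Qed.
Let mulE a b : mul (cls a) (cls b) = cls (rp_mul a b).
Proof. by apply/cls_eq/rp_mulcong; exact: rep_cls. Qed.
Let oppE a : opp (cls a) = cls (rp_opp a).
Proof. by apply/cls_eq/rp_oppcong; exact: rep_cls. Qed.

Fact quo_addA : associative add.
Proof.
move=> x y z; have [[a ->] [b ->] [c ->]] := And3 (cls_surj x) (cls_surj y) (cls_surj z).
by rewrite !addE; exact/cls_eq/rp_addA.
Qed.
Fact quo_addC : commutative add.
Proof.
move=> x y; have [[a ->] [b ->]] := conj (cls_surj x) (cls_surj y).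
by rewrite !addE; exact/cls_eq/rp_addC.
Qed.
Fact quo_add0 : left_id (cls (rp_zero r)) add.
Proof. by move=> x; have [a ->] := cls_surj x; rewrite addE; exact/cls_eq/rp_add0. Qed.
Fact quo_addN : left_inverse (cls (rp_zero r)) opp add.
Proof.
by move=> x; have [a ->] := cls_surj x; rewrite oppE addE; exact/cls_eq/rp_addN.
Qed.
Fact quo_mulA : associative mul.
Proof.
move=> x y z; have [[a ->] [b ->] [c ->]] := And3 (cls_surj x) (cls_surj y) (cls_surj z).
by rewrite !mulE; exact/cls_eq/rp_mulA.
Qed.
Fact quo_mulC : commutative mul.
Proof.
move=> x y; have [[a ->] [b ->]] := conj (cls_surj x) (cls_surj y).
by rewrite !mulE; exact/cls_eq/rp_mulC.
Qed.
Fact quo_mul1 : left_id (cls (rp_one r)) mul.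
Proof. by move=> x; have [a ->] := cls_surj x; rewrite mulE; exact/cls_eq/rp_mul1. Qed.
Fact quo_mulD : left_distributive mul add.
Proof.
move=> x y z; have [[a ->] [b ->] [c ->]] := And3 (cls_surj x) (cls_surj y) (cls_surj z).
by rewrite !(addE, mulE); exact/cls_eq/rp_mulD.
Qed.
Fact quo_neq0 : cls (rp_one r) != cls (rp_zero r).
Proof. by apply/eqP => /cls_eq; exact: rp_nontrivial. Qed.

HB.instance Definition _ := GRing.isZmodule.Build (quo r)
  quo_addA quo_addC quo_add0 quo_addN.
HB.instance Definition _ := GRing.Zmodule_isComNzRing.Build (quo r)
  quo_mulA quo_mulC quo_mul1 quo_mulD quo_neq0.

Definition quo_unit : pred (quo r) := fun x => `[< exists y, y * x = 1 >].
Definition quo_inv (x : quo r) : quo r :=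
  if pselect (exists y, y * x = 1) is left h then sval (cid h) else x.

Fact quo_mulV : {in quo_unit, left_inverse 1 quo_inv *%R}.
Proof.
move=> x /asboolP h; rewrite /quo_inv; case: pselect => // h'.
by case: cid.
Qed.
Fact quo_unitP (x y : quo r) : y * x = 1 -> quo_unit x.
Proof. by move=> h; apply/asboolP; exists y. Qed.
Fact quo_inv_out : {in [predC quo_unit], quo_inv =1 id}.
Proof. by move=> x /asboolP h; rewrite /quo_inv; case: pselect. Qed.

HB.instance Definition _ := GRing.ComNzRing_hasMulInverse.Build (quo r)
  quo_mulV quo_unitP quo_inv_out.

Lemma clsD a b : cls (rp_add a b) = cls a + cls b :> quo r.
Proof. by rewrite -addE. Qed.
Lemma clsM a b : cls (rp_mul a b) = cls a * cls b :> quo r.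
Proof. by rewrite -mulE. Qed.
Lemma clsN a : cls (rp_opp a) = - cls a :> quo r.
Proof. by rewrite -oppE. Qed.
Lemma cls1 : cls (rp_one r) = 1 :> quo r. Proof. by []. Qed.
Lemma cls0 : cls (rp_zero r) = 0 :> quo r. Proof. by []. Qed.

End QuotientRing.

Lemma rmorphism_of (R S : nzRingType) (f : R -> S) :
    (forall a b, f (a - b) = f a - f b) -> (forall a b, f (a * b) = f a * f b) ->
    f 1 = 1 -> exists g : {rmorphism R -> S}, g =1 f.
Proof.
move=> fB fM f1.
pose M := GRing.isZmodMorphism.Build R S f fB.
pose N := GRing.isMonoidMorphism.Build R S f (conj f1 fM).
pose g : {rmorphism R -> S} := HB.pack f M N.
by exists g.
Qed.

Section Localization.
Variables (B : comUnitRingType) (P : set B).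
Hypothesis pP : is_prime P.

Let E := (B * {s : B | ~ P s})%type.
Let loc_eq (x y : E) :=
  exists2 t, ~ P t & t * (x.1 * sval y.2) = t * (y.1 * sval x.2).

Let nP1 : ~ P 1. Proof. by case: pP. Qed.
Let nPM s t : ~ P s -> ~ P t -> ~ P (s * t).
Proof. by case: pP => _ _ h ns nt /h[]. Qed.
Let one : {s : B | ~ P s} := exist _ 1 nP1.
Let mulS (s t : {s : B | ~ P s}) : {s : B | ~ P s} :=
  exist _ (sval s * sval t) (nPM (svalP s) (svalP t)).

Lemma localization_exists :
  exists (L : comUnitRingType) (h : {rmorphism B -> L}), is_localization P h.
Proof.
pose add (x y : E) : E := (x.1 * sval y.2 + y.1 * sval x.2, mulS x.2 y.2).
pose mul (x y : E) : E := (x.1 * y.1, mulS x.2 y.2).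
pose opp (x : E) : E := (- x.1, x.2).
have eqE (x y : E) : x.1 * sval y.2 = y.1 * sval x.2 -> loc_eq x y.
  by move=> h; exists 1; rewrite ?mul1r.
have refl (x : E) : loc_eq x x by exact: eqE.
have sym (x y : E) : loc_eq x y -> loc_eq y x by move=> [t nt h]; exists t.
have trans (x y z : E) : loc_eq x y -> loc_eq y z -> loc_eq x z.
  move=> [t nt h] [u nu h']; exists (t * u * sval y.2).
    by apply: nPM (svalP y.2); exact: nPM.
  have -> : t * u * sval y.2 * (x.1 * sval z.2) =
    u * sval z.2 * (t * (x.1 * sval y.2)) by ring.
  have -> : t * u * sval y.2 * (z.1 * sval x.2) =
    t * sval x.2 * (u * (z.1 * sval y.2)) by ring.
  by rewrite h -h'; ring.
have addcong (a a' b b' : E) : loc_eq a a' -> loc_eq b b' ->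
    loc_eq (add a b) (add a' b').
  move=> [t nt h] [u nu h']; exists (t * u); first exact: nPM.
  rewrite /=; set x := _ * (_ * _).
  have -> : x = u * sval b.2 * sval b'.2 * (t * (a.1 * sval a'.2)) +
    t * sval a.2 * sval a'.2 * (u * (b.1 * sval b'.2)) by rewrite /x; ring.
  by rewrite h h'; ring.
have oppcong (a a' : E) : loc_eq a a' -> loc_eq (opp a) (opp a').
  by move=> [t nt h]; exists t => //=; rewrite !mulNr !mulrN h.
have mulcong (a a' b b' : E) : loc_eq a a' -> loc_eq b b' ->
    loc_eq (mul a b) (mul a' b').
  move=> [t nt h] [u nu h']; exists (t * u); first exact: nPM.
  rewrite /=; set x := _ * (_ * _).
  have -> : x = (t * (a.1 * sval a'.2)) * (u * (b.1 * sval b'.2)) by rewrite /x; ring.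
  by rewrite h h'; ring.
have addA (a b c : E) : loc_eq (add a (add b c)) (add (add a b) c).
  by apply: eqE => /=; ring.
have addC (a b : E) : loc_eq (add a b) (add b a) by apply: eqE => /=; ring.
have add0 (a : E) : loc_eq (add (0, one) a) a by apply: eqE => /=; ring.
have addN (a : E) : loc_eq (add (opp a) a) (0, one) by apply: eqE => /=; ring.
have mulA (a b c : E) : loc_eq (mul a (mul b c)) (mul (mul a b) c).
  by apply: eqE => /=; ring.
have mulC (a b : E) : loc_eq (mul a b) (mul b a) by apply: eqE => /=; ring.
have mul1 (a : E) : loc_eq (mul (1, one) a) a by apply: eqE => /=; ring.
have mulD (a b c : E) : loc_eq (mul (add a b) c) (add (mul a c) (mul b c)).
  by apply: eqE => /=; ring.
have nz : ~ loc_eq (1, one) (0, one).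
  move=> [t nt] /=; rewrite mul1r mul0r mulr1 mulr0 => t0; apply: nt.
  by rewrite t0; case: pP => -[].
pose r := RingPresentation refl sym trans addcong oppcong mulcong addA addC
  add0 addN mulA mulC mul1 mulD nz.
pose k (b : B) : quo r := @cls r (b, one).
have kB a b : k (a - b) = k a - k b.
  by rewrite /k -clsN -clsD; apply/cls_eq/eqE => /=; ring.
have kM a b : k (a * b) = k a * k b.
  by rewrite /k -clsM; apply/cls_eq/eqE => /=; ring.
have [h hE] := rmorphism_of kB kM erefl.
exists (quo r : comUnitRingType), h; split.
- move=> s ns; rewrite hE; apply/unitrPr.
  exists (@cls r (1, exist _ s ns)).
  by rewrite /k -clsM -cls1; apply/cls_eq/eqE => /=; ring.
- move=> x; have [[b [s ns]] ->] := cls_surj x.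
  exists b, s; split=> //; rewrite !hE /k -clsM.
  by apply/cls_eq/eqE => /=; ring.
- move=> b; rewrite hE /k -cls0 => /cls_eq[t nt] /=.
  by rewrite mulr1 mul0r mulr0 => h0; exists t.
Qed.

End Localization.

Section Fractions.
Variable V : comUnitRingType.
Implicit Types x y z w : V.

Lemma mulr_frac x y z w : y \is a GRing.unit -> w \is a GRing.unit ->
  x / y * (z / w) = (x * z) / (y * w).
Proof. by move=> uy uw; rewrite invrM // mulrACA (mulrC y^-1). Qed.

Lemma addr_frac x y z w : y \is a GRing.unit -> w \is a GRing.unit ->
  x / y + z / w = (x * w + z * y) / (y * w).
Proof.
move=> uy uw; rewrite invrM // mulrDl mulrA mulrK //; congr (_ + _).
by rewrite mulrA mulrAC mulrK.
Qed.

Lemma subr_frac x y z w : y \is a GRing.unit -> w \is a GRing.unit ->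
  x / y - z / w = (x * w - z * y) / (y * w).
Proof. by move=> uy uw; rewrite -!mulNr addr_frac // mulNr. Qed.

End Fractions.

Section LocalizationTheory.
Variables (B R : comUnitRingType) (P : set B) (h : {rmorphism B -> R}).
Hypotheses (pP : is_prime P) (lh : is_localization P h).

Lemma localization_frac r : exists b s, ~ P s /\ r = h b / h s.
Proof.
have [hu hf _] := lh; have [b [s [ns hs]]] := hf r.
by exists b, s; split=> //; rewrite -hs mulrC mulrA mulVr ?mul1r //; exact: hu.
Qed.

Lemma localization_eq b s b' s' : ~ P s -> ~ P s' ->
  h b / h s = h b' / h s' -> exists2 t, ~ P t & t * (b * s') = t * (b' * s).
Proof.
have [hu _ hk] := lh; move=> ns ns' E.
have : h (b * s' - b' * s) = 0.
  have us := hu _ ns; have us' := hu _ ns'.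
  by rewrite rmorphB !rmorphM -[h b](divrK us) E mulrAC divrK // subrr.
by move=> /hk[t nt]; rewrite mulrBr => /eqP; rewrite subr_eq0 => /eqP ?; exists t.
Qed.

Lemma localization_univ (W : comUnitRingType) (k : {rmorphism B -> W}) :
    (forall s, ~ P s -> k s \is a GRing.unit) ->
  exists g : {rmorphism R -> W}, forall b, g (h b) = k b.
Proof.
move=> ku; have [hu _ hk] := lh.
have wd b s b' s' : ~ P s -> ~ P s' -> h b / h s = h b' / h s' -> k b / k s = k b' / k s'.
  move=> ns ns' /(localization_eq ns ns')[t nt].
  move=> /(congr1 k); rewrite !rmorphM => /(mulrI (ku _ nt)) E.
  apply: (mulIr (ku _ ns)); apply: (mulIr (ku _ ns')).
  by rewrite divrK ?ku // E mulrAC divrK ?ku.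
have /choice[f fP] r : exists w, exists b s, [/\ ~ P s, r = h b / h s & w = k b / k s].
  by have [b [s [ns ->]]] := localization_frac r; exists (k b / k s), b, s.
have fE b s : ~ P s -> f (h b / h s) = k b / k s.
  by move=> ns; have [b' [s' [ns' E ->]]] := fP (h b / h s); apply: wd.
have nP1 : ~ P 1 by case: pP.
have nPM s t : ~ P s -> ~ P t -> ~ P (s * t).
  by case: pP => _ _ hp ns nt /hp[].
have hE b s b' s' : ~ P s -> ~ P s' -> b * s' = b' * s -> h b / h s = h b' / h s'.
  move=> ns ns' E; apply: (mulIr (hu _ ns)); apply: (mulIr (hu _ ns')).
  by rewrite divrK ?hu // mulrAC divrK ?hu // -!rmorphM E.
have ff x y : exists b s c t, [/\ ~ P s, ~ P t, x = h b / h s & y = h c / h t].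
  have [b [s [ns ->]]] := localization_frac x.
  have [c [t [nt ->]]] := localization_frac y.
  by exists b, s, c, t.
have fB x y : f (x - y) = f x - f y.
  have [b [s [c [t [ns nt -> ->]]]]] := ff x y.
  rewrite subr_frac ?hu // -!rmorphM -rmorphB.
  rewrite !fE //; last exact: nPM.
  by rewrite [RHS]subr_frac ?ku // rmorphB !rmorphM.
have fM x y : f (x * y) = f x * f y.
  have [b [s [c [t [ns nt -> ->]]]]] := ff x y.
  rewrite mulr_frac ?hu // -!rmorphM.
  rewrite !fE //; last exact: nPM.
  by rewrite [RHS]mulr_frac ?ku // !rmorphM.
have fh b : f (h b) = k b.
  by have := fE b 1 nP1; rewrite !rmorph1 !divr1.
have [g gE] := rmorphism_of fB fM (etrans (congr1 f (esym (rmorph1 h))) (etrans (fh 1) (rmorph1 k))).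
by exists g => b; rewrite gE fh.
Qed.

Lemma localization_ext (W : comUnitRingType) (g g' : {rmorphism R -> W}) :
  (forall b, g (h b) = g' (h b)) -> g =1 g'.
Proof.
move=> E r; have [b [s [ns ->]]] := localization_frac r; have [hu _ _] := lh.
have us := hu _ ns.
by rewrite !rmorphM !rmorphV // !E.
Qed.

End LocalizationTheory.

Section TensorLists.
Variables (I J : Type) (W : comUnitRingType).
Implicit Types (u : I -> W) (v : J -> W) (l : seq (I * J)).

Definition tev u v l : W := \sum_(p <- l) u p.1 * v p.2.

Definition tmul (mI : I -> I -> I) (mJ : J -> J -> J) l l' : seq (I * J) :=
  [seq (mI p.1 q.1, mJ p.2 q.2) | p <- l, q <- l'].

Definition topp (oI : I -> I) l : seq (I * J) := [seq (oI p.1, p.2) | p <- l].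

Lemma tev_nil u v : tev u v [::] = 0. Proof. by rewrite /tev big_nil. Qed.

Lemma tev_cons u v p l : tev u v (p :: l) = u p.1 * v p.2 + tev u v l.
Proof. by rewrite /tev big_cons. Qed.

Lemma tev1 u v a b : tev u v [:: (a, b)] = u a * v b.
Proof. by rewrite tev_cons tev_nil addr0. Qed.

Lemma tev_cat u v l l' : tev u v (l ++ l') = tev u v l + tev u v l'.
Proof. by rewrite /tev big_cat. Qed.

Lemma tev_mul mI mJ u v l l' : (forall a b, u (mI a b) = u a * u b) ->
  (forall a b, v (mJ a b) = v a * v b) ->
  tev u v (tmul mI mJ l l') = tev u v l * tev u v l'.
Proof.
move=> uM vM; elim: l => [|p l IH]; first by rewrite /= !tev_nil mul0r.
rewrite /tmul /= tev_cat -/(tmul mI mJ l l') IH tev_cons mulrDl; congr (_ + _).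
rewrite /tev big_map mulr_sumr; apply: eq_bigr => q _ /=.
by rewrite uM vM mulrACA.
Qed.

Lemma tev_opp oI u v l : (forall a, u (oI a) = - u a) ->
  tev u v (topp oI l) = - tev u v l.
Proof.
move=> uN; rewrite /tev /topp big_map -sumrN; apply: eq_bigr => p _ /=.
by rewrite uN mulNr.
Qed.

Lemma tev_eq u u' v v' l : u =1 u' -> v =1 v' -> tev u v l = tev u' v' l.
Proof. by move=> hu hv; apply: eq_bigr => p _; rewrite hu hv. Qed.

End TensorLists.

Lemma rmorph_tev (I J : Type) (W W' : comUnitRingType) (g : {rmorphism W -> W'})
    (u : I -> W) (v : J -> W) l : g (tev u v l) = tev (g \o u) (g \o v) l.
Proof. by rewrite rmorph_sum; apply: eq_bigr => p _; rewrite rmorphM. Qed.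

Section Pushout.
Variables (R B C W0 : comUnitRingType) (f : {rmorphism R -> B}) (g : {rmorphism R -> C}).
Variables (u0 : {rmorphism B -> W0}) (v0 : {rmorphism C -> W0}).
Hypothesis uv0 : forall r, u0 (f r) = v0 (g r).

Let E := seq (B * C).
Let teq (l l' : E) := forall (W : comUnitRingType) (u : {rmorphism B -> W})
  (v : {rmorphism C -> W}), (forall r, u (f r) = v (g r)) -> tev u v l = tev u v l'.

(** Two formal sums are identified when they have the same value under every compatible pair of
    maps, so that the universal property is built into the congruence. The given pair [u0], [v0]
    shows that 1 and 0 remain distinct. *)
Lemma pushout_exists :
  exists (T : comUnitRingType) (i : {rmorphism B -> T}) (j : {rmorphism C -> T}),
    is_pushout f g i j /\
    forall t, exists l : seq (B * C), t = tev i j l.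
Proof.
pose mul : E -> E -> E := tmul *%R *%R.
pose opp : E -> E := topp -%R.
have evM (W : comUnitRingType) (u : {rmorphism B -> W}) (v : {rmorphism C -> W})
    l l' : tev u v (mul l l') = tev u v l * tev u v l'.
  by rewrite tev_mul // => a b; rewrite rmorphM.
have evN (W : comUnitRingType) (u : {rmorphism B -> W}) (v : {rmorphism C -> W})
    l : tev u v (opp l) = - tev u v l.
  by rewrite tev_opp // => a; rewrite rmorphN.
have ev1 (W : comUnitRingType) (u : {rmorphism B -> W}) (v : {rmorphism C -> W}) :
    tev u v [:: (1, 1)] = 1.
  by rewrite tev1 !rmorph1 mulr1.
have refl (a : E) : teq a a by [].
have sym (a b : E) : teq a b -> teq b a by move=> h W u v /h.
have trans (a b c : E) : teq a b -> teq b c -> teq a c.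
  by move=> h h' W u v uv; rewrite h // h'.
have addcong (a a' b b' : E) : teq a a' -> teq b b' -> teq (a ++ b) (a' ++ b').
  by move=> h h' W u v uv; rewrite !tev_cat h // h'.
have oppcong (a a' : E) : teq a a' -> teq (opp a) (opp a').
  by move=> h W u v uv; rewrite !evN h.
have mulcong (a a' b b' : E) : teq a a' -> teq b b' -> teq (mul a b) (mul a' b').
  by move=> h h' W u v uv; rewrite !evM h // h'.
have addA (a b c : E) : teq (a ++ (b ++ c)) ((a ++ b) ++ c).
  by move=> W u v uv; rewrite !tev_cat addrA.
have addC (a b : E) : teq (a ++ b) (b ++ a).
  by move=> W u v uv; rewrite !tev_cat addrC.
have add0 (a : E) : teq ([::] ++ a) a by [].
have addN (a : E) : teq (opp a ++ a) [::].
  by move=> W u v uv; rewrite tev_cat evN addNr tev_nil.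
have mulA (a b c : E) : teq (mul a (mul b c)) (mul (mul a b) c).
  by move=> W u v uv; rewrite !evM mulrA.
have mulC (a b : E) : teq (mul a b) (mul b a).
  by move=> W u v uv; rewrite !evM mulrC.
have mul1 (a : E) : teq (mul [:: (1, 1)] a) a.
  by move=> W u v uv; rewrite !evM ev1 mul1r.
have mulD (a b c : E) : teq (mul (a ++ b) c) (mul a c ++ mul b c).
  by move=> W u v uv; rewrite tev_cat !evM tev_cat mulrDl.
have nz : ~ teq [:: (1, 1)] [::].
  by move=> /(_ _ _ _ uv0); rewrite ev1 tev_nil => /eqP; rewrite oner_eq0.
pose r := RingPresentation refl sym trans addcong oppcong mulcong addA addC
  add0 addN mulA mulC mul1 mulD nz.
pose c (l : E) : quo r := @cls r l.
have [i iE] : exists i : {rmorphism B -> quo r}, forall b, i b = c [:: (b, 1)].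
  apply: rmorphism_of => [a b|a b|//].
    rewrite /c -clsN -clsD; apply/cls_eq => W u v uv.
    by rewrite tev_cat evN !tev1 rmorphB rmorph1 !mulr1.
  rewrite /c -clsM; apply/cls_eq => W u v uv.
  by rewrite evM !tev1 rmorphM rmorph1 !mulr1.
have [j jE] : exists j : {rmorphism C -> quo r}, forall b, j b = c [:: (1, b)].
  apply: rmorphism_of => [a b|a b|//].
    rewrite /c -clsN -clsD; apply/cls_eq => W u v uv.
    by rewrite tev_cat evN !tev1 rmorphB rmorph1 !mul1r.
  rewrite /c -clsM; apply/cls_eq => W u v uv.
  by rewrite evM !tev1 rmorphM rmorph1 !mul1r.
have cE l : c l = tev i j l.
  elim: l => [|[a b] l IH]; first by rewrite tev_nil.
  rewrite tev_cons -IH iE jE /= /c -clsM -clsD; apply/cls_eq => W u v uv.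
  by rewrite tev_cat evM !tev1 tev_cons !rmorph1 mulr1 mul1r.
exists (quo r : comUnitRingType), i, j; split; last first.
  by move=> t; have [l ->] := cls_surj t; exists l; rewrite -cE.
split.
  move=> x; rewrite iE jE; apply/cls_eq => W u v uv.
  by rewrite !tev1 !rmorph1 mulr1 mul1r.
move=> W u v uv.
have wd l l' : c l = c l' -> tev u v l = tev u v l' by move=> /cls_eq; apply.
pose w (x : quo r) := tev u v (cls_rep x).
have wE l : w (c l) = tev u v l.
  by apply: wd; rewrite /c cls_repK.
have [w' w'E] : exists w' : {rmorphism quo r -> W}, w' =1 w.
  apply: rmorphism_of => [x y|x y|].
  - have [[a ->] [b ->]] := conj (cls_surj x) (cls_surj y).
    by rewrite -clsN -clsD -!/(c _) !wE tev_cat evN.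
  - have [[a ->] [b ->]] := conj (cls_surj x) (cls_surj y).
    by rewrite -clsM -!/(c _) !wE evM.
  - by rewrite -cls1 -/(c _) wE ev1.
exists w'; split.
- by move=> b; rewrite w'E iE wE tev1 rmorph1 mulr1.
- by move=> b; rewrite w'E jE wE tev1 rmorph1 mul1r.
- move=> w2 hu hv x; have [l ->] := cls_surj x.
  rewrite -/(c l) w'E wE cE rmorph_tev; apply: tev_eq => b /=; [exact: hu|exact: hv].
Qed.

End Pushout.

Lemma open_from_nbhds (T : topologicalType) (O : set T) :
  (forall x, O x -> exists V, [/\ open V, V x & V `<=` O]) -> open O.
Proof.
move=> h; rewrite openE => x /h[V [oV Vx VO]]; rewrite /interior nbhsE.
by exists V.
Qed.

(** * Sections of structure sheaves and affine open sets *)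

Section SheafLemmas.
Variable X : lrspace.
Implicit Types (U V : set X) (s t : forall x : X, stalk x).

Lemma sect0 U : open U -> ls_sect U (fun=> 0).
Proof.
move=> oU; have := ls_sectB oU (ls_sect1 oU) (ls_sect1 oU).
by apply: ls_ext => // x _; rewrite subrr.
Qed.

Lemma sectN U s : open U -> ls_sect U s -> ls_sect U (fun x => - s x).
Proof.
move=> oU hs; have := ls_sectB oU (sect0 oU) hs.
by apply: ls_ext => // x _; rewrite sub0r.
Qed.

Lemma sectD U s t : open U -> ls_sect U s -> ls_sect U t ->
  ls_sect U (fun x => s x + t x).
Proof.
move=> oU hs ht; have := ls_sectB oU hs (sectN oU ht).
by apply: ls_ext => // x _; rewrite opprK.
Qed.

Lemma sect_germ_eq U s t x : open U -> ls_sect U s -> ls_sect U t -> U x ->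
  s x = t x -> exists V, [/\ open V, V x, V `<=` U & forall y, V y -> s y = t y].
Proof.
move=> oU hs ht Ux st.
have [|V [oV Vx VU h]] := ls_germ0 oU (ls_sectB oU hs ht) Ux; first by rewrite st subrr.
by exists V; split=> // y /h /eqP; rewrite subr_eq0 => /eqP.
Qed.

Lemma sect_unit_open U s x : open U -> ls_sect U s -> U x -> s x \is a GRing.unit ->
  exists V, [/\ open V, V x, V `<=` U & forall y, V y -> s y \is a GRing.unit].
Proof.
move=> oU hs Ux us; have [W [t [oW Wx ht tx]]] := ls_germ ((s x)^-1).
have oUW : open (U `&` W) by exact: openI.
have [||||V [oV Vx VU h]] := @sect_germ_eq (U `&` W) (fun y => t y * s y) (fun=> 1) x oUW.
- by apply: ls_sectM => //; [apply: ls_res ht|apply: ls_res hs] => // y [].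
- exact: ls_sect1.
- by [].
- by rewrite tx mulVr.
exists V; split=> //; first by move=> y /VU[].
by move=> y /h h1; apply/unitrPr; exists (t y); rewrite mulrC.
Qed.

Lemma sect_inv U s : open U -> ls_sect U s ->
  (forall x, U x -> s x \is a GRing.unit) -> ls_sect U (fun x => (s x)^-1).
Proof.
move=> oU hs us; apply: ls_glue => // x Ux.
have [W [t [oW Wx ht tx]]] := ls_germ ((s x)^-1).
have oUW : open (U `&` W) by exact: openI.
have hs' : ls_sect (U `&` W) s by apply: ls_res hs => // y [].
have ht' : ls_sect (U `&` W) t by apply: ls_res ht => // y [].
have [||||V [oV Vx VU h]] := @sect_germ_eq (U `&` W) (fun y => t y * s y) (fun=> 1) x oUW.
- exact: ls_sectM.
- exact: ls_sect1.
- by [].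
- by rewrite tx mulVr //; exact: us.
exists V; split=> //; first by move=> y /VU[].
have ht2 : ls_sect V t by apply: ls_res ht'.
apply: ls_ext ht2 => // y Vy; have uy := us y (VU y Vy).1.
by rewrite -[LHS](mulrK uy) h // mul1r.
Qed.

Lemma mor_unit (Y : lrspace) (f : morphism X Y) x a :
  (mor_stalk f x a \is a GRing.unit) = (a \is a GRing.unit).
Proof. by apply/idP/idP => [/mor_local//|h]; exact: rmorph_unit. Qed.

Lemma nonunitE (R : comUnitRingType) (a : R) : nonunits a <-> ~ a \is a GRing.unit.
Proof. by split=> [/negP|h]; [|apply/negP]. Qed.

Section Affine.
Variables (B : comUnitRingType) (U : set X) (psi : B -> forall x : X, stalk x).
Hypothesis sp : is_Spec U psi.

Let oU : open U. Proof. exact: Spec_open sp. Qed.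

Definition spec_prime x : set B := [set b | nonunits (psi b x)].

Lemma spec_primeP x : U x -> is_prime (spec_prime x).
Proof.
move=> Ux; have [h hE _] := Spec_stalk sp Ux.
split.
- split=> [|a b|r a] /=; rewrite /spec_prime /= -!hE.
  + by apply/negP; rewrite rmorph0 unitr0.
  + by rewrite rmorphD; exact: ls_local.
  + move=> /nonunitE na; apply/negP; rewrite rmorphM unitrM.
    by move=> /andP[_ /na].
- by rewrite /spec_prime /= -hE rmorph1; apply/negP; rewrite unitr1.
- move=> a b; rewrite /spec_prime /= -!hE rmorphM => /nonunitE nab.
  apply: contrapT => /not_orP[]; rewrite !nonunitE => /contrapT ua /contrapT ub.
  by apply: nab; rewrite unitrM ua ub.
Qed.

Lemma spec_rmorphism x : U x -> exists h : {rmorphism B -> stalk x}, forall b, h b = psi b x.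
Proof. by move=> Ux; have [h hE _] := Spec_stalk sp Ux; exists h. Qed.

Lemma spec_basis V x : open V -> V x -> U x ->
  exists e, psi e x \is a GRing.unit /\ forall y, U y -> psi e y \is a GRing.unit -> V y.
Proof.
move=> oV Vx Ux; have [T hT] : exists T : set B, forall x, U x ->
       ((V `&` U) x <-> exists2 b, T b & psi b x \is a GRing.unit).
  exact: (Spec_top sp (V := V `&` U) (fun y h => h.2)).1 (openI oV oU).
have [e Te ue] := (hT x Ux).1 (conj Vx Ux).
exists e; split=> // y Uy uy; have [] := (hT y Uy).2 => //.
by exists e.
Qed.

Lemma spec_basic_open e : open [set x | U x /\ psi e x \is a GRing.unit].
Proof.
apply: (Spec_top sp (V := [set x | U x /\ psi e x \is a GRing.unit]) (fun y h => h.1)).2.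
exists [set e] => x Ux.
by split=> [[_ ue]|[b -> ue]]; [exists e|split].
Qed.

Lemma spec_frac V s x : open V -> ls_sect V s -> V x -> U x ->
  exists (b t : B) V', [/\ open V', V' x, V' `<=` V `&` U &
    forall y, V' y -> psi t y \is a GRing.unit /\ psi t y * s y = psi b y].
Proof.
move=> oV hs Vx Ux; have [h hE [hu hf hk]] := Spec_stalk sp Ux.
have [b [t [nt]]] := hf (s x); rewrite !hE => E.
have oVU : open (V `&` U) by exact: openI.
have [V1 [oV1 V1x V1U h1]] : exists V1, [/\ open V1, V1 x, V1 `<=` U &
    forall y, V1 y -> psi t y \is a GRing.unit].
  by apply: sect_unit_open => //; [exact: Spec_sect sp t|apply: contrapT => /negP].
have hs' : ls_sect (V `&` U) (fun y => psi t y * s y).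
  apply: ls_sectM => //; first by apply: ls_res (Spec_sect sp t) => // y [].
  by apply: ls_res hs => // y [].
have hb : ls_sect (V `&` U) (psi b) by apply: ls_res (Spec_sect sp b) => // y [].
have [V2 [oV2 V2x V2U h2]] := sect_germ_eq oVU hs' hb (conj Vx Ux) E.
exists b, t, (V1 `&` V2); split=> //; first exact: openI.
  by move=> y [_ /V2U].
by move=> y [/h1 ? /h2].
Qed.

End Affine.
End SheafLemmas.

(** * General sections and cohomology classes *)

Section GeneralSections.
Variables (F : fieldType) (A : set F) (X : topologicalType) (O : X -> set F) (eta : X).
Variables (S : seq X) (unif : X -> F).
Hypothesis D : exceptional_data A O eta S unif.
Implicit Types (x w e : X) (a b c g u v p : F) (Y : X -> nat).

Let M : local_model A O eta. Proof. exact: ed_model D. Qed.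
Let lA : is_loc A. Proof. exact: lm_A M. Qed.
Let sA : is_subring A. Proof. by case: lA. Qed.
Let lO x : is_loc (O x). Proof. exact: lm_loc M x. Qed.
Let sO x : is_subring (O x). Proof. by case: (lO x). Qed.
Let nO x : is_mod (O x) (nmax (O x)). Proof. by case: (nmax_idl (lO x)). Qed.
Let AO x : A `<=` O x. Proof. exact: (lm_AO M). Qed.
Notation J Y x := (Jmod O unif Y x).
Notation I Y := (Iglob O unif Y).

(** A section fails to generate at [x] exactly if it lies in the local generator times the maximal
    ideal. By global generation [I Y] is not contained in this submodule, and finitely many of them
    can be avoided at once. *)
Lemma generic_section Y (s : seq X) : cyc S Y -> ggen O unif Y ->
  exists2 g, I Y g & forall x, x \in s -> generates O unif Y g x.
Proof.
move=> cY gY; have [z zP] := local_equations D.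
pose x0 i := nth eta s i.
pose N i := scale_set (local_gen S z Y (x0 i)) (nmax (O (x0 i))).
have mN i : is_mod (O (x0 i)) (N i) by exact: scale_mod.
have G0 i : local_gen S z Y (x0 i) != 0 by exact: (local_gen_neq0 D zP).
have [i _|i _|g Ig hg] := @submodule_avoidance _ _ _ _ _ M (I Y) 0 (size s) N (Iglob_mod D cY).
- exact: (mod_sub (@AO (x0 i)) (mN i)).
- apply: contrapT => h; apply: (nmax1 (sO (x0 i))).
  have : N i (local_gen S z Y (x0 i)).
    apply: (gY _ _ (mN i)) => [a Ia|].
      by apply: contrapT => na; apply: h; exists a.
    by rewrite (local_genP D zP _ cY); exists 1; [exact: sub1|rewrite mulr1].
  by move=> [t nt tE]; have <- : t = 1 by apply: (mulfI (G0 i)); rewrite tE mulr1.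
exists g => // x xs; have lti : (index x s < size s)%N by rewrite index_mem.
have := hg _ lti; rewrite /N /x0 nth_index // add0r => ng.
have := Ig x; rewrite (local_genP D zP _ cY) => -[t Ot tE].
have [|t0 Ot'] := nmaxPn Ot; first by move=> nt; apply: ng; exists t.
rewrite /generates (local_genP D zP _ cY) => _ [b Ob <-].
by exists (t^-1 * b); [exact: subM|rewrite -tE; field].
Qed.

(** [I Y] is finitely generated over [A]; generating at a point amounts to dividing these finitely
    many sections there, which is an open condition. *)
Lemma generates_open Y g x : cyc S Y -> ggen O unif Y -> I Y g -> generates O unif Y g x ->
  exists V, [/\ open V, V x & forall y, V y -> generates O unif Y g y].
Proof.
move=> cY gY Ig gx; have iI : is_idl A (I Y) by split; [exact: (Iglob_mod D cY)|exact: (Iglob_A D cY)].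
have [n [v [Iv vI]]] := rnoeth_fg sA (lm_noeth M) iI.
have [V [oV Vx hV]] : exists V, [/\ open V, V x & forall y, V y ->
    forall i, (i < n)%N -> scale_set g (O y) (v i)].
  elim: (n) => [|k [V [oV Vx hV]]]; first by exists setT; split=> //; exact: openT.
  have [c Oc cE] := gx _ (Iv k x); have [W [oW Wx hW]] := lm_open M Oc.
  exists (V `&` W); split=> //; first exact: openI.
  move=> y [Vy Wy] i; rewrite ltnS leq_eqVlt => /predU1P[->|lt]; last exact: hV.
  by exists c => //; exact: hW.
exists V; split=> // y Vy; have mS : is_mod (O y) (scale_set g (O y)).
  by apply: scale_mod; exact: mod_subring.
apply: gY => // a /vI; apply: rspan_le; first exact: (mod_sub (@AO y) mS).
by move=> i lt; exact: hV.
Qed.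

Lemma bad_locus_closed Y g : cyc S Y -> ggen O unif Y -> I Y g ->
  closed [set x | ~ generates O unif Y g x].
Proof.
move=> cY gY Ig; rewrite -openC; apply: open_from_nbhds => x /= /contrapT gx.
have [V [oV Vx hV]] := generates_open cY gY Ig gx.
by exists V; split=> // y Vy /=; apply; exact: hV.
Qed.

Lemma exceptional_closed : closed [set x | exceptional A O x].
Proof.
rewrite -openC; apply: open_from_nbhds => x /= /existsNP[a /not_implyP[na nx]].
have [Aa _] := na; have [a0 Oa'] := nmaxPn (@AO x a Aa) nx.
have [V [oV Vx hV]] := lm_open M Oa'.
exists V; split=> // y Vy /= /(_ a na)[_ [/eqP|]]; first by rewrite (negbTE a0).
by apply; exact: hV.
Qed.

Lemma generates_gen Y g x y : cyc S Y -> ggen O unif Y -> I Y g -> generizes y x ->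
  generates O unif Y g x -> generates O unif Y g y.
Proof.
move=> cY gY Ig gyx /(generates_open cY gY Ig)[V [oV Vx hV]].
by apply: hV; exact: gyx.
Qed.

Variables (Z Z' : X -> nat).
Hypotheses (cZ : cyc S Z) (cZ' : cyc S Z') (gZ : ggen O unif Z) (gZ' : ggen O unif Z').
Hypothesis pZ : exists e, Z e != 0%N.

Lemma closed_point e x w : e \in S -> generizes e x -> x \notin S -> generizes x w -> w = x.
Proof.
move=> eS gex xS gxw; apply/esym; apply: (exc_chain M (exc_divisorS D eS) gex gxw).
by move=> ex; rewrite -ex eS in xS.
Qed.

Lemma bad_closed g x w : (forall e, e \in S -> generates O unif Z g e) ->
  ~ generates O unif Z g x -> exceptional A O x -> generizes x w -> w = x.
Proof.
move=> gS bx Ex; have [e [_ eS ge]] := full_support D cZ gZ pZ Ex.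
by apply: (closed_point eS ge); apply/negP => /gS.
Qed.

(** A bad exceptional point is closed, and a bad non-exceptional point has no proper generization
    but [eta], which is good. So each is a generic point of the bad locus or of its exceptional
    part, and closed sets have finitely many of these. *)
Lemma bad_finite g : I Z g -> (forall e, e \in S -> generates O unif Z g e) ->
    generates O unif Z g eta ->
  exists s : seq X, forall x, ~ generates O unif Z g x -> x \in s.
Proof.
move=> Ig gS geta; have cB := bad_locus_closed cZ gZ Ig.
have [s hs] := lm_closed M cB; have [s' hs'] := lm_closed M (closedI cB exceptional_closed).
exists (s ++ s') => x bx; rewrite mem_cat; apply/orP.
have [Ex|nE] := pselect (exceptional A O x).
  have [w ws wx] := (hs' x).1 (conj bx Ex); right.
  have [bw Ew] : ~ generates O unif Z g w /\ exceptional A O w.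
    by apply: (hs' w).2; exists w.
  by rewrite (bad_closed gS bw Ew wx).
have [w ws wx] := (hs x).1 bx; left.
have bw : ~ generates O unif Z g w by apply: (hs w).2; exists w.
have <- // : w = x; apply: (nonexc_trace M nE wx) => we.
by apply: bw; rewrite we.
Qed.

(** [g] is taken to generate at [eta] and along all curves of [S], so that only finitely many points
    are bad for it; [g'] is then taken to generate at those points. *)
Lemma general_pair : exists g g', [/\ I Z g, I Z' g',
  forall x, generates O unif Z g x \/ generates O unif Z' g' x,
  forall e, e \in S -> generates O unif Z g e & generates O unif Z g eta].
Proof.
have [g Ig hg] := generic_section (eta :: S) cZ gZ.
have gS e : e \in S -> generates O unif Z g e by move=> eS; apply: hg; rewrite inE eS orbT.
have geta : generates O unif Z g eta by apply: hg; exact: mem_head.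
have [s hs] := bad_finite Ig gS geta.
have [g' Ig' hg'] := generic_section [seq x <- s | `[< ~ generates O unif Z g x >]] cZ' gZ'.
exists g, g'; split=> // x; apply: contrapT => /not_orP[bx bx'].
have cB := closedI (bad_locus_closed cZ gZ Ig) (bad_locus_closed cZ' gZ' Ig').
have [|y [by_ by'] Ey] := lm_meet M cB; first by exists x.
by apply: by'; apply: hg'; rewrite mem_filter hs // andbT; apply/asboolP.
Qed.

End GeneralSections.

(** * Local rings of a thickened curve *)

Section Thickening.
Variables (F : fieldType) (V R : set F) (g a : F).
Hypotheses (lV : is_loc V) (lR : is_loc R) (nR : rnoeth R) (RV : R `<=` V).
Hypothesis fracV : forall x, V x -> exists b s, [/\ R b, R s, ~ nmax V s & x = b / s].
Hypotheses (ng : nmax V g) (g0 : g != 0).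
Hypothesis nil_g : forall b, nmax V b -> exists n, scale_set g V (b ^+ n).
Hypotheses (na : nmax R a) (nVa : ~ nmax V a).
Hypothesis dichotomy : forall Q, is_rprime R Q -> R `&` nmax V `<=` Q ->
  Q `<=` nmax V \/ nmax R `<=` Q.

Let sV : is_subring V. Proof. by case: lV. Qed.
Let sR : is_subring R. Proof. by case: lR. Qed.
Let mnV : is_mod V (nmax V). Proof. by case: (nmax_idl lV). Qed.
Let mnR : is_mod R (nmax R). Proof. by case: (nmax_idl lR). Qed.

(** The preimage in [V] of the image of [R] in [V/gV], that is, the local ring at a point of the
    curve with the structure cut out by [g]. All points of one curve share the ideal [gV]. *)
Definition thickening := sum_set R (scale_set g V).

Notation W := thickening.
Let K := scale_set g V.

Let mK : is_mod V K. Proof. by apply: scale_mod; exact: mod_subring. Qed.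
Let mKR : is_mod R K. Proof. exact: (mod_sub RV mK). Qed.
Let KnV : K `<=` nmax V.
Proof. by move=> _ [b Vb <-]; rewrite mulrC; apply: (modM mnV). Qed.
Let Ra : R a. Proof. by case: na. Qed.
Let Va : V a. Proof. exact: RV. Qed.
Let a0 : a != 0. Proof. by have [] := nmaxPn Va nVa. Qed.
Let Va' : V a^-1. Proof. by have [] := nmaxPn Va nVa. Qed.

Lemma thickening_base : R `<=` W.
Proof. exact: (sum_setl mKR). Qed.

Lemma thickening_ideal : K `<=` W.
Proof. exact: (sum_setr (mod_subring sR)). Qed.

Lemma thickening_sub : W `<=` V.
Proof.
move=> _ [r [k [Rr Kk ->]]]; apply: subD => //; first exact: RV.
by case: (KnV Kk).
Qed.

Let KV := KnV.

Lemma thickening_subring : is_subring W.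
Proof.
have mW : is_mod R W by apply: sum_mod => //; exact: mod_subring.
split; first by apply: thickening_base; exact: sub1.
- by move=> b c Wb Wc; exact: (modB sR mW).
- move=> _ c [r [k [Rr Kk ->]]] Wc; rewrite mulrDl; apply: (modD mW).
    exact: (modM mW).
  apply: thickening_ideal; rewrite mulrC; apply: (modM mK) => //.
  exact: thickening_sub.
Qed.

Let sW := thickening_subring.

(** If [r] is a unit of [R] and [k] lies in [gV], then [r + k] is invertible in [V], and its inverse
    differs from [r^-1] by an element of [gV]; hence it is a unit of [W]. *)
Lemma thickening_nmax : nmax W = sum_set (nmax R) K.
Proof.
have mN : is_mod R (sum_set (nmax R) K) by exact: sum_mod.
apply/seteqP; split; last first.
  apply: idl_nmax => //.
    split; last first.
      move=> _ [r [k [[Rr _] Kk ->]]]; apply: subD => //; first exact: thickening_base.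
      exact: thickening_ideal.
    split; [exact: (mod0 mN)|by move=> *; exact: (modD mN)|].
    move=> _ x [r [k [Rr Kk ->]]] Nx; rewrite mulrDl; apply: (modD mN).
      exact: (modM mN).
    apply: (sum_setr mnR); rewrite mulrC; apply: (modM mK) => //.
    by case: Nx => r' [k' [[Rr' _] Kk' ->]]; apply: subD => //; [exact: RV|case: (KV Kk')].
  move=> [r [k [nr Kk E1]]]; have [Rr _] := nr.
  have nV1r : nmax V (1 - r) by rewrite E1 addrAC subrr add0r; exact: KV.
  apply: (nmax1 sR); rewrite -(subrK r 1); apply: (modD mnR) => //.
  have R1 : R (1 - r) by apply: subB => //; exact: sub1.
  apply: contrapT => n1; have [w0 Rw] := nmaxPn R1 n1.
  by case: nV1r => _ [/eqP|]; [rewrite (negbTE w0)|apply; exact: RV].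
move=> x [[r [k [Rr Kk xE]]] hx]; exists r, k; split=> //.
apply: contrapT => nr; have [r0 Rr'] := nmaxPn Rr nr.
have nk : nmax V (r^-1 * k) by apply: (modM mnV); [exact: RV|exact: KV].
have [||u0 Vu] := @nmaxPn _ V (1 + r^-1 * k).
- by apply: subD => //; [exact: sub1|case: nk].
- by move=> n1; apply: (nmax1 sV); rewrite -(addrK (r^-1 * k) 1); exact: (modB sV mnV).
have xr : x = r * (1 + r^-1 * k) by rewrite xE; field.
case: hx => [/eqP|]; first by rewrite xr mulf_eq0 (negbTE r0) (negbTE u0).
apply; exists r^-1, (- (r^-1 * (1 + r^-1 * k)^-1 * r^-1) * k); split=> //.
  apply: (modM mK) => //; apply: subN => //; apply: subM => //; last exact: RV.
  by apply: subM => //; exact: RV.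
have u1 : r + k != 0 by rewrite -xE xr mulf_neq0.
by rewrite xE; field; rewrite r0 u1.
Qed.

Lemma thickening_loc : is_loc W.
Proof.
split=> // x y; rewrite thickening_nmax.
exact: (modD (sum_mod mnR mKR)).
Qed.

Let dich Q : is_rprime R Q -> R `&` K `<=` Q -> Q `<=` nmax V \/ nmax R `<=` Q.
Proof.
move=> pQ KQ; apply: dichotomy => // b [Rb nb].
have [n hn] := nil_g nb; apply: (rprimeX sR pQ Rb (n := n)).
by apply: KQ; split=> //; exact: subX.
Qed.

Let K_divisible l : K `<=` scale_set (a ^+ l) W.
Proof.
move=> k Kk; exists (a^-1 ^+ l * k).
  by apply: thickening_ideal; apply: (modM mK) => //; exact: subX.
by rewrite exprVn mulVKf // expf_neq0.
Qed.

(** [R/I0] is [W/aW], because [a] is a unit of [V] and so [gV] is contained in [aW]. *)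
Let I0 := sum_set (scale_set a R) (R `&` K).
Let iI0 : is_idl R I0.
Proof.
have mS : is_mod R (scale_set a R) by apply: scale_mod; exact: mod_subring.
have mI : is_mod R (R `&` K) by apply: setI_mod => //; exact: mod_subring.
split; first exact: sum_mod.
by move=> _ [_ [k [[r Rr <-] [Rk _] ->]]]; apply: subD => //; exact: subM.
Qed.

Let max_over Q : is_rprime R Q -> I0 `<=` Q -> nmax R `<=` Q.
Proof.
have mS : is_mod R (scale_set a R) by apply: scale_mod; exact: mod_subring.
have mI : is_mod R (R `&` K) by apply: setI_mod => //; exact: mod_subring.
move=> pQ IQ; have [k|QV|//] := dich pQ.
  by move=> h; apply: IQ; exact: (sum_setr mS).
case: nVa; apply: QV; apply: IQ; apply: (sum_setl mI).
by exists 1; [exact: sub1|rewrite mulr1].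
Qed.

(** An ideal of [W] containing some [a ^+ l W] contains [gV] and is determined by its trace on [R],
    so the chain conditions descend from [R]. Powers of [a] serve as denominators because, by the
    dichotomy, every prime of [R] above a denominator ideal contains the maximal ideal. *)
Lemma thickening_curve_point : curve_point V a W.
Proof.
have mS : is_mod R (scale_set a R) by apply: scale_mod; exact: mod_subring.
have trace I : is_idl W I -> is_idl R (I `&` R).
  move=> [mI _]; split; last by move=> x [].
  apply: setI_mod; last exact: mod_subring.
  exact: (mod_sub thickening_base mI).
have untrace I I' l : scale_set (a ^+ l) W `<=` I' -> scale_set (a ^+ l) W `<=` I ->
    is_idl W I -> is_idl W I' -> I `&` R `<=` I' `&` R -> I `<=` I'.
  move=> aI' aI [mI IW] [mI' _] h x Ix; have [r [k [Rr Kk xE]]] := IW _ Ix.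
  have Ik := K_divisible l Kk; rewrite xE; apply: (modD mI'); last exact: aI'.
  have [] // : (I' `&` R) r.
  by apply: h; split=> //; rewrite -(addrK k r) -xE; apply: (modB sW mI) => //; exact: aI.
split.
- exact: thickening_loc.
- exact: thickening_sub.
- by rewrite thickening_nmax; apply: (sum_setl mKR).
- exact: a0.
- move=> x Vx; have [b [s [Rb Rs ns xE]]] := fracV Vx.
  have s0 : s != 0 by apply: contra_notN ns => /eqP ->; exact: (mod0 mnV).
  suff [n []] : exists n, [set r | R r /\ W (r * x)] (a ^+ n) by exists n.
  apply: (radical_power (R := R)) => //.
    split; last by move=> r [].
    split; first by split; [exact: sub0|rewrite mul0r; exact: sub0].
      by move=> r t [Rr h] [Rt h']; split; [exact: subD|rewrite mulrDl; exact: subD].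
    move=> t r Rt [Rr h]; split; first exact: subM.
    by rewrite -mulrA; apply: subM => //; exact: thickening_base.
  move=> Q pQ IQ; have [k|QV|] := dich pQ; last by apply.
    move=> [Rk Kk]; apply: IQ; split=> //; apply: thickening_ideal.
    by rewrite mulrC; exact: (modM mK).
  case: ns; apply: QV; apply: IQ; split=> //.
  by rewrite xE mulrC divfK //; exact: thickening_base.
- move=> x; rewrite thickening_nmax => -[b [k [nb Kk ->]]]; have [Rb _] := nb.
  have [n hn] := radical_power sR iI0 Rb (fun Q pQ IQ => max_over pQ IQ nb).
  exists n.
  have Kn m : K ((b + k) ^+ m - b ^+ m).
    elim: m => [|m IH]; first by rewrite !expr0 subrr; exact: (mod0 mK).
    have -> : (b + k) ^+ m.+1 - b ^+ m.+1 = (b + k) * ((b + k) ^+ m - b ^+ m) + b ^+ m * k.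
      by rewrite !exprS; ring.
    apply: (modD mK); apply: (modM mK) => //; last by apply: subX => //; exact: RV.
    by apply: subD => //; [exact: RV|case: (KV Kk)].
  have mA : is_mod W (scale_set a W) by apply: scale_mod; exact: mod_subring.
  rewrite -(subrK (b ^+ n) ((b + k) ^+ n)); apply: (modD mA).
    by have := @K_divisible 1%N _ (Kn n); rewrite expr1.
  have [_ [k' [[r Rr <-] [Rk' Kk'] ->]]] := hn; apply: (modD mA).
    by exists r => //; exact: thickening_base.
  by have := @K_divisible 1%N _ Kk'; rewrite expr1.
- move=> I iI aI Idec.
  have dR : rdcc R I0.
    apply: dcc_of_primes => // P Q pP IP iQ PQ Q1; apply: subset_trans (max_over pP IP).
    exact: idl_nmax.
  have [n|n|n|n hn] := dR (fun n => I n `&` R).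
  + exact: trace.
  + move=> _ [_ [k [[r Rr <-] [Rk Kk] ->]]]; have [mI _] := iI n; split.
      apply: (modD mI); first by apply: aI; exists r => //; exact: thickening_base.
      by apply: aI; have := @K_divisible 1%N _ Kk; rewrite expr1.
    by apply: subD => //; exact: subM.
  + by move=> x [Ix Rx]; split=> //; exact: Idec.
  exists n => m nm; apply: (@untrace _ _ 1%N); rewrite ?expr1 //; exact: hn.
- move=> l I iI aI Iinc.
  have nR' : forall K, _ := nR.
  have [n|n|n hn] := nR' (fun n => I n `&` R).
  + exact: trace.
  + by move=> x [Ix Rx]; split=> //; exact: Iinc.
  exists n => m nm; apply: (@untrace _ _ l) => //; exact: hn.
Qed.

End Thickening.

Section Residues.
Variables (F : fieldType) (A W : set F).
Hypotheses (lA : is_loc A) (lW : is_loc W) (AW : A `<=` W) (mAW : nmax A `<=` nmax W).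
Hypothesis root : forall p : {poly F}, polyR A p -> p \is monic -> (1 < size p)%N ->
  exists2 a, A a & nmax A p.[a].

Let sA : is_subring A. Proof. by case: lA. Qed.
Let sW : is_subring W. Proof. by case: lW. Qed.
Let mnW : is_mod W (nmax W). Proof. by case: (nmax_idl lW). Qed.

(** A root in [A] modulo the maximal ideal is split off. Either [b] is congruent to this root, or it
    is a root of the quotient, whose size is smaller. *)
Lemma residue_root b p : W b -> polyR A p -> p \is monic -> nmax W p.[b] ->
  exists2 a, A a & nmax W (b - a).
Proof.
move=> Wb; have [n] := ubnP (size p); elim: n p => // n IH p sp Ap mp np.
have [sp1|sp1] := leqP (size p) 1.
  have := size1_polyC sp1 => pE; move: mp np; rewrite pE monicE lead_coefC => /eqP ->.
  by rewrite hornerC => /(nmax1 sW).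
have [a Aa na] := root Ap mp sp1.
have [q [Aq [pE sq]]] := root_division sA Aa Ap.
have q0 : q != 0.
  apply: contraTneq sp1 => q0; rewrite pE q0 mul0r add0r -leqNgt; exact: size_polyC_leq1.
have mq : q \is monic.
  move: mp; rewrite !monicE pE lead_coefDl; last first.
    apply: (leq_ltn_trans (size_polyC_leq1 _)).
    by rewrite size_Mmonic ?monicXsubC // size_XsubC addn2 /= ltnS size_poly_gt0.
  by rewrite lead_coef_Mmonic ?monicXsubC.
have Wq : W q.[b] by exact: (horner_sub sW AW Wb Aq).
have nqb : nmax W (q.[b] * (b - a)).
  have -> : q.[b] * (b - a) = p.[b] - p.[a] by rewrite {1}pE !hornerE addrK.
  by apply: (modB sW mnW) => //; exact: mAW.
have [_ _ Wp] := nmax_rprime lW.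
have [||nq|nb] := Wp _ _ _ _ nqb => //; last by exists a.
  by apply: subB => //; exact: AW.
apply: (IH q) => //; rewrite (leq_ltn_trans sq) // -ltnS prednK //.
exact: ltn_trans sp1.
Qed.

(** Top coefficients in the maximal ideal are dropped until a unit leads; dividing by it reduces to
    [residue_root]. *)
Lemma residue_monic b n (c : nat -> F) : W b -> (forall i, A (c i)) ->
    nmax W (\sum_(i < n) c i * b ^+ i) -> (exists2 i, (i < n)%N & ~ nmax A (c i)) ->
  exists2 a, A a & nmax W (b - a).
Proof.
move=> Wb Ac; elim: n => [|n IH]; first by move=> _ [].
rewrite big_ord_recr /= => ns [i lti ni].
have [nc|nc] := pselect (nmax A (c n)).
  apply: IH.
    have -> : \sum_(i < n) c i * b ^+ i = \sum_(i < n) c i * b ^+ i + c n * b ^+ n - b ^+ n * c n.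
      by ring.
    by apply: (modB sW mnW) => //; apply: (modM mnW); [exact: subX|exact: mAW].
  exists i => //; move: lti; rewrite ltnS leq_eqVlt => /predU1P[ie|//].
  by rewrite ie in ni.
have [c0 Ac'] := nmaxPn (Ac n) nc.
have sz : (size (\poly_(i < n) (c i / c n)) < size ('X^n : {poly F}))%N.
  by rewrite size_polyXn ltnS size_poly.
apply: (@residue_root b ('X^n + \poly_(i < n) (c i / c n))) => //.
- apply: polyRD => //; first by apply: polyRX_n => //; exact: polyRX.
  by apply: polyR_poly => // j; exact: subM.
- by rewrite monicE lead_coefDl // lead_coefXn.
- rewrite !hornerE horner_poly.
  have -> : b ^+ n + \sum_(i < n) c i / c n * b ^+ i =
      (c n)^-1 * (\sum_(i < n) c i * b ^+ i + c n * b ^+ n).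
    rewrite mulrDr mulKf // addrC; congr (_ + _); rewrite mulr_sumr.
    by apply: eq_bigr => j _; ring.
  by apply: (modM mnW) => //; exact: AW.
Qed.

End Residues.

Section CechModel.
Variables (F : fieldType) (X : topologicalType) (O : X -> set F) (unif : X -> F).

(* 1-cocycles with values in O(-Y), written as t(x') - t(x) for a 0-cochain
   t of rational functions. *)
Definition TT (Y : X -> nat) : set (X -> F) := [set t |
  exists2 U : X -> set X, (forall x, open (U x) /\ U x x) &
    forall x x' y, U x y -> U x' y -> Jmod O unif Y y (t x' - t x)].

(** The coboundary of [t] equals that of local sections b exactly if [t - b] is a constant [c] of F.
    As every nonempty open set contains the generic point, [TT Y] modulo [BB Y] is H^1 of O(-Y). *)
Definition BB (Y : X -> nat) : set (X -> F) := [set t | exists c : F,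
  exists2 U : X -> set X, (forall x, open (U x) /\ U x x) &
    forall x y, U x y -> Jmod O unif Y y (t x - c)].

End CechModel.

(** * Multiplication by [g] is surjective on first cohomology *)

Section Surjectivity.
Variables (F : fieldType) (A : set F) (X : topologicalType) (O : X -> set F) (eta : X).
Variables (S : seq X) (unif : X -> F).
Hypothesis D : exceptional_data A O eta S unif.
Implicit Types (x w e p q y : X) (a b c g u v : F) (Y : X -> nat).

Let M : local_model A O eta. Proof. exact: ed_model D. Qed.
Let lA : is_loc A. Proof. exact: lm_A M. Qed.
Let sA : is_subring A. Proof. by case: lA. Qed.
Let lO x : is_loc (O x). Proof. exact: lm_loc M x. Qed.
Let sO x : is_subring (O x). Proof. by case: (lO x). Qed.
Let nO x : is_mod (O x) (nmax (O x)). Proof. by case: (nmax_idl (lO x)). Qed.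
Let AO x : A `<=` O x. Proof. exact: (lm_AO M). Qed.
Notation J Y x := (Jmod O unif Y x).
Notation I Y := (Iglob O unif Y).

Variable Z : X -> nat.
Hypotheses (cZ : cyc S Z) (gZ : ggen O unif Z) (pZ : exists e, Z e != 0%N).
Variable g : F.
Hypotheses (Ig : I Z g) (gS : forall e, e \in S -> generates O unif Z g e)
  (geta : generates O unif Z g eta).

Let bad x := ~ generates O unif Z g x.
Let Og x : O x g. Proof. exact: (Jmod_O D cZ (Ig x)). Qed.

Lemma section_neq0 : g != 0.
Proof.
apply/eqP => g0; have [z zP] := local_equations D.
have : J Z eta (local_gen S z Z eta).
  by rewrite (local_genP D zP _ cZ); exists 1; [exact: sub1|rewrite mulr1].
move=> /geta[b _]; rewrite g0 mul0r => /esym/eqP.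
by rewrite (negbTE (local_gen_neq0 D zP Z eta)).
Qed.

Let g0 := section_neq0.

Lemma Jmod_scale Y x : cyc S Y -> generates O unif Z g x ->
  J (fun x => Y x + Z x)%N x `<=` scale_set g (J Y x).
Proof.
move=> cY gx; have [z zP] := local_equations D.
have cYZ : cyc S (fun x => Y x + Z x)%N.
  by move=> e; rewrite addn_eq0 negb_and => /orP[/cY|/cZ].
rewrite (local_genP D zP _ cYZ) (local_genP D zP _ cY) (local_genD) => _ [b Ob <-].
have [|t Ot tE] := gx (local_gen S z Z x).
  by rewrite (local_genP D zP _ cZ); exists 1; [exact: sub1|rewrite mulr1].
exists (local_gen S z Y x * (t * b)); last by rewrite -tE; ring.
by exists (t * b) => //; exact: subM.
Qed.

Lemma Jmod_mul Y x b : cyc S Y -> J Y x b -> J (fun x => Y x + Z x)%N x (g * b).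
Proof.
move=> cY Jb; have [z zP] := local_equations D.
have cYZ : cyc S (fun x => Y x + Z x)%N.
  by move=> e; rewrite addn_eq0 negb_and => /orP[/cY|/cZ].
have := Ig x; rewrite (local_genP D zP _ cZ) => -[t Ot <-].
move: Jb; rewrite (local_genP D zP _ cYZ) (local_genP D zP _ cY) local_genD => -[s Os <-].
by exists (t * s); [exact: subM|ring].
Qed.

Lemma bad_gen x y : generizes y x -> bad y -> bad x.
Proof. by move=> gyx by_ gx; apply: by_; exact: (generates_gen D cZ gZ Ig gyx gx). Qed.

Section AtPoint.
Variable y : X.
Hypotheses (nEy : ~ exceptional A O y) (by_ : bad y).
Variable a : F.
Hypotheses (ma : nmax A a) (nya : ~ nmax (O y) a).

Let yeta : y <> eta. Proof. by move=> ye; apply: by_; rewrite ye. Qed.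

(** The points in which the closure of the bad curve [y] meets the exceptional fibre. Being bad
    themselves, they are closed and finite in number. *)
Definition over p := exceptional A O p /\ generizes y p.

Lemma over_bad p : over p -> bad p.
Proof. by move=> [_ gyp]; exact: bad_gen gyp by_. Qed.

Lemma over_closed p w : over p -> generizes p w -> w = p.
Proof. by move=> op; case: (op) => Ep _; apply: (bad_closed D cZ gZ pZ gS _ Ep); exact: over_bad. Qed.

Let ng : nmax (O y) g.
Proof.
apply: contrapT => ng; have [_ Og'] := nmaxPn (Og y) ng; apply: by_ => b Jb.
exists (g^-1 * b); last by rewrite mulVKf.
by apply: subM => //; exact: (Jmod_O D cZ Jb).
Qed.

Let nilg b : nmax (O y) b -> exists n, scale_set g (O y) (b ^+ n).
Proof. exact: (curve_nilpotent M nEy (Og y) g0). Qed.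

Let frac p c : generizes y p -> O y c ->
  exists b s, [/\ O p b, O p s, ~ nmax (O y) s & c = b / s].
Proof. exact: (lm_genloc M). Qed.

(** The prime [Q] belongs to a point between [y] and [p]. If exceptional, this point is closed and
    equals [p]; if not, it equals [y] by [nonexc_trace]. *)
Let dich p (Q : set F) : over p -> is_rprime (O p) Q -> O p `&` nmax (O y) `<=` Q ->
  Q `<=` nmax (O y) \/ nmax (O p) `<=` Q.
Proof.
move=> op pQ yQ; have [Ep gyp] := op; have [w gwp QE] := lm_prime M pQ.
have gyw : generizes y w.
  by apply: (lm_gencmp M gyp gwp) => c /yQ; rewrite QE => -[].
have [Ew|nEw] := pselect (exceptional A O w).
  right; have ow : over w by [].
  have pw : p = w by exact: (over_closed ow gwp).
  by rewrite QE -pw => c nc; split=> //; case: nc.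
by left; rewrite QE (nonexc_trace M nEw gyw yeta) => c [].
Qed.

Let W p := thickening (O y) (O p) g.

Let curveW p : over p -> curve_point (O y) a (W p) /\
  nmax (W p) = sum_set (nmax (O p)) (scale_set g (O y)).
Proof.
move=> op; have [Ep gyp] := op; have pOy : O p `<=` O y by move=> c; exact: (lm_gen M gyp).
split; last exact: thickening_nmax.
apply: thickening_curve_point => //.
- exact: (lm_Onoeth M).
- by move=> c; exact: frac.
- exact: Ep.
- by move=> Q; exact: dich.
Qed.

Let traceP : is_rprime A (A `&` nmax (O y)). Proof. exact: (A_trace_prime M). Qed.

(** [A] itself is thickened along [y]: it serves as the base ring over which the residues at the
    points [p] are shown to be algebraic. *)
Let curveA : curve_point (O y) a (thickening (O y) A g) /\
  nmax (thickening (O y) A g) = sum_set (nmax A) (scale_set g (O y)).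
Proof.
have AOy : A `<=` O y by exact: AO.
split; last exact: thickening_nmax.
apply: thickening_curve_point => //.
- exact: (lm_noeth M).
- move=> c Oc; have [b [s [Ab As ns ->]]] : locz A (A `&` nmax (O y)) c.
    by rewrite -(height_one_stalk M nEy yeta).
  by exists b, s; split=> // ns'; apply: ns.
- move=> Q pQ yQ; have [QP|QP] := pselect (Q `<=` A `&` nmax (O y)).
    by left=> c /QP[].
  right; apply: (lm_dim M traceP pQ yQ _ QP).
  have [b [s [Ab As s0 gE]]] := lm_frac M g; exists b; last first.
    by apply: contraNneq g0 => b0; rewrite gE b0 mul0r.
  split=> //; have -> : b = s * g by rewrite gE; field.
  by apply: (modM (nO y)) => //; exact: AOy.
Qed.

(** Krull-Akizuki over the thickening of [A] gives a polynomial relation for [b] with nonzero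
    reduction. Its coefficients can be moved into [A] modulo [g], and an algebraically closed
    residue field admits no new algebraic residues. *)
Let residue p b : over p -> O p b -> exists2 c, A c & nmax (W p) (b - c).
Proof.
move=> op Ob; have [Ep gyp] := op; have [cW nW] := curveW op; have [cB nB] := curveA.
have pOy : O p `<=` O y by move=> c; exact: (lm_gen M gyp).
have AOy : A `<=` O y by exact: AO.
have sB : is_subring (thickening (O y) A g) by case: (cp_loc cB).
have nKW : scale_set g (O y) `<=` nmax (W p).
  by rewrite nW; apply: (sum_setr (nO p)).
have mW : is_mod (W p) (nmax (W p)) by case: (nmax_idl (cp_loc cW)).
have sW : is_subring (W p) by case: (cp_loc cW).
have OW : O p `<=` W p by exact: thickening_base.
have Ba : thickening (O y) A g a by case: (cp_a cB).
have [|G [hG G0 [i ni]]] := @krull_akizuki_poly _ _ a b _ sB Ba (cp_a0 cB)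
    (nmax_idl (cp_loc cB)) (cp_a cB) (nmax1 sB) (cp_dcc cB) (cp_acc cB).
  by move=> m; apply: (cp_den cB); apply: subX => //; exact: pOy.
have /choice[c cP] j : exists c, A c /\ scale_set g (O y) (G`_j - c).
  by have [c [k [Ac Kk ->]]] := hG j; exists c; split=> //; rewrite addrAC subrr add0r.
have mK : is_mod (O y) (scale_set g (O y)) by apply: scale_mod; exact: mod_subring.
apply: (@residue_monic _ A (W p) lA (cp_loc cW) _ _ (lm_root M) b (size G) c).
- by move=> d Ad; apply: OW; exact: AO.
- by move=> d md; rewrite nW; apply: (sum_setl (mod_sub pOy mK)); exact: Ep.
- exact: OW.
- by move=> j; case: (cP j).
- have -> : \sum_(j < size G) c j * b ^+ j = G.[b] - \sum_(j < size G) (G`_j - c j) * b ^+ j.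
    by rewrite horner_coef -sumrB; apply: eq_bigr => j _; ring.
  rewrite G0 sub0r; apply: (modN sW mW); apply: (mod_sum _ mW) => j _.
  rewrite mulrC; apply: (modM mW); last by apply: nKW; case: (cP j).
  by apply: subX => //; exact: OW.
- exists i; last first.
    move=> nc; apply: ni; rewrite nB; exists (c i), (G`_i - c i); split=> //.
      by case: (cP i).
    by rewrite addrC subrK.
  rewrite ltnNge; apply: contra_notN ni => /(nth_default 0) ->.
  by have [mB _] := nmax_idl (cp_loc cB); exact: (mod0 mB).
Qed.

(** In the relation supplied by [lm_sep], each [al k] is diminished by its residue [c k] in [A], or
    by 0 if it already vanishes at [p]. All first factors then vanish at [p], while the subtracted
    sum [nu] vanishes at [p']; division by [1 - nu] restores the shape required by [separate]. *)
Let separated p p' : over p -> over p' -> p <> p' ->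
  separated_from (O y) a (W p) (W p').
Proof.
move=> op op' ne; have [Ep gyp] := op; have [Ep' gyp'] := op'.
have [cW nW] := curveW op; have [cW' nW'] := curveW op'.
have [kk [Ak hk]] := lm_units M.
have [n [al [be [Oal Obe hab nsum]]]] := lm_sep M gyp gyp' ne.
have pOy : O p `<=` O y by move=> c; exact: (lm_gen M gyp).
have pOy' : O p' `<=` O y by move=> c; exact: (lm_gen M gyp').
have mK : is_mod (O y) (scale_set g (O y)) by apply: scale_mod; exact: mod_subring.
have AW q : over q -> A `<=` W q.
  move=> [_ gq] c Ac; apply: thickening_base; [exact: lO| |exact: AO].
  by move=> d; exact: (lm_gen M gq).
have kW q i j : over q -> i != j -> ~ nmax (W q) (kk i - kk j).
  move=> oq ij; have [u0 Au] := nmaxPn (subB sA (Ak i) (Ak j)) (hk i j ij).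
  by move=> [_ [/eqP|]]; [rewrite (negbTE u0)|apply; exact: (AW q oq)].
have /choice[c cP] k : exists c, [/\ A c, nmax (W p) (al k - c) & nmax (O p') (c * be k)].
  have [nk|nk] := pselect (nmax (O p) (al k)).
    exists 0; split; [exact: sub0| |by rewrite mul0r; exact: (mod0 (nO p'))].
    by rewrite subr0 nW; exact: (sum_setl (mod_sub pOy mK)).
  have [//|nbe] := hab k; have [c Ac nc] := residue op (Oal k).
  by exists c; split=> //; apply: (modM (nO p')) => //; exact: AO.
pose nu := \sum_(k < n) c k * be k; pose tau := \sum_(k < n) al k * be k - 1.
have nnu : nmax (O p') nu by apply: (mod_sum _ (nO p')) => k _; case: (cP k).
have [||u0 Ou] := @nmaxPn _ (O p') (1 - nu).
- by apply: subB => //; [exact: sub1|case: nnu].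
- by move=> n1; apply: (nmax1 (sO p')); rewrite -(subrK nu 1); exact: (modD (nO p')).
pose th := - (1 - nu)^-1 * tau.
have nth_ : nmax (O y) th by apply: (modM (nO y)) => //; apply: subN => //; exact: pOy'.
have [N hN] := nilg nth_.
apply: (@separate _ (O y) a kk A (lO y) sA Ak (W p) (W p') n (fun k => al k - c k)
   (fun k => be k / (1 - nu)) th N).
- by split=> // [|i j]; [exact: AW|exact: kW].
- by split=> // [|i j]; [exact: AW|exact: kW].
- by move=> k _; case: (cP k).
- by move=> k; apply: thickening_base => //; exact: subM.
- by [].
- rewrite /th /tau; have -> : \sum_(k < n) (al k - c k) * (be k / (1 - nu)) =
      (1 - nu)^-1 * (\sum_(k < n) al k * be k - nu).
    rewrite /nu -sumrB mulr_sumr; apply: eq_bigr => k _; ring.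
  by field.
- by rewrite nW'; exact: (sum_setr (nO p')).
Qed.

Lemma exc_power YY : cyc S YY -> exists N, forall x, J YY x (a ^+ N).
Proof.
move=> cYY; exists (\max_(e <- S) YY e) => x; have [Aa _] := ma.
apply/(Jmod_char D _ _ cYY); split=> [|e eS gex]; first by apply: subX => //; exact: AO.
have : nmax (O e) a by exact: (ed_exc D eS).
rewrite (ed_unif D eS) => -[t Ot tE].
have le : (YY e <= \max_(e <- S) YY e)%N by exact: leq_bigmax_seq.
exists (unif e ^+ (\max_(e <- S) YY e - YY e) * t ^+ \max_(e <- S) YY e).
  apply: subM => //; apply: subX => //; have [//] : nmax (O e) (unif e).
  by rewrite (ed_unif D eS); exists 1; [exact: sub1|rewrite mulr1].
by rewrite mulrA -exprD subnKC // -exprMn tE.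
Qed.

Let trace_nsub y' p : ~ exceptional A O y' -> bad y' -> generizes y' p -> generizes y p ->
  y' <> y -> exists2 t, O p t & nmax (O y') t /\ ~ nmax (O y) t.
Proof.
move=> nE b' g' gy ne; apply: contrapT => h; apply: ne.
apply: (nonexc_trace M nEy); last by move=> ye; apply: b'; rewrite ye.
apply: (lm_gencmp M g' gy) => t [Ot nt]; apply: contrapT => nty.
by apply: h; exists t.
Qed.

(* a^n belongs to F_p + g O_y, where F_p consists of the elements of J_p
   congruent to 0 modulo g at the points ys. *)
Let correction YY (ys : seq X) p : cyc S YY ->
    (forall y', y' \in ys -> ~ exceptional A O y' /\ bad y') -> y \notin ys -> over p ->
  exists n, sum_set [set d | J YY p d /\ forall y', y' \in ys -> generizes y' p ->
    scale_set g (O y') d] (scale_set g (O y)) (a ^+ n).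
Proof.
move=> cYY hys yys op; have [Ep gyp] := op; set Fp := [set d | _].
have mS x : is_mod (O x) (scale_set g (O x)) by apply: scale_mod; exact: mod_subring.
have pO y' : generizes y' p -> O p `<=` O y' by move=> g' c; exact: (lm_gen M g').
have mF : is_mod (O p) Fp.
  have mJ := Jmod_mod D p cYY; split.
  - by split=> [|y' _ _]; [exact: (mod0 mJ)|exact: (mod0 (mS y'))].
  - move=> c d [Jc hc] [Jd hd]; split=> [|y' ys' g']; first exact: (modD mJ).
    by apply: (modD (mS y')); [exact: hc|exact: hd].
  - move=> r c Or [Jc hc]; split=> [|y' ys' g']; first exact: (modM mJ).
    by apply: (modM (mS y')); [exact: (pO y' g')|exact: hc].
(* An element of [Fp] not vanishing along [y]: a power of [a], multiplied for each other curve of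
   [ys] through [p] by a power of a function that vanishes along it but not along [y]. *)
have [d Fd nd] : exists2 d, Fp d & ~ nmax (O y) d.
  have [N hN] := exc_power cYY.
  suff H (s : seq X) : {subset s <= ys} -> exists2 d, (J YY p d /\
      forall y', y' \in s -> generizes y' p -> scale_set g (O y') d) & ~ nmax (O y) d.
    by exact: (H ys).
  elim: s => [|y' s IH] sub.
    exists (a ^+ N); first by split.
    have Oya : O y a by apply: AO; case: ma.
    by move=> /(rprimeX (sO y) (nmax_rprime (lO y)) Oya).
  have [|d [Jd hd] nd] := IH; first by move=> w ws; apply: sub; rewrite inE ws orbT.
  have [g'|ng'] := pselect (generizes y' p); last first.
    by exists d => //; split=> // w; rewrite inE => /predU1P[->//|]; exact: hd.
  have y's : y' \in ys by apply: sub; exact: mem_head.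
  have [nE b'] := hys y' y's.
  have [|t Ot [nt nty]] := trace_nsub nE b' g' gyp.
    by move=> yy; rewrite -yy y's in yys.
  have [n hn] := curve_nilpotent M nE (Og y') g0 nt.
  have Od : O p d by exact: (Jmod_O D cYY Jd).
  exists (t ^+ n * d).
    split; first by apply: (modM (Jmod_mod D p cYY)) => //; exact: subX.
    move=> w; rewrite inE => /predU1P[->|ws] gw.
      by rewrite mulrC; apply: (modM (mS y')) => //; exact: (pO _ g').
    by apply: (modM (mS w)); [apply: subX => //; exact: (pO _ gw)|exact: hd].
  have [_ _ pr] := nmax_rprime (lO y).
  have Oyt : O y t by exact: (pO _ gyp).
  move=> /(pr _ _ (subX n (sO y) Oyt) (pO _ gyp _ Od))[] //.
  by move=> /(rprimeX (sO y) (nmax_rprime (lO y)) Oyt).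
pose II := sum_set Fp (scale_set g (O y) `&` O p).
have mK : is_mod (O p) (scale_set g (O y) `&` O p).
  apply: setI_mod; last exact: mod_subring.
  by apply: mod_sub (mS y); exact: pO.
have FO : Fp `<=` O p by move=> c [Jc _]; exact: (Jmod_O D cYY Jc).
have iI : is_idl (O p) II.
  split; first exact: sum_mod.
  by move=> _ [c [k [/FO Oc [_ Ok] ->]]]; exact: subD.
have Opa : O p a by apply: AO; case: ma.
(* By the dichotomy a prime above [II] either vanishes along [y], which [d] excludes, or contains
   the maximal ideal at [p] and with it [a]. *)
have [Q pQ IQ|n hn] := radical_power (sO p) iI Opa; last first.
  by exists n; have [c [k [Fc [Kk _] ->]]] := hn; exists c, k.
have [c [Oc nc]|QV|nQ] := dich op pQ.
- have [n [e' Oe' eE]] := nilg nc; apply: (rprimeX (sO p) pQ Oc (n := n)).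
  apply: IQ; apply: (sum_setr mF); split; last exact: subX.
  by exists e'.
- by case: nd; apply: QV; apply: IQ; exact: (sum_setl mK).
- by apply: nQ; exact: Ep.
Qed.

(** With a partition of unity on the points of the curve, the average [c] of the values [T p]
    differs from each of them by a high power of [a] times an element of the thickened local ring,
    and [correction] turns this power into an admissible section modulo [g]. The corrections vanish
    modulo [g] along the curves of [ys], which are already settled. *)
Lemma level_step YY (ys : seq X) (T : X -> F) : cyc S YY ->
    (forall y', y' \in ys -> ~ exceptional A O y' /\ bad y') -> y \notin ys ->
    (forall p q, over p -> over q -> O y (T p - T q)) ->
  exists d : X -> F, (forall p, over p -> J YY p (d p) /\
      forall y', y' \in ys -> generizes y' p -> scale_set g (O y') (d p)) /\
    forall p q, over p -> over q -> scale_set g (O y) ((T p - d p) - (T q - d q)).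
Proof.
move=> cYY hys yys hT.
have mS x : is_mod (O x) (scale_set g (O x)) by apply: scale_mod; exact: mod_subring.
have [s hs] := bad_finite D cZ gZ pZ Ig gS geta.
pose ps := undup [seq p <- s | `[< over p >]].
have inps p : over p -> p \in ps.
  by move=> op; rewrite mem_undup mem_filter hs ?andbT; [exact/asboolP|exact: over_bad].
have psin p : p \in ps -> over p by rewrite mem_undup mem_filter => /andP[/asboolP].
have [n0|n0] := posnP (size ps).
  by exists (fun=> 0); split=> p => [|q] /inps; move/size0nil: n0 => ->.
pose P i := nth y ps i.
have oP i : (i < size ps)%N -> over (P i) by move=> lt; apply: psin; exact: mem_nth.
have Opy p : over p -> O p `<=` O y by move=> [_ gyp] c; exact: (lm_gen M gyp).
have [kk [Ak hk]] := lm_units M.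
have AW q : over q -> A `<=` W q.
  by move=> oq c Ac; apply: thickening_base; [exact: lO|exact: Opy|exact: AO].
have kW q i j : over q -> i != j -> ~ nmax (W q) (kk i - kk j).
  move=> oq ij; have [u0 Au] := nmaxPn (subB sA (Ak i) (Ak j)) (hk i j ij).
  by move=> [_ [/eqP|]]; [rewrite (negbTE u0)|apply; exact: (AW q oq)].
have cW i : (i < size ps)%N -> curve_point (O y) a (W (P i)).
  by move=> lt; case: (curveW (oP i lt)).
have [|L hL] := @common_den _ (O y) a (size ps) (fun i => W (P i)) (size ps)
    (fun i => T (P i) - T (P 0%N)) cW.
  by move=> i lt; apply: hT; exact: oP.
have Opa p : O p a by apply: AO; case: ma.
pose Fp p := [set d | J YY p d /\ forall y', y' \in ys -> generizes y' p ->
    scale_set g (O y') d].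
have mN p : over p -> is_mod (O p) (sum_set (Fp p) (scale_set g (O y))).
  move=> op; apply: sum_mod; last exact: (mod_sub (Opy p op) (mS y)).
  have mJ := Jmod_mod D p cYY; split.
  - by split=> [|y' _ _]; [exact: (mod0 mJ)|exact: (mod0 (mS y'))].
  - move=> c d [Jc hc] [Jd hd]; split=> [|y' ys' g']; first exact: (modD mJ).
    by apply: (modD (mS y')); [exact: hc|exact: hd].
  - move=> r c Or [Jc hc]; split=> [|y' ys' g']; first exact: (modM mJ).
    by apply: (modM (mS y')); [exact: (lm_gen M g')|exact: hc].
have mF0 p : Fp p 0.
  by split=> [|y' _ _]; [exact: (mod0 (Jmod_mod D p cYY))|exact: (mod0 (mS y'))].
have [N hN] : exists N, forall i, (i < size ps)%N ->
    sum_set (Fp (P i)) (scale_set g (O y)) (a ^+ N).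
  suff H k : (k <= size ps)%N -> exists N, forall i, (i < k)%N ->
      sum_set (Fp (P i)) (scale_set g (O y)) (a ^+ N) by exact: H.
  elim: k => [|k IH] lek; first by exists 0%N.
  have [N hN] := IH (ltnW lek); have [N' hN'] := correction cYY hys yys (oP k lek).
  exists (N + N')%N => i; rewrite ltnS leq_eqVlt exprD => /predU1P[->|lt].
    by apply: (modM (mN _ (oP k lek))) => //; exact: subX.
  rewrite mulrC; apply: (modM (mN _ (oP i (leq_trans lt (ltnW lek))))); last exact: hN.
  exact: subX.
have ptW i : (i < size ps)%N -> [/\ curve_point (O y) a (W (P i)), A `<=` W (P i) &
    forall j j', j != j' -> ~ nmax (W (P i)) (kk j - kk j')].
  move=> lti; split; [exact: cW|exact: (AW _ (oP i lti))|].
  by move=> j j'; exact: (kW _ _ _ (oP i lti)).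
have sepW i j : (i < size ps)%N -> (j < size ps)%N -> i != j ->
    separated_from (O y) a (W (P i)) (W (P j)).
  move=> lti ltj ij; apply: separated; [exact: oP|exact: oP|] => /eqP.
  by rewrite nth_uniq ?undup_uniq // (negbTE ij).
(* [a ^+ L] brings the differences of the [T (P i)] into the thickened local rings; [a ^+ N] is a
   correction plus a multiple of [g]. *)
have [e [e1 Oe eW]] := partition_of_unity (lO y) sA Ak n0 ptW sepW (N + L)%N.
pose c := \sum_(j < size ps) e j * T (P j).
have key i : (i < size ps)%N -> sum_set (Fp (P i)) (scale_set g (O y)) (T (P i) - c).
  move=> lti; have oi := oP i lti; have mNi := mN _ oi.
  have -> : T (P i) - c = \sum_(j < size ps) e j * (T (P i) - T (P j)).
    rewrite (eq_bigr (fun j : 'I_(size ps) => e j * T (P i) - e j * T (P j))).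
      by rewrite sumrB -mulr_suml e1 mul1r.
    by move=> j _; rewrite mulrBr.
  apply: (mod_sum _ mNi) => j _; have [->|ij] := eqVneq (j : nat) i.
    by rewrite subrr mulr0; exact: (mod0 mNi).
  have [w Ww <-] := eW j i (ltn_ord j) lti ij.
  have sW : is_subring (W (P i)) by case: (cp_loc (cW i lti)).
  have : W (P i) (w * (a ^+ L * (T (P i) - T (P j)))).
    apply: subM => //.
    have -> : a ^+ L * (T (P i) - T (P j)) =
        a ^+ L * (T (P i) - T (P 0%N)) - a ^+ L * (T (P j) - T (P 0%N)) by ring.
    by apply: subB => //; apply: hL.
  move=> [r [k [Or Kk E]]].
  have -> : a ^+ (N + L) * w * (T (P i) - T (P j)) = r * a ^+ N + k * a ^+ N.
    by rewrite -mulrDl -E exprD; ring.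
  apply: (modD mNi); first by apply: (modM mNi) => //; exact: hN.
  exists 0, (k * a ^+ N); split=> //; last by rewrite add0r.
  by rewrite mulrC; apply: (modM (mS y)) => //; apply: subX => //; exact: (Opy _ oi).
have /choice[d dP] p : exists d, over p -> Fp p d /\ scale_set g (O y) (T p - c - d).
  have [op|] := pselect (over p); last by exists 0.
  have lti : (index p ps < size ps)%N by rewrite index_mem inps.
  have [d [k [Fd Kk E]]] := key _ lti; rewrite /P nth_index ?inps // in Fd E.
  by exists d => _; split=> //; rewrite E addrAC subrr add0r.
exists d; split; first by move=> p /dP[].
move=> p q /dP[_ hp] /dP[_ hq].
have -> : T p - d p - (T q - d q) = (T p - c - d p) - (T q - c - d q) by ring.
exact: (modB (sO y) (mS y)).
Qed.

End AtPoint.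
(** Induction over the bad curves. The corrections made for a new curve are multiples of [g] along
    the earlier ones and preserve what was achieved there. *)
Lemma adjust YY (T : X -> F) (ys : seq X) : cyc S YY -> TT O unif YY T -> uniq ys ->
    (forall y, y \in ys -> ~ exceptional A O y /\ bad y) ->
  exists b : X -> F, (forall p, exceptional A O p -> bad p -> J YY p (b p)) /\
    forall y, y \in ys -> forall p q, over y p -> over y q ->
      scale_set g (O y) ((T p - b p) - (T q - b q)).
Proof.
move=> cYY [U hU hT]; have J0 x : J YY x 0 by exact: (mod0 (Jmod_mod D x cYY)).
elim: ys => [|y ys IH] /=; first by exists (fun=> 0).
move=> /andP[yys uys] hys; have [|b [Jb hb]] := IH uys.
  by move=> w ws; apply: hys; rewrite inE ws orbT.
have [nEy by_] := hys y (mem_head _ _).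
have [a ma nya] : exists2 a, nmax A a & ~ nmax (O y) a.
  apply: contrapT => h; apply: nEy => a ma; apply: contrapT => na; apply: h.
  by exists a.
have Jy p : over y p -> O y (b p).
  move=> op; have [Ep gyp] := op.
  by apply: (lm_gen M gyp); apply: (Jmod_O D cYY); apply: Jb => //; exact: (over_bad by_ op).
have [||d [hd1 hd2]] := @level_step y nEy by_ a ma nya YY ys (fun p => T p - b p) cYY _ yys.
- by move=> w ws; apply: hys; rewrite inE ws orbT.
- move=> p q op oq; have [_ gp] := op; have [_ gq] := oq.
  have -> : T p - b p - (T q - b q) = (T p - T q) - (b p - b q) by ring.
  apply: subB => //; last by apply: subB => //; exact: Jy.
  have [oUp Up] := hU p; have [oUq Uq] := hU q.
  by apply: (Jmod_O D cYY); apply: hT; [exact: gq|exact: gp].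
exists (fun p => if `[< over y p >] then b p + d p else b p); split.
  move=> p Ep bp; case: asboolP => [op|_]; last exact: Jb.
  by apply: (modD (Jmod_mod D p cYY)); [exact: Jb|case: (hd1 p op)].
move=> w; rewrite inE => /predU1P[->|ws] p q op oq.
  case: asboolP => // _; case: asboolP => // _.
  have -> : T p - (b p + d p) - (T q - (b q + d q)) =
      T p - b p - d p - (T q - b q - d q) by ring.
  exact: hd2.
have mS : is_mod (O w) (scale_set g (O w)) by apply: scale_mod; exact: mod_subring.
have key r : over w r -> exists2 e, scale_set g (O w) e &
    (if `[< over y r >] then b r + d r else b r) = b r + e.
  move=> or; case: asboolP => [oy|_]; last by exists 0; rewrite ?addr0 //; exact: (mod0 mS).
  by exists (d r) => //; have [_ h] := hd1 r oy; apply: h => //; case: or.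
have [ep Kp ->] := key p op; have [eq Kq ->] := key q oq.
have -> : T p - (b p + ep) - (T q - (b q + eq)) =
    T p - b p - (T q - b q) - (ep - eq) by ring.
by apply: (modB (sO w) mS); [exact: hb|exact: (modB (sO w) mS)].
Qed.

(** The cochain [T] is divided by [g] after subtracting local sections [b'], chosen so that at every
    bad point the difference is independent of the chart modulo [g] times the stalk of O(-Y). At the
    other points divisibility by [g] is automatic by [Jmod_scale]. *)
Lemma H1_surjective Y (T : X -> F) : cyc S Y -> TT O unif (fun x => Y x + Z x)%N T ->
  exists2 t, TT O unif Y t & exists2 U, (forall x, open (U x) /\ U x x) &
    forall x y, U x y -> J (fun x => Y x + Z x)%N y (T x - g * t x).
Proof.
move=> cY TT_T; set YY := (fun x => Y x + Z x)%N in TT_T *.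
have cYY : cyc S YY.
  by move=> e; rewrite addn_eq0 negb_and => /orP[/cY|/cZ].
have [U hU hT] := TT_T; have [s hs] := bad_finite D cZ gZ pZ Ig gS geta.
pose ys := undup [seq y <- s | `[< ~ exceptional A O y /\ bad y >]].
have [|b [Jb hb]] := adjust cYY TT_T (undup_uniq [seq y <- s | `[< ~ exceptional A O y /\ bad y >]]).
  by move=> y; rewrite mem_undup mem_filter => /andP[/asboolP].
have {}hb y : ~ exceptional A O y -> bad y -> forall p q, over y p -> over y q ->
    scale_set g (O y) ((T p - b p) - (T q - b q)).
  move=> nE by_; apply: hb; rewrite mem_undup mem_filter hs // andbT.
  exact/asboolP.
have J0 x : J YY x 0 by exact: (mod0 (Jmod_mod D x cYY)).
have Jx x : is_mod (O x) (J YY x) by exact: (Jmod_mod D x cYY).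
(* At a good point 0 serves, at a bad exceptional point the value found by [adjust]. On a bad curve
   the section is defined through an exceptional point [q] in its closure, so that [T x - b' x]
   becomes [T q - b q]. *)
have /choice[b' b'P] x : exists c, J YY x c /\
    forall y, bad y -> generizes y x -> forall p, over y p \/ (exceptional A O y /\ p = y) ->
    scale_set g (J Y y) ((T x - c) - (T p - b p)).
  have [bx|gx] := pselect (bad x); last first.
    by exists 0; split=> // y by_ gyx; case: gx; exact: (bad_gen gyx by_).
  have mJ y : is_mod (O y) (scale_set g (J Y y)) by apply: scale_mod; exact: (Jmod_mod D y cY).
  have nonexcJ y : ~ exceptional A O y -> scale_set g (J Y y) = scale_set g (O y).
    by move=> nE; rewrite (Jmod_nonexc D cY nE).
  have [Ex|nEx] := pselect (exceptional A O x).
    exists (b x); split=> [|y by_ gyx p]; first exact: Jb.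
    have [Ey|nEy] := pselect (exceptional A O y).
      have yx : x = y by exact: (bad_closed D cZ gZ pZ gS by_ Ey gyx).
      case=> [[Ep gyp]|[_ ->]]; last by rewrite yx subrr; exact: (mod0 (mJ y)).
      have -> : p = y by exact: (bad_closed D cZ gZ pZ gS by_ Ey gyp).
      by rewrite yx subrr; exact: (mod0 (mJ y)).
    by move=> [op|[/nEy//]]; rewrite nonexcJ //; apply: hb.
  have [q oq] : exists q, over x q.
    have cl : closed [set w | generizes x w].
      rewrite -openC; apply: open_from_nbhds => w /= /existsNP[V /not_implyP[oV /not_implyP[Vw nV]]].
      by exists V; split=> // w' Vw' /= /(_ V oV Vw').
    have [|q gq Eq] := lm_meet M cl; first by exists x; exact: gen_refl.
    by exists q.
  have [_ gxq] := oq.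
  have xeta : x <> eta by move=> xe; apply: bx; rewrite xe.
  exists (T x - (T q - b q)); split.
    have -> : T x - (T q - b q) = (T x - T q) + b q by ring.
    have [oUx Ux] := hU x; have [oUq Uq] := hU q.
    apply: (modD (Jx x)); first by apply: hT => //; exact: gxq.
    by apply: (Jmod_gen gxq); apply: Jb; [case: oq|exact: (bad_gen gxq)].
  move=> y by_ gyx.
  have yeta : y <> eta by move=> ye; apply: by_; rewrite ye.
  have -> : y = x by exact: (nonexc_trace M nEx gyx yeta).
  move=> p [op|[/nEx//]]; rewrite subKr nonexcJ //.
  exact: hb.
(* The bad points being finite in number, the neighbourhood of [x] can be shrunk until the only bad
   points in it are generizations of [x]. *)
have /choice[V VP] x : exists V, [/\ open V, V x, forall y, V y -> J YY y (b' x) &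
    forall y, bad y -> V y -> generizes y x].
  have [V [oV Vx hV]] := Jmod_open (b'P x).1; have [V' [oV' Vx' hV']] := open_avoiding s x.
  exists (V `&` V'); split=> // [|y [/hV//]|y /hs ys' [_ Vy]]; [exact: openI|exact: hV'].
pose U' x := U x `&` V x.
have cU' x : open (U' x) /\ U' x x.
  by have [oU Ux] := hU x; have [oV Vx _ _] := VP x; split=> //; exact: openI.
have g0' : g != 0 by exact: section_neq0.
exists (fun x => g^-1 * (T x - b' x)); last first.
  exists U' => // x y [_ Vy]; rewrite mulVKf // subKr.
  by have [_ _ h _] := VP x; exact: h.
exists U' => // x x' y [Uy Vy] [Uy' Vy'].
have [_ _ hx gx] := VP x; have [_ _ hx' gx'] := VP x'.
suff : scale_set g (J Y y) ((T x' - b' x') - (T x - b' x)).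
  by move=> [c Jc cE]; rewrite -mulrBr -cE mulKf.
have [by_|gy] := pselect (bad y); last first.
  apply: (Jmod_scale cY); first exact: contrapT.
  have -> : T x' - b' x' - (T x - b' x) = (T x' - T x) - (b' x' - b' x) by ring.
  apply: (modB (sO y) (Jx y)); first exact: hT.
  by apply: (modB (sO y) (Jx y)); [exact: hx'|exact: hx].
have mJ : is_mod (O y) (scale_set g (J Y y)) by apply: scale_mod; exact: (Jmod_mod D y cY).
(* A common reference point for both charts: [y] itself if it is exceptional, otherwise an
   exceptional point in its closure. *)
have [p hp] : exists p, over y p \/ (exceptional A O y /\ p = y).
  have [Ey|nEy] := pselect (exceptional A O y); first by exists y; right.
  have cl : closed [set w | generizes y w].
    rewrite -openC; apply: open_from_nbhds => w /= /existsNP[W /not_implyP[oW /not_implyP[Ww nW]]].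
    by exists W; split=> // w' Ww' /= /(_ W oW Ww').
  have [|q gq Eq] := lm_meet M cl; first by exists y; exact: gen_refl.
  by exists q; left.
have h1 := (b'P x).2 y by_ (gx y by_ Vy) p hp; have h2 := (b'P x').2 y by_ (gx' y by_ Vy') p hp.
have -> : T x' - b' x' - (T x - b' x) =
    (T x' - b' x' - (T p - b p)) - (T x - b' x - (T p - b p)) by ring.
exact: (modB (sO y) mJ).
Qed.

End Surjectivity.

(** * Length *)

(** The laws used by chain arguments, stated for bare operations as in [has_length]; the action of
    -1 provides negatives. *)
Record module_laws (A : comUnitRingType) (V : Type) (add : V -> V -> V) (act : A -> V -> V)
    (zero : V) : Prop := ModuleLaws {
  ml_A : associative add;
  ml_C : commutative add;
  ml_0 : left_id zero add;
  ml_N : forall v, add v (act (-1) v) = zero;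
  ml_D : forall r u v, act r (add u v) = add (act r u) (act r v)
}.

Section Chains.
Variables (A : comUnitRingType) (V : Type) (add : V -> V -> V) (act : A -> V -> V) (zero : V).
Hypothesis L : module_laws add act zero.
Implicit Types (N M K : set V).

Notation sub := (is_submodule add act).
Notation chain := (submodule_chain add act).

Lemma submodD M u v : sub M -> M u -> M v -> M (add u v).
Proof. by case=> _ h _; exact: h. Qed.

Lemma submodZ M r v : sub M -> M v -> M (act r v).
Proof. by case=> _ _; apply. Qed.

Lemma submod0 M : sub M -> M zero.
Proof.
by move=> sM; have [[v Mv] _ _] := sM; rewrite -(ml_N L v); apply: submodD => //; exact: submodZ.
Qed.

Lemma addKm u v : add (add u v) (act (-1) v) = u.
Proof. by rewrite -(ml_A L) (ml_N L) (ml_C L) (ml_0 L). Qed.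

Lemma subKm u v : add (add u (act (-1) v)) v = u.
Proof. by rewrite -(ml_A L) (ml_C L _ v) (ml_N L) (ml_C L) (ml_0 L). Qed.

Lemma submodDr M u v : sub M -> M v -> M (add u v) -> M u.
Proof. by move=> sM Mv Muv; rewrite -(addKm u v); apply: submodD => //; exact: submodZ. Qed.

Lemma chain_mono N M P n i j : chain N M P n -> (i <= j)%N -> (j <= n)%N -> P i `<=` P j.
Proof.
move=> [_ _ _ h]; elim: j => [|j IH]; first by rewrite leqn0 => /eqP -> _ x.
rewrite leq_eqVlt => /predU1P[-> _ x //|lt] le; apply: subset_trans (IH lt (ltnW le)) _.
by have [] := h j le.
Qed.

Lemma chain_sub N M P n : chain N M P n -> N `<=` M.
Proof.
move=> c; have := chain_mono c (leq0n n) (leqnn n).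
by case: c => -> ->.
Qed.

Lemma chain_cons N K M P n : sub N -> N `<` K -> chain K M P n ->
  chain N M (fun i => if i is i'.+1 then P i' else N) n.+1.
Proof.
move=> sN NK [P0 Pn sP hP]; split=> //; first by case=> // i; exact: sP.
by case=> [_|i]; [rewrite P0|exact: hP].
Qed.

Lemma chain_rcons N K M P n : sub M -> K `<` M -> chain N K P n ->
  chain N M (fun i => if (i <= n)%N then P i else M) n.+1.
Proof.
move=> sM KM [P0 Pn sP hP]; split=> //; first by rewrite ltnn.
  by move=> i _; case: ifP => // le; exact: sP.
move=> i; rewrite ltnS => le; rewrite le; case: ltnP => [lt|]; first exact: hP.
move=> le'; have -> : i = n by apply/eqP; rewrite eqn_leq le.
by rewrite Pn.
Qed.

Lemma chain_extend N K M P n : sub M -> K `<=` M -> chain N K P n ->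
  exists P' n', (n <= n')%N /\ chain N M P' n'.
Proof.
move=> sM KM c; have [MK|nMK] := pselect (M `<=` K).
  by exists P, n; split=> //; have <- : K = M by apply/seteqP.
by exists (fun i => if (i <= n)%N then P i else M), n.+1; split; [exact: leqnSn|exact: (chain_rcons sM (conj KM nMK) c)].
Qed.

Lemma has_length0 M : sub M -> has_length add act M M 0.
Proof.
move=> sM; split; first by exists (fun=> M).
move=> P [|n] // [P0 Pn sP hP].
have c : chain (P 1%N) M (fun i => P i.+1) n.
  by split=> // i lt; [exact: sP|exact: hP].
have [_] := hP 0%N (ltn0Sn n); rewrite P0; case.
exact: (chain_sub c).
Qed.

End Chains.

Section LinearMaps.
Variables (A : comUnitRingType).
Variables (V : Type) (add : V -> V -> V) (act : A -> V -> V) (zero : V).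
Variables (V' : Type) (add' : V' -> V' -> V') (act' : A -> V' -> V') (zero' : V').
Hypotheses (L : module_laws add act zero) (L' : module_laws add' act' zero').
Variable phi : V -> V'.
Hypotheses (phiD : forall u v, phi (add u v) = add' (phi u) (phi v))
  (phiZ : forall r v, phi (act r v) = act' r (phi v)).
Variables (N M : set V) (N' M' : set V').

Notation sub := (is_submodule add act).
Notation sub' := (is_submodule add' act').
Notation chain := (submodule_chain add act).
Notation chain' := (submodule_chain add' act').

Definition pull (P' : set V') : set V := [set m | M m /\ P' (phi m)].
Definition push (P : set V) : set V' :=
  [set v | exists m k, [/\ P m, N' k & v = add' (phi m) k]].

Hypotheses (sM : sub M) (sN : sub N) (sN' : sub' N').
Hypotheses (phiN : forall m, N m -> N' (phi m)).

Let phi0 : phi zero = zero'.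
Proof. by rewrite -(ml_N L zero) phiD phiZ (ml_N L'). Qed.

Lemma pull_sub P' : sub' P' -> sub (pull P').
Proof.
move=> sP; split.
- by exists zero; split; [exact: (submod0 L sM)|rewrite phi0; exact: (submod0 L' sP)].
- move=> u v [Mu Pu] [Mv Pv]; split; first exact: (submodD sM).
  by rewrite phiD; exact: (submodD sP).
- move=> r v [Mv Pv]; split; first exact: (submodZ _ sM).
  by rewrite phiZ; exact: (submodZ _ sP).
Qed.

Lemma push_sub P : sub P -> sub' (push P).
Proof.
move=> sP; split.
- by exists (add' (phi zero) zero'), zero, zero'; split=> //; [exact: (submod0 L sP)|exact: (submod0 L' sN')].
- move=> _ _ [m [k [Pm Nk ->]]] [m' [k' [Pm' Nk' ->]]].
  exists (add m m'), (add' k k'); split; [exact: (submodD sP)|exact: (submodD sN')|].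
  by rewrite phiD -!(ml_A L') (ml_A L' k) (ml_C L' k) !(ml_A L').
- move=> r _ [m [k [Pm Nk ->]]]; exists (act r m), (act' r k); split.
  + exact: (submodZ _ sP).
  + exact: (submodZ _ sN').
  + by rewrite (ml_D L') phiZ.
Qed.

Hypothesis surj : forall v, M' v -> exists m k, [/\ M m, N' k & v = add' (phi m) k].

Lemma pull_chain P' n : (forall m, M m -> M' (phi m)) -> chain' N' M' P' n ->
  chain (pull N') M (fun i => pull (P' i)) n.
Proof.
move=> phiM c; have [P0 Pn sP hP] := c; split.
- by rewrite P0.
- by rewrite Pn; apply/seteqP; split=> [m []//|m Mm]; split=> //; exact: phiM.
- by move=> i le; apply: pull_sub; exact: sP.
- move=> i lt; have [P12 P21] := hP i lt; split; first by move=> m [Mm Pm]; split=> //; exact: P12.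
  move=> h; apply: P21 => v Pv.
  have M'v : M' v by rewrite -Pn; apply: (chain_mono c lt (leqnn n)).
  have [m [k [Mm Nk vE]]] := surj M'v.
  have NP j : (j <= n)%N -> N' `<=` P' j by move=> le; rewrite -P0; exact: (chain_mono c (leq0n j) le).
  have sPi := sP i (ltnW lt); have sPi1 := sP i.+1 lt.
  have [|_ Pm] := h m.
    split=> //; apply: (submodDr L' sPi1 (v := k)); first exact: (NP _ lt).
    by rewrite -vE.
  by rewrite vE; apply: (submodD sPi) => //; exact: (NP _ (ltnW lt)).
Qed.

Lemma push_chain P n : (forall m, M m -> N' (phi m) -> N m) -> chain N M P n ->
  chain' N' (push M) (fun i => push (P i)) n.
Proof.
move=> inj c; have [P0 Pn sP hP] := c; split.
- rewrite P0; apply/seteqP; split=> [_ [m [k [Nm Nk ->]]]|k Nk].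
    by apply: (submodD sN') => //; exact: phiN.
  by exists zero, k; split=> //; [exact: (submod0 L sN)|rewrite phi0 (ml_0 L')].
- by rewrite Pn.
- by move=> i le; apply: push_sub; exact: sP.
- move=> i lt; have [P12 P21] := hP i lt; split.
    by move=> _ [m [k [Pm Nk ->]]]; exists m, k; split=> //; exact: P12.
  move=> h; apply: P21 => m Pm.
  have [|m' [k [Pm' Nk E]]] := h (phi m).
    exists m, zero'; split=> //; first exact: (submod0 L' sN').
    by rewrite (ml_C L') (ml_0 L').
  have sPi := sP i (ltnW lt).
  have PM j : (j <= n)%N -> P j `<=` M.
    by move=> le; rewrite -Pn; exact: (chain_mono c le (leqnn n)).
  have Nmm : N (add m (act (-1) m')).
    apply: inj.
      apply: (submodD sM); first exact: (PM _ lt).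
      by apply: (submodZ _ sM); exact: (PM _ (ltnW lt)).
    by rewrite phiD phiZ E (ml_C L' (phi m')) (addKm L').
  rewrite -(subKm L m m'); apply: (submodD sPi) => //.
  by rewrite -P0 in Nmm; exact: (chain_mono c (leq0n i) (ltnW lt)).
Qed.

Lemma pull_inj : (forall m, M m -> N' (phi m) -> N m) -> N `<=` M -> pull N' = N.
Proof.
move=> inj NM; apply/seteqP; split=> [m [Mm]|m Nm]; first exact: inj.
by split; [exact: NM|exact: phiN].
Qed.

Lemma push_surj : (forall m, M m -> M' (phi m)) -> sub' M' -> N' `<=` M' -> push M = M'.
Proof.
move=> phiM sM' NM'; apply/seteqP; split; last by move=> v /surj[m [k [Mm Nk ->]]]; exists m, k.
by move=> _ [m [k [Mm Nk ->]]]; apply: (submodD sM'); [exact: phiM|exact: NM'].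
Qed.

Lemma has_length_iso n : (forall m, M m -> M' (phi m)) -> sub' M' -> N' `<=` M' -> N `<=` M ->
    (forall m, M m -> N' (phi m) -> N m) ->
  has_length add act N M n <-> has_length add' act' N' M' n.
Proof.
move=> phiM sM' NM' NM inj; split=> -[[P c] h]; split.
- by exists (fun i => push (P i)); have := push_chain inj c; rewrite push_surj.
- move=> P' m c'; apply: (h (fun i => pull (P' i))).
  by have := pull_chain phiM c'; rewrite pull_inj.
- by exists (fun i => pull (P i)); have := pull_chain phiM c; rewrite pull_inj.
- move=> P' m c'; apply: (h (fun i => push (P' i))).
  by have := push_chain inj c'; rewrite push_surj.
Qed.

(** A nonzero kernel could be placed below the inverse image of a chain of full length in [M'/N'],
    giving a chain one step too long for [M/N]. *)
Lemma has_length_inj n : (forall m, M m -> M' (phi m)) -> N `<=` M ->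
    has_length add act N M n -> has_length add' act' N' M' n ->
  forall m, M m -> N' (phi m) -> N m.
Proof.
move=> phiM NM [_ h] [[P' c'] _] m Mm Nm; apply: contrapT => nN.
have c := pull_chain phiM c'.
have NK : N `<` pull N'.
  split; first by move=> u Nu; split; [exact: NM|exact: phiN].
  by move=> hh; apply: nN; apply: hh.
by have := h _ _ (chain_cons sN NK c); rewrite ltnn.
Qed.

End LinearMaps.

Section SurjectiveInjective.
Variables (A : comUnitRingType).
Variables (V : Type) (add : V -> V -> V) (act : A -> V -> V) (zero : V).
Variables (V' : Type) (add' : V' -> V' -> V') (act' : A -> V' -> V') (zero' : V').
Hypotheses (L : module_laws add act zero) (L' : module_laws add' act' zero').
Variables (phi psi : V -> V') (N M T : set V) (N' M' : set V').

(** If [phi] had a kernel, a chain of [M/N] could be pushed along [psi], extended to [M'], pulled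
    back along [phi] and lengthened by the kernel. Repetition would exceed the length of [T/N]. *)
Lemma has_length_surj_inj n :
    (forall u v, phi (add u v) = add' (phi u) (phi v)) ->
    (forall r v, phi (act r v) = act' r (phi v)) ->
    (forall u v, psi (add u v) = add' (psi u) (psi v)) ->
    (forall r v, psi (act r v) = act' r (psi v)) ->
    is_submodule add act N -> is_submodule add act M -> is_submodule add act T ->
    is_submodule add' act' N' -> is_submodule add' act' M' ->
    N `<=` M -> M `<=` T -> N' `<=` M' ->
    (forall m, N m -> N' (phi m)) -> (forall m, N m -> N' (psi m)) ->
    (forall m, M m -> M' (phi m)) -> (forall m, M m -> M' (psi m)) ->
    (forall v, M' v -> exists m k, [/\ M m, N' k & v = add' (phi m) k]) ->
    (forall m, M m -> N' (psi m) -> N m) ->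
    has_length add act N T n ->
  forall m, M m -> N' (phi m) -> N m.
Proof.
move=> phiD phiZ psiD psiZ sN sM sT sN' sM' NM MT NM' phiN psiN phiM psiM surj inj [_ hT].
move=> m0 Mm0 Nm0; apply: contrapT => nN.
have NK : N `<` pull phi M N'.
  split; first by move=> u Nu; split; [exact: NM|exact: phiN].
  by move=> h; apply: nN; apply: h.
have long k : exists P k', (k < k')%N /\ submodule_chain add act N M P k'.
  elim: k => [|k [P [k' [lt c]]]].
    exists (fun i => if i is i'.+1 then M else N), 1%N; split=> //.
    apply: (@chain_cons _ _ add act N M M (fun=> M) 0) => //; split=> //.
    by move=> h; apply: nN; exact: h.
  have c1 := push_chain L L' psiD psiZ sM sN sN' psiN inj c.
  have [|P' [k2 [le c2]]] := chain_extend sM' _ c1.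
    by move=> _ [m [u [Mm Nu ->]]]; apply: (submodD sM'); [exact: psiM|exact: NM'].
  have c3 := pull_chain L L' phiD phiZ sM surj phiM c2.
  exists (fun i => if i is i'.+1 then pull phi M (P' i') else N), k2.+1.
  by split; [rewrite ltnS (leq_trans lt)|exact: (chain_cons sN NK c3)].
have [P [k [lt c]]] := long n; have [P' [k' [le c']]] := chain_extend sT MT c.
by have := hT _ _ c'; rewrite leqNgt (leq_trans lt).
Qed.

End SurjectiveInjective.

(** * The exact sequence of a general pair *)

Section Conclusion.
Variables (F : fieldType) (A : set F) (X : topologicalType) (O : X -> set F) (eta : X).
Variables (S : seq X) (unif : X -> F).
Hypothesis D : exceptional_data A O eta S unif.
Implicit Types (x y w e : X) (a b c f g u v : F) (Y : X -> nat).

Let M : local_model A O eta. Proof. exact: ed_model D. Qed.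
Let lA : is_loc A. Proof. exact: lm_A M. Qed.
Let sA : is_subring A. Proof. by case: lA. Qed.
Let lO x : is_loc (O x). Proof. exact: lm_loc M x. Qed.
Let sO x : is_subring (O x). Proof. by case: (lO x). Qed.
Let nO x : is_mod (O x) (nmax (O x)). Proof. by case: (nmax_idl (lO x)). Qed.
Let AO x : A `<=` O x. Proof. exact: (lm_AO M). Qed.
Notation J Y x := (Jmod O unif Y x).
Notation I Y := (Iglob O unif Y).

Variables (AR : comUnitRingType) (emb : {rmorphism AR -> F}).
Hypothesis embA : forall r, A (emb r).
Variables (Z Z' : X -> nat).
Hypotheses (cZ : cyc S Z) (gZ : ggen O unif Z) (pZ : exists e, Z e != 0%N).
Hypotheses (cZ' : cyc S Z') (gZ' : ggen O unif Z').

Notation T Y := (TT O unif Y).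
Notation B Y := (BB O unif Y).
Notation ZZ := (fun x => Z x + Z' x)%N.
Notation zero_c := (fun _ : X => 0%N).
Notation add := (fun (s t : X -> F) (x : X) => s x + t x).
Notation act := (fun (r : AR) (t : X -> F) (x : X) => emb r * t x).

Let cZZ : cyc S ZZ.
Proof. by move=> e; rewrite addn_eq0 negb_and => /orP[/cZ|/cZ']. Qed.

Let c0 : cyc S zero_c. Proof. by []. Qed.

Let mJ Y y : cyc S Y -> is_mod (O y) (J Y y).
Proof. exact: (Jmod_mod D y). Qed.

Lemma functions_laws : module_laws add act (fun=> 0).
Proof.
split=> [s t u|s t|s|s|r s t]; apply/funext => x /=.
- exact: addrA.
- exact: addrC.
- exact: add0r.
- by rewrite rmorphN1 mulN1r subrr.
- exact: mulrDr.
Qed.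

Lemma cover_meet (U U' : X -> set X) : (forall x, open (U x) /\ U x x) ->
  (forall x, open (U' x) /\ U' x x) -> forall x, open (U x `&` U' x) /\ (U x `&` U' x) x.
Proof. by move=> h h' x; have [? ?] := h x; have [? ?] := h' x; split=> //; exact: openI. Qed.

Lemma TT_submodule Y : cyc S Y -> is_submodule add act (T Y).
Proof.
move=> cY; split.
- exists (fun=> 0); exists (fun=> setT); first by move=> x; split=> //; exact: openT.
  by move=> x x' y _ _; rewrite subrr; exact: (mod0 (mJ y cY)).
- move=> s t [U hU hs] [U' hU' ht]; exists (fun x => U x `&` U' x); first exact: cover_meet.
  move=> x x' y [Uy Uy'] [Vy Vy'].
  have -> : s x' + t x' - (s x + t x) = (s x' - s x) + (t x' - t x) by ring.
  by apply: (modD (mJ y cY)); [exact: hs|exact: ht].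
- move=> r t [U hU ht]; exists U => // x x' y Uy Uy'; rewrite -mulrBr.
  by apply: (modM (mJ y cY)); [exact/AO/embA|exact: ht].
Qed.

Lemma BB_submodule Y : cyc S Y -> is_submodule add act (B Y).
Proof.
move=> cY; split.
- exists (fun=> 0), 0; exists (fun=> setT); first by move=> x; split=> //; exact: openT.
  by move=> x y _; rewrite subrr; exact: (mod0 (mJ y cY)).
- move=> s t [c [U hU hs]] [d [U' hU' ht]]; exists (c + d), (fun x => U x `&` U' x).
    exact: cover_meet.
  move=> x y [Uy Uy']; have -> : s x + t x - (c + d) = (s x - c) + (t x - d) by ring.
  by apply: (modD (mJ y cY)); [exact: hs|exact: ht].
- move=> r t [c [U hU ht]]; exists (emb r * c), U => // x y Uy; rewrite -mulrBr.
  by apply: (modM (mJ y cY)); [exact/AO/embA|exact: ht].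
Qed.

Lemma BB_TT Y : cyc S Y -> B Y `<=` T Y.
Proof.
move=> cY t [c [U hU ht]]; exists U => // x x' y Uy Uy'.
have -> : t x' - t x = (t x' - c) - (t x - c) by ring.
by apply: (modB (sO y) (mJ y cY)); exact: ht.
Qed.

Definition mult c (t : X -> F) : X -> F := fun x => c * t x.

Lemma TT_mult Y Y' c t : (forall y b, J Y y b -> J Y' y (c * b)) -> T Y t -> T Y' (mult c t).
Proof. by move=> h [U hU ht]; exists U => // x x' y Uy Uy'; rewrite /mult -mulrBr; apply: h; exact: ht. Qed.

Lemma BB_mult Y Y' c t : (forall y b, J Y y b -> J Y' y (c * b)) -> B Y t -> B Y' (mult c t).
Proof.
move=> h [d [U hU ht]]; exists (c * d), U => // x y Uy.
by rewrite /mult -mulrBr; apply: h; exact: ht.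
Qed.

Lemma BB_sub_eq Y s t c (U : X -> set X) : cyc S Y -> (forall x, open (U x) /\ U x x) ->
  (forall x y, U x y -> J Y y (s x - t x - c)) -> B Y t -> B Y s.
Proof.
move=> cY hU h [d [U' hU' ht]]; exists (c + d), (fun x => U x `&` U' x); first exact: cover_meet.
move=> x y [Uy Uy']; have -> : s x - (c + d) = (s x - t x - c) + (t x - d) by ring.
by apply: (modD (mJ y cY)); [exact: h|exact: ht].
Qed.

Lemma I_mul f : I Z f -> (forall y b, J zero_c y b -> J Z y (f * b)) /\
  (forall y b, J Z' y b -> J ZZ y (f * b)).
Proof.
move=> If; split=> y b; first by rewrite (Jmod0 D) mulrC => Ob; exact: (modM (mJ y cZ)).
move=> /(Jmod_mul D cZ If cZ'); congr (Jmod _ _ _ _ _); apply/funext => x; exact: addnC.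
Qed.

Lemma I_mul' f : I Z' f -> (forall y b, J zero_c y b -> J Z' y (f * b)) /\
  (forall y b, J Z y b -> J ZZ y (f * b)).
Proof.
move=> If; split=> y b; first by rewrite (Jmod0 D) mulrC => Ob; exact: (modM (mJ y cZ')).
exact: (Jmod_mul D cZ' If cZ).
Qed.

Definition exact_at f f' x := [/\ forall u, O x u -> f * u = 0 -> f' * u = 0 -> u = 0,
  forall a b, J Z x a -> J Z' x b -> - f' * a + f * b = 0 ->
    exists u, [/\ O x u, a = f * u & b = f' * u] &
  forall c, J ZZ x c -> exists a b, [/\ J Z x a, J Z' x b & c = - f' * a + f * b]].

Definition general f f' := [/\ I Z f, I Z' f' & forall x, exact_at f f' x].

(** Two pieces of the long exact sequence in one: exactness at the middle H^1, and, for
    [tau = sig = 0] with [- c] a global section, the connecting map into H^1(O). The constants [c1]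
    and [c2] keep track of the global part. *)
Lemma exact_middle f f' (tau sig : X -> F) c : general f f' -> T Z tau -> T Z' sig ->
    (exists2 U : X -> set X, (forall x, open (U x) /\ U x x) &
      forall x y, U x y -> J ZZ y (- f' * tau x + f * sig x - c)) ->
  exists t c1 c2, [/\ T zero_c t, c = f' * c1 - f * c2 &
    exists2 U : X -> set X, (forall x, open (U x) /\ U x x) &
      forall x y, U x y -> J Z y (f * t x - tau x - c1) /\ J Z' y (f' * t x - sig x - c2)].
Proof.
move=> [If If' ex] [U1 hU1 htau] [U2 hU2 hsig] [U3 hU3 h].
have /choice[a /choice[b hab]] x : exists a b, [/\ J Z x a, J Z' x b &
    - f' * tau x + f * sig x - c = - f' * a + f * b].
  by have [_ _ +] := ex x; apply; apply: h; have [] := hU3 x.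
have /choice[V hV] x : exists V, [/\ open V, V x & forall y, V y -> J Z y (a x) /\ J Z' y (b x)].
  have [Ja Jb _] := hab x; have [V [oV Vx hV]] := Jmod_open Ja; have [V' [oV' Vx' hV']] := Jmod_open Jb.
  exists (V `&` V'); split=> // [|y [Vy Vy']]; first exact: openI.
  by split; [exact: hV|exact: hV'].
pose U x := (U1 x `&` U2 x) `&` V x.
have hU x : open (U x) /\ U x x.
  have [? ? _] := hV x; have [? ?] := hU1 x; have [? ?] := hU2 x.
  by split=> //; do 2!apply: openI => //.
(* After subtraction of the local lifts [a] and [b], the equation [- f' * al x + f * be x = c] holds
   exactly, so the differences of the pair come from sections of O. *)
pose al x := tau x - a x; pose be x := sig x - b x.
have E x : - f' * al x + f * be x = c.
  have [_ _ e] := hab x.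
  have -> : - f' * al x + f * be x =
      (- f' * tau x + f * sig x - c) - (- f' * a x + f * b x) + c by rewrite /al /be; ring.
  by rewrite e subrr add0r.
have diff x x' y : U x y -> U x' y -> exists u, [/\ O y u, al x' - al x = f * u & be x' - be x = f' * u].
  move=> [[U1y U2y] Vy] [[U1y' U2y'] Vy'].
  have [_ _ hx] := hV x; have [_ _ hx'] := hV x'.
  have [Ja Jb] := hx y Vy; have [Ja' Jb'] := hx' y Vy'.
  have [_ + _] := ex y; apply.
  - have -> : al x' - al x = (tau x' - tau x) - (a x' - a x) by rewrite /al; ring.
    by apply: (modB (sO y) (mJ y cZ)); [exact: htau|exact: (modB (sO y) (mJ y cZ))].
  - have -> : be x' - be x = (sig x' - sig x) - (b x' - b x) by rewrite /be; ring.
    by apply: (modB (sO y) (mJ y cZ')); [exact: hsig|exact: (modB (sO y) (mJ y cZ'))].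
  - have -> : - f' * (al x' - al x) + f * (be x' - be x) =
        (- f' * al x' + f * be x') - (- f' * al x + f * be x) by ring.
    by rewrite !E subrr.
have near x y : U x y -> J Z y (- a x) /\ J Z' y (- b x).
  move=> [_ Vy]; have [_ _ hx] := hV x; have [Ja Jb] := hx y Vy.
  by split; [exact: (modN (sO y) (mJ y cZ))|exact: (modN (sO y) (mJ y cZ'))].
(* The class sought is [al / f] or [be / f']. Exactness at [eta] excludes that both [f] and [f']
   vanish. *)
have [f'0|f'0] := eqVneq f' 0.
  have f0 : f != 0.
    apply/eqP => f0; have [h1 _ _] := ex eta.
    have := h1 1 (sub1 (sO eta)); rewrite f0 f'0 !mul0r => /(_ erefl erefl)/eqP.
    by rewrite oner_eq0.
  exists (fun x => f^-1 * al x), 0, (- c / f); split.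
  - exists U => // x x' y Uy Uy'; rewrite -mulrBr.
    by have [u [Ou -> _]] := diff x x' y Uy Uy'; rewrite mulKf // (Jmod0 D).
  - by rewrite f'0; field.
  - exists U => // x y Uy; have [Ja Jb] := near x y Uy; split.
      by have -> : f * (f^-1 * al x) - tau x - 0 = - a x by rewrite /al; field.
    have -> : f' * (f^-1 * al x) - sig x - - c / f = - b x; last by [].
    by rewrite -(E x) /be f'0; field.
exists (fun x => f'^-1 * be x), (c / f'), 0; split.
- exists U => // x x' y Uy Uy'; rewrite -mulrBr.
  by have [u [Ou _ ->]] := diff x x' y Uy Uy'; rewrite mulKf // (Jmod0 D).
- by field.
- exists U => // x y Uy; have [Ja Jb] := near x y Uy; split.
    have -> : f * (f'^-1 * be x) - tau x - c / f' = - a x; last by [].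
    by rewrite -(E x) /al; field.
  by have -> : f' * (f'^-1 * be x) - sig x - 0 = - b x by rewrite /be; field.
Qed.

(** The sequence is a Koszul complex twisted by the two cycles, split wherever one of the two
    sections generates. *)
Lemma generates_exact f f' x : I Z f -> I Z' f' ->
  generates O unif Z f x \/ generates O unif Z' f' x -> exact_at f f' x.
Proof.
move=> If If' gen; have [z zP] := local_equations D.
have G0 Y := local_gen_neq0 D zP Y x.
have JE Y : cyc S Y -> J Y x = scale_set (local_gen S z Y x) (O x) by exact: (local_genP D zP x).
have gJ Y : cyc S Y -> J Y x (local_gen S z Y x).
  by move=> cY; rewrite JE //; exists 1; [exact: sub1|rewrite mulr1].
have nz Y h : cyc S Y -> generates O unif Y h x -> h != 0.
  move=> cY gh; apply: contraNneq (G0 Y) => h0.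
  by have [b _ <-] := gh _ (gJ Y cY); rewrite h0 mul0r.
have DE : local_gen S z ZZ x = local_gen S z Z x * local_gen S z Z' x by exact: local_genD.
case: gen => gf.
  have f0 := nz Z f cZ gf; split.
  - by move=> u _ /eqP; rewrite mulf_eq0 (negbTE f0) => /eqP.
  - move=> a b Ja Jb E; have [u Ou uE] := gf a Ja; exists u; split=> //.
    apply: (mulfI f0); apply/eqP; rewrite -subr_eq0 -[X in _ == X]E -uE.
    by apply/eqP; ring.
  - move=> c; rewrite (JE _ cZZ) DE => -[d Od <-].
    have [t Ot tE] := gf _ (gJ Z cZ).
    exists 0, (t * d * local_gen S z Z' x); split; first exact: (mod0 (mJ x cZ)).
      by apply: (modM (mJ x cZ')); [exact: subM|exact: gJ].
    by rewrite -tE; ring.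
have f0 := nz Z' f' cZ' gf; split.
- by move=> u _ _ /eqP; rewrite mulf_eq0 (negbTE f0) => /eqP.
- move=> a b Ja Jb E; have [u Ou uE] := gf b Jb; exists u; split=> //.
  apply: (mulfI f0); apply/eqP; rewrite -subr_eq0 -[X in _ == X]oppr0 -[X in _ == - X]E -uE.
  by apply/eqP; ring.
- move=> c; rewrite (JE _ cZZ) DE => -[d Od <-].
  have [t Ot tE] := gf _ (gJ Z' cZ').
  exists (- (t * d) * local_gen S z Z x), 0; split; last by rewrite -tE; ring.
    by apply: (modM (mJ x cZ)); [apply: subN => //; exact: subM|exact: gJ].
  exact: (mod0 (mJ x cZ')).
Qed.

Lemma general_exists : exists f f', general f f'.
Proof.
have [f [f' [If If' gen _ _]]] := general_pair D cZ cZ' gZ gZ' pZ.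
by exists f, f'; split=> // x; exact: generates_exact.
Qed.

(** Products of global sections suffice: global generation is applied to [Z'] with the first factor
    fixed, then to [Z] while this factor varies. *)
Lemma ggen_add : ggen O unif ZZ.
Proof.
move=> x N mN IN; have [z zP] := local_equations D.
have JE Y : cyc S Y -> J Y x = scale_set (local_gen S z Y x) (O x) by exact: (local_genP D zP x).
have gJ Y : cyc S Y -> J Y x (local_gen S z Y x).
  by move=> cY; rewrite JE //; exists 1; [exact: sub1|rewrite mulr1].
have key f : I Z f -> [set b | N (f * b)] (local_gen S z Z' x).
  move=> If; apply: (gZ' _ _ (gJ Z' cZ')).
    split; first by rewrite /= mulr0; exact: (mod0 mN).
      by move=> a b /= Na Nb; rewrite mulrDr; exact: (modD mN).
    by move=> r a Or /= Na; rewrite mulrCA; exact: (modM mN).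
  move=> f' If'; apply: IN => y; have [_ h] := I_mul If; exact: h.
have : [set a | N (a * local_gen S z Z' x)] (local_gen S z Z x).
  apply: (gZ _ _ (gJ Z cZ)) => [|f If]; last exact: key.
  split; first by rewrite /= mul0r; exact: (mod0 mN).
    by move=> a b /= Na Nb; rewrite mulrDl; exact: (modD mN).
  by move=> r a Or /= Na; rewrite -mulrA; exact: (modM mN).
move=> /= NG; rewrite (JE _ cZZ) => _ [b Ob <-]; rewrite mulrC; apply: (modM mN) => //.
by rewrite (local_genD).
Qed.

Variable n : nat.
Hypotheses (h0 : has_length add act (B zero_c) (T zero_c) n)
  (hZ : has_length add act (B Z) (T Z) n).

Let multD c s t : mult c (add s t) = add (mult c s) (mult c t).
Proof. by apply/funext => x; exact: mulrDr. Qed.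

Let multZ c r t : mult c (act r t) = act r (mult c t).
Proof. by apply/funext => x; exact: mulrCA. Qed.

Let L := functions_laws.

(* A section g of O(-Z) generating it outside finitely many points induces a
   surjection of H^1(O) onto H^1(O(-Z)), bijective when Z is a p_g-cycle. *)
Lemma good_multiplier : exists g g', [/\ general g g',
  forall t, T zero_c t -> B Z (mult g t) -> B zero_c t &
  forall v : X -> F, T ZZ v -> exists m k, [/\ T Z' m, B ZZ k & v = add (mult g m) k]].
Proof.
have [g [g' [Ig Ig' gen gS geta]]] := general_pair D cZ cZ' gZ gZ' pZ.
have surj Y (v : X -> F) : cyc S Y -> T (fun x => Y x + Z x)%N v ->
    exists m k, [/\ T Y m, B (fun x => Y x + Z x)%N k & v = add (mult g m) k].
  move=> cY /(H1_surjective D cZ gZ pZ Ig gS geta cY)[t Tt [U hU h]].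
  exists t, (fun x => v x - g * t x); split=> //.
    by exists 0, U => // x y Uy; rewrite subr0; exact: h.
  by apply/funext => x; rewrite /mult addrC subrK.
exists g, g'; split.
- by split=> // x; exact: generates_exact.
- have [g0Z _] := I_mul Ig.
  apply: (has_length_inj L L (multD g) (multZ g) (TT_submodule c0) (BB_submodule c0)
     _ _ _ (BB_TT c0) h0 hZ).
  + by move=> t; exact: BB_mult.
  + by move=> v Tv; exact: (surj zero_c v c0 Tv).
  + by move=> t; exact: TT_mult.
- move=> v Tv; have EZ : ZZ = (fun x => Z' x + Z x)%N by apply/funext => x; exact: addnC.
  by rewrite EZ in Tv *; exact: (surj Z' v cZ' Tv).
Qed.

Lemma general_injective f f' t : general f f' -> T zero_c t -> B Z' (mult f' t) ->
  B Z (mult f t) -> B zero_c t.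
Proof.
move=> gf; have [If If' _] := gf; have [g [g' [[Ig _ _] injg _]]] := good_multiplier.
have [f0 fZ'] := I_mul If; have [g0 gZZ'] := I_mul Ig; have [f'0 f'Z] := I_mul' If'.
pose K := [set t | T zero_c t /\ B Z' (mult f' t)].
pose K' := [set t | T Z t /\ B ZZ (mult f' t)].
have multC c d s : mult c (mult d s) = mult d (mult c s).
  by apply/funext => x; exact: mulrCA.
have subK Y Y' c (h : forall y b, J Y y b -> J Y' y (c * b)) : cyc S Y -> cyc S Y' ->
    is_submodule add act [set t | T Y t /\ B Y' (mult c t)].
  move=> cY cY'; have sT := TT_submodule cY; have sB := BB_submodule cY'; split.
  - exists (fun=> 0); split; first exact: (submod0 L sT).
    have -> : mult c (fun=> 0) = fun=> 0 by apply/funext => x; exact: mulr0.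
    exact: (submod0 L sB).
  - move=> u v [Tu Bu] [Tv Bv]; split; first exact: (submodD sT).
    by rewrite multD; exact: (submodD sB).
  - move=> r v [Tv Bv]; split; first exact: (submodZ _ sT).
    by rewrite multZ; exact: (submodZ _ sB).
have toK' c : (forall y b, J zero_c y b -> J Z y (c * b)) ->
    (forall y b, J Z' y b -> J ZZ y (c * b)) -> forall m, K m -> K' (mult c m).
  move=> h1 h2 m [Tm Bm]; split; first exact: (TT_mult h1).
  by rewrite multC; exact: (BB_mult h2).
move=> Tt Bt; have Kt : K t by [].
apply: (@has_length_surj_inj _ _ _ _ _ _ _ _ _ L L (mult f) (mult g) (B zero_c) K (T zero_c)
  (B Z) K' n) => //.
- exact: BB_submodule.
- exact: (subK _ _ _ f'0 c0 cZ').
- exact: TT_submodule.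
- exact: BB_submodule.
- exact: (subK _ _ _ f'Z cZ cZZ).
- by move=> s Bs; split; [exact: (BB_TT c0)|exact: (BB_mult f'0)].
- by move=> s [].
- by move=> s Bs; split; [exact: (BB_TT cZ)|exact: (BB_mult f'Z)].
- by move=> s; exact: BB_mult.
- by move=> s; exact: BB_mult.
- exact: toK'.
- exact: toK'.
(* Surjectivity of [f] from [K] to [K']: a class [v] killed by [f'] forms with 0 a pair in the
   kernel, which comes from a class [s] of O with [f s = v] and [f' s = 0] in cohomology. *)
- move=> v [Tv [c [U hU h]]].
  have T0 : T Z' (fun=> 0) by exact: (submod0 L (TT_submodule cZ')).
  have [|s [c1 [c2 [Ts _ [V hV h']]]]] := exact_middle (c := - c) gf Tv T0.
    exists U => // x y Uy; have -> : - f' * v x + f * 0 - - c = - (f' * v x - c) by ring.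
    by apply: (modN (sO y) (mJ y cZZ)); exact: h.
  exists s, (fun x => v x - f * s x); split; last by apply/funext => x; rewrite /mult addrC subrK.
    split=> //; exists c2, V => // x y Vy.
    by have [_] := h' x y Vy; rewrite subr0.
  exists (- c1), V => // x y Vy; have [h1 _] := h' x y Vy.
  have -> : v x - f * s x - - c1 = - (f * s x - v x - c1) by ring.
  exact: (modN (sO y) (mJ y cZ)).
- by move=> m [Tm _]; exact: injg.
Qed.

(** The connecting map sends [s] to a class [t] killed by both [f] and [f'], hence trivial. The
    constant [d] that trivializes [t] corrects [c1] and [c2] into genuine global sections. *)
Lemma ideal_decomposition f f' : general f f' ->
  I ZZ = [set f * u + f' * v | u in I Z' & v in I Z].
Proof.
move=> gf; have [If If' ex] := gf.
apply/seteqP; split; last first.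
  move=> _ [u Iu [v Iv <-]] x; apply: (modD (mJ x cZZ)).
    by have [_ h] := I_mul If; exact: h.
  by have [_ h] := I_mul' If'; exact: h.
move=> s Is; have T0 Y : cyc S Y -> T Y (fun=> 0).
  by move=> cY; exact: (submod0 L (TT_submodule cY)).
have hU0 (x : X) : open ([set: X]) /\ [set: X] x by split=> //; exact: openT.
have [|t [c1 [c2 [Tt E [U hU h]]]]] := exact_middle (c := - s) gf (T0 Z cZ) (T0 Z' cZ').
  by exists (fun=> setT) => // x y _; rewrite !mulr0 addr0 sub0r opprK; exact: Is.
have BZ' : B Z' (mult f' t).
  by exists c2, U => // x y Uy; have [_] := h x y Uy; rewrite subr0.
have BZ : B Z (mult f t).
  by exists c1, U => // x y Uy; have [+ _] := h x y Uy; rewrite subr0.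
have [d [V hV ht]] := general_injective gf Tt BZ' BZ.
have [f0 _] := I_mul If; have [f'0 _] := I_mul' If'.
exists (c2 - f' * d).
  move=> x; have [_ Ux] := hU x; have [_ Vx] := hV x; have [_ h2] := h x x Ux.
  have -> : c2 - f' * d = f' * (t x - d) - (f' * t x - 0 - c2) by ring.
  by apply: (modB (sO x) (mJ x cZ')) => //; apply: f'0; exact: ht.
exists (f * d - c1).
  move=> x; have [_ Ux] := hU x; have [_ Vx] := hV x; have [h1 _] := h x x Ux.
  have -> : f * d - c1 = (f * t x - 0 - c1) - f * (t x - d) by ring.
  by apply: (modB (sO x) (mJ x cZ)) => //; apply: f0; exact: ht.
have -> : s = - (f' * c1 - f * c2) by rewrite -E opprK.
ring.
Qed.

(** Multiplication by [g] realizes the isomorphism. If [g t] is a coboundary, the pair formed by 0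
    and [t] comes from a class [u] of O with [g u] trivial; then [u] is trivial, and so is [t],
    which is [g' u] in cohomology. *)
Lemma H1_add m : has_length add act (B Z') (T Z') m <-> has_length add act (B ZZ) (T ZZ) m.
Proof.
have [g [g' [gg injg surjg]]] := good_multiplier; have [Ig Ig' _] := gg.
have [g0 gZ1] := I_mul Ig; have [g'0 g'Z] := I_mul' Ig'.
apply: (has_length_iso L L (multD g) (multZ g) (TT_submodule cZ') (BB_submodule cZ')
  (BB_submodule cZZ) _ surjg _ _ (TT_submodule cZZ) (BB_TT cZZ) (BB_TT cZ')).
- by move=> t; exact: BB_mult.
- by move=> t; exact: TT_mult.
- move=> t Tt [c [U hU h]].
  have T0 : T Z (fun=> 0) by exact: (submod0 L (TT_submodule cZ)).
  have [|u [c1 [c2 [Tu _ [V hV hu]]]]] := exact_middle (c := c) gg T0 Tt.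
    by exists U => // x y Uy; rewrite mulr0 add0r; exact: h.
  have Bgu : B Z (mult g u).
    by exists c1, V => // x y Vy; have [+ _] := hu x y Vy; rewrite subr0.
  have Bg'u : B Z' (mult g' u) by apply: (BB_mult g'0); exact: injg.
  apply: (BB_sub_eq (t := mult g' u) (c := - c2) cZ' hV _ Bg'u) => x y Vy.
  have [_ h2] := hu x y Vy.
  have -> : t x - mult g' u x - - c2 = - (g' * u x - t x - c2) by rewrite /mult; ring.
  exact: (modN (sO y) (mJ y cZ')).
Qed.

End Conclusion.

(** * The self-product of a scheme over an affine base *)

Section LocalizationMore.
Variables (B R : comUnitRingType) (P : set B) (h : {rmorphism B -> R}).
Hypotheses (pP : is_prime P) (lh : is_localization P h).

Lemma localization_unit b : h b \is a GRing.unit <-> ~ P b.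
Proof.
have [hu _ hk] := lh; split; last exact: hu.
move=> ub Pb; have [c [s [ns E]]] := localization_frac lh (h b)^-1.
have [[_ _ PM] _ Pp] := pP.
have : h (b * c - s) = 0.
  have us := hu _ ns.
  rewrite rmorphB rmorphM -[h c](divrK us) -E mulrA divrr // mul1r subrr //.
move=> /hk[t nt]; rewrite mulrBr => /eqP; rewrite subr_eq0 => /eqP E'.
have /Pp[//|//] : P (t * s).
  by rewrite -E' (_ : t * (b * c) = t * c * b); [exact: PM|ring].
Qed.

Lemma localization_local : is_local R.
Proof.
move=> x y nx ny; have [hu _ _] := lh.
have [b [s [ns E]]] := localization_frac lh x.
have [c [t [nt E']]] := localization_frac lh y.
have us := hu _ ns; have ut := hu _ nt.
have num (d u : B) (z : R) : ~ P u -> z = h d / h u -> nonunits z -> P d.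
  move=> nu -> /nonunitE nz; apply: contrapT => /localization_unit ud.
  by apply: nz; rewrite unitrM ud unitrV; exact: hu.
have Pb := num _ _ _ ns E nx; have Pc := num _ _ _ nt E' ny.
have [[_ PD PM] _ Pp] := pP.
apply/nonunitE => uxy.
have : h (t * b + s * c) \is a GRing.unit.
  have hb : h b = x * h s by rewrite E divrK.
  have hc : h c = y * h t by rewrite E' divrK.
  have -> : h (t * b + s * c) = h t * (h s * (x + y)).
    by rewrite rmorphD !rmorphM hb hc; ring.
  by rewrite !unitrM ut us.
by move=> /localization_unit; apply; apply: PD; exact: PM.
Qed.

End LocalizationMore.

Section SelfProduct.
Variables (X : lrspace) (A : comUnitRingType) (al : A -> forall x : X, stalk x).
Hypothesis al_sect : forall a, ls_sect setT (al a).

Definition fam := forall x : X, stalk x.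
(** Families over all of X are used instead of germs, so that one and the same tensor can be
    evaluated at every pair of points and primes at different points become comparable sets. *)
Definition tens := seq (fam * fam).

(** A ring receiving both stalks compatibly over [A]. Quantifying over all such rings replaces the
    tensor product of the stalks. *)
Record ctx (x y : X) := Ctx {
  ctx_ring : comUnitRingType;
  ctx_u : {rmorphism stalk x -> ctx_ring};
  ctx_v : {rmorphism stalk y -> ctx_ring};
  ctx_uv : forall a, ctx_u (al a x) = ctx_v (al a y)
}.

Definition cev x y (c : ctx x y) (l : tens) : ctx_ring c :=
  tev (fun s : fam => ctx_u c (s x)) (fun t : fam => ctx_v c (t y)) l.

Definition famM (s t : fam) : fam := fun x => s x * t x.
Definition famN (s : fam) : fam := fun x => - s x.
Definition fam1 : fam := fun=> 1.
Definition tens1 : tens := [:: (fam1, fam1)].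
Definition tensM : tens -> tens -> tens := tmul famM famM.
Definition tensN : tens -> tens := topp famN.

Lemma cevM x y (c : ctx x y) l l' : cev c (tensM l l') = cev c l * cev c l'.
Proof. by rewrite /cev tev_mul // => a b; rewrite rmorphM. Qed.
Lemma cevN x y (c : ctx x y) l : cev c (tensN l) = - cev c l.
Proof. by rewrite /cev tev_opp // => a; rewrite rmorphN. Qed.
Lemma cev1 x y (c : ctx x y) : cev c tens1 = 1.
Proof. by rewrite /cev tev1 !rmorph1 mulr1. Qed.
Lemma cevD x y (c : ctx x y) l l' : cev c (l ++ l') = cev c l + cev c l'.
Proof. exact: tev_cat. Qed.
Lemma cev_cons x y (c : ctx x y) s t l :
  cev c ((s, t) :: l) = ctx_u c (s x) * ctx_v c (t y) + cev c l.
Proof. exact: tev_cons. Qed.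
Lemma cev_nil x y (c : ctx x y) : cev c [::] = 0. Proof. exact: tev_nil. Qed.

Definition local_ctx x y (c : ctx x y) := [/\ is_local (ctx_ring c),
  forall a, ctx_u c a \is a GRing.unit -> a \is a GRing.unit &
  forall a, ctx_v c a \is a GRing.unit -> a \is a GRing.unit].

(* Points of X x_S X over Spec A. A prime of O_x (x) O_y is recorded by the
   formal tensors of sections whose value lies in it. *)
Record fpt := FPt {
  fp1 : X; fp2 : X; fpQ : set tens;
  fpP : exists c : ctx fp1 fp2, local_ctx c /\ forall l, fpQ l <-> nonunits (cev c l)
}.

Lemma fpt_eq p q : fp1 p = fp1 q -> fp2 p = fp2 q -> fpQ p = fpQ q -> p = q.
Proof.
case: p => x y Q H; case: q => x' y' Q' H' /= ex ey eQ; subst x' y' Q'.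
by congr FPt; exact: Prop_irrelevance.
Qed.

Section Stalk.
Variable p : fpt.

(** The contexts that ought to be maps out of the local ring at [p]; equality of fractions in all of
    them defines the stalk. *)
Definition good (c : ctx (fp1 p) (fp2 p)) := forall l, ~ fpQ p l -> cev c l \is a GRing.unit.

Lemma good_exists : exists c, [/\ good c, local_ctx c &
  forall l, fpQ p l <-> nonunits (cev c l)].
Proof.
have [c [lc hc]] := fpP p; exists c; split=> // l nl.
by apply: contrapT => /nonunitE /hc.
Qed.

Lemma fpQ1 : ~ fpQ p tens1.
Proof. by have [c [_ _ hc]] := good_exists; rewrite hc cev1 => /nonunitE; apply; exact: unitr1. Qed.
Lemma fpQM l l' : ~ fpQ p l -> ~ fpQ p l' -> ~ fpQ p (tensM l l').
Proof.
have [c [_ _ hc]] := good_exists; rewrite !hc !nonunitE => /contrapT ul /contrapT ul'.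
by rewrite cevM unitrM ul ul'.
Qed.
Lemma fpQM_inv l l' : ~ fpQ p (tensM l l') -> ~ fpQ p l /\ ~ fpQ p l'.
Proof.
have [c [_ _ hc]] := good_exists; rewrite !hc !nonunitE => /contrapT.
by rewrite cevM unitrM => /andP[ul ul']; split; apply.
Qed.

Let E := (tens * {d : tens | ~ fpQ p d})%type.
Let val (c : ctx (fp1 p) (fp2 p)) (e : E) := cev c e.1 / cev c (sval e.2).
Let seq_ (e e' : E) := forall c, good c -> val c e = val c e'.
Let one : {d : tens | ~ fpQ p d} := exist _ tens1 fpQ1.
Let mulS (d e : {d : tens | ~ fpQ p d}) : {d : tens | ~ fpQ p d} :=
  exist _ (tensM (sval d) (sval e)) (fpQM (svalP d) (svalP e)).
Let sadd (e e' : E) : E :=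
  (tensM e.1 (sval e'.2) ++ tensM e'.1 (sval e.2), mulS e.2 e'.2).
Let smul (e e' : E) : E := (tensM e.1 e'.1, mulS e.2 e'.2).
Let sopp (e : E) : E := (tensN e.1, e.2).

Let valD c e e' : good c -> val c (sadd e e') = val c e + val c e'.
Proof.
move=> gc; have us := gc _ (svalP e.2); have us' := gc _ (svalP e'.2).
by rewrite /val /= cevD !cevM addr_frac.
Qed.
Let valM c e e' : good c -> val c (smul e e') = val c e * val c e'.
Proof.
move=> gc; have us := gc _ (svalP e.2); have us' := gc _ (svalP e'.2).
by rewrite /val /= !cevM mulr_frac.
Qed.
Let valN c e : val c (sopp e) = - val c e.
Proof. by rewrite /val /= cevN mulNr. Qed.
Let val0 c : val c ([::], one) = 0. Proof. by rewrite /val /= cev_nil mul0r. Qed.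
Let val1 c : val c (tens1, one) = 1. Proof. by rewrite /val /= cev1 divr1. Qed.

Fact stalk_refl e : seq_ e e. Proof. by []. Qed.
Fact stalk_sym e e' : seq_ e e' -> seq_ e' e. Proof. by move=> h c /h. Qed.
Fact stalk_trans a b c : seq_ a b -> seq_ b c -> seq_ a c.
Proof. by move=> h h' z gz; rewrite h // h'. Qed.
Fact stalk_addcong a a' b b' : seq_ a a' -> seq_ b b' -> seq_ (sadd a b) (sadd a' b').
Proof. by move=> h h' c gc; rewrite !valD // h // h'. Qed.
Fact stalk_oppcong a a' : seq_ a a' -> seq_ (sopp a) (sopp a').
Proof. by move=> h c gc; rewrite !valN h. Qed.
Fact stalk_mulcong a a' b b' : seq_ a a' -> seq_ b b' -> seq_ (smul a b) (smul a' b').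
Proof. by move=> h h' c gc; rewrite !valM // h // h'. Qed.
Fact stalk_addA a b d : seq_ (sadd a (sadd b d)) (sadd (sadd a b) d).
Proof. by move=> c gc; rewrite !valD // addrA. Qed.
Fact stalk_addC a b : seq_ (sadd a b) (sadd b a).
Proof. by move=> c gc; rewrite !valD // addrC. Qed.
Fact stalk_add0 a : seq_ (sadd ([::], one) a) a.
Proof. by move=> c gc; rewrite !valD // val0 add0r. Qed.
Fact stalk_addN a : seq_ (sadd (sopp a) a) ([::], one).
Proof. by move=> c gc; rewrite !valD // valN addNr val0. Qed.
Fact stalk_mulA a b d : seq_ (smul a (smul b d)) (smul (smul a b) d).
Proof. by move=> c gc; rewrite !valM // mulrA. Qed.
Fact stalk_mulC a b : seq_ (smul a b) (smul b a).
Proof. by move=> c gc; rewrite !valM // mulrC. Qed.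
Fact stalk_mul1 a : seq_ (smul (tens1, one) a) a.
Proof. by move=> c gc; rewrite !valM // val1 mul1r. Qed.
Fact stalk_mulD a b d : seq_ (smul (sadd a b) d) (sadd (smul a d) (smul b d)).
Proof. by move=> c gc; rewrite !(valM, valD) // mulrDl. Qed.
Fact stalk_nz : ~ seq_ (tens1, one) ([::], one).
Proof.
have [c [gc _ _]] := good_exists => /(_ c gc); rewrite val1 val0 => /eqP.
by rewrite oner_eq0.
Qed.

Definition fp_presentation := RingPresentation stalk_refl stalk_sym stalk_trans
  stalk_addcong stalk_oppcong stalk_mulcong stalk_addA stalk_addC stalk_add0
  stalk_addN stalk_mulA stalk_mulC stalk_mul1 stalk_mulD stalk_nz.

Definition fstalk : comUnitRingType := quo fp_presentation.

Definition ffrac (n d : tens) : fstalk :=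
  if pselect (~ fpQ p d) is left nd then
    @cls fp_presentation (n, exist _ d nd) else 0.

Lemma ffrac_surj (r : fstalk) : exists n d, ~ fpQ p d /\ r = ffrac n d.
Proof.
have [[n [d nd]] ->] := cls_surj r; exists n, d; split=> //.
rewrite /ffrac; case: pselect => // nd'.
by rewrite (Prop_irrelevance nd nd').
Qed.

Lemma ffrac_eq n d n' d' : ~ fpQ p d -> ~ fpQ p d' ->
  ffrac n d = ffrac n' d' <->
  forall c, good c -> cev c n / cev c d = cev c n' / cev c d'.
Proof.
move=> nd nd'; rewrite /ffrac; case: pselect => // h; case: pselect => // h'.
by rewrite cls_eq.
Qed.

Lemma flift (c : ctx (fp1 p) (fp2 p)) : good c ->
  exists g : {rmorphism fstalk -> ctx_ring c},
    forall n d, ~ fpQ p d -> g (ffrac n d) = cev c n / cev c d.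
Proof.
move=> gc; pose g (r : fstalk) := val c (cls_rep r).
have gE (e : fp_presentation) : g (cls e) = val c e.
  by apply: (rep_cls (r := fp_presentation) e c gc).
have [||| g' g'E] := @rmorphism_of fstalk (ctx_ring c) g.
- move=> x y; have [[a ->] [b ->]] := conj (cls_surj x) (cls_surj y).
  by rewrite -clsN -clsD !gE valD // valN.
- move=> x y; have [[a ->] [b ->]] := conj (cls_surj x) (cls_surj y).
  by rewrite -clsM !gE valM.
- by rewrite -cls1 gE val1.
by exists g' => n d nd; rewrite g'E /ffrac; case: pselect.
Qed.

Lemma fconst (x : X) (a : stalk x) : exists s : fam, s x = a.
Proof. by have [U [s [_ _ _ sx]]] := ls_germ a; exists s. Qed.

Lemma ffrac_sub n n' d d' : ~ fpQ p d -> ~ fpQ p d' ->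
  ffrac n d - ffrac n' d' = ffrac (tensM n d' ++ tensN (tensM n' d)) (tensM d d').
Proof.
move=> nd nd'; rewrite /ffrac; case: pselect => // h; case: pselect => // h'.
case: pselect => [h2|]; last by case; exact: fpQM.
rewrite -clsN -clsD; apply/cls_eq => c gc; rewrite valD // valN /val /=.
have us := gc _ nd; have us' := gc _ nd'.
by rewrite cevD cevN !cevM subr_frac.
Qed.

Lemma ffracM n n' d d' : ~ fpQ p d -> ~ fpQ p d' ->
  ffrac n d * ffrac n' d' = ffrac (tensM n n') (tensM d d').
Proof.
move=> nd nd'; rewrite /ffrac; case: pselect => // h; case: pselect => // h'.
case: pselect => [h2|]; last by case; exact: fpQM.
rewrite -clsM; apply/cls_eq => c gc; rewrite valM // /val /= !cevM.
by rewrite mulr_frac ?gc.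
Qed.

Lemma ffrac1 : ffrac tens1 tens1 = 1.
Proof.
rewrite /ffrac; case: pselect => [h|/(_ fpQ1)//].
by rewrite -cls1; apply/cls_eq => c gc; rewrite /val /= !cev1 divr1.
Qed.

Lemma ffrac_unit n d : ~ fpQ p d -> (ffrac n d \is a GRing.unit <-> ~ fpQ p n).
Proof.
move=> nd; split.
  have [c [gc _ hc]] := good_exists; have [g gE] := flift gc.
  move=> /(rmorph_unit g); rewrite gE // unitrM => /andP[un _] /hc.
  by move/nonunitE.
move=> nn; apply/unitrPr; exists (ffrac d n); rewrite ffracM // -ffrac1.
apply/ffrac_eq; [exact: fpQM|exact: fpQ1|] => c gc.
rewrite !cevM !cev1 divr1 (mulrC (cev c d)) divrr // unitrM.
by apply/andP; split; exact: gc.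
Qed.

Lemma fstalk_local : is_local fstalk.
Proof.
have [c [gc [lc _ _] hc]] := good_exists => x y.
have [n [d [nd ->]]] := ffrac_surj x; have [n' [d' [nd' ->]]] := ffrac_surj y.
have nE m e : ~ fpQ p e -> nonunits (ffrac m e) <-> fpQ p m.
  move=> ne; rewrite nonunitE ffrac_unit //; split; [exact: contrapT|by move=> h; apply].
rewrite !nE // => /hc h /hc h'.
have -> : ffrac n' d' = - (0 - ffrac n' d') by rewrite sub0r opprK.
have ns : ~ fpQ p (tensM d' d) by exact: fpQM.
have -> : ffrac n d + - (0 - ffrac n' d') = ffrac n d - ffrac (tensN n') d'.
  congr (_ - _); rewrite sub0r; have [g _] := flift gc.
  have -> : - ffrac n' d' = 0 - ffrac n' d' by rewrite sub0r.
  have -> : 0 = ffrac [::] tens1 :> fstalk.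
    rewrite /ffrac; case: pselect => [h1|/(_ fpQ1)//].
    by rewrite -cls0; apply/cls_eq => z gz; rewrite val0 /val /= cev_nil mul0r.
  rewrite ffrac_sub //; last exact: fpQ1.
  apply/ffrac_eq => //; first by apply: fpQM => //; exact: fpQ1.
  move=> z gz; rewrite cevD cevM cev_nil mul0r add0r !cevN !cevM !cev1.
  by rewrite mulr1 mul1r.
rewrite ffrac_sub // nE; last exact: fpQM.
apply/hc; rewrite cevD cevN !cevM cevN mulNr opprK.
have mulN m m' : nonunits (cev c m) -> nonunits (cev c m * cev c m').
  by move=> /nonunitE nm; apply/nonunitE; rewrite unitrM => /andP[].
by apply: lc; exact: mulN.
Qed.

Lemma ffrac_tev n d n' d' : ~ fpQ p d -> ~ fpQ p d' ->
  (forall c, good c -> cev c n / cev c d = cev c n' / cev c d') ->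
  ffrac n d = ffrac n' d'.
Proof. by move=> nd nd' h; apply/ffrac_eq. Qed.

Lemma fi1_exists : exists i : {rmorphism stalk (fp1 p) -> fstalk},
  forall s : fam, i (s (fp1 p)) = ffrac [:: (s, fam1)] tens1.
Proof.
have n1 := fpQ1.
have ev c (s : fam) : cev c [:: (s, fam1)] = ctx_u c (s (fp1 p)).
  by rewrite /cev tev1 rmorph1 mulr1.
have [f fP] := choice (fun a => @fconst (fp1 p) a).
have [||| i iE] := @rmorphism_of (stalk (fp1 p)) fstalk (fun a => ffrac [:: (f a, fam1)] tens1).
- move=> a b; rewrite ffrac_sub //; apply: ffrac_tev => //; first exact: fpQM.
  by move=> c gc; rewrite cevD cevN !cevM !cev1 !ev !fP !mulr1 rmorphB.
- move=> a b; rewrite ffracM //; apply: ffrac_tev => //; first exact: fpQM.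
  by move=> c gc; rewrite !cevM !cev1 !ev !fP !mulr1 rmorphM.
- rewrite -ffrac1; apply: ffrac_tev => // c gc.
  by rewrite !ev fP.
exists i => s; rewrite iE; apply: ffrac_tev => // c gc.
by rewrite !ev fP.
Qed.

Lemma fi2_exists : exists i : {rmorphism stalk (fp2 p) -> fstalk},
  forall s : fam, i (s (fp2 p)) = ffrac [:: (fam1, s)] tens1.
Proof.
have n1 := fpQ1.
have ev c (s : fam) : cev c [:: (fam1, s)] = ctx_v c (s (fp2 p)).
  by rewrite /cev tev1 rmorph1 mul1r.
have [f fP] := choice (fun a => @fconst (fp2 p) a).
have [||| i iE] := @rmorphism_of (stalk (fp2 p)) fstalk (fun a => ffrac [:: (fam1, f a)] tens1).
- move=> a b; rewrite ffrac_sub //; apply: ffrac_tev => //; first exact: fpQM.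
  by move=> c gc; rewrite cevD cevN !cevM !cev1 !ev !fP !mulr1 rmorphB.
- move=> a b; rewrite ffracM //; apply: ffrac_tev => //; first exact: fpQM.
  by move=> c gc; rewrite !cevM !cev1 !ev !fP !mulr1 rmorphM.
- rewrite -ffrac1; apply: ffrac_tev => // c gc.
  by rewrite !ev fP.
exists i => s; rewrite iE; apply: ffrac_tev => // c gc.
by rewrite !ev fP.
Qed.

Definition fi1 : {rmorphism stalk (fp1 p) -> fstalk} := sval (cid fi1_exists).
Definition fi2 : {rmorphism stalk (fp2 p) -> fstalk} := sval (cid fi2_exists).
Lemma fi1E (s : fam) : fi1 (s (fp1 p)) = ffrac [:: (s, fam1)] tens1.
Proof. by rewrite /fi1; case: cid. Qed.
Lemma fi2E (s : fam) : fi2 (s (fp2 p)) = ffrac [:: (fam1, s)] tens1.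
Proof. by rewrite /fi2; case: cid. Qed.

Lemma fi_compat a : fi1 (al a (fp1 p)) = fi2 (al a (fp2 p)).
Proof.
rewrite fi1E fi2E; apply: ffrac_tev; try exact: fpQ1.
by move=> c gc; rewrite /cev !tev1 !rmorph1 mulr1 !mul1r ctx_uv.
Qed.

(** The stalk as a context of its own. Sections are described by evaluating tensors in it, and
    [flift_taut] maps it to every good context. *)
Definition ftaut : ctx (fp1 p) (fp2 p) := Ctx fi_compat.

Lemma cev_taut l : cev ftaut l = ffrac l tens1.
Proof.
have n1 := fpQ1; elim: l => [|[s t] l IH].
  rewrite cev_nil /ffrac; case: pselect => // h.
  by rewrite -cls0; apply/cls_eq => z gz; rewrite val0 /val /= cev_nil mul0r.
rewrite cev_cons IH /= fi1E fi2E ffracM // /ffrac.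
case: pselect => [h|/(_ (fpQM n1 n1))//]; case: pselect => // h'.
rewrite -clsD; apply/cls_eq => c gc; rewrite valD // /val /=.
by rewrite !cevM !cev1 /cev !tev1 tev_cons /fam1 /= !rmorph1 !mulr1 mul1r !divr1.
Qed.

Lemma taut_unit l : cev ftaut l \is a GRing.unit <-> ~ fpQ p l.
Proof. by rewrite cev_taut ffrac_unit //; exact: fpQ1. Qed.

Lemma ffrac_taut n d : ~ fpQ p d -> ffrac n d = cev ftaut n / cev ftaut d.
Proof.
move=> nd; have ud := (taut_unit d).2 nd; apply: (mulIr ud).
rewrite divrK // !cev_taut ffracM //; last exact: fpQ1.
apply: ffrac_tev; [exact/fpQM/fpQ1|exact: fpQ1|].
move=> c gc; rewrite !cevM !cev1 mulr1 divr1 mulrK //; exact: gc.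
Qed.

Lemma fstalk_frac (r : fstalk) : exists n d, ~ fpQ p d /\ r = cev ftaut n / cev ftaut d.
Proof.
by have [n [d [nd ->]]] := ffrac_surj r; exists n, d; split=> //; exact: ffrac_taut.
Qed.

Lemma flift_taut (c : ctx (fp1 p) (fp2 p)) : good c ->
  exists g : {rmorphism fstalk -> ctx_ring c},
    [/\ forall a, g (fi1 a) = ctx_u c a, forall a, g (fi2 a) = ctx_v c a &
        forall l, g (cev ftaut l) = cev c l].
Proof.
move=> gc; have [g gE] := flift gc; have n1 := fpQ1; exists g.
have gl l : g (cev ftaut l) = cev c l by rewrite cev_taut gE // cev1 divr1.
split=> // a.
  have [s <-] := fconst a; rewrite fi1E -cev_taut gl /cev tev1 rmorph1 mulr1 //.
have [s <-] := fconst a; rewrite fi2E -cev_taut gl /cev tev1 rmorph1 mul1r //.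
Qed.

Lemma local_taut : local_ctx ftaut.
Proof.
have [c [gc [_ lu lv] _]] := good_exists; have [g [gu gv _]] := flift_taut gc.
split; first exact: fstalk_local.
- by move=> a /= /(rmorph_unit g); rewrite gu; exact: lu.
- by move=> a /= /(rmorph_unit g); rewrite gv; exact: lv.
Qed.

End Stalk.
End SelfProduct.

(** * Topology and structure sheaf of the self-product *)

Section SelfProductSpace.
Variables (X : lrspace) (A : comUnitRingType) (al : A -> forall x : X, stalk x).
Local Notation fpt := (fpt al).
Local Notation fam := (fam X).
Local Notation tens := (tens X).
Implicit Types (U V : set X) (l n d : tens) (p q : fpt) (O : set fpt).

Fixpoint tsect U V l : Prop :=
  if l is (s, t) :: l' then [/\ ls_sect U s, ls_sect V t & tsect U V l'] else True.

Lemma tsect_res U V U' V' l : open U -> open V -> open U' -> open V' ->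
  U' `<=` U -> V' `<=` V -> tsect U V l -> tsect U' V' l.
Proof.
move=> oU oV oU' oV' UU VV; elim: l => // -[s t] l IH [hs ht hl].
by split; [apply: ls_res hs|apply: ls_res ht|exact: IH].
Qed.

Lemma tsect_cat U V l l' : tsect U V l -> tsect U V l' -> tsect U V (l ++ l').
Proof. by elim: l => // -[s t] l IH [hs ht hl] hl'; split=> //; exact: IH. Qed.

Lemma tsect_mul U V l l' : open U -> open V ->
  tsect U V l -> tsect U V l' -> tsect U V (tensM l l').
Proof.
move=> oU oV; elim: l => // -[s t] l IH [hs ht hl] hl'.
rewrite /tensM /tmul /=; apply: tsect_cat; last exact: IH.
elim: l' hl' {IH} => // -[s' t'] l' IH' [hs' ht' hl']; split=> /=.
- exact: ls_sectM.
- exact: ls_sectM.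
- exact: IH'.
Qed.

Lemma tsect_opp U V l : open U -> tsect U V l -> tsect U V (tensN l).
Proof.
move=> oU; elim: l => // -[s t] l IH [hs ht hl]; split=> //; last exact: IH.
exact: sectN.
Qed.

Lemma tsect1 U V : open U -> open V -> tsect U V (tens1 X).
Proof. by move=> oU oV; split=> //; exact: ls_sect1. Qed.

Definition fbasic U V l : set fpt := [set p | [/\ U (fp1 p), V (fp2 p) & ~ fpQ p l]].

Definition fopen O := forall p, O p -> exists U V l,
  [/\ open U, open V, tsect U V l, fbasic U V l p & fbasic U V l `<=` O].

Lemma fbasicI U V l U' V' l' :
  fbasic (U `&` U') (V `&` V') (tensM l l') = fbasic U V l `&` fbasic U' V' l'.
Proof.
apply/seteqP; split=> p.
  by move=> [[? ?] [? ?] /fpQM_inv[? ?]].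
by move=> [[? ? ?] [? ? ?]]; split; [split|split|exact: fpQM].
Qed.

Lemma fbasic_cap U V l U' V' l' : open U -> open V -> tsect U V l ->
  open U' -> open V' -> tsect U' V' l' ->
  [/\ open (U `&` U'), open (V `&` V') & tsect (U `&` U') (V `&` V') (tensM l l')].
Proof.
move=> oU oV hl oU' oV' hl'.
have oUU := openI oU oU'; have oVV := openI oV oV'.
split=> //; apply: tsect_mul => //.
  by apply: tsect_res hl => // x [].
by apply: tsect_res hl' => // x [].
Qed.

HB.instance Definition _ := gen_eqMixin fpt.
HB.instance Definition _ := gen_choiceMixin fpt.

Fact fopenT : fopen setT.
Proof.
move=> p _; exists setT, setT, (tens1 X); split=> //; try exact: openT.
  by apply: tsect1; exact: openT.
by split=> //; exact: fpQ1.
Qed.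

Fact fopenI : setI_closed fopen.
Proof.
move=> O O' hO hO' p [Op Op'].
have [U [V [l [oU oV hl bp bO]]]] := hO p Op.
have [U' [V' [l' [oU' oV' hl' bp' bO']]]] := hO' p Op'.
have [o1 o2 h] := fbasic_cap oU oV hl oU' oV' hl'.
exists (U `&` U'), (V `&` V'), (tensM l l'); split=> //; rewrite fbasicI //.
exact: setISS.
Qed.

Fact fopen_bigU (I : Type) (f : I -> set fpt) :
  (forall i, fopen (f i)) -> fopen (\bigcup_i f i).
Proof.
move=> hf p [i _ fp]; have [U [V [l [oU oV hl bp bO]]]] := hf i p fp.
exists U, V, l; split=> //; apply: subset_trans bO _; exact: bigcup_sup.
Qed.

HB.instance Definition _ := isOpenTopological.Build fpt fopenT fopenI fopen_bigU.

Lemma fopenE (O : set fpt) : open O <-> fopen O.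
Proof. by []. Qed.

Lemma fbasic_open U V l : open U -> open V -> tsect U V l -> open (fbasic U V l).
Proof. by move=> oU oV hl; apply/fopenE => p bp; exists U, V, l; split. Qed.

Definition fsect (O : set fpt) (s : forall p : fpt, fstalk p) := forall p, O p ->
  exists U V n d, [/\ [/\ open U, open V, tsect U V n & tsect U V d],
    fbasic U V d p & forall q, fbasic U V d q -> O q ->
      s q = cev (ftaut q) n / cev (ftaut q) d].

Record alg_chart (B : comUnitRingType) (U : set X) (psi : B -> fam)
    (h : {rmorphism A -> B}) : Prop := AlgChart {
  ac_spec : is_Spec U psi;
  ac_alg : forall a x, U x -> psi (h a) x = al a x
}.

Section TwoCharts.
Variables (B B' : comUnitRingType) (U U' : set X) (psi : B -> fam) (psi' : B' -> fam)
  (h : {rmorphism A -> B}) (h' : {rmorphism A -> B'}).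
Hypotheses (ch : alg_chart U psi h) (ch' : alg_chart U' psi' h').
Variables (T : comUnitRingType) (i : {rmorphism B -> T}) (j : {rmorphism B' -> T}).
Hypotheses (po : is_pushout h h' i j) (gen : forall t, exists l : seq (B * B'), t = tev i j l).

Let sp := ac_spec ch.
Let sp' := ac_spec ch'.

Definition chart_map x y (c : ctx al x y) (k : {rmorphism T -> ctx_ring c}) :=
  (forall b, k (i b) = ctx_u c (psi b x)) /\ (forall b, k (j b) = ctx_v c (psi' b y)).

Lemma chart_map_exists x y (c : ctx al x y) : U x -> U' y -> exists k, chart_map (c := c) k.
Proof.
move=> Ux Uy; have [h1 h1E] := spec_rmorphism sp Ux; have [h2 h2E] := spec_rmorphism sp' Uy.
have [_ pu] := po.
pose u : {rmorphism B -> ctx_ring c} := [the {rmorphism _ -> _} of ctx_u c \o h1].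
pose v : {rmorphism B' -> ctx_ring c} := [the {rmorphism _ -> _} of ctx_v c \o h2].
have [|w [hu hv _]] := pu (ctx_ring c) u v.
  move=> a; rewrite /u /v /= h1E h2E (ac_alg ch) // (ac_alg ch') //; exact: ctx_uv.
by exists w; split=> b; [rewrite hu /u /= h1E|rewrite hv /v /= h2E].
Qed.

(** Each factor of a term is locally a fraction of chart functions. Multiplying by the denominators
    term by term turns the tensor into a fraction [b / s], uniformly over all contexts at nearby
    points. *)
Lemma chart_represent_near V V' l x y : open V -> open V' -> tsect V V' l ->
    V x -> V' y -> U x -> U' y ->
  exists (s b : T) (V1 V1' : set X), [/\ open V1, open V1', V1 x, V1' y &
    [/\ V1 `<=` V `&` U, V1' `<=` V' `&` U' &
    forall x1 y1 (c : ctx al x1 y1) k, V1 x1 -> V1' y1 -> chart_map (c := c) k ->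
      k s \is a GRing.unit /\ k s * cev c l = k b]].
Proof.
move=> oV oV' hl Vx Vy Ux Uy.
have oU := Spec_open sp; have oU' := Spec_open sp'.
elim: l hl => [|[s0 t0] l IH].
  move=> _; exists 1, 0, (V `&` U), (V' `&` U'); split=> //.
  - exact: openI.
  - exact: openI.
  by split=> // x1 y1 c k _ _ _; rewrite rmorph1 rmorph0 cev_nil unitr1 mulr0.
move=> [hs ht /IH[s [b [V1 [V1' [oV1 oV1' V1x V1y [V1V V1V' H]]]]]]].
have [b0 [e0 [V2 [oV2 V2x V2V H2]]]] := spec_frac sp oV hs Vx Ux.
have [b0' [e0' [V2' [oV2' V2y V2V' H2']]]] := spec_frac sp' oV' ht Vy Uy.
exists (i e0 * j e0' * s), (i b0 * j b0' * s + i e0 * j e0' * b), (V1 `&` V2), (V1' `&` V2').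
split=> //; first exact: openI.
  exact: openI.
split; first by move=> z [/V1V].
  by move=> z [/V1V'].
move=> x1 y1 c k [V1x1 V2x1] [V1y1 V2y1] ck.
have [us E] := H x1 y1 c k V1x1 V1y1 ck; have [k1 k2] := ck.
have [ue E2] := H2 x1 V2x1; have [ue' E2'] := H2' y1 V2y1.
rewrite cev_cons; split.
  by rewrite !rmorphM !unitrM us k1 k2 !rmorph_unit.
rewrite !rmorphD !rmorphM -E !k1 !k2 -E2 -E2' !rmorphM; ring.
Qed.

Lemma chart_represent l x y : U x -> U' y -> exists s b : T,
  forall (c : ctx al x y) k, chart_map (c := c) k ->
      k s \is a GRing.unit /\ k s * cev c l = k b.
Proof.
move=> Ux Uy; elim: l => [|[s0 t0] l [s [b H]]].
  exists 1, 0 => c k _; by rewrite rmorph1 rmorph0 cev_nil unitr1 mulr0.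
have [h1 h1E [hu hf hk]] := Spec_stalk sp Ux.
have [h2 h2E [hu' hf' hk']] := Spec_stalk sp' Uy.
have [b0 [e0 [ne0]]] := hf (s0 x); rewrite !h1E => E2.
have [b0' [e0' [ne0']]] := hf' (t0 y); rewrite !h2E => E2'.
exists (i e0 * j e0' * s), (i b0 * j b0' * s + i e0 * j e0' * b) => c k ck.
have [us E] := H c k ck; have [k1 k2] := ck.
have ue := hu _ ne0; have ue' := hu' _ ne0'; rewrite h1E in ue; rewrite h2E in ue'.
rewrite cev_cons; split.
  by rewrite !rmorphM !unitrM us k1 k2 !rmorph_unit.
rewrite !rmorphD !rmorphM -E !k1 !k2 -E2 -E2' !rmorphM; ring.
Qed.

Section AtPoint.
Variable p : fpt.
Hypotheses (Up : U (fp1 p)) (Up' : U' (fp2 p)).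
Variable k : {rmorphism T -> ctx_ring (ftaut p)}.
Hypothesis kc : chart_map (c := ftaut p) k.

Definition cprime : set T := [set t | nonunits (k t)].

Lemma cprimeP : is_prime cprime.
Proof.
split.
- split=> [|a b|r a]; rewrite /cprime /=.
  + by apply/negP; rewrite rmorph0 unitr0.
  + by rewrite rmorphD; exact: fstalk_local.
  + by move=> /nonunitE na; apply/nonunitE; rewrite rmorphM unitrM => /andP[].
- by rewrite /cprime /= rmorph1; apply/nonunitE => /(_ (unitr1 _)).
- move=> a b; rewrite /cprime /= => /nonunitE nab.
  apply: contrapT => /not_orP[]; rewrite !nonunitE => /contrapT ua /contrapT ub.
  by apply: nab; rewrite rmorphM unitrM ua ub.
Qed.

(** The kernel clause is the delicate one: the localization of [T] at [cprime] is itself a good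
    context at [p], so the stalk maps to it, and what dies in the stalk dies in the localization. *)
Lemma cprime_localization : is_localization cprime k.
Proof.
have ns s : ~ cprime s -> k s \is a GRing.unit.
  by rewrite /cprime /= nonunitE => /contrapT.
split=> //.
- move=> r; have [n [d [nd ->]]] := fstalk_frac r.
  have [s [b H]] := chart_represent n Up Up'; have [us E] := H _ _ kc.
  have [s' [b' H']] := chart_represent d Up Up'; have [us' E'] := H' _ _ kc.
  have ud := (taut_unit p d).2 nd.
  exists (s' * b), (s * b'); split.
    rewrite /cprime /= => /nonunitE; apply.
    by rewrite rmorphM -E' !unitrM us us' ud.
  rewrite !rmorphM -E -E' [_ / _]mulrC.
  have -> : k s * (k s' * cev (ftaut p) d) * ((cev (ftaut p) d)^-1 * cev (ftaut p) n) =
    k s' * (k s * cev (ftaut p) n) * (cev (ftaut p) d * (cev (ftaut p) d)^-1) by ring.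
  by rewrite divrr // mulr1.
move=> b kb.
have [L [g gl]] := localization_exists cprimeP; have [gu _ gk] := gl.
have [h1 h1E l1] := Spec_stalk sp Up; have [h2 h2E l2] := Spec_stalk sp' Up'.
have pr1 := spec_primeP sp Up; have pr2 := spec_primeP sp' Up'.
have [k1 k2] := kc; have [_ lu lv] := local_taut p.
have [|u uE] := localization_univ pr1 l1 (k := [the {rmorphism _ -> _} of g \o i]).
  move=> s /nonunitE /contrapT us; apply: gu.
  by rewrite /cprime /= nonunitE; apply; rewrite k1 rmorph_unit.
have [|v vE] := localization_univ pr2 l2 (k := [the {rmorphism _ -> _} of g \o j]).
  move=> s /nonunitE /contrapT us; apply: gu.
  by rewrite /cprime /= nonunitE; apply; rewrite k2 rmorph_unit.
have uv a : u (al a (fp1 p)) = v (al a (fp2 p)).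
  rewrite -(ac_alg ch a Up) -(ac_alg ch' a Up') -h1E -h2E uE vE /=.
  by case: po => <-.
pose c := Ctx uv.
have gc : chart_map (c := c) g.
  by split=> a /=; rewrite -?h1E -?h2E ?uE ?vE.
have good_c : good c.
  move=> l nl; have [s [b' H]] := chart_represent l Up Up'.
  have [us E] := H _ _ kc; have [_ E'] := H _ _ gc.
  have ub : ~ cprime b'.
    rewrite /cprime /= nonunitE; apply; rewrite -E unitrM us.
    exact/(taut_unit p).
  by have := gu _ ub; rewrite -E' unitrM => /andP[].
have [r [ru rv _]] := flift_taut good_c.
have rk t : r (k t) = g t.
  have [l ->] := gen t; rewrite !rmorph_tev; apply: tev_eq => a /=.
    by rewrite k1 /= ru /= -h1E uE.
  by rewrite k2 /= rv /= -h2E vE.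
by apply: gk; rewrite -rk kb rmorph0.
Qed.

End AtPoint.

End TwoCharts.
End SelfProductSpace.

Section SelfProductScheme.
Variables (X : lrspace) (A : comUnitRingType) (al : A -> forall x : X, stalk x).
Hypothesis cover : forall x : X, exists (B : comUnitRingType) (U : set X)
  (psi : B -> fam X) (h : {rmorphism A -> B}), U x /\ alg_chart al U psi h.
Local Notation fpt := (fpt al).
Local Notation fam := (fam X).
Local Notation tens := (tens X).
Local Notation fbasic := (@fbasic X A al).
Implicit Types (U V : set X) (l n d : tens) (p q : fpt) (O : set fpt).

Let W p := ctx_ring (ftaut p).

Lemma taut_mul_unit p l l' : ~ fpQ p (tensM l l') ->
  cev (ftaut p) l \is a GRing.unit /\ cev (ftaut p) l' \is a GRing.unit.
Proof. by move=> /fpQM_inv[? ?]; split; exact/taut_unit. Qed.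

Lemma germ_list l (x y : X) : exists U V l', [/\ [/\ open U, open V, U x & V y],
  tsect U V l' & forall c : ctx al x y, cev c l' = cev c l].
Proof.
elim: l => [|[s t] l [U [V [l' [[oU oV Ux Vy] hl' H]]]]].
  by exists setT, setT, [::]; split=> //; split=> //; exact: openT.
have [U1 [s' [oU1 U1x hs' sx]]] := ls_germ (s x).
have [V1 [t' [oV1 V1y ht' tx]]] := ls_germ (t y).
have oUU := openI oU oU1; have oVV := openI oV oV1.
exists (U `&` U1), (V `&` V1), ((s', t') :: l'); split=> //; last first.
  by move=> c; rewrite !cev_cons H sx tx.
split.
- by apply: ls_res hs' => // z [].
- by apply: ls_res ht' => // z [].
- by apply: tsect_res hl' => // z [].
Qed.

Fact fsect_ext O s t : open O -> (forall p, O p -> s p = t p) ->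
  fsect O s -> fsect O t.
Proof.
move=> _ st hs p Op; have [U [V [n [d [h1 bp H]]]]] := hs p Op.
by exists U, V, n, d; split=> // q bq Oq; rewrite -st // H.
Qed.

Fact fsect1 O : open O -> fsect O (fun p => 1 : fstalk p).
Proof.
move=> _ p Op; exists setT, setT, (tens1 X), (tens1 X); split.
- by split; [exact: openT|exact: openT| |]; apply: tsect1; exact: openT.
- by split=> //; exact: fpQ1.
- by move=> q _ _; rewrite cev1 divr1.
Qed.

Fact fsectB O (s t : forall p : fpt, fstalk p) : open O -> fsect O s -> fsect O t ->
  fsect O (fun p => s p - t p).
Proof.
move=> _ hs ht p Op; have [U [V [n [d [[oU oV hn hd] bp H]]]]] := hs p Op.
have [U' [V' [n' [d' [[oU' oV' hn' hd'] bp' H']]]]] := ht p Op.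
have oUU := openI oU oU'; have oVV := openI oV oV'.
have r1 l : tsect U V l -> tsect (U `&` U') (V `&` V') l.
  by apply: tsect_res => // z [].
have r2 l : tsect U' V' l -> tsect (U `&` U') (V `&` V') l.
  by apply: tsect_res => // z [].
exists (U `&` U'), (V `&` V'), (tensM n d' ++ tensN (tensM n' d)), (tensM d d'); split.
- split=> //; last by apply: tsect_mul => //; [exact: r1|exact: r2].
  apply: tsect_cat; first by apply: tsect_mul => //; [exact: r1|exact: r2].
  by apply: tsect_opp => //; apply: tsect_mul => //; [exact: r2|exact: r1].
- by rewrite fbasicI.
- move=> q bq Oq; have [_ _ /taut_mul_unit[ud ud']] := bq.
  move: bq; rewrite fbasicI => -[bq bq']; rewrite H // H' //.
  by rewrite cevD cevN !cevM subr_frac.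
Qed.

Fact fsectM O (s t : forall p : fpt, fstalk p) : open O -> fsect O s -> fsect O t ->
  fsect O (fun p => s p * t p).
Proof.
move=> _ hs ht p Op; have [U [V [n [d [[oU oV hn hd] bp H]]]]] := hs p Op.
have [U' [V' [n' [d' [[oU' oV' hn' hd'] bp' H']]]]] := ht p Op.
have oUU := openI oU oU'; have oVV := openI oV oV'.
have r1 l : tsect U V l -> tsect (U `&` U') (V `&` V') l.
  by apply: tsect_res => // z [].
have r2 l : tsect U' V' l -> tsect (U `&` U') (V `&` V') l.
  by apply: tsect_res => // z [].
exists (U `&` U'), (V `&` V'), (tensM n n'), (tensM d d'); split.
- by split=> //; apply: tsect_mul => //; [exact: r1|exact: r2|exact: r1|exact: r2].
- by rewrite fbasicI.
- move=> q bq Oq; have [_ _ /taut_mul_unit[ud ud']] := bq.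
  move: bq; rewrite fbasicI => -[bq bq']; rewrite H // H' //.
  by rewrite !cevM mulr_frac.
Qed.

Fact fsect_res O O' s : open O -> open O' -> O' `<=` O -> fsect O s -> fsect O' s.
Proof.
move=> _ _ OO hs p Op; have [U [V [n [d [h1 bp H]]]]] := hs p (OO p Op).
by exists U, V, n, d; split=> // q bq Oq; apply: H => //; exact: OO.
Qed.

Fact fsect_glue O s : open O ->
  (forall p, O p -> exists O', [/\ open O', O' p, O' `<=` O & fsect O' s]) -> fsect O s.
Proof.
move=> _ hs p Op; have [O' [oO' O'p _ hO']] := hs p Op.
have [U [V [n [d [[oU oV hn hd] bp H]]]]] := hO' p O'p.
have [U' [V' [l [oU' oV' hl bp' bO']]]] := (fopenE O').1 oO' p O'p.
have oUU := openI oU oU'; have oVV := openI oV oV'.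
have r1 l' : tsect U V l' -> tsect (U `&` U') (V `&` V') l'.
  by apply: tsect_res => // z [].
have r2 : tsect (U `&` U') (V `&` V') l by apply: tsect_res hl => // z [].
exists (U `&` U'), (V `&` V'), (tensM n l), (tensM d l); split.
- by split=> //; apply: tsect_mul => //; exact: r1.
- by rewrite fbasicI.
- move=> q bq Oq; have [_ _ /taut_mul_unit[ud ul]] := bq.
  move: bq; rewrite fbasicI => -[bq /bO' bq']; rewrite H //.
  by rewrite !cevM -mulr_frac // divrr // mulr1.
Qed.

Fact fsect_germ p (a : fstalk p) : exists O s, [/\ open O, O p, fsect O s & s p = a].
Proof.
have [n [d [nd ->]]] := fstalk_frac a.
have [U [V [n' [[oU oV Ux Vy] hn' Hn]]]] := germ_list n (fp1 p) (fp2 p).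
have [U' [V' [d' [[oU' oV' Ux' Vy'] hd' Hd]]]] := germ_list d (fp1 p) (fp2 p).
have oUU := openI oU oU'; have oVV := openI oV oV'.
have hd2 : tsect (U `&` U') (V `&` V') d' by apply: tsect_res hd' => // z [].
have nd' : ~ fpQ p d' by apply/taut_unit; rewrite Hd; exact/taut_unit.
exists (fbasic (U `&` U') (V `&` V') d'), (fun q => cev (ftaut q) n' / cev (ftaut q) d').
split=> //; last by rewrite Hn Hd.
- exact: fbasic_open.
- move=> q bq; exists (U `&` U'), (V `&` V'), n', d'; split=> //.
  by split=> //; apply: tsect_res hn' => // z [].
Qed.

Lemma two_charts p : exists (B B' : comUnitRingType) (U U' : set X) (psi : B -> fam)
    (psi' : B' -> fam) (h : {rmorphism A -> B}) (h' : {rmorphism A -> B'}),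
  [/\ alg_chart al U psi h, alg_chart al U' psi' h', U (fp1 p), U' (fp2 p) &
  exists (T : comUnitRingType) (i : {rmorphism B -> T}) (j : {rmorphism B' -> T}),
    is_pushout h h' i j /\ forall t, exists l : seq (B * B'), t = tev i j l].
Proof.
have [B [U [psi [h [Up ch]]]]] := cover (fp1 p).
have [B' [U' [psi' [h' [Up' ch']]]]] := cover (fp2 p).
exists B, B', U, U', psi, psi', h, h'; split=> //.
have [h1 h1E] := spec_rmorphism (ac_spec ch) Up.
have [h2 h2E] := spec_rmorphism (ac_spec ch') Up'.
have [|T [i [j [po gen]]]] := @pushout_exists _ _ _ (fstalk p) h h'
  [the {rmorphism _ -> _} of fi1 p \o h1] [the {rmorphism _ -> _} of fi2 p \o h2].
  move=> a /=; rewrite h1E h2E (ac_alg ch) // (ac_alg ch') //.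
  exact: (ctx_uv (ftaut p)).
by exists T, i, j.
Qed.

Section OnCharts.
Variables (B B' : comUnitRingType) (U U' : set X) (psi : B -> fam) (psi' : B' -> fam)
  (h : {rmorphism A -> B}) (h' : {rmorphism A -> B'}).
Hypotheses (ch : alg_chart al U psi h) (ch' : alg_chart al U' psi' h').
Variables (T : comUnitRingType) (i : {rmorphism B -> T}) (j : {rmorphism B' -> T}).
Hypotheses (po : is_pushout h h' i j) (gen : forall t, exists l : seq (B * B'), t = tev i j l).

Let sp := ac_spec ch.
Let sp' := ac_spec ch'.
Let oU : open U. Proof. exact: Spec_open sp. Qed.
Let oU' : open U'. Proof. exact: Spec_open sp'. Qed.

Definition chart_tens (t : T) : tens :=
  [seq (psi e.1, psi' e.2) | e <- sval (cid (gen t))].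

Lemma chart_tens_sect t : tsect U U' (chart_tens t).
Proof.
rewrite /chart_tens; elim: (sval _) => // -[a b] l IH; split=> //=.
  exact: Spec_sect sp a.
exact: Spec_sect sp' b.
Qed.

Lemma chart_tensE x y (c : ctx al x y) k t : chart_map psi psi' i j (c := c) k ->
  cev c (chart_tens t) = k t.
Proof.
move=> [k1 k2]; rewrite /chart_tens; case: cid => l /= ->.
rewrite rmorph_tev /cev /tev big_map; apply: eq_bigr => a _ /=.
by rewrite k1 k2.
Qed.

Definition chart_dom : set fpt := [set p | U (fp1 p) /\ U' (fp2 p)].

Lemma chart_dom_open : open chart_dom.
Proof.
have -> : chart_dom = fbasic U U' (tens1 X).
  by apply/seteqP; split=> p; [move=> [? ?]; split=> //; exact: fpQ1|case].
by apply: fbasic_open => //; exact: tsect1.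
Qed.

Lemma chart_represent_open V V' l p : open V -> open V' -> tsect V V' l ->
    V (fp1 p) -> V' (fp2 p) -> chart_dom p ->
  exists s b O, [/\ open O, O p, O `<=` chart_dom &
    forall q, O q -> [/\ V (fp1 q), V' (fp2 q) & forall (c : ctx al (fp1 q) (fp2 q)) k,
      chart_map psi psi' i j (c := c) k ->
      k s \is a GRing.unit /\ k s * cev c l = k b]].
Proof.
move=> oV oV' hl Vp Vp' [Up Up'].
have [s [b [V1 [V1' [oV1 oV1' V1p V1p' [V1V V1V' H]]]]]] :=
  chart_represent_near ch ch' i j oV oV' hl Vp Vp' Up Up'.
exists s, b, (fbasic V1 V1' (tens1 X)); split.
- by apply: fbasic_open => //; exact: tsect1.
- by split=> //; exact: fpQ1.
- by move=> q [/V1V[_ ?] /V1V'[_ ?] _].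
- move=> q [q1 q2 _]; split; [by case: (V1V _ q1)|by case: (V1V' _ q2)|].
  by move=> c k ck; exact: H.
Qed.

Lemma sect_zero_near O s p : open O -> fsect O s -> O p -> chart_dom p -> s p = 0 ->
  exists O', [/\ open O', O' p, O' `<=` O & forall q, O' q -> s q = 0].
Proof.
move=> oO hs Op Dp s0; have [Up Up'] := Dp.
have [V [V' [n [d [[oV oV' hn hd] bp H]]]]] := hs p Op.
have [Vp Vp' nd] := bp.
have [sg [b [O1 [oO1 O1p O1D H1]]]] := chart_represent_open oV oV' hn Vp Vp' Dp.
have [k kc] := chart_map_exists ch ch' po (ftaut p) Up Up'.
have ud := (taut_unit p d).2 nd.
have n0 : cev (ftaut p) n = 0.
  by rewrite -[LHS](divrK ud) -(H p bp Op) s0 mul0r.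
have [_ _ /(_ _ k kc)[us E]] := H1 p O1p.
have kb : k b = 0 by rewrite -E n0 mulr0.
have [_ _ /(_ b kb)[s' ns' s'b]] := cprime_localization ch ch' po gen Up Up' kc.
have us' : k s' \is a GRing.unit by apply: contrapT => /nonunitE.
have ob : open (fbasic U U' (chart_tens s')).
  by apply: fbasic_open => //; exact: chart_tens_sect.
have ob2 : open (fbasic V V' d) by exact: fbasic_open.
exists (O `&` O1 `&` fbasic U U' (chart_tens s') `&` fbasic V V' d); split.
- by apply: openI => //; apply: openI => //; exact: openI.
- split=> //; split=> //; split=> //; apply/taut_unit.
  by rewrite (chart_tensE _ kc).
- by move=> q [[[]]].
move=> q [[[Oq O1q] bq] bq2]; rewrite H //.
have [Uq Uq' /taut_unit uq] := bq.
have [k' kc'] := chart_map_exists ch ch' po (ftaut q) Uq Uq'.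
have [_ _ /(_ _ k' kc')[us2 E2]] := H1 q O1q.
rewrite (chart_tensE _ kc') in uq.
have kb' : k' b = 0.
  by apply: (mulrI uq); rewrite -rmorphM s'b rmorph0 mulr0.
suff -> : cev (ftaut q) n = 0 by rewrite mul0r.
by apply: (mulrI us2); rewrite E2 kb' mulr0.
Qed.

Definition chart_psi (t : T) (p : fpt) : fstalk p := cev (ftaut p) (chart_tens t).

Lemma chart_psiE p k t : chart_map psi psi' i j (c := ftaut p) k -> chart_psi t p = k t.
Proof. exact: chart_tensE. Qed.

End OnCharts.

Fact fsect_germ0 O s p : open O -> fsect O s -> O p -> s p = 0 ->
  exists O', [/\ open O', O' p, O' `<=` O & forall q, O' q -> s q = 0].
Proof.
move=> oO hs Op s0.
have [B [B' [U [U' [psi [psi' [h [h' [ch ch' Up Up' [T [i [j [po gen]]]]]]]]]]]]] := two_charts p.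
exact: (sect_zero_near ch ch' po gen oO hs Op (conj Up Up') s0).
Qed.

Definition fp_space : lrspace := LRSpace fsect_ext fsect1 fsectB fsectM fsect_res
  fsect_glue fsect_germ fsect_germ0 (@fstalk_local X A al).

End SelfProductScheme.

Section SelfProductCharts.
Variables (X : lrspace) (A : comUnitRingType) (al : A -> forall x : X, stalk x).
Hypothesis cover : forall x : X, exists (B : comUnitRingType) (U : set X)
  (psi : B -> fam X) (h : {rmorphism A -> B}), U x /\ alg_chart al U psi h.
Local Notation fpt := (fpt al).
Local Notation fam := (fam X).
Local Notation tens := (tens X).
Local Notation fbasic := (@fbasic X A al).
Local Notation P := (fp_space cover).

Section OnCharts.
Variables (B B' : comUnitRingType) (U U' : set X) (psi : B -> fam) (psi' : B' -> fam)
  (h : {rmorphism A -> B}) (h' : {rmorphism A -> B'}).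
Hypotheses (ch : alg_chart al U psi h) (ch' : alg_chart al U' psi' h').
Variables (T : comUnitRingType) (i : {rmorphism B -> T}) (j : {rmorphism B' -> T}).
Hypotheses (po : is_pushout h h' i j) (gen : forall t, exists l : seq (B * B'), t = tev i j l).

Let sp := ac_spec ch.
Let sp' := ac_spec ch'.
Let oU : open U. Proof. exact: Spec_open sp. Qed.
Let oU' : open U'. Proof. exact: Spec_open sp'. Qed.
Let D : set P := chart_dom (al := al) U U'.
Let psiT : T -> forall p : P, stalk p := @chart_psi X A al B B' psi psi' T i j gen.

Let taut_map (p : fpt) : D p -> exists k, chart_map psi psi' i j (c := ftaut p) k.
Proof. by move=> [Up Up']; exact: (chart_map_exists ch ch' po). Qed.

Let psiTE (p : fpt) k t : chart_map psi psi' i j (c := ftaut p) k -> psiT t p = k t.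
Proof. exact: chart_psiE. Qed.

Lemma chart_sect t : ls_sect D (psiT t).
Proof.
move=> p [Up Up']; exists U, U', (chart_tens psi psi' gen t), (tens1 X); split.
- split=> //; last exact: tsect1.
  exact: (chart_tens_sect ch ch' gen t).
- by split=> //; exact: fpQ1.
- by move=> q _ _; rewrite cev1 divr1.
Qed.

(** The localization of [T] at [Q] is a context for the points of the two charts below [Q], and its
    nonunits define the point sought. *)
Lemma chart_spec_surj (Q : set T) : is_prime Q ->
  exists2 p, D p & Q = [set t | nonunits (psiT t p)].
Proof.
move=> pQ; have [L [g gl]] := localization_exists pQ; have [gu _ gk] := gl.
have pre (C : comUnitRingType) (f : {rmorphism C -> T}) : is_prime [set b | Q (f b)].
  have [[Q0 QD QM] Q1 Qp] := pQ; split; [split|..] => /=.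
  - by rewrite rmorph0.
  - by move=> a b; rewrite rmorphD; exact: QD.
  - by move=> r a; rewrite rmorphM; exact: QM.
  - by rewrite rmorph1.
  - by move=> a b; rewrite rmorphM; exact: Qp.
have [x Ux xE] := Spec_surj sp (pre _ i); have [y Uy yE] := Spec_surj sp' (pre _ j).
have [h1 h1E l1] := Spec_stalk sp Ux; have [h2 h2E l2] := Spec_stalk sp' Uy.
have pr1 := spec_primeP sp Ux; have pr2 := spec_primeP sp' Uy.
have [|u uE] := localization_univ pr1 l1 (k := [the {rmorphism _ -> _} of g \o i]).
  by move=> s ns; apply: gu => Qs; apply: ns; have : [set b | Q (i b)] s by []; rewrite xE.
have [|v vE] := localization_univ pr2 l2 (k := [the {rmorphism _ -> _} of g \o j]).
  by move=> s ns; apply: gu => Qs; apply: ns; have : [set b | Q (j b)] s by []; rewrite yE.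
have uv a : u (al a x) = v (al a y).
  rewrite -(ac_alg ch a Ux) -(ac_alg ch' a Uy) -h1E -h2E uE vE /=.
  by case: po => <-.
pose c := Ctx uv.
have gc : chart_map psi psi' i j (c := c) g.
  by split=> a /=; rewrite -?h1E -?h2E ?uE ?vE.
have lc : local_ctx c.
  split=> /=; first exact: (localization_local pQ gl).
  - move=> a; have [b [s [ns ->]]] := localization_frac l1 a.
    have us : h1 s \is a GRing.unit by case: l1 => hu _ _; exact: hu.
    rewrite rmorphM rmorphV // uE /= unitrM => /andP[ub _].
    rewrite unitrM unitrV us andbT; apply: contrapT => nb.
    have : [set b | nonunits (psi b x)] b by rewrite /= nonunitE -h1E.
    by rewrite -xE /=; apply/(localization_unit pQ gl).
  - move=> a; have [b [s [ns ->]]] := localization_frac l2 a.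
    have us : h2 s \is a GRing.unit by case: l2 => hu _ _; exact: hu.
    rewrite rmorphM rmorphV // vE /= unitrM => /andP[ub _].
    rewrite unitrM unitrV us andbT; apply: contrapT => nb.
    have : [set b | nonunits (psi' b y)] b by rewrite /= nonunitE -h2E.
    by rewrite -yE /=; apply/(localization_unit pQ gl).
pose p : fpt := FPt (fp1 := x) (fp2 := y) (fpQ := [set l | nonunits (cev c l)])
  (ex_intro _ c (conj lc (fun l => iff_refl _))).
have Dp : D p by [].
have [k kc] := taut_map Dp.
exists p => //; apply/seteqP; split=> t /=.
  move=> Qt; rewrite nonunitE => /taut_unit; apply => /=; apply/nonunitE.
  by rewrite (chart_tensE gen t gc) => /(localization_unit pQ gl).
rewrite nonunitE => nt; apply: contrapT => nQ; apply: nt.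
apply/taut_unit; rewrite /= nonunitE; apply.
by rewrite (chart_tensE gen t gc); apply/(localization_unit pQ gl).
Qed.

Lemma chart_spec_inj (p q : P) : D p -> D q ->
  (forall t, nonunits (psiT t p) <-> nonunits (psiT t q)) -> p = q.
Proof.
have unitl (r : fpt) : D r -> (forall b, psiT (i b) r \is a GRing.unit <-> psi b (fp1 r) \is a GRing.unit)
    /\ (forall b, psiT (j b) r \is a GRing.unit <-> psi' b (fp2 r) \is a GRing.unit).
  move=> Dr; have [k kc] := taut_map Dr; have [k1 k2] := kc.
  have [_ lu lv] := local_taut r.
  split=> b; rewrite (psiTE _ kc) ?k1 ?k2; split.
  - exact: lu.
  - exact: rmorph_unit.
  - exact: lv.
  - exact: rmorph_unit.
move=> Dp Dq pq; have [Up Up'] := Dp; have [Uq Uq'] := Dq.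
have pq' t : psiT t p \is a GRing.unit <-> psiT t q \is a GRing.unit.
  by have := pq t; rewrite !nonunitE => -[h1 h2]; split=> hu; apply: contrapT => /[dup] hn;
    [move=> /h2|move=> /h1]; apply.
have [i1 j1] := unitl p Dp; have [i2 j2] := unitl q Dq.
have E1 : fp1 p = fp1 q.
  apply: (Spec_inj sp) => // b; rewrite !nonunitE; apply: not_iff_compat.
  by rewrite -i1 -i2.
have E2 : fp2 p = fp2 q.
  apply: (Spec_inj sp') => // b; rewrite !nonunitE; apply: not_iff_compat.
  by rewrite -j1 -j2.
apply: (fpt_eq (p := p) (q := q)) => //; apply/seteqP.
have key (r : fpt) l s b : D r -> (forall (c : ctx al (fp1 r) (fp2 r)) k,
    chart_map psi psi' i j (c := c) k -> k s \is a GRing.unit /\ k s * cev c l = k b) ->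
    fpQ r l <-> nonunits (psiT b r).
  move=> Dr H; have [k kc] := taut_map Dr; have [us E] := H _ k kc.
  rewrite (psiTE _ kc) -E nonunitE unitrM us /=.
  split=> [Ql /taut_unit//|nu]; apply: contrapT => nQ; apply: nu.
  exact/taut_unit.
suff E l : fpQ p l <-> fpQ q l by split=> l /E.
have [s [b H]] := chart_represent ch ch' i j l Up Up'.
rewrite (key p l s b Dp H) pq (key q l s b Dq) // -E1 -E2.
exact: H.
Qed.

(** A basic open set is cut down to a principal open set of Spec [T] by [i e * j e' * b]: [e] and
    [e'] shrink the two charts until the tensor is a fraction, and [b] is its numerator. *)
Lemma chart_spec_top (V : set P) : V `<=` D ->
    (open V <-> exists Q : set T, forall p, D p ->
       (V p <-> exists2 t, Q t & psiT t p \is a GRing.unit)).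
Proof.
move=> VD; split; last first.
  move=> [Q HQ]; apply/fopenE => p Vp; have Dp := VD _ Vp; have [Up Up'] := Dp.
  have [t Qt ut] := (HQ p Dp).1 Vp.
  exists U, U', (chart_tens psi psi' gen t); split=> //.
  - exact: (chart_tens_sect ch ch' gen t).
  - by split=> //; exact/taut_unit.
  - by move=> q [Uq Uq' /taut_unit uq]; apply/HQ => //; exists t.
move=> /fopenE oV.
exists [set t | forall p, D p -> psiT t p \is a GRing.unit -> V p] => p Dp.
split; last by move=> [t Ht ut]; exact: Ht.
move=> Vp; have [Up Up'] := Dp.
have [V1 [V1' [l [oV1 oV1' hl bp bV]]]] := oV p Vp; have [Vp1 Vp1' nl] := bp.
have [s [b [V2 [V2' [oV2 oV2' V2p V2p' [V2V V2V' H]]]]]] :=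
  chart_represent_near ch ch' i j oV1 oV1' hl Vp1 Vp1' Up Up'.
have [e [ue He]] := spec_basis sp oV2 V2p Up.
have [e' [ue' He']] := spec_basis sp' oV2' V2p' Up'.
have num (q : fpt) k : chart_map psi psi' i j (c := ftaut q) k ->
    psiT (i e * j e' * b) q = fi1 q (psi e (fp1 q)) * fi2 q (psi' e' (fp2 q)) * k b.
  by move=> kc; rewrite (psiTE _ kc) !rmorphM; case: kc => -> ->.
exists (i e * j e' * b) => /=.
  move=> q [Uq Uq']; have [k kc] := taut_map (conj Uq Uq').
  rewrite (num q k kc) !unitrM => /andP[/andP[u1 u2] ub].
  have [_ lu lv] := local_taut q.
  have V2q := He _ Uq (lu _ u1); have V2q' := He' _ Uq' (lv _ u2).
  have [us E] := H _ _ _ k V2q V2q' kc.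
  apply: bV; split; [by case: (V2V _ V2q)|by case: (V2V' _ V2q')|].
  by apply/taut_unit; move: ub; rewrite -E unitrM => /andP[].
have [k kc] := taut_map Dp; rewrite (num p k kc) !unitrM (rmorph_unit (fi1 p) ue) (rmorph_unit (fi2 p) ue') /=.
have [us <-] := H _ _ _ k V2p V2p' kc.
by rewrite unitrM us; exact/taut_unit.
Qed.

Lemma chart_spec : is_Spec (X := P) D psiT.
Proof.
split.
- exact: (chart_dom_open ch ch').
- exact: chart_sect.
- exact: chart_spec_surj.
- exact: chart_spec_inj.
- exact: chart_spec_top.
- move=> p Dp; have [k kc] := taut_map Dp; have [Up Up'] := Dp.
  exists k; first by move=> b; rewrite (psiTE _ kc).
  have := cprime_localization ch ch' po gen Up Up' kc.
  congr is_localization; apply/seteqP.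
  by split=> t; rewrite /cprime /= (psiTE _ kc).
Qed.

End OnCharts.

Lemma fp_affine (p : P) : exists (B : comUnitRingType) (U : set P) phi,
  U p /\ @is_Spec B P U phi.
Proof.
have [B [B' [U [U' [psi [psi' [h [h' [ch ch' Up Up' [T [i [j [po gen]]]]]]]]]]]]] := two_charts cover p.
exists T, (chart_dom (al := al) U U'), (@chart_psi X A al B B' psi psi' T i j gen).
by split=> //; exact: (chart_spec ch ch' po gen).
Qed.

Definition fp_scheme : scheme := Scheme fp_affine.

Fact fp1_continuous : continuous (fun p : P => fp1 p).
Proof.
apply/continuousP => V oV; apply/fopenE => p Vp.
exists V, setT, (tens1 X); split=> //; first exact: openT.
- by apply: tsect1 => //; exact: openT.
- by split=> //; exact: fpQ1.
- by move=> q [].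
Qed.

Fact fp2_continuous : continuous (fun p : P => fp2 p).
Proof.
apply/continuousP => V oV; apply/fopenE => p Vp.
exists setT, V, (tens1 X); split=> //; first exact: openT.
- by apply: tsect1 => //; exact: openT.
- by split=> //; exact: fpQ1.
- by move=> q [].
Qed.

Fact fp1_local (p : P) a : fi1 p a \is a GRing.unit -> a \is a GRing.unit.
Proof. by have [_ + _] := local_taut p; apply. Qed.
Fact fp2_local (p : P) a : fi2 p a \is a GRing.unit -> a \is a GRing.unit.
Proof. by have [_ _] := local_taut p; apply. Qed.

Fact fp1_sect (V : set X) (s : fam) : open V -> ls_sect V s ->
  ls_sect (l := P) [set p | V (fp1 p)] (fun p => fi1 p (s (fp1 p))).
Proof.
move=> oV hs p Vp; exists V, setT, [:: (s, @fam1 X)], (tens1 X); split.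
- split=> //; [exact: openT| |by apply: tsect1 => //; exact: openT].
  by split=> //; exact/ls_sect1/openT.
- by split=> //; exact: fpQ1.
- by move=> q _ _; rewrite cev1 divr1 /cev tev1 rmorph1 mulr1.
Qed.

Fact fp2_sect (V : set X) (s : fam) : open V -> ls_sect V s ->
  ls_sect (l := P) [set p | V (fp2 p)] (fun p => fi2 p (s (fp2 p))).
Proof.
move=> oV hs p Vp; exists setT, V, [:: (@fam1 X, s)], (tens1 X); split.
- split=> //; [exact: openT| |by apply: tsect1 => //; exact: openT].
  by split=> //; exact/ls_sect1/openT.
- by split=> //; exact: fpQ1.
- by move=> q _ _; rewrite cev1 divr1 /cev tev1 rmorph1 mul1r.
Qed.

Definition fpr1 : morphism P X := @Morphism P X (fun p : P => fp1 p) (fun p : P => fi1 p)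
  fp1_continuous fp1_local fp1_sect.
Definition fpr2 : morphism P X := @Morphism P X (fun p : P => fp2 p) (fun p : P => fi2 p)
  fp2_continuous fp2_local fp2_sect.

Section Universal.
Variables (T : lrspace) (u v : morphism T X).
Hypothesis uv : forall a (x : T), mor_stalk u x (al a (u x)) = mor_stalk v x (al a (v x)).

Definition lift_ctx (x : T) : ctx al (u x) (v x) :=
  @Ctx X A al (u x) (v x) (stalk x) (mor_stalk u x) (mor_stalk v x) (fun a => uv a x).

Lemma lift_local x : local_ctx (lift_ctx x).
Proof. by split=> [|a|a]; [exact: ls_local|exact: mor_local|exact: mor_local]. Qed.

Definition lift_fun (x : T) : P :=
  FPt (fp1 := u x) (fp2 := v x) (fpQ := [set l | nonunits (cev (lift_ctx x) l)])
  (ex_intro _ (lift_ctx x) (conj (lift_local x) (fun l => iff_refl _))).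

Lemma lift_good x : good (p := lift_fun x) (lift_ctx x).
Proof. by move=> l /= /nonunitE /contrapT. Qed.

Definition lift_stalk (x : T) : {rmorphism stalk (lift_fun x) -> stalk x} :=
  sval (cid (flift_taut (@lift_good x))).

Lemma lift_stalkP x : [/\ forall a, lift_stalk x (fi1 _ a) = mor_stalk u x a,
  forall a, lift_stalk x (fi2 _ a) = mor_stalk v x a &
  forall l, lift_stalk x (cev (ftaut (lift_fun x)) l) = cev (lift_ctx x) l].
Proof. by rewrite /lift_stalk; case: cid. Qed.

Lemma lift_cev_sect (U V : set X) l (W : set T) : open U -> open V -> tsect U V l ->
  open W -> W `<=` u @^-1` U -> W `<=` v @^-1` V ->
  ls_sect W (fun x => cev (lift_ctx x) l).
Proof.
move=> oU oV; elim: l => [|[s t] l IH] /=.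
  move=> _ oW _ _; have := sect0 oW; apply: ls_ext => // x _; by rewrite cev_nil.
move=> [hs ht hl] oW Wu Wv.
have ou : open (u @^-1` U) by apply: open_comp => // x _; exact: mor_continuous.
have ov : open (v @^-1` V) by apply: open_comp => // x _; exact: mor_continuous.
have h1 : ls_sect W (fun x => mor_stalk u x (s (u x))).
  exact: (ls_res ou oW Wu (mor_sect u oU hs)).
have h2 : ls_sect W (fun x => mor_stalk v x (t (v x))).
  exact: (ls_res ov oW Wv (mor_sect v oV ht)).
have := sectD oW (ls_sectM oW h1 h2) (IH hl oW Wu Wv).
by apply: ls_ext => // x _; rewrite cev_cons.
Qed.

Lemma lift_preim_open U V l : open U -> open V -> tsect U V l ->
  open (lift_fun @^-1` fbasic U V l).
Proof.
move=> oU oV hl; apply: open_from_nbhds => x [Ux Vx /= nl].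
have ou : open (u @^-1` U) by apply: open_comp => // z _; exact: mor_continuous.
have ov : open (v @^-1` V) by apply: open_comp => // z _; exact: mor_continuous.
have oW := openI ou ov.
have hs := lift_cev_sect oU oV hl oW (fun z h => h.1) (fun z h => h.2).
have [||W [oW' Wx WW H]] := sect_unit_open oW hs (x := x) => //.
  by apply: contrapT => /nonunitE.
exists W; split=> // z Wz; have [? ?] := WW _ Wz; split=> //=.
by rewrite nonunitE; apply; exact: H.
Qed.

Fact lift_continuous : continuous lift_fun.
Proof.
apply/continuousP => O /fopenE oO; apply: open_from_nbhds => x Ox.
have [U [V [l [oU oV hl bx bO]]]] := oO _ Ox.
exists (lift_fun @^-1` fbasic U V l); split=> //; last by move=> z /bO.
exact: lift_preim_open.
Qed.

Fact lift_loc x a : lift_stalk x a \is a GRing.unit -> a \is a GRing.unit.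
Proof.
have [_ _ hl] := lift_stalkP x.
have [n [d [nd ->]]] := fstalk_frac a.
have ud := (taut_unit _ d).2 nd.
rewrite rmorphM rmorphV // !hl !unitrM !unitrV ud andbT => /andP[un _].
by apply/taut_unit => /= /nonunitE.
Qed.

Fact lift_sect (O : set P) s : open O -> ls_sect O s ->
  ls_sect (lift_fun @^-1` O) (fun x => lift_stalk x (s (lift_fun x))).
Proof.
move=> oO hs; have oPO : open (lift_fun @^-1` O).
  by apply: open_comp => // x _; exact: lift_continuous.
apply: ls_glue => // x Ox.
have [U [V [n [d [[oU oV hn hd] bx H]]]]] := hs _ Ox.
have oW : open (lift_fun @^-1` O `&` lift_fun @^-1` fbasic U V d).
  by apply: openI => //; exact: lift_preim_open.
exists (lift_fun @^-1` O `&` lift_fun @^-1` fbasic U V d); split=> //.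
have WU : lift_fun @^-1` O `&` lift_fun @^-1` fbasic U V d `<=` u @^-1` U by move=> z [_ []].
have WV : lift_fun @^-1` O `&` lift_fun @^-1` fbasic U V d `<=` v @^-1` V by move=> z [_ []].
have h1 := lift_cev_sect oU oV hn oW WU WV.
have h2 := lift_cev_sect oU oV hd oW WU WV.
have h2' : forall z, (lift_fun @^-1` O `&` lift_fun @^-1` fbasic U V d) z ->
    cev (lift_ctx z) d \is a GRing.unit.
  by move=> z [_ [_ _ /= /nonunitE /contrapT]].
have := ls_sectM oW h1 (sect_inv oW h2 h2').
apply: ls_ext => // z [Oz bz]; have [_ _ hl] := lift_stalkP z.
have [_ _ nd] := bz; have ud := (taut_unit _ d).2 nd.
by rewrite (H _ bz Oz) rmorphM rmorphV // !hl.
Qed.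

Definition fp_lift : morphism T P := Morphism lift_continuous lift_loc lift_sect.

(** The two projections determine the value of every tensor of sections; these values determine the
    recorded prime, hence the point, and then the stalk maps on fractions. *)
Lemma fp_lift_unique (w : morphism T P) :
  mor_eq (mor_comp w fpr1) u -> mor_eq (mor_comp w fpr2) v -> mor_eq w fp_lift.
Proof.
move=> [p1 s1] [p2 s2].
have ev (x : T) U V l : open U -> open V -> tsect U V l -> U (u x) -> V (v x) ->
    mor_stalk w x (cev (ftaut (w x)) l) = cev (lift_ctx x) l.
  move=> oU oV hl Ux Vx; elim: l hl => [|[s t] l IH] /=.
    by rewrite !cev_nil rmorph0.
  move=> [hs ht hl]; rewrite !cev_cons rmorphD rmorphM IH //; congr (_ * _ + _) => /=.
    by apply: (s1 _ _ oU hs); have /= -> := p1 x.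
  by apply: (s2 _ _ oV ht); have /= -> := p2 x.
have px x : fp1 (w x) = u x by exact: p1.
have py x : fp2 (w x) = v x by exact: p2.
have E x : w x = lift_fun x.
  apply: (fpt_eq (p := w x) (q := lift_fun x)) => //.
  suff H l : fpQ (w x) l <-> nonunits (cev (lift_ctx x) l).
    by apply/seteqP; split=> l /H.
  have [U [V [l' [[oU oV Ux Vx] hl' Hl]]]] := germ_list al l (u x) (v x).
  have Hl2 : fpQ (w x) l' <-> fpQ (w x) l.
    have [c [_ _ hc]] := good_exists (w x).
    rewrite !hc; move: c {hc}; rewrite px py => c.
    by rewrite Hl.
  rewrite -Hl2 -Hl -(ev x U V) // nonunitE mor_unit taut_unit.
  by split=> [h []|/contrapT].
split=> // O s oO hs x Ox; rewrite /pullback.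
have Ox' : O (lift_fun x) by rewrite -E.
have [U [V [n [d [[oU oV hn hd] bx H]]]]] := hs _ Ox.
rewrite (H _ bx Ox); have bx' : fbasic U V d (lift_fun x) by rewrite -E.
have sE : s (lift_fun x) = cev (ftaut (lift_fun x)) n / cev (ftaut (lift_fun x)) d.
  exact: H.
have [Ux Vx nd] := bx; have [Ux' Vx' nd'] := bx'.
rewrite [RHS](_ : _ = lift_stalk x (s (lift_fun x))) // sE.
have [_ _ hl] := lift_stalkP x.
have ud := (taut_unit _ d).2 nd; have ud' := (taut_unit _ d).2 nd'.
rewrite !rmorphM !rmorphV // !hl (ev x U V) ?(ev x U V) //.
Qed.

End Universal.
End SelfProductCharts.

Section SelfProductSeparated.
Variables (A : comUnitRingType) (S : scheme) (phi : A -> forall s : S, stalk s).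
Hypothesis S_Spec : is_Spec [set: S] phi.
Variables (X : scheme) (pi : morphism X S).
Local Notation al := (fun_of phi pi).
Hypothesis cover : forall x : X, exists (B : comUnitRingType) (U : set X)
  (psi : B -> fam X) (h : {rmorphism A -> B}), U x /\ alg_chart al U psi h.
Local Notation P := (fp_scheme cover).

Lemma alg_sect a : ls_sect setT (al a).
Proof. by apply: (mor_sect pi openT); exact: Spec_sect S_Spec a. Qed.

Lemma alg_stalk_unit a x : al a x \is a GRing.unit <-> phi a (pi x) \is a GRing.unit.
Proof. by rewrite /fun_of /pullback mor_unit. Qed.

Lemma fp_is_product : is_fibre_product pi pi (fpr1 cover : morphism P X) (fpr2 cover).
Proof.
split; last first.
  move=> T u v [uv1 uv2].
  have uv a (x : T) : mor_stalk u x (al a (u x)) = mor_stalk v x (al a (v x)).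
    exact: (uv2 setT (phi a) openT (Spec_sect S_Spec a) x).
  exists (fp_lift cover uv); split.
  - split=> // V s oV hs x Vx.
    by have [h _ _] := lift_stalkP cover uv x; exact: h.
  - split=> // V s oV hs x Vx.
    by have [_ h _] := lift_stalkP cover uv x; exact: h.
  - by move=> w wu wv; exact: fp_lift_unique wu wv.
(* An element of [A] is a unit at one projection exactly if it is at the other, both being tested in
   the local ring at [p]; this determines a point of Spec [A]. *)
have E (p : P) : pi (fp1 p) = pi (fp2 p).
  apply: (Spec_inj S_Spec) => // b; rewrite !nonunitE -!alg_stalk_unit.
  apply: not_iff_compat; have c := ctx_uv (ftaut p) b.
  have [_ lu lv] := local_taut p.
  split=> ub; first by apply: lv; rewrite -c rmorph_unit.
  by apply: lu; rewrite c rmorph_unit.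
split=> // V s oV hs p Vp; rewrite /pullback /=.
have [h hE [hu hf hk]] := Spec_stalk S_Spec (I : setT (pi (fp1 p))).
have [b [t [nt]]] := hf (s (pi (fp1 p))); rewrite !hE => Ets.
have ut : phi t (pi (fp1 p)) \is a GRing.unit by apply: contrapT => /nonunitE.
have key (z : S) : z = pi (fp1 p) -> phi t z * s z = phi b z by move=> ->.
have K2 := key _ (esym (E p)).
have c a := ctx_uv (ftaut p) a; rewrite /= in c.
have u1 : fi1 p (al t (fp1 p)) \is a GRing.unit.
  by apply/rmorph_unit/alg_stalk_unit.
have L : fi1 p (al t (fp1 p)) * fi1 p (mor_stalk pi (fp1 p) (s (pi (fp1 p)))) =
    fi1 p (al b (fp1 p)) by rewrite -rmorphM /fun_of /pullback -rmorphM Ets.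
have R : fi2 p (al t (fp2 p)) * fi2 p (mor_stalk pi (fp2 p) (s (pi (fp2 p)))) =
    fi2 p (al b (fp2 p)) by rewrite -rmorphM /fun_of /pullback -rmorphM K2.
apply: (mulrI u1); rewrite /= in L R *; rewrite L c; rewrite c in u1.
by rewrite -R; congr (_ * _); rewrite -c.
Qed.

(** The last hypothesis puts the point of the self-product given by [Q] into the closure of the
    diagonal point of [y]. As the diagonal is closed, that point lies on it and its two projections
    agree. *)
Lemma separated_points (B B' : comUnitRingType) (U U' : set X) (psi : B -> fam X)
    (psi' : B' -> fam X) (h : {rmorphism A -> B}) (h' : {rmorphism A -> B'})
    (T : comUnitRingType) (i : {rmorphism B -> T}) (j : {rmorphism B' -> T})
    (y x x' : X) (Q : set T) (kd : {rmorphism T -> stalk y}) :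
    separated pi -> alg_chart al U psi h -> alg_chart al U' psi' h' ->
    is_pushout h h' i j -> (forall t, exists l : seq (B * B'), t = tev i j l) ->
    U x -> U' x' -> U y -> U' y -> is_prime Q ->
    (forall b, Q (i b) <-> nonunits (psi b x)) ->
    (forall b, Q (j b) <-> nonunits (psi' b x')) ->
    (forall b, kd (i b) = psi b y) -> (forall b, kd (j b) = psi' b y) ->
    (forall t, ~ Q t -> kd t \is a GRing.unit) -> x = x'.
Proof.
move=> sep ch ch' po gen Ux Ux' Uy Uy' pQ Qi Qj ki kj kQ.
have uv a (z : X) : mor_stalk (mor_id X) z (al a z) = mor_stalk (mor_id X) z (al a z) by [].
pose delta : morphism X P := fp_lift cover uv.
have [||dinj dcl dst] := sep P (fpr1 cover) (fpr2 cover) delta fp_is_product.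
- split=> // V s oV hs z Vz.
  by have [hh _ _] := lift_stalkP cover uv z; exact: hh.
- split=> // V s oV hs z Vz.
  by have [_ hh _] := lift_stalkP cover uv z; exact: hh.
have [p [Up Up'] pE] := chart_spec_surj cover ch ch' po gen pQ.
have [k [k1 k2]] := chart_map_exists ch ch' po (ftaut p) Up Up'.
have [_ lu lv] := local_taut p.
have kQ' t : Q t <-> nonunits (k t).
  by rewrite pE /= (chart_psiE gen t (conj k1 k2)).
have E1 : fp1 p = x.
  apply: (Spec_inj (ac_spec ch)) => // b; rewrite -Qi kQ' k1 !nonunitE.
  by apply: not_iff_compat; split=> ub; [exact: rmorph_unit|exact: lu].
have E2 : fp2 p = x'.
  apply: (Spec_inj (ac_spec ch')) => // b; rewrite -Qj kQ' k2 !nonunitE.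
  by apply: not_iff_compat; split=> ub; [exact: rmorph_unit|exact: lv].
have [[z zE]|np] := pselect (exists z, delta z = p :> P).
  by rewrite -E1 -E2 -zE.
have oC : open (~` (delta @` [set: X])).
  by apply: closed_openC; apply: dcl; exact: closedT.
have sp := chart_spec cover ch ch' po gen.
have [||e [ue He]] := spec_basis sp oC (x := p).
- by move=> [z _ zE]; apply: np; exists z.
- by [].
exfalso; apply: (He (delta y)); last by exists y.
  by [].
have [_ _ hl] := lift_stalkP cover uv y.
apply: (lift_loc (cover := cover) (uv := uv)).
rewrite /chart_psi hl.
rewrite (chart_tensE (c := lift_ctx uv y) (k := kd) gen e); last by split.
by apply: kQ => Qe; move: ue; rewrite (chart_psiE gen e (conj k1 k2)); apply/nonunitE/kQ'.
Qed.

End SelfProductSeparated.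

(** * The model defined by a resolution *)

Lemma rprimeT (B : comUnitRingType) (P : set B) : is_rprime setT P <-> is_prime P.
Proof.
split=> [[[[P0 PD PM] _] P1 Pp]|[[P0 PD PM] P1 Pp]].
- by split=> [|//|a b]; [split=> // r a; exact: PM|exact: Pp].
- split=> [|//|a b _ _]; last exact: Pp.
  by split=> //; split=> // r a _; exact: PM.
Qed.

Lemma nonunits_prime (B : comUnitRingType) : is_local B -> is_prime (@nonunits B).
Proof.
move=> lB; split.
- split=> [|//|r a /nonunitE na]; first by apply/nonunitE; rewrite unitr0.
  by apply/nonunitE; rewrite unitrM => /andP[_ /na].
- by move/nonunitE; rewrite unitr1; apply.
- move=> a b /nonunitE nab; apply: contrapT => /not_orP[].
  rewrite !nonunitE => /contrapT ua /contrapT ub.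
  by apply: nab; rewrite unitrM ua ub.
Qed.

Lemma nonunit_in_prime (B : comUnitRingType) (b : B) : nonunits b ->
  exists2 P, is_prime P & P b.
Proof.
move=> /nonunitE nb.
have iI : is_idl setT (scale_set b setT).
  by split=> //; apply: scale_mod; exact: mod_subring.
have [[c _ cE]|P /rprimeT pP IP] := maximal_containing (@subringT B) iI.
  by apply: nb; apply/unitrPr; exists c.
by exists P => //; apply: IP; exists 1; rewrite // mulr1.
Qed.

Lemma unit_localization (B R : comUnitRingType) (P : set B) (h : {rmorphism B -> R}) :
  is_localization P h -> (forall s, ~ P s -> s \is a GRing.unit) -> bijective h.
Proof.
move=> [hu hf hk] uP.
have sur r : exists b, h b = r.
  have [b [s [ns E]]] := hf r; have us := uP s ns; exists (b / s).
  by rewrite rmorphM rmorphV // -E mulrC mulKr // rmorph_unit.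
have inj : injective h.
  move=> b b' E; have [|s ns] := hk (b - b'); first by rewrite rmorphB E subrr.
  move=> s0; apply/eqP; rewrite -subr_eq0; apply/eqP.
  by rewrite -(mulKr (uP s ns) (b - b')) s0 mulr0.
have [g gK] := choice sur.
by exists g => // b; apply: inj; rewrite gK.
Qed.

Section Base.
Variables (A : comUnitRingType) (S : scheme) (phi : A -> forall s : S, stalk s).
Hypotheses (A_local : is_local A) (S_Spec : is_Spec [set: S] phi).
Variables (X : scheme) (pi : morphism X S).
Local Notation al := (fun_of phi pi).

Lemma closed_point_exists : exists s0 : S, (forall b, nonunits (phi b s0) <-> nonunits b) /\
  forall V, open V -> V s0 -> V = setT.
Proof.
have [s0 _ mE] := Spec_surj S_Spec (nonunits_prime A_local).
have E b : nonunits (phi b s0) <-> nonunits b.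
  by change ([set b | nonunits (phi b s0)] b <-> nonunits b); rewrite -mE.
exists s0; split=> // V oV Vs0.
have [e [ue He]] := spec_basis S_Spec oV Vs0 I.
have {}ue : e \is a GRing.unit by apply: contrapT => /nonunitE/E/nonunitE.
apply/seteqP; split=> // s _; apply: He => //.
by have [h <-] := spec_rmorphism S_Spec (I : setT s); exact: rmorph_unit.
Qed.

(** The trivial base change, by which universal closedness shows that [pi] itself is closed. *)
Lemma base_change_id : is_fibre_product pi (mor_id S) (mor_id X) pi.
Proof.
split=> // T u v [uv1 uv2]; by exists u; split.
Qed.

Hypothesis pi_res : is_resolution pi.

Lemma resolution_closed : closed_map pi.
Proof. by have [_ _ [_ _ uc] _] := pi_res; exact: (uc _ _ _ _ _ base_change_id). Qed.

Lemma resolution_surjective s : exists x, pi x = s.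
Proof.
have [_ _ _ [U [V [[oU dU oV dV] [bUV _ _]]]]] := pi_res.
have cl := resolution_closed closedT.
apply: contrapT => h; have oC : open (~` (pi @` [set: X])) by exact: closed_openC.
have [|t [nt Vt]] := dV _ _ oC; first by exists s => -[x _ xs]; apply: h; exists x.
have [_ _ sur] := bUV; have [x _ xt] := sur t Vt.
by apply: nt; exists x.
Qed.

(** An affine open set containing the closed point is all of S, but its ring [B] is not given as
    [A]. Both rings are identified with the stalk at the closed point, since a function invertible
    there is invertible everywhere. *)
Lemma resolution_charts : exists n (U : 'I_n -> set X), (forall x, exists i, U i x) /\
  forall i, exists (C : comUnitRingType) (h : {rmorphism A -> C}) psi,
    alg_chart al (U i) psi h /\ finite_type_alg h.
Proof.
have [s0 [ms0 opS]] := closed_point_exists.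
have [_ _ [ft _ _] _] := pi_res.
have [B [V [phiB [Vs0 spB [n [U [UE hU]]]]]]] := ft s0.
have VT : V = setT by apply: opS => //; exact: (Spec_open spB).
move: Vs0 UE spB hU; rewrite {V}VT => _ UE spB hU.
have [hA hAE lA] := Spec_stalk S_Spec (I : setT s0).
have [hB hBE lB] := Spec_stalk spB (I : setT s0).
have [gA gAK gAK'] : bijective hA.
  apply: (unit_localization lA) => s /= /nonunitE; rewrite -hAE => us.
  by apply: contrapT => /nonunitE/ms0/nonunitE; rewrite -hAE.
have [gB gBK gBK'] : bijective hB.
  apply: (unit_localization lB) => b /= nb; apply: contrapT => /nonunitE/nonunit_in_prime[P pP Pb].
  have [x _ PE] := Spec_surj spB pP; move: Pb; rewrite PE => /nonunitE; apply.
  have ub : phiB b s0 \is a GRing.unit by apply: contrapT => /nonunitE.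
  have [W [oW Ws0 _ hW]] := sect_unit_open (Spec_open spB) (Spec_sect spB b) I ub.
  by apply: hW; rewrite (opS W).
have [be beE] : exists be : {rmorphism A -> B}, be =1 gB \o hA.
  have inj := can_inj gBK.
  apply: rmorphism_of => [a b|a b|] /=; apply: inj.
  - by rewrite gBK' [RHS]rmorphB !gBK' rmorphB.
  - by rewrite gBK' [RHS]rmorphM !gBK' rmorphM.
  - by rewrite !gBK' !rmorph1.
have beK a s : phiB (be a) s = phi a s.
  have E : phiB (be a) s0 = phi a s0 by rewrite -hBE beE /= gBK' hAE.
  have [W [oW Ws0 _ h]] := sect_germ_eq openT (Spec_sect spB (be a)) (Spec_sect S_Spec a) I E.
  by apply: h; rewrite (opS W).
exists n, U; split.
  move=> x; have : (pi @^-1` [set: S]) x by [].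
  by rewrite UE => -[i _ Ux]; exists i.
move=> i; have [C [h [psi [spC [gs gsE] hpsi]]]] := hU i.
exists C, [the {rmorphism A -> C} of h \o be], psi; split.
  split=> // a x Ux /=; rewrite hpsi // /pullback beK.
  by [].
exists gs; rewrite -gsE; congr (gen_subring (_ `|` _)).
apply/seteqP; split=> _ [a _ <-]; first by exists (be a).
exists (gA (hB a)) => //=; congr (h _); apply: (can_inj gBK).
by rewrite beE /= gBK' gAK'.
Qed.

End Base.

Lemma fraction_frac (R : idomainType) (x : {fraction R}) :
  exists a b : R, b != 0 /\ x = tofrac a / tofrac b.
Proof.
elim/quotW: x => x; exists (frac x).1, (frac x).2; split; first exact: denom_ratioP.
have d0 : tofrac (frac x).2 != 0 by rewrite tofrac_eq0 denom_ratioP.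
apply: (mulIf d0); rewrite divfK //.
rewrite -[_ * _]/(FracField.mul (\pi_({fraction R})%qT x) (tofrac (frac x).2)).
apply/eqP; rewrite piE /= FracField.equivfE /FracField.mulf.
by rewrite !numden_Ratio ?mulf_neq0 ?denom_ratioP ?oner_eq0 // !mulr1 mulrC.
Qed.

Lemma fraction_localization (R : idomainType) :
  is_localization [set 0] (@tofrac R : {rmorphism R -> {fraction R}}).
Proof.
split=> [s /eqP s0|r|b /eqP].
- by rewrite unitfE tofrac_eq0.
- have [a [b [b0 ->]]] := fraction_frac r; exists a, b; split; first exact/eqP.
  by rewrite mulrC divfK // tofrac_eq0.
- rewrite tofrac_eq0 => /eqP ->; exists 1; last exact: mulr0.
  by apply/eqP; rewrite oner_eq0.
Qed.

Lemma zero_prime (R : idomainType) : is_prime [set (0 : R)].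
Proof.
split=> [|/eqP|a b /eqP]; last 2 first.
- by rewrite oner_eq0.
- by rewrite mulf_eq0 => /orP[] /eqP; [left|right].
by split=> // [a b -> ->|r a ->]; rewrite ?addr0 ?mulr0.
Qed.

(** * The function field and the embedding of the stalks *)

Section FunctionField.
Variables (A : idomainType) (S : scheme) (phi : A -> forall s : S, stalk s).
Hypothesis S_Spec : is_Spec [set: S] phi.
Variables (X : scheme) (pi : morphism X S).
Hypothesis pi_res : is_resolution pi.
Local Notation al := (fun_of phi pi).
Local Notation F := {fraction A}.

(** [eta] is the point of U above the zero ideal. A nonempty open set meets U in an open set whose
    image contains the generic point of S, so it contains [eta] by injectivity on U. *)
Lemma generic_point_exists : exists2 eta : X, (forall x, generizes eta x) &
  exists2 r : {rmorphism stalk eta -> F}, (forall a, r (al a eta) = tofrac a) & bijective r.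
Proof.
have [[X0 Xirr _] _ _ [U [V [[oU dU oV dV] [bUV opn bij]]]]] := pi_res.
have [se _ seE] := Spec_surj S_Spec (zero_prime A).
have gen_se s : generizes se s.
  move=> W oW Ws; have [e [ue He]] := spec_basis S_Spec oW Ws I.
  apply: He => //; apply: contrapT => /nonunitE ne.
  have : [set b | nonunits (phi b se)] e by [].
  rewrite -seE => e0; rewrite e0 in ue.
  have [h hE] := spec_rmorphism S_Spec (I : setT s).
  by move: ue; rewrite -hE rmorph0 unitr0.
have [_ inj sur] := bUV; have [x0 _] := X0.
have U0 : U !=set0.
  by have [|x [_ Ux]] := dU setT _ openT; [exists x0|exists x].
have Vse : V se.
  have [x Ux] := U0; apply: (gen_se (pi x)) => //.
  by have [fUV _ _] := bUV; exact: fUV.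
have [eta Ueta piE] := sur se Vse; exists eta.
  move=> x W oW Wx; have [w [Ww Uw]] := dU W (ex_intro _ x Wx) oW.
  have oWU : open (W `&` U) by exact: openI.
  have := opn _ oWU (@subIsetr _ W U) => oP.
  have [w' [Ww' Uw'] pw'] : (pi @` (W `&` U)) se.
    by apply: (gen_se (pi w)) => //; exists w.
  have <- // : w' = eta by apply: inj; rewrite ?inE // pw' piE.
have Pse : [set b | nonunits (phi b (pi eta))] = [set 0] by rewrite piE -seE.
have [h hE lh] := Spec_stalk S_Spec (I : setT (pi eta)); rewrite Pse in lh.
have [k kK kK'] := bij eta Ueta.
have [r1 r1E] : exists g : {rmorphism stalk (pi eta) -> F}, forall b, g (h b) = tofrac b.
  by apply: (localization_univ (zero_prime A) lh) => s /eqP s0; rewrite unitfE tofrac_eq0.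
have [r2 r2E] : exists g : {rmorphism F -> stalk (pi eta)}, forall b, g (tofrac b) = h b.
  by apply: (localization_univ (zero_prime A) (fraction_localization A)) => s ns; case: lh => hu _ _; exact: hu.
have r12 : cancel r1 r2.
  have E b : (r2 \o r1) (h b) = idfun (h b) by rewrite /= r1E.
  by move=> a; have := localization_ext lh E a.
have r21 : cancel r2 r1.
  have E b : (r1 \o r2) (tofrac b) = idfun (tofrac b) by rewrite /= r2E.
  by move=> a; have := localization_ext (fraction_localization A) E a.
have kinj := can_inj kK.
have [r rE] : exists r : {rmorphism stalk eta -> F}, r =1 r1 \o k.
  apply: rmorphism_of => [a b|a b|] /=.
  - by rewrite -rmorphB; congr (r1 _); apply: (can_inj kK); rewrite rmorphB !kK'.
  - by rewrite -rmorphM; congr (r1 _); apply: (can_inj kK); rewrite rmorphM !kK'.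
  - by rewrite -(rmorph1 r1); congr (r1 _); apply: (can_inj kK); rewrite kK' rmorph1.
exists r.
  by move=> a; rewrite rE /= /fun_of /pullback kK -hE r1E.
exists (mor_stalk pi eta \o r2) => a /=; first by rewrite rE /= r12 kK'.
by rewrite rE /= kK r21.
Qed.

End FunctionField.

Section EmbeddedRing.
Variables (F : fieldType) (R : comUnitRingType) (rho : {rmorphism R -> F}).
Hypothesis rho_inj : forall a, rho a = 0 -> a = 0.
Local Notation im := (range rho).

Lemma rho_injective : injective rho.
Proof.
by move=> a b E; apply/eqP; rewrite -subr_eq0; apply/eqP/rho_inj; rewrite rmorphB E subrr.
Qed.

Lemma im_subring : is_subring im.
Proof.
split=> [|_ _ [a _ <-] [b _ <-]|_ _ [a _ <-] [b _ <-]].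
- by exists 1; rewrite // rmorph1.
- by exists (a - b); rewrite // rmorphB.
- by exists (a * b); rewrite // rmorphM.
Qed.

Lemma im_nmax a : nmax im (rho a) <-> nonunits a.
Proof.
split=> [[_ h]|na].
  apply/nonunitE => ua; case: h => [a0|]; last first.
    by apply; exists a^-1; rewrite // rmorphV.
  by move: ua; rewrite (rho_inj a0) unitr0.
split; first by exists a.
have [->|ra0] := eqVneq (rho a) 0; [by left|right=> -[b _ bE]].
move/nonunitE: na; apply; apply/unitrPr; exists b; apply: rho_injective.
by rewrite rmorphM bE rmorph1 divff.
Qed.

Lemma im_loc : is_local R -> is_loc im.
Proof.
move=> lR; split; first exact: im_subring.
move=> x y nx ny; have [[a _ aE] _] := nx; have [[b _ bE] _] := ny.
rewrite -aE -bE -rmorphD; apply/im_nmax; apply: lR; apply/im_nmax.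
  by rewrite aE.
by rewrite bE.
Qed.

Lemma preim_ideal J : is_idl im J -> is_ideal (rho @^-1` J).
Proof.
move=> [mJ _]; split=> [|a b|r a] /=.
- by rewrite rmorph0; exact: (mod0 mJ).
- by rewrite rmorphD; exact: (modD mJ).
- by rewrite rmorphM; apply: (modM mJ); exists r.
Qed.

Lemma im_ideal I : is_ideal I -> is_idl im (rho @` I).
Proof.
move=> [I0 ID IM]; split; last by move=> _ [a _ <-]; exists a.
split; first by exists 0; rewrite // rmorph0.
- by move=> _ _ [a Ia <-] [b Ib <-]; exists (a + b); rewrite ?rmorphD //; exact: ID.
- by move=> _ _ [r _ <-] [a Ia <-]; exists (r * a); rewrite ?rmorphM //; exact: IM.
Qed.

Lemma preim_prime Q : is_rprime im Q -> is_prime (rho @^-1` Q).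
Proof.
move=> [iQ Q1 Qp]; split; first exact: preim_ideal.
  by rewrite /= rmorph1.
by move=> a b /=; rewrite rmorphM; apply: Qp; [exists a|exists b].
Qed.

Lemma im_memE I a : (rho @` I) (rho a) <-> I a.
Proof. by split=> [[b Ib /rho_injective <-]|Ia]; last exists a. Qed.

Lemma im_prime I : is_prime I -> is_rprime im (rho @` I).
Proof.
move=> [iI I1 Ip]; split; first exact: im_ideal.
  by rewrite -(rmorph1 rho) => /im_memE.
move=> _ _ [a _ <-] [b _ <-]; rewrite -rmorphM => /im_memE /Ip[].
  by move=> /im_memE; left.
by move=> /im_memE; right.
Qed.

Lemma im_noeth : noetherian R -> rnoeth im.
Proof.
move=> nR J iJ Jinc.
have iI : is_ideal [set a | exists n, J n (rho a)].
  split=> [|a b [n Ja] [m Jb]|r a [n Ja]].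
  - by exists 0%N; rewrite rmorph0; exact: (mod0 (iJ 0%N).1).
  - exists (maxn n m); rewrite rmorphD; apply: (modD (iJ _).1).
      exact: (chain_le Jinc (leq_maxl n m)).
    exact: (chain_le Jinc (leq_maxr n m)).
  - by exists n; rewrite rmorphM; apply: (modM (iJ n).1) => //; exists r.
have [s sE] := nR _ iI.
have sI b : b \in s -> exists n, J n (rho b).
  move=> bs; suff : [set a | exists n, J n (rho a)] b by [].
  by rewrite sE => K _; apply.
have [N hN] : exists N, forall b, b \in s -> J N (rho b).
  elim: (s) sI => [|b t IH] sI; first by exists 0%N.
  have [|N hN] := IH; first by move=> c ct; apply: sI; rewrite inE ct orbT.
  have [n hn] := sI b (mem_head _ _); exists (maxn N n) => c.
  rewrite inE => /predU1P[->|/hN]; first exact: (chain_le Jinc (leq_maxr N n)).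
  exact: (chain_le Jinc (leq_maxl N n)).
exists N => m _ x Jx; have [a _ aE] := (iJ m).2 x Jx; rewrite -aE.
have : [set a | exists n, J n (rho a)] a by exists m; rewrite aE.
rewrite sE => /(_ (rho @^-1` J N)); apply; first exact: preim_ideal.
by move=> b /= bs; exact: hN.
Qed.

End EmbeddedRing.

Section StalkEmbedding.
Variables (X : scheme) (F : fieldType) (eta : X) (r : {rmorphism stalk eta -> F}).
Hypotheses (X_int : integral_scheme X) (eta_gen : forall x, generizes eta x).

Lemma stalk_embedding_exists x : exists rho : {rmorphism stalk x -> F},
  forall U s, open U -> U x -> ls_sect U s -> rho (s x) = r (s eta).
Proof.
have /choice[f fP] (a : stalk x) : exists c, exists U s,
    [/\ open U, U x, ls_sect U s, s x = a & c = r (s eta)].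
  by have [U [s [oU Ux hs sx]]] := ls_germ a; exists (r (s eta)), U, s.
have fE U s : open U -> U x -> ls_sect U s -> f (s x) = r (s eta).
  move=> oU Ux hs; have [V [t [oV Vx ht tx ->]]] := fP (s x).
  have oUV : open (U `&` V) by exact: openI.
  have ht' : ls_sect (U `&` V) t by apply: ls_res ht => // y [].
  have hs' : ls_sect (U `&` V) s by apply: ls_res hs => // y [].
  have [W [oW Wx _ hW]] := sect_germ_eq oUV ht' hs' (conj Ux Vx) tx.
  by rewrite hW //; exact: (eta_gen oW Wx).
have both (a b : stalk x) : exists U s t, [/\ open U, U x, ls_sect U s, ls_sect U t & s x = a /\ t x = b].
  have [U [s [oU Ux hs sx]]] := ls_germ a; have [V [t [oV Vx ht tx]]] := ls_germ b.
  have oUV : open (U `&` V) by exact: openI.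
  exists (U `&` V), s, t; split=> //.
  - by apply: ls_res hs => // y [].
  - by apply: ls_res ht => // y [].
have [rho rhoE] : exists rho : {rmorphism stalk x -> F}, rho =1 f.
  apply: rmorphism_of => [a b|a b|].
  - have [U [s [t [oU Ux hs ht [<- <-]]]]] := both a b.
    have := fE U (fun y => s y - t y) oU Ux (ls_sectB oU hs ht).
    by rewrite (fE U s) // (fE U t) // rmorphB.
  - have [U [s [t [oU Ux hs ht [<- <-]]]]] := both a b.
    have := fE U (fun y => s y * t y) oU Ux (ls_sectM oU hs ht).
    by rewrite (fE U s) // (fE U t) // rmorphM.
  - by have := fE setT (fun=> 1) openT I (ls_sect1 openT); rewrite /= rmorph1.
by exists rho => U s oU Ux hs; rewrite rhoE; exact: (fE U s).
Qed.

Definition stalk_embedding x : {rmorphism stalk x -> F} :=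
  sval (cid (stalk_embedding_exists x)).

Local Notation rho := stalk_embedding.

Lemma stalk_embeddingE x U s : open U -> U x -> ls_sect U s -> rho x (s x) = r (s eta).
Proof. by rewrite /stalk_embedding; case: cid => f h; exact: h. Qed.

(** A chart function vanishing at the generic point is a unit nowhere on the chart, so it lies in
    all primes and is nilpotent; the stalks are reduced. *)
Lemma stalk_embedding_inj x a : rho x a = 0 -> a = 0.
Proof.
have [B [U [psi [Ux sp]]]] := sch_affine x; have oU := Spec_open sp.
have [h hE lh] := Spec_stalk sp Ux; have [b [s [ns ->]]] := localization_frac lh a.
have us : h s \is a GRing.unit by case: lh => hu _ _; exact: hu.
rewrite rmorphM rmorphV //; have urs : rho x (h s) \is a GRing.unit by exact: rmorph_unit.
move=> /eqP; rewrite mulf_eq0 invr_eq0; move: (urs); rewrite unitfE => /negbTE ->.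
rewrite orbF => /eqP; rewrite hE (stalk_embeddingE oU Ux (Spec_sect sp b)) => rb.
have [_ _ red] := X_int.
have [n hn] : exists n, [set 0] (b ^+ n).
  apply: (@radical_power B setT [set 0]) => //.
    by split=> //; split=> // [c d -> ->|t c _ ->]; rewrite ?addr0 ?mulr0.
  move=> P /rprimeT pP _; have [y Uy ->] := Spec_surj sp pP.
  apply/nonunitE => ub.
  have [V [oV Vy VU hV]] := sect_unit_open oU (Spec_sect sp b) Uy ub.
  have /(@rmorph_unit _ _ r) := hV eta (eta_gen oV Vy).
  by rewrite rb unitr0.
rewrite -hE in rb *; rewrite (_ : h b = 0) ?mul0r //; apply: (red x _ n).
by rewrite -rmorphXn hn rmorph0.
Qed.

Definition local_ring (x : X) : set F := range (rho x).

End StalkEmbedding.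

(** An affine open set seen inside F, with coordinate ring [R]. The clauses of [local_model] about
    the generizations of a single point are derived from it. *)
Record affine_model (F : fieldType) (X : topologicalType) (O : X -> set F) (U : set X)
    (R : set F) : Prop := AffineModel {
  am_open : open U;
  am_sub : is_subring R;
  am_noeth : rnoeth R;
  am_loc : forall x, U x -> O x = locz R (R `&` nmax (O x));
  am_islocal : forall x, U x -> is_loc (O x);
  am_surj : forall P, is_rprime R P -> exists2 x, U x & P = R `&` nmax (O x);
  am_inj : forall x y, U x -> U y -> R `&` nmax (O x) `<=` nmax (O y) ->
    R `&` nmax (O y) `<=` nmax (O x) -> x = y;
  am_basis : forall V x, open V -> V x -> U x -> exists b, [/\ R b, ~ nmax (O x) b &
    forall y, U y -> ~ nmax (O y) b -> V y];
  am_basic : forall b, R b -> open [set x | U x /\ ~ nmax (O x) b]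
}.

Section AffineModelTheory.
Variables (F : fieldType) (X : topologicalType) (O : X -> set F).
Variables (U : set X) (R : set F).
Hypothesis M : affine_model O U R.
Implicit Types (x y z w : X) (a b s : F).

Let sR : is_subring R. Proof. exact: (am_sub M). Qed.

Lemma am_le x : U x -> R `<=` O x.
Proof.
move=> Ux b Rb; rewrite (am_loc M Ux); exists b, 1; rewrite divr1; split=> //.
  exact: sub1.
by move=> [_]; apply: nmax1; case: (am_islocal M Ux).
Qed.

Lemma am_prime x : U x -> is_rprime R (R `&` nmax (O x)).
Proof.
move=> Ux; have lO := am_islocal M Ux; have [sO _] := lO.
have [[mn _] n1 np] := nmax_rprime lO.
split.
- split; last by move=> b [].
  by apply: setI_mod; [exact: mod_subring|exact: (mod_sub (am_le Ux) mn)].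
- by case.
- by move=> a b Ra Rb [_ /np]; case; [exact: am_le|exact: am_le|left|right].
Qed.

Lemma am_frac x a : U x -> O x a -> exists b s, [/\ R b, R s, ~ nmax (O x) s & a = b / s].
Proof.
move=> Ux Oa; have [b [s [Rb Rs ns aE]]] : locz R (R `&` nmax (O x)) a by rewrite -(am_loc M Ux).
by exists b, s; split=> // n; apply: ns.
Qed.

Lemma am_inv x s : U x -> R s -> ~ nmax (O x) s -> s != 0 /\ O x s^-1.
Proof. by move=> Ux Rs ns; apply: nmaxPn => //; exact: am_le. Qed.

Lemma am_gen x y : U x -> generizes y x -> U y.
Proof. by move=> Ux g; apply: g => //; exact: (am_open M). Qed.

Lemma am_genP x y : U x -> U y -> generizes y x <-> R `&` nmax (O y) `<=` nmax (O x).
Proof.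
move=> Ux Uy; split=> [g b [Rb nb]|h V oV Vx].
  apply: contrapT => nx; have [_] := g _ (am_basic M Rb) (conj Ux nx).
  by apply.
have [b [Rb nb hb]] := am_basis M oV Vx Ux; apply: hb => // ny; apply: nb.
exact: h.
Qed.

Lemma am_sections x a : U x -> O x a -> exists V, [/\ open V, V x & forall y, V y -> O y a].
Proof.
move=> Ux /(am_frac Ux)[b [s [Rb Rs ns ->]]].
exists [set x | U x /\ ~ nmax (O x) s]; split=> //; first exact: (am_basic M).
move=> y [Uy ny]; have [_ Os] := am_inv Uy Rs ny.
by apply: subM => //; [case: (am_islocal M Uy)|exact: am_le].
Qed.

Lemma am_generize x y a : U x -> generizes y x -> O x a -> O y a.
Proof. by move=> Ux g /(am_sections Ux)[V [oV Vx hV]]; apply: hV; exact: g. Qed.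

Lemma am_points x Q : U x -> is_rprime (O x) Q ->
  exists2 y, generizes y x & Q = O x `&` nmax (O y).
Proof.
move=> Ux [[mQ QO] Q1 Qp]; have [sO _] := am_islocal M Ux; have RO := am_le Ux.
have pQR : is_rprime R (R `&` Q).
  split.
  - split; last by move=> b [].
    by apply: setI_mod; [exact: mod_subring|exact: (mod_sub RO mQ)].
  - by case.
  - by move=> a b Ra Rb [_ /Qp]; case; [exact: RO|exact: RO|left|right].
have [y Uy QE] := am_surj M pQR; have g : generizes y x.
  apply/(am_genP Ux Uy); rewrite -QE => b [_ Qb].
  by apply: (idl_nmax sO _ Q1).
exists y => //; have [mn _] := nmax_idl (am_islocal M Uy).
apply/seteqP; split=> a.
  move=> Qa; have Oa := QO _ Qa; split=> //.
  have [b [s [Rb Rs ns aE]]] := am_frac Ux Oa; have [s0 Os] := am_inv Ux Rs ns.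
  have [_ nb] : (R `&` nmax (O y)) b.
    rewrite -QE; split=> //; have -> : b = s * a by rewrite aE; field.
    by apply: (modM mQ) => //; exact: RO.
  by rewrite aE mulrC; apply: (modM mn) => //; exact: (am_generize Ux g).
move=> [Oa na]; have [b [s [Rb Rs ns aE]]] := am_frac Ux Oa; have [s0 Os] := am_inv Ux Rs ns.
have [_ Qb] : (R `&` Q) b.
  rewrite QE; split=> //; have -> : b = s * a by rewrite aE; field.
  by apply: (modM mn) => //; exact: am_le.
by rewrite aE mulrC; apply: (modM mQ).
Qed.

Lemma am_localize x y a : U x -> generizes y x -> O y a ->
  exists b s, [/\ O x b, O x s, ~ nmax (O y) s & a = b / s].
Proof.
move=> Ux g /(am_frac (am_gen Ux g))[b [s [Rb Rs ns ->]]].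
by exists b, s; split=> //; exact: am_le.
Qed.

Lemma am_compare x y z : U x -> generizes y x -> generizes z x ->
  O x `&` nmax (O y) `<=` nmax (O z) -> generizes y z.
Proof.
move=> Ux gy gz h; apply/(am_genP (am_gen Ux gz) (am_gen Ux gy)) => b [Rb nb].
by apply: h; split=> //; exact: am_le.
Qed.

Lemma am_T0 x y : U x -> generizes y x -> generizes x y -> x = y.
Proof.
move=> Ux g g'; have Uy := am_gen Ux g.
by apply: (am_inj M Ux Uy); apply/am_genP.
Qed.

(** The points come from the minimal primes over the vanishing ideal of [C] in the chart; they lie
    in [C] because a closed set contains every point of the chart at which this ideal vanishes. *)
Lemma am_closed (C : set X) : closed C -> exists s : seq X,
  (forall w, w \in s -> C w) /\ forall x, U x -> C x -> exists2 w, w \in s & generizes w x.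
Proof.
move=> cC; pose J := [set b | R b /\ forall x, U x -> C x -> nmax (O x) b].
have iJ : is_idl R J.
  split; last by move=> b [].
  split=> [|a b [Ra ha] [Rb hb]|r a Rr [Ra ha]].
  - by split=> [|x Ux _]; [exact: sub0|case: (nmax_idl (am_islocal M Ux)) => mn _; exact: (mod0 mn)].
  - split=> [|x Ux Cx]; first exact: subD.
    by case: (nmax_idl (am_islocal M Ux)) => mn _; apply: (modD mn); [exact: ha|exact: hb].
  - split=> [|x Ux Cx]; first exact: subM.
    case: (nmax_idl (am_islocal M Ux)) => mn _; apply: (modM mn); last exact: ha.
    exact: am_le.
have CJ x : U x -> J `<=` nmax (O x) -> C x.
  move=> Ux h; apply: contrapT => nC.
  have oC : open (~` C) by exact: closed_openC.
  have [b [Rb nb hb]] := am_basis M oC nC Ux; apply: nb; apply: h; split=> // y Uy Cy.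
  by apply: contrapT => ny; apply: (hb y Uy ny).
have [ps [hps minps]] := minimal_primes sR (am_noeth M) iJ.
have /choice[t tP] (i : nat) : exists o : option X, (i < size ps)%N ->
    exists2 x, o = Some x & U x /\ nth set0 ps i = R `&` nmax (O x).
  have [lt|_] := boolP (i < size ps)%N; last by exists None.
  have [x Ux PE] := am_surj M (hps i lt).1.
  by exists (Some x) => _; exists x.
exists (pmap t (iota 0 (size ps))); split.
  move=> w; rewrite mem_pmap.
  move=> /mapP[i]; rewrite mem_iota /= add0n => lt wE.
  have [x xE [Ux PE]] := tP i lt; move: xE; rewrite -wE => -[->].
  by apply: CJ => // b Jb; have [_ /(_ b Jb)] := hps i lt; rewrite PE => -[].
move=> x Ux Cx; have [i lt Pi] := minps _ (am_prime Ux) (fun b Jb => conj Jb.1 (Jb.2 x Ux Cx)).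
have [w wE [Uw PE]] := tP i lt; exists w.
  by rewrite mem_pmap -wE; apply: map_f; rewrite mem_iota.
by apply/(am_genP Ux Uw); rewrite -PE => b /Pi[].
Qed.

End AffineModelTheory.

Section ChartModel.
Variables (X : scheme) (F : fieldType) (eta : X) (r : {rmorphism stalk eta -> F}).
Hypotheses (X_int : integral_scheme X) (eta_gen : forall x, generizes eta x).
Hypothesis r_inj : injective r.
Local Notation rho := (stalk_embedding r eta_gen).
Local Notation O := (local_ring r eta_gen).

Let rho_inj x a : rho x a = 0 -> a = 0.
Proof. exact: (stalk_embedding_inj X_int). Qed.

Lemma local_ring_nmax x a : nmax (O x) (rho x a) <-> nonunits a.
Proof. exact: (im_nmax (@rho_inj x)). Qed.

Lemma local_ring_loc x : is_loc (O x).
Proof. by apply: (im_loc (@rho_inj x)); exact: ls_local. Qed.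

Variables (C : comUnitRingType) (U : set X) (psi : C -> fam X).
Hypotheses (sp : is_Spec U psi) (U0 : U !=set0).

Lemma chart_eta : U eta.
Proof. by have [x Ux] := U0; exact: (eta_gen (Spec_open sp) Ux). Qed.

Lemma chart_embedding_exists : exists ka : {rmorphism C -> F}, forall c, ka c = r (psi c eta).
Proof.
have [h hE] := spec_rmorphism sp chart_eta.
by exists [the {rmorphism C -> F} of r \o h] => c /=; rewrite hE.
Qed.

Variable ka : {rmorphism C -> F}.
Hypothesis kaE : forall c, ka c = r (psi c eta).

Lemma chart_rho x c : U x -> rho x (psi c x) = ka c.
Proof. by move=> Ux; rewrite (stalk_embeddingE _ _ (Spec_open sp) Ux (Spec_sect sp c)) kaE. Qed.

Lemma chart_nmax x c : U x -> nmax (O x) (ka c) <-> nonunits (psi c x).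
Proof. by move=> Ux; rewrite -(chart_rho c Ux); exact: local_ring_nmax. Qed.

Lemma chart_affine_model : rnoeth (range ka) -> affine_model O U (range ka).
Proof.
move=> nR; have sR := im_subring ka.
have unitP x c : U x -> (psi c x \is a GRing.unit) <-> ~ nmax (O x) (ka c).
  move=> Ux; rewrite (chart_nmax c Ux) nonunitE; split=> [u h|/contrapT//].
  exact: h.
split=> //.
- exact: (Spec_open sp).
- move=> x Ux; have [h hE lh] := Spec_stalk sp Ux; apply/seteqP; split=> y.
    move=> [a _ <-]; have [b [s [ns ->]]] := localization_frac lh a.
    have us : h s \is a GRing.unit by case: lh => hu _ _; exact: hu.
    exists (ka b), (ka s); rewrite rmorphM rmorphV // !hE !chart_rho //.
    split=> //; try by exists b. try by exists s.
    by move=> [_]; apply/unitP => //; rewrite -hE.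
  move=> [_ [_ [[b _ <-] [s _ <-] ns ->]]].
  have us : psi s x \is a GRing.unit.
    by apply/(unitP _ _ Ux) => n; apply: ns; split=> //; exists s.
  exists (psi b x / psi s x) => //.
  by rewrite rmorphM rmorphV // !chart_rho.
- by move=> x _; exact: local_ring_loc.
- move=> P pP; have [x Ux PE] := Spec_surj sp (preim_prime pP); exists x => //.
  have [[_ PR] _ _] := pP.
  apply/seteqP; split=> y.
    move=> Py; have [c _ cE] := PR y Py; rewrite -cE; split; first by exists c.
    apply/(chart_nmax _ Ux).
    by have : [set b | nonunits (psi b x)] c by rewrite -PE /= cE.
  move=> [[c _ <-]] /(chart_nmax _ Ux) nc.
  by have : (ka @^-1` P) c by rewrite PE.
- move=> x y Ux Uy hx hy; apply: (Spec_inj sp Ux Uy) => c.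
  rewrite -(chart_nmax c Ux) -(chart_nmax c Uy).
  by split=> n; [apply: hx|apply: hy]; split=> //; exists c.
- move=> V x oV Vx Ux; have [e [ue he]] := spec_basis sp oV Vx Ux.
  exists (ka e); split; [by exists e|exact/unitP|].
  by move=> y Uy /(unitP _ _ Uy); exact: he.
- move=> _ [b _ <-]; have := spec_basic_open sp b.
  congr open; apply/seteqP; split=> x [Ux]; move=> h; split=> //.
    by apply/(unitP _ _ Ux).
  by apply/(unitP _ _ Ux).
Qed.

End ChartModel.

(** The algebra generators are adjoined to the image of [A] one at a time inside F, each step being
    an instance of [hilbert_basis]. *)
Lemma finite_type_noeth (A C : comUnitRingType) (F : fieldType) (h : {rmorphism A -> C})
    (ka : {rmorphism C -> F}) : finite_type_alg h -> rnoeth (range (ka \o h)) ->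
  rnoeth (range ka).
Proof.
move=> [s sE] nA; have sA : is_subring (range (ka \o h)).
  exact: (im_subring [the {rmorphism A -> F} of ka \o h]).
have [T [sT nT AT sT' TK]] : exists T, [/\ is_subring T, rnoeth T, range (ka \o h) `<=` T,
    forall c, c \in s -> T (ka c) & T `<=` range ka].
  elim: (s) => [|c t [T [sT nT AT ht TK]]].
    by exists (range (ka \o h)); split=> // _ [a _ <-]; exists (h a).
  exists (adj T (ka c)); split.
  - exact: adj_subring.
  - exact: hilbert_basis.
  - by apply: subset_trans AT _; exact: adj_sub.
  - move=> d; rewrite inE => /predU1P[->|/ht]; first exact: adj_gen.
    exact: adj_sub.
  - by apply: adj_min; [exact: im_subring|exact: TK|exists c].
suff -> : range ka = T by [].
apply/seteqP; split=> // _ [c _ <-].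
have : [set: C] c by [].
rewrite -sE => /(_ (ka @^-1` T)); apply.
  split=> [|a b|a b] /=; first by rewrite rmorph1; exact: sub1.
    by rewrite rmorphB; exact: subB.
  by rewrite rmorphM; exact: subM.
move=> d [[a _ <-]|ds] /=; first by apply: AT; exists a.
exact: sT'.
Qed.

Section ResolutionModel.
Variables (A : idomainType).
Hypotheses (A_noeth : noetherian A) (A_local : is_local A) (A_dim2 : krull_dim A 2)
  (A_normal : normal_domain A).
Variables (k : closedFieldType) (iota : {rmorphism k -> A}) (res : {rmorphism A -> k}).
Hypotheses (res_surj : forall c : k, exists a : A, res a = c)
  (res_ker : forall a : A, res a = 0 <-> nonunits a).
Variables (S : scheme) (phi : A -> forall s : S, stalk s).
Hypothesis S_Spec : is_Spec [set: S] phi.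
Variables (X : scheme) (pi : morphism X S).
Hypothesis pi_res : is_resolution pi.
Local Notation al := (fun_of phi pi).
Local Notation F := {fraction A}.
Local Notation emb := (@tofrac A : {rmorphism A -> {fraction A}}).
Local Notation AF := (range (@tofrac A)).
Variables (eta : X) (r : {rmorphism stalk eta -> F}).
Hypotheses (eta_gen : forall x, generizes eta x).
Hypotheses (r_al : forall a, r (al a eta) = tofrac a) (r_bij : bijective r).
Local Notation rho := (stalk_embedding r eta_gen).
Local Notation O := (local_ring r eta_gen).

Let X_int : integral_scheme X. Proof. by case: pi_res. Qed.

Lemma tofrac_inj0 (a : A) : emb a = 0 -> a = 0.
Proof. by move=> /eqP; rewrite tofrac_eq0 => /eqP. Qed.

Lemma rho_al x a : rho x (al a x) = tofrac a.
Proof. by rewrite (stalk_embeddingE _ _ openT I (alg_sect S_Spec pi a)) r_al. Qed.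

Lemma A_le x : AF `<=` O x.
Proof. by move=> _ [a _ <-]; exists (al a x) => //; exact: rho_al. Qed.

Lemma A_nmax a : nmax AF (tofrac a) <-> nonunits a.
Proof. exact: (im_nmax tofrac_inj0). Qed.

Lemma A_loc : is_loc AF.
Proof. exact: (im_loc tofrac_inj0 A_local). Qed.

Lemma O_nmax x a : nmax (O x) (rho x a) <-> nonunits a.
Proof. exact: (local_ring_nmax _ X_int). Qed.

Lemma al_nmax x a : nmax (O x) (tofrac a) <-> nonunits (phi a (pi x)).
Proof. by rewrite -(rho_al x) O_nmax !nonunitE (alg_stalk_unit phi pi). Qed.

Lemma exceptionalP x : exceptional AF O x <-> exceptional_set phi pi x.
Proof.
split=> [h a ua|h _ [[a _ <-] na]].
  apply: contrapT => /nonunitE/A_nmax/h/al_nmax/nonunitE; exact.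
apply/al_nmax/nonunitE => /h ua; apply/nonunitE: ua.
by apply/A_nmax; split; first by exists a.
Qed.

Lemma affine_cover : exists n (U : 'I_n -> set X) (R : 'I_n -> set F),
  (forall x, exists i, U i x) /\
  forall i, U i !=set0 -> affine_model O (U i) (R i).
Proof.
have [n [U [cov hU]]] := resolution_charts A_local S_Spec pi_res.
have /choice[R hR] i : exists R, U i !=set0 -> affine_model O (U i) R.
  have [U0|] := pselect (U i !=set0); last by exists set0.
  have [C [h [psi [[sp hal] ft]]]] := hU i.
  have [ka kaE] := chart_embedding_exists r eta_gen sp U0.
  exists (range ka) => _; apply: (chart_affine_model X_int eta_gen sp kaE).
  apply: (finite_type_noeth ft); have -> : range (ka \o h) = AF.
    have E a : ka (h a) = tofrac a.
      by rewrite kaE hal ?r_al //; exact: (chart_eta eta_gen sp U0).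
    by apply/seteqP; split=> _ [a _ <-]; exists a => //=.
  by apply: im_noeth.
by exists n, U, R.
Qed.

Lemma point_model x : exists U R, U x /\ affine_model O U R.
Proof.
have [n [U [R [cov hU]]]] := affine_cover; have [i Ux] := cov x.
by exists (U i), (R i); split=> //; apply: hU; exists x.
Qed.

(** Otherwise 0, [P], [Q] and the maximal ideal would form a chain of length three. *)
Lemma model_dim (P Q : set F) : is_rprime AF P -> is_rprime AF Q -> P `<=` Q ->
  (exists2 a, P a & a != 0) -> ~ (Q `<=` P) -> nmax AF `<=` Q.
Proof.
move=> pP pQ PQ [a0 Pa0 a00] nQP; apply: contrapT => nm.
pose c (i : nat) : set A := if i is i'.+1 then if i' is i''.+1 then
  if i'' is _.+1 then @nonunits A else emb @^-1` Q else emb @^-1` P else [set 0].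
suff H : prime_chain c 3%N by have [_ /(_ c 3%N H)] := A_dim2.
have [[mP PA] P1 _] := pP; have [[mQ QA] Q1 _] := pQ.
split.
- case=> [_|[_|[_|n _]]]; first exact: zero_prime.
  + exact: (preim_prime pP).
  + exact: (preim_prime pQ).
  + exact: nonunits_prime.
- case=> [_|[_|[_|n //]]].
  + split; first by move=> _ ->; rewrite /= rmorph0; exact: (mod0 mP).
    move=> h; have [a _ aE] := PA _ Pa0.
    have : [set 0] a by apply: h; rewrite /= aE.
    by move=> /= a0E; rewrite -aE a0E rmorph0 eqxx in a00.
  + split; first by move=> a; exact: PQ.
    move=> h; apply: nQP => x Qx; have [a _ aE] := QA _ Qx.
    by rewrite -aE; apply: h; rewrite /= aE.
  + split.
      by move=> a /= Qa; apply/A_nmax; apply: (idl_nmax (im_subring emb) (conj mQ QA) Q1).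
    by move=> h; apply: nm => x nx; have [[a _ aE] _] := nx; rewrite -aE; apply: h; apply/A_nmax; rewrite aE.
Qed.

Lemma model_normal n (c : nat -> F) (x : F) : (forall i, AF (c i)) ->
  x ^+ n = \sum_(i < n) c i * x ^+ i -> AF x.
Proof.
move=> Ac xE; have /choice[d dE] i : exists d, tofrac d = c i.
  by have [d _ dE] := Ac i; exists d.
have [a ->] : exists a, x = tofrac a; last by exists a.
apply: A_normal; exists ('X^n - \poly_(i < n) d i).
  rewrite monicE lead_coefDl ?lead_coefXn //.
  by rewrite size_polyN size_polyXn ltnS size_poly.
rewrite /root rmorphB /= map_polyXn !hornerE.
have -> : map_poly (@tofrac A) (\poly_(i < n) d i) = \poly_(i < n) c i.
  by apply/polyP => i; rewrite coef_map /= !coef_poly; case: ifP => _; [exact: dE|exact: rmorph0].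
by rewrite horner_poly xE subrr.
Qed.

(** Being monic, the polynomial keeps its degree over the residue field [k], where it has a root;
    any lift of this root along [res] will do. *)
Lemma model_root (p : {poly F}) : polyR AF p -> p \is monic -> (1 < size p)%N ->
  exists2 a, AF a & nmax AF p.[a].
Proof.
move=> Ap mp sp; have /choice[d dE] i : exists d, tofrac d = p`_i.
  by have [d _ dE] := Ap i; exists d.
pose q := \poly_(i < size p) d i.
have pE : p = map_poly (@tofrac A) q.
  apply/polyP => i; rewrite coef_map /= coef_poly; case: ltnP => [_|le]; first by rewrite dE.
  by rewrite rmorph0 nth_default.
have dl : d (size p).-1 = 1.
  by apply: (rho_injective tofrac_inj0); rewrite /= dE rmorph1 -lead_coefE; apply/eqP.
have p0 : (0 < size p)%N by exact: ltn_trans sp.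
have sq0 : size q = size p by apply: size_poly_eq; rewrite dl oner_eq0.
have sq : size (map_poly res q) = size p.
  rewrite size_map_poly_id0 // lead_coefE sq0 coef_poly prednK // leqnn dl.
  by rewrite rmorph1 oner_eq0.
have /closed_rootP[c] : size (map_poly res q) != 1 by rewrite sq neq_ltn sp orbT.
have [a <-] := res_surj c; rewrite rootE horner_map => /eqP/res_ker na.
exists (tofrac a); first by exists a.
by rewrite pE horner_map; apply/A_nmax.
Qed.

(** Scalars of the infinite field [k], each chosen outside the list of its predecessors; [iota]
    carries their nonzero differences to units. *)
Lemma model_units : exists kk : nat -> F, (forall i, AF (kk i)) /\
  forall i j, i != j -> ~ nmax AF (kk i - kk j).
Proof.
have next (s : seq k) : exists c, c \notin s.
  have [|c] := closed_nonrootP (\prod_(x <- s) ('X - x%:P)) _.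
    by rewrite monic_neq0 // monic_prod_XsubC.
  by rewrite root_prod_XsubC => h; exists c.
have [f fP] := choice next.
pose l := fix l n := if n is n'.+1 then f (l n') :: l n' else [::].
have lt i j : (i < j)%N -> f (l i) \in l j.
  elim: j => // j IH; rewrite ltnS leq_eqVlt => /predU1P[->|/IH h] /=.
    exact: mem_head.
  by rewrite inE h orbT.
have ne i j : i != j -> f (l i) != f (l j).
  rewrite neq_ltn => /orP[] h; have h' := lt _ _ h.
    by apply: contraTneq h' => ->; exact: fP.
  by apply: contraTneq h' => <-; exact: fP.
exists (fun i => tofrac (iota (f (l i)))); split; first by move=> i; exists (iota (f (l i))).
move=> i j ij; rewrite -!rmorphB /= => /A_nmax/nonunitE; apply.
by apply: rmorph_unit; rewrite unitfE subr_eq0 ne.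
Qed.

Lemma model_meet (C : set X) : closed C -> C !=set0 ->
  exists2 x, C x & nmax AF `<=` nmax (O x).
Proof.
move=> cC [x Cx]; have [s0 [ms0 opS]] := closed_point_exists A_local S_Spec.
have cl := resolution_closed pi_res cC.
have [y Cy yE] : (pi @` C) s0.
  apply: contrapT => h; have := opS _ (closed_openC cl) h.
  by move=> /seteqP[_ /(_ (pi x) I)]; apply; exists x.
exists y => // _ [[a _ <-] na]; apply/al_nmax; rewrite yE; apply/ms0.
by apply/A_nmax; split; first by exists a.
Qed.

Lemma model_surj (P : set F) : is_rprime AF P -> exists x, AF `&` nmax (O x) = P.
Proof.
move=> pP; have [s _ PE] := Spec_surj S_Spec (preim_prime pP).
have [x xE] := resolution_surjective pi_res s; exists x.
have [[_ PA] _ _] := pP; apply/seteqP; split=> y.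
  move=> [[a _ <-] /al_nmax]; rewrite xE => na.
  by have : (emb @^-1` P) a by rewrite PE.
move=> Py; have [a _ aE] := PA y Py; rewrite -aE; split; first by exists a.
apply/al_nmax; rewrite xE; have : [set b | nonunits (phi b s)] a by rewrite -PE /= aE.
by [].
Qed.

Lemma model_eta : O eta = setT.
Proof.
apply/seteqP; split=> // c _; have [g gK gK'] := r_bij.
exists (g c) => //; have [U [s [oU Ue hs sE]]] := ls_germ (g c).
by rewrite -sE (stalk_embeddingE _ _ oU Ue hs) sE.
Qed.

Lemma cover_charts : forall x : X, exists (B : comUnitRingType) (U : set X)
  (psi : B -> fam X) (h : {rmorphism A -> B}), U x /\ alg_chart al U psi h.
Proof.
have [n [U [cov hU]]] := resolution_charts A_local S_Spec pi_res.
move=> x; have [i Ux] := cov x; have [C [h [psi [ch _]]]] := hU i.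
by exists C, (U i), psi, h.
Qed.

Lemma O_subring x : is_subring (O x). Proof. exact: im_subring. Qed.

(* If no such relation exists, the elements of the tensor product of two
   charts whose image at y lies in the span N form an ideal avoiding the
   products of elements prime to x and x'; a prime above it is a point of the
   self-product of X in the closure of the diagonal. *)
Lemma model_sep (y x x' : X) : generizes y x -> generizes y x' -> x <> x' ->
  exists n (a b : nat -> F), [/\ forall i, O x (a i), forall i, O x' (b i),
    forall i, nmax (O x) (a i) \/ nmax (O x') (b i) &
    nmax (O y) (\sum_(i < n) a i * b i - 1)].
Proof.
move=> gx gx' ne; apply: contrapT => h0; apply: ne.
have [C [U [psi [h [Ux ch]]]]] := cover_charts x.
have [C' [U' [psi' [h' [Ux' ch']]]]] := cover_charts x'.
have sp := ac_spec ch; have sp' := ac_spec ch'.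
have Uy : U y by apply: gx => //; exact: (Spec_open sp).
have Uy' : U' y by apply: gx' => //; exact: (Spec_open sp').
have [u uE] := spec_rmorphism sp Uy; have [v vE] := spec_rmorphism sp' Uy'.
have uv a : u (h a) = v (h' a) by rewrite uE vE (ac_alg ch) // (ac_alg ch').
have [T [i [j [po gen]]]] := pushout_exists uv.
have [kd [kdi kdj _]] : exists kd : {rmorphism T -> stalk y}, [/\ forall b, kd (i b) = u b,
    forall c, kd (j c) = v c & True].
  by have [_ univ] := po; have [w [w1 w2 _]] := univ _ u v uv; exists w.
have sy := O_subring y; have sx := O_subring x; have sx' := O_subring x'.
have [my _] := nmax_idl (local_ring_loc r X_int eta_gen y).
have [mx _] := nmax_idl (local_ring_loc r X_int eta_gen x).
have [mx' _] := nmax_idl (local_ring_loc r X_int eta_gen x').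
pose good (l : seq (F * F)) := forall p, p \in l ->
  [/\ O x p.1, O x' p.2 & nmax (O x) p.1 \/ nmax (O x') p.2].
(* The functions congruent at [y] to a sum of products in which one factor vanishes at [x] or at
   [x']. Its preimage in the tensor product is an ideal, and a proper one by [h0]. *)
pose N := [set z | exists l, good l /\ nmax (O y) (\sum_(p <- l) p.1 * p.2 - z)].
have ND z w : N z -> N w -> N (z + w).
  move=> [l [gl nl]] [l' [gl' nl']]; exists (l ++ l'); split.
    by move=> p; rewrite mem_cat => /orP[/gl|/gl'].
  rewrite big_cat /= opprD addrACA; exact: (modD my).
have NM a b z : O x a -> O x' b -> O y a -> O y b -> N z -> N (a * b * z).
  move=> Oa Ob Oya Oyb [l [gl nl]].
  exists [seq (a * p.1, b * p.2) | p <- l]; split.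
    move=> _ /mapP[p /gl[O1 O2 np] ->]; split; [exact: subM|exact: subM|].
    by case: np => np; [left; exact: (modM mx)|right; exact: (modM mx')].
  rewrite big_map (_ : _ - _ = a * b * (\sum_(p <- l) p.1 * p.2 - z)).
    by apply: (modM my) => //; exact: subM.
  by rewrite mulrBr mulr_sumr; congr (_ - _); apply: eq_bigr => p _ /=; ring.
have N1 : ~ N 1.
  move=> [l [gl nl]]; apply: h0; exists (size l), (fun i => (nth (0, 0) l i).1), (fun i => (nth (0, 0) l i).2).
  have g0 q : [/\ O x (nth (0, 0) l q).1, O x' (nth (0, 0) l q).2 &
      nmax (O x) (nth (0, 0) l q).1 \/ nmax (O x') (nth (0, 0) l q).2].
    have [lt|le] := ltnP q (size l); first by apply: gl; exact: mem_nth.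
    rewrite nth_default //=; split; [exact: sub0|exact: sub0|left; exact: (mod0 mx)].
  split; try by move=> q; case: (g0 q).
  by rewrite (big_nth (0, 0)) big_mkord in nl.
have Oyx a : O x a -> O y a.
  have [V [R [Vx mV]]] := point_model x; exact: (am_generize mV Vx gx).
have Oyx' a : O x' a -> O y a.
  have [V [R [Vx mV]]] := point_model x'; exact: (am_generize mV Vx gx').
have rpsi b z : U z -> U y -> rho z (psi b z) = rho y (psi b y).
  by move=> Uz _; rewrite !(stalk_embeddingE _ _ (Spec_open sp) _ (Spec_sect sp b)).
have rpsi' b z : U' z -> U' y -> rho z (psi' b z) = rho y (psi' b y).
  by move=> Uz _; rewrite !(stalk_embeddingE _ _ (Spec_open sp') _ (Spec_sect sp' b)).
pose II := [set t : T | N (rho y (kd t))].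
have kij b c : rho y (kd (i b * j c)) = rho x (psi b x) * rho x' (psi' c x').
  by rewrite !rmorphM kdi kdj uE vE (rpsi _ x) // (rpsi' _ x').
have iII : is_idl setT II.
  split=> //; split.
  - exists [::]; split=> //; rewrite big_nil rmorph0 rmorph0 subrr; exact: (mod0 my).
  - by move=> a b Na Nb; rewrite /II /= !rmorphD; exact: ND.
  - move=> t a _ Na; have [l ->] := gen t; rewrite /II /= /tev mulr_suml !rmorph_sum /=.
    elim: l => [|p l IH]; last first.
      rewrite big_cons; apply: ND => //.
      have -> : rho y (kd (i p.1 * j p.2 * a)) =
          rho x (psi p.1 x) * rho x' (psi' p.2 x') * rho y (kd a) by rewrite -kij -!rmorphM.
      have Op : O x (rho x (psi p.1 x)) by exists (psi p.1 x).
      have Op' : O x' (rho x' (psi' p.2 x')) by exists (psi' p.2 x').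
      by apply: NM => //; [exact: Oyx|exact: Oyx'].
    by rewrite big_nil; exists [::]; split=> //; rewrite big_nil subrr; exact: (mod0 my).
(* Disjointness from [SS] keeps a prime from containing functions invertible at [x] or at [x'],
   while the ideal [II] contains those vanishing there; the prime therefore lies over exactly these
   two points. *)
pose SS := [set t : T | exists b c, [/\ ~ nonunits (psi b x), ~ nonunits (psi' c x') & t = i b * j c]].
have psi1 (b : C) z : U z -> ~ nonunits (psi b z) -> psi b z \is a GRing.unit.
  by move=> _ nb; apply: contrapT => /nonunitE.
have [| | | |Q [/rprimeT pQ IQ SQ]] := @prime_avoiding T setT II SS (subringT _) iII.
- exists 1, 1; rewrite !rmorph1 mulr1.
  have [w wE] := spec_rmorphism sp Ux; have [w' wE'] := spec_rmorphism sp' Ux'.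
  by split=> //; rewrite -?wE -?wE' rmorph1; move/nonunitE; apply; exact: unitr1.
- move=> _ _ [b [c [nb nc ->]]] [b' [c' [nb' nc' ->]]].
  exists (b * b'), (c * c'); have [w wE] := spec_rmorphism sp Ux; have [w' wE'] := spec_rmorphism sp' Ux'.
  split; last by rewrite !rmorphM mulrACA.
    rewrite -wE rmorphM !wE; move/nonunitE; apply; rewrite unitrM.
    by apply/andP; split; apply: contrapT => /nonunitE.
  rewrite -wE' rmorphM !wE'; move/nonunitE; apply; rewrite unitrM.
  by apply/andP; split; apply: contrapT => /nonunitE.
- by [].
- move=> _ [b [c [nb nc ->]]]; rewrite /II /= kij => Nz; apply: N1.
  have ub : psi b x \is a GRing.unit by apply: contrapT => /nonunitE.
  have uc : psi' c x' \is a GRing.unit by apply: contrapT => /nonunitE.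
  pose b' := rho x (psi b x)^-1; pose c' := rho x' (psi' c x')^-1.
  have -> : 1 = b' * c' * (rho x (psi b x) * rho x' (psi' c x')).
    rewrite /b' /c' !rmorphV //.
    have b0 := rmorph_unit (rho x) ub; have c0 := rmorph_unit (rho x') uc.
    by rewrite !unitfE in b0 c0; field; rewrite b0 c0.
  have Ob' : O x b' by exists (psi b x)^-1.
  have Oc' : O x' c' by exists (psi' c x')^-1.
  by apply: NM => //; [exact: Oyx|exact: Oyx'].
have [_ _ [_ sep _] _] := pi_res.
apply: (separated_points S_Spec cover_charts (kd := kd) (Q := Q) sep ch ch' po gen Ux Ux' Uy Uy' pQ).
- move=> b; split=> [Qb|nb].
    apply: contrapT => nb; apply: (SQ (i b)) => //; exists b, 1.
    rewrite rmorph1 mulr1; split=> //; have [w' wE'] := spec_rmorphism sp' Ux'.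
    by rewrite -wE' rmorph1 => /nonunitE; apply; exact: unitr1.
  apply: IQ; have := kij b 1; rewrite rmorph1 mulr1 /II /= => ->.
  have [w' wE'] := spec_rmorphism sp' Ux'; rewrite -wE' !rmorph1 mulr1.
  exists [:: (rho x (psi b x), 1)]; split.
    move=> p; rewrite inE => /eqP ->; split; [by exists (psi b x)|exact: sub1|left].
    exact/O_nmax.
  by rewrite big_seq1 /= mulr1 subrr; exact: (mod0 my).
- move=> b; split=> [Qb|nb].
    apply: contrapT => nb; apply: (SQ (j b)) => //; exists 1, b.
    rewrite rmorph1 mul1r; split=> //; have [w wE] := spec_rmorphism sp Ux.
    by rewrite -wE rmorph1 => /nonunitE; apply; exact: unitr1.
  apply: IQ; have := kij 1 b; rewrite rmorph1 mul1r /II /= => ->.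
  have [w wE] := spec_rmorphism sp Ux; rewrite -wE !rmorph1 mul1r.
  exists [:: (1, rho x' (psi' b x'))]; split.
    move=> p; rewrite inE => /eqP ->; split; [exact: sub1|by exists (psi' b x')|right].
    exact/O_nmax.
  by rewrite big_seq1 /= mul1r subrr; exact: (mod0 my).
- by move=> b; rewrite kdi.
- by move=> b; rewrite kdj.
- move=> t nt; apply: contrapT => /nonunitE nk; apply: nt; apply: IQ.
  exists [::]; split=> //; rewrite big_nil sub0r; apply: (modN sy my).
  exact/O_nmax.
Qed.

Lemma resolution_model : local_model AF O eta.
Proof.
have pm := point_model.
split.
- exact: A_loc.
- by apply: im_noeth.
- exact: model_dim.
- move=> x; have [a [b [b0 ->]]] := fraction_frac x; exists (tofrac a), (tofrac b).
  by split; [exists a|exists b|rewrite tofrac_eq0|].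
- exact: model_normal.
- exact: model_root.
- exact: model_units.
- exact: A_le.
- exact: (local_ring_loc r X_int eta_gen).
- move=> x; have [_ reg _ _] := pi_res; have [_ nx _] := reg x.
  by apply: im_noeth.
- by move=> x a; have [U [R [Ux mU]]] := pm x; exact: (am_sections mU Ux).
- by move=> x Q; have [U [R [Ux mU]]] := pm x; exact: (am_points mU Ux).
- by move=> x y a; have [U [R [Ux mU]]] := pm x; exact: (am_generize mU Ux).
- by move=> x y a; have [U [R [Ux mU]]] := pm x; exact: (am_localize mU Ux).
- by move=> x y z; have [U [R [Ux mU]]] := pm x; exact: (am_compare mU Ux).
- by move=> x y g g'; have [U [R [Ux mU]]] := pm x; exact: (am_T0 mU Ux g' g).
- move=> C cC; have [n [U [R [cov hU]]]] := affine_cover.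
  have /choice[s hs] i : exists s : seq X, (forall w, w \in s -> C w) /\
      forall x, U i x -> C x -> exists2 w, w \in s & generizes w x.
    have [U0|U0] := pselect (U i !=set0); first exact: (am_closed (hU i U0) cC).
    by exists [::]; split=> // x Ux; case: U0; exists x.
  exists (flatten [seq s i | i <- enum 'I_n]) => x; split=> [Cx|[w wf g]].
    have [i Ux] := cov x; have [w ws g] := (hs i).2 x Ux Cx; exists w => //.
    by apply/flattenP; exists (s i) => //; apply: map_f; rewrite mem_enum.
  have /flattenP[t /mapP[i _ ->] wt] := wf; have Cw := (hs i).1 w wt.
  apply: contrapT => nC; exact: (g _ (closed_openC cC) nC).
- exact: model_meet.
- exact: model_surj.
- exact: eta_gen.
- exact: model_eta.
- exact: model_sep.
Qed.

End ResolutionModel.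

Lemma gen_ideal1 (R : comUnitRingType) (p x : R) :
  gen_ideal [set` [:: p]] x <-> exists c, x = p * c.
Proof.
split; last first.
  move=> [c ->] I [_ _ IM] pI; rewrite mulrC; apply: IM; apply: pI.
  by rewrite /= inE.
move=> /(_ [set x | exists c, x = p * c]); apply; last first.
  by move=> y /=; rewrite inE => /eqP ->; exists 1; rewrite mulr1.
split; first by exists 0; rewrite mulr0.
  by move=> _ _ [c ->] [d ->]; exists (c + d); rewrite mulrDr.
by move=> t _ [c ->]; exists (t * c); rewrite mulrCA.
Qed.

Lemma gen_ideal2 (R : comUnitRingType) (u v x : R) :
  gen_ideal [set` [:: u; v]] x -> exists a b, x = a * u + b * v.
Proof.
move=> /(_ [set x | exists a b, x = a * u + b * v]); apply.
  split; first by exists 0, 0; rewrite !mul0r addr0.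
    by move=> _ _ [a [b ->]] [c [d ->]]; exists (a + c), (b + d); ring.
  by move=> t _ [a [b ->]]; exists (t * a), (t * b); ring.
move=> y /=; rewrite !inE => /orP[] /eqP ->; first by exists 1, 0; ring.
by exists 0, 1; ring.
Qed.

Lemma gen_ideal_mem (R : comUnitRingType) (s : seq R) x : x \in s -> gen_ideal [set` s] x.
Proof. by move=> xs I _; apply. Qed.

Lemma krull_dim_uniq (R : comUnitRingType) d d' :
  krull_dim R d -> krull_dim R d' -> d = d'.
Proof.
move=> [[P cP] h] [[P' cP'] h']; apply/eqP; rewrite eqn_leq.
by rewrite (h' _ _ cP) (h _ _ cP').
Qed.

(** * Uniformizers and regular parameters *)

Section ResolutionPrimes.
Variables (A : idomainType).
Hypotheses (A_noeth : noetherian A) (A_local : is_local A) (A_dim2 : krull_dim A 2)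
  (A_normal : normal_domain A).
Variables (k : closedFieldType) (iota : {rmorphism k -> A}) (res : {rmorphism A -> k}).
Hypotheses (res_surj : forall c : k, exists a : A, res a = c)
  (res_ker : forall a : A, res a = 0 <-> nonunits a).
Variables (S : scheme) (phi : A -> forall s : S, stalk s).
Hypothesis S_Spec : is_Spec [set: S] phi.
Variables (X : scheme) (pi : morphism X S).
Hypothesis pi_res : is_resolution pi.
Local Notation al := (fun_of phi pi).
Local Notation F := {fraction A}.
Local Notation emb := (@tofrac A : {rmorphism A -> {fraction A}}).
Local Notation AF := (range (@tofrac A)).
Variables (eta : X) (r : {rmorphism stalk eta -> F}).
Hypotheses (eta_gen : forall x, generizes eta x).
Hypotheses (r_al : forall a, r (al a eta) = tofrac a) (r_bij : bijective r).
Local Notation rho := (stalk_embedding r eta_gen).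
Local Notation O := (local_ring r eta_gen).
Hypothesis A_cat : universally_catenary A.

Let X_int : integral_scheme X. Proof. by case: pi_res. Qed.
Let M : local_model AF O eta.
Proof.
exact: (resolution_model A_noeth A_local A_dim2 A_normal iota res_surj res_ker S_Spec pi_res
  eta_gen r_al r_bij).
Qed.
Let rinj x a : rho x a = 0 -> a = 0. Proof. exact: (stalk_embedding_inj X_int). Qed.
Let nmaxP x a : nmax (O x) (rho x a) <-> nonunits a. Proof. exact: (im_nmax (@rinj x)). Qed.
Let regular (x : X) : regular_local (stalk x). Proof. by have [_ reg _ _] := pi_res; exact: reg. Qed.

Lemma uniformizer e : krull_dim (stalk e) 1 ->
  exists p, p != 0 /\ nmax (O e) = scale_set p (O e).
Proof.
move=> dim1; have [_ _ [d dimd [s sd sE]]] := regular e.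
have d1 := krull_dim_uniq dimd dim1; rewrite d1 in sd.
case: s sd sE => [|p [|? ?]] // _ sE; exists (rho e p).
have pP a : nonunits a <-> exists c, a = p * c by rewrite sE gen_ideal1.
split.
  apply/eqP => /rinj p0; have [[P [pP' /(_ 0%N isT)[P01 nP10]]] _] := dim1.
  apply: nP10 => a P1a; have [[P00 _ _] _ _] := pP' 0%N isT.
  have [iP1 P11 _] := pP' 1%N isT.
  have /pP[c ->] : nonunits a; last by rewrite p0 mul0r.
  apply/nonunitE => ua; apply: P11; rewrite -(mulVr ua).
  by have [_ _ h] := iP1; exact: h.
apply/seteqP; split=> y.
  move=> ny; have [[a _ aE] _] := ny; rewrite -aE in ny *.
  by have /nmaxP/pP[c ->] := ny; exists (rho e c); [exists c|rewrite rmorphM].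
move=> [_ [c _ <-] <-]; rewrite -rmorphM; apply/nmaxP/pP.
by exists c.
Qed.

Definition point_chain x (y : nat -> X) n :=
  (forall i, (i <= n)%N -> generizes (y i) x) /\
  forall i, (i < n)%N -> generizes (y i) (y i.+1) /\ y i <> y i.+1.

Lemma chain_of_points x y n : point_chain x y n ->
  exists P : nat -> set (stalk x), prime_chain P n.
Proof.
move=> [hy hy']; exists (fun i => rho x @^-1` (O x `&` nmax (O (y i)))); split.
  by move=> i le; apply: preim_prime; exact: (trace_prime M (hy i le)).
move=> i lt; have [g ne] := hy' i lt; have gi := hy i (ltnW lt); have gi1 := hy i.+1 lt; split.
  by move=> a; apply: (gen_trace_sub M gi gi1 g).
move=> h; apply: ne; apply: (lm_T0 M) => //; apply: (lm_gencmp M gi1 gi) => _ [[a _ <-] na].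
by have [_] := h a (conj (ex_intro2 _ _ a I erefl) na).
Qed.

Lemma points_of_chain x (P : nat -> set (stalk x)) n : prime_chain P n ->
  exists y, point_chain x y n.
Proof.
move=> [pP hP].
have /choice[y hy] i : exists y, (i <= n)%N ->
    generizes y x /\ rho x @` P i = O x `&` nmax (O y).
  have [le|_] := boolP (i <= n)%N; last by exists x.
  by have [y g yE] := lm_prime M (im_prime (@rinj x) (pP i le)); exists y.
exists y; split; first by move=> i /hy[].
move=> i lt; have [gi Ei] := hy i (ltnW lt); have [gi1 Ei1] := hy i.+1 lt.
have [P01 P10] := hP i lt; split.
  apply: (lm_gencmp M gi gi1) => z; rewrite -Ei => -[a Pa <-].
  have [//] : (O x `&` nmax (O (y i.+1))) (rho x a).
  by rewrite -Ei1; exists a => //; exact: P01.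
move=> yy; apply: P10 => a Pa.
have : (rho x @` P i) (rho x a) by rewrite Ei yy -Ei1; exists a.
by move/(im_memE (@rinj x)).
Qed.

Lemma point_chain_bound x y n d : krull_dim (stalk x) d -> point_chain x y n -> (n <= d)%N.
Proof. by move=> [_ h] /chain_of_points[P cP]; exact: h cP. Qed.

(** A regular stalk of dimension [d] has [d] generators of its maximal ideal, so [d = 2] is what has
    to be shown. A longest chain of generizations of [x] and the chain [eta], [e], [x] are both
    saturated in a chart of finite type over [A], with the same ends; catenarity makes them equally
    long. *)
Lemma regular_parameters e x : exc_divisor AF O e -> generizes e x -> e <> x ->
    (forall w, generizes e w -> generizes w x -> w = e \/ w = x) ->
  exists u v, [/\ nmax (O x) u, nmax (O x) v &
    forall n, nmax (O x) n -> exists r s, [/\ O x r, O x s & n = r * u + s * v]].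
Proof.
move=> De gex ex hw; have [_ _ [d dimd [s sd sE]]] := regular x.
have [[P cP] _] := dimd; have [y cy] := points_of_chain cP; have [hy hy'] := cy.
have bound := point_chain_bound dimd.
(* A chain of maximal length begins at [eta], ends at [x] and admits no insertion, as it could
   otherwise be prolonged beyond [d]. *)
have y0 : y 0%N = eta.
  apply: contrapT => ne; have : (d.+1 <= d)%N; last by rewrite ltnn.
  apply: (bound (fun i => if i is i'.+1 then y i' else eta)); split.
    by case=> [_|i]; [exact: eta_gen|exact: hy].
  by case=> [_|i]; [split; [exact: eta_gen|move=> h; apply: ne]|exact: hy'].
have yd : y d = x.
  apply: contrapT => ne; have : (d.+1 <= d)%N; last by rewrite ltnn.
  apply: (bound (fun i => if (i <= d)%N then y i else x)); split.
    by move=> i _; case: ifP => [le|_]; [exact: hy|exact: gen_refl].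
  move=> i; rewrite ltnS => le; rewrite le; case: ltnP => [lt|le']; first exact: hy'.
  have id : i = d by apply/eqP; rewrite eqn_leq le.
  by rewrite id; split=> //; exact: hy.
have sat i w : (i < d)%N -> generizes (y i) w -> generizes w (y i.+1) -> w = y i \/ w = y i.+1.
  move=> lt g1 g2; apply: contrapT => /not_orP[n1 n2].
  have : (d.+1 <= d)%N; last by rewrite ltnn.
  apply: (bound (fun j => if (j <= i)%N then y j else if j == i.+1 then w else y j.-1)); split.
    move=> j le; case: leqP => [ji|ij]; first by apply: hy; exact: leq_trans ji (ltnW lt).
    case: eqP => _; first exact: (gen_trans g2 (hy i.+1 lt)).
    by apply: hy; case: j le ij.
  move=> j; rewrite ltnS => le; case: (ltngtP j i) => [ji|ij|->].
  - by apply: hy'; exact: ltn_trans ji lt.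
  - rewrite (gtn_eqF (ij : (i.+1 < j.+1)%N)) /=.
    case: eqP => [->|ne] /=; first by split=> // h; apply: n2.
    case: j ij le ne => // j ij le ne; apply: hy' => //=.
  - by rewrite eqxx; split=> // h; apply: n1.
have [n [U [cov hU]]] := resolution_charts A_local S_Spec pi_res.
have [i Ux] := cov x; have [C [h [psi [[sp hal] ft]]]] := hU i.
have catC := A_cat ft.
have [ka kaE] := chart_embedding_exists r eta_gen sp (ex_intro _ x Ux).
pose pt w : set C := [set c | nonunits (psi c w)].
have up w : generizes w x -> U i w by move=> g; apply: g => //; exact: (Spec_open sp).
have kan w c : U i w -> nmax (O w) (ka c) <-> pt w c by move=> Uw; exact: (chart_nmax X_int eta_gen sp kaE c Uw).
have ptle w w' : generizes w x -> generizes w' x -> (generizes w w' <-> pt w `<=` pt w').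
  move=> gw gw'; split=> [g c|le V oV Vw'].
    move=> /(kan w c (up w gw)) nc; apply/(kan w' c (up w' gw')).
    apply: (gen_nmax M g) nc; exists (psi c w') => //.
    exact: (chart_rho eta_gen sp kaE c (up w' gw')).
  have [e0 [ue He]] := spec_basis sp oV Vw' (up w' gw').
  apply: He; first exact: up.
  by apply: contrapT => /nonunitE /le /nonunitE.
have strict w w' : generizes w x -> generizes w' x -> generizes w w' -> w <> w' -> pt w `<` pt w'.
  move=> gw gw' g ne; split; first exact/ptle.
  by move=> /(ptle _ _ gw' gw) g'; apply: ne; exact: (lm_T0 M).
have satC m (z : nat -> X) : point_chain x z m ->
    (forall j w, (j < m)%N -> generizes (z j) w -> generizes w (z j.+1) -> w = z j \/ w = z j.+1) ->
    saturated_chain (fun j => pt (z j)) m.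
  move=> [hz hz'] hs; split.
    split=> j lt; first exact: (spec_primeP sp (up _ (hz j lt))).
    by have [g ne] := hz' j lt; apply: strict => //; apply: hz => //; exact: ltnW.
  move=> j Q lt pQ; have [w Uw QE] := Spec_surj sp pQ.
  rewrite QE -/(pt w) => -[[h1 n1] [h2 n2]].
  have gz1 := hz j.+1 lt; have gz := hz j (ltnW lt).
  have gwz : generizes w (z j.+1).
    move=> V oV Vz; have [e0 [ue He]] := spec_basis sp oV Vz (up _ gz1).
    by apply: He => //; apply: contrapT => /nonunitE /h2 /nonunitE.
  have gw : generizes w x by exact: (gen_trans gwz).
  have [wE|wE] := hs j w lt ((ptle _ _ gz gw).2 h1) gwz.
  - by apply: n1; rewrite wE.
  - by apply: n2; rewrite wE.
have E2 : point_chain x (fun j => if j is j'.+1 then if j' is _.+1 then x else e else eta) 2.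
  split; first by case=> [|[|[|//]]] _; [exact: eta_gen|exact: gex|exact: gen_refl].
  case=> [_|[_|//]] /=; last by split.
  by split; [exact: eta_gen|move=> he; apply: (divisor_neq_eta M De); rewrite he].
have d2 : d = 2%N.
  apply: (catC _ _ _ _ (satC _ _ cy sat) (satC _ _ E2 _)); rewrite ?y0 ?yd //.
  case=> [|[|//]] w _ /= g1 g2; last exact: hw.
  by have [->|->] := divisor_gen M De g2; [right|left].
rewrite d2 in sd; case: s sd sE => [|u [|v [|? ?]]] // _ sE.
exists (rho x u), (rho x v); split.
- by apply/nmaxP; rewrite sE; apply: gen_ideal_mem; rewrite !inE eqxx.
- by apply/nmaxP; rewrite sE; apply: gen_ideal_mem; rewrite !inE eqxx orbT.
- move=> z nz; have [[a _ aE] _] := nz; rewrite -aE in nz *; move/nmaxP: nz.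
  rewrite sE => /gen_ideal2[b [c ->]]; exists (rho x b), (rho x c).
  by split; [exists b|exists c|rewrite rmorphD !rmorphM].
Qed.

End ResolutionPrimes.

(** * Comparison with Cech cohomology *)

Lemma ideal_pow_principal (R : comUnitRingType) (I : set R) p n a :
  (forall b, I b <-> exists c, b = p * c) ->
  ideal_pow I n a <-> exists c, a = p ^+ n * c.
Proof.
move=> hI; elim: n a => [|n IH] a /=.
  by split=> // _; exists a; rewrite mul1r.
split.
  move=> /(_ [set x | exists c, x = p ^+ n.+1 * c]); apply.
    split; first by exists 0; rewrite mulr0.
      by move=> _ _ [c ->] [d ->]; exists (c + d); rewrite mulrDr.
    by move=> t _ [c ->]; exists (t * c); rewrite mulrCA.
  move=> _ [b /hI[c ->] [d /IH[e ->] <-]]; exists (c * e).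
  by rewrite exprS; ring.
move=> [c ->] K _; apply; exists p; first by apply/hI; exists 1; rewrite mulr1.
by exists (p ^+ n * c); [apply/IH; exists c|rewrite exprS mulrA].
Qed.

Section Translation.
Variables (A : idomainType).
Hypotheses (A_noeth : noetherian A) (A_local : is_local A) (A_dim2 : krull_dim A 2)
  (A_normal : normal_domain A).
Variables (k : closedFieldType) (iota : {rmorphism k -> A}) (res : {rmorphism A -> k}).
Hypotheses (res_surj : forall c : k, exists a : A, res a = c)
  (res_ker : forall a : A, res a = 0 <-> nonunits a).
Variables (S : scheme) (phi : A -> forall s : S, stalk s).
Hypothesis S_Spec : is_Spec [set: S] phi.
Variables (X : scheme) (pi : morphism X S).
Hypothesis pi_res : is_resolution pi.
Local Notation al := (fun_of phi pi).
Local Notation F := {fraction A}.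
Local Notation emb := (@tofrac A : {rmorphism A -> {fraction A}}).
Local Notation AF := (range (@tofrac A)).
Variables (eta : X) (r : {rmorphism stalk eta -> F}).
Hypotheses (eta_gen : forall x, generizes eta x).
Hypotheses (r_al : forall a, r (al a eta) = tofrac a) (r_bij : bijective r).
Local Notation rho := (stalk_embedding r eta_gen).
Local Notation O := (local_ring r eta_gen).
Hypothesis A_cat : universally_catenary A.

Let X_int : integral_scheme X. Proof. by case: pi_res. Qed.
Let M : local_model AF O eta.
Proof.
exact: (resolution_model A_noeth A_local A_dim2 A_normal iota res_surj res_ker S_Spec pi_res
  eta_gen r_al r_bij).
Qed.
Let rinj x a : rho x a = 0 -> a = 0. Proof. exact: (stalk_embedding_inj X_int). Qed.
Let rinj2 (x : X) : injective (rho x). Proof. exact: (rho_injective (@rinj x)). Qed.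
Let nmaxP x a : nmax (O x) (rho x a) <-> nonunits a. Proof. exact: (im_nmax (@rinj x)). Qed.
Let rhoal x a : rho x (al a x) = tofrac a. Proof. exact: (rho_al S_Spec eta_gen r_al). Qed.
Let rho_eta a : rho eta a = r a.
Proof.
by have [U [s [oU Ue hs <-]]] := ls_germ a; rewrite (stalk_embeddingE _ _ oU Ue hs).
Qed.

Lemma exceptional_data_exists (Z Z' : X -> nat) : is_cycle phi pi Z -> is_cycle phi pi Z' ->
  exists S unif, [/\ exceptional_data AF O eta S unif, cyc S Z & cyc S Z'].
Proof.
move=> [/finite_seqP[s sE] hZ] [/finite_seqP[s' sE'] hZ'].
pose L := undup (s ++ s').
have inZ x : Z x != 0%N -> x \in s.
  by move=> h; have : [set x | Z x != 0%N] x by []; rewrite sE.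
have inZ' x : Z' x != 0%N -> x \in s'.
  by move=> h; have : [set x | Z' x != 0%N] x by []; rewrite sE'.
have Lexc e : e \in L -> exceptional_prime phi pi e.
  rewrite mem_undup mem_cat => /orP[es|es].
    by apply: hZ; have : [set` s] e by []; rewrite -sE.
  by apply: hZ'; have : [set` s'] e by []; rewrite -sE'.
have /choice[unif hu] e : exists p, e \in L -> p != 0 /\ nmax (O e) = scale_set p (O e).
  have [eL|_] := boolP (e \in L); last by exists 0.
  by have [p hp] := uniformizer pi_res r eta_gen (Lexc e eL).2; exists p.
exists L, unif; split.
- split=> //.
  + exact: undup_uniq.
  + by move=> e /Lexc[Ee _]; apply/(exceptionalP S_Spec pi_res eta_gen r_al).
  + by move=> e /hu[].
  + by move=> e /hu[].
  + exact: (regular_parameters A_noeth A_local A_dim2 A_normal iota res_surj res_ker S_Spec pi_res r_al r_bij A_cat).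
- by move=> x /inZ xs; rewrite mem_undup mem_cat xs.
- by move=> x /inZ' xs; rewrite mem_undup mem_cat xs orbT.
Qed.

Variables (L : seq X) (unif : X -> F).
Hypothesis D : exceptional_data AF O eta L unif.
Local Notation J Y x := (Jmod O unif Y x).
Implicit Types (Y : X -> nat) (x y : X).

Lemma rho_section (U : set X) s x y : open U -> U x -> U y -> ls_sect U s ->
  rho x (s x) = rho y (s y).
Proof. by move=> oU Ux Uy hs; rewrite !(stalk_embeddingE _ _ oU _ hs). Qed.

(** Germs with a common image in F agree near each point with any section through one of them, by
    injectivity of the embeddings. *)
Lemma constant_section (U : set X) (s : forall y : X, stalk y) c : open U ->
  (forall y, U y -> rho y (s y) = c) -> ls_sect U s.
Proof.
move=> oU hs; apply: ls_glue => // x Ux.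
have [W [t [oW Wx ht tx]]] := ls_germ (s x).
have oUW : open (U `&` W) by exact: openI.
exists (U `&` W); split; [by []|by []|by move=> y []|].
have ht' : ls_sect (U `&` W) t by apply: ls_res ht => // y [].
apply: ls_ext ht' => // y [Uy Wy]; apply: (@rinj2 y).
by rewrite hs // (rho_section oW Wy Wx ht) tx hs.
Qed.

Lemma vanishingP Y x a : cyc L Y ->
  ideal_pow (@nonunits (stalk x)) (Y x) a <-> scale_set (unif x ^+ Y x) (O x) (rho x a).
Proof.
move=> cY; have [xL|xL] := boolP (x \in L); last first.
  have /negbNE/eqP -> := contraNN (@cY x) xL; split=> // _.
  by exists (rho x a); [exists a|rewrite expr0 mul1r].
have uE := ed_unif D xL.
have [p _ pE] : O x (unif x).
  have [//] : nmax (O x) (unif x).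
  by rewrite uE; exists 1; [exists 1; rewrite // rmorph1|rewrite mulr1].
rewrite (ideal_pow_principal (p := p)); last first.
  move=> b; rewrite -nmaxP uE -pE; split.
    by move=> [_ [c _ <-]]; rewrite -rmorphM => /rinj2 <-; exists c.
  by move=> [c ->]; exists (rho x c); [exists c|rewrite rmorphM].
rewrite -pE; split.
  by move=> [c ->]; exists (rho x c); [exists c|rewrite rmorphM rmorphXn].
by move=> [_ [c _ <-]]; rewrite -rmorphXn -rmorphM => /rinj2 <-; exists c.
Qed.

Lemma OmZ_Jmod Y U s x : cyc L Y -> open U -> OmZ Y U s -> U x -> J Y x (rho x (s x)).
Proof.
move=> cY oU [hs hv] Ux; exists U; split=> // y Uy.
by rewrite (rho_section oU Ux Uy hs); apply/vanishingP => //; exact: hv.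
Qed.

Lemma Jmod_OmZ Y (U : set X) s c : cyc L Y -> open U ->
  (forall y, U y -> rho y (s y) = c) -> (forall y, U y -> J Y y c) -> OmZ Y U s.
Proof.
move=> cY oU hs hJ; split; first exact: constant_section hs.
move=> x Ux; apply/vanishingP => //; rewrite hs //.
by have [V [oV Vx hV]] := hJ x Ux; exact: hV.
Qed.

Lemma OmZ_stalkP Y x a : cyc L Y -> OmZ_stalk Y a <-> J Y x (rho x a).
Proof.
move=> cY; split; first by move=> [U [s [oU Ux hs <-]]]; exact: (OmZ_Jmod cY oU hs Ux).
move=> [V [oV Vx hV]]; have [W [s [oW Wx hs sx]]] := ls_germ a.
have oVW : open (V `&` W) by exact: openI.
exists (V `&` W), s; split=> //; apply: (@Jmod_OmZ _ _ _ (rho x a)) => // y [Vy Wy].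
  by rewrite -sx; exact: (rho_section oW Wy Wx hs).
by exists V.
Qed.

Lemma I_P Y a : cyc L Y -> I_ phi pi Y a <-> Iglob O unif Y (tofrac a).
Proof.
move=> cY; split=> [h x|h].
  by rewrite -(rhoal x); exact: (OmZ_Jmod cY openT h I).
by apply: (@Jmod_OmZ _ _ _ (tofrac a)) => //; exact: openT.
Qed.

Lemma global_OmZ Y s : cyc L Y -> OmZ Y setT s -> exists c, Iglob O unif Y c /\
  forall x, rho x (s x) = c.
Proof.
move=> cY hs; have [h _] := hs; exists (rho eta (s eta)).
have E x : rho x (s x) = rho eta (s eta) by exact: (rho_section openT I I h).
by split=> // x; rewrite -(E x); exact: (OmZ_Jmod cY openT hs I).
Qed.

Lemma globally_generatedP Y : cyc L Y -> globally_generated Y <-> ggen O unif Y.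
Proof.
move=> cY; split=> [gg x N mN IN c Jc|gg x].
  have [a _ aE] := Jmod_O D cY Jc; rewrite -aE in Jc *.
  move/(OmZ_stalkP _ cY): Jc; rewrite gg => /(_ [set a | N (rho x a)]); apply.
    split=> [|b d|t b] /=; first by rewrite rmorph0; exact: (mod0 mN).
      by rewrite rmorphD; exact: (modD mN).
    by rewrite rmorphM; apply: (modM mN); exists t.
  move=> _ [s hs <-] /=; have [d [Id E]] := global_OmZ cY hs.
  by rewrite E; exact: IN.
have mJ := Jmod_mod D x cY.
apply/seteqP; split=> a.
  move=> /(OmZ_stalkP _ cY) Ja; set G := gen_ideal _.
  have iG : is_ideal G.
    split=> [K [K0 _ _] _ //|b d Gb Gd K iK hK|t b Gb K iK hK]; have [K0 KD KM] := iK.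
      by apply: KD; [exact: Gb|exact: Gd].
    by apply: KM; exact: Gb.
  have [mG _] := im_ideal (rho x) iG.
  apply/(im_memE (@rinj x)); apply: (gg x _ mG) Ja => c Ic.
  have [b _ bE] := Iglob_A D cY Ic; exists (al b x); last by rewrite rhoal.
  move=> K iK; apply; exists (al b) => //; apply/I_P => //.
  by rewrite bE.
move=> /(_ [set a | J Y x (rho x a)]) h; apply/(OmZ_stalkP _ cY); apply: h.
  split=> [|b d|t b] /=; first by rewrite rmorph0; exact: (mod0 mJ).
    by rewrite rmorphD; exact: (modD mJ).
  by rewrite rmorphM; apply: (modM mJ); exists t.
by move=> _ [s hs <-]; exact: (OmZ_Jmod cY openT hs I).
Qed.

Lemma general_elementsP Z Z' f f' : cyc L Z -> cyc L Z' ->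
  general_elements phi pi Z Z' f f' <-> general O unif Z Z' (tofrac f) (tofrac f').
Proof.
move=> cZ cZ'; have cZZ : cyc L (fun x => Z x + Z' x)%N.
  by move=> e; rewrite addn_eq0 negb_and => /orP[/cZ|/cZ'].
have lift Y x c : cyc L Y -> J Y x c -> exists2 a : stalk x, rho x a = c & OmZ_stalk Y a.
  move=> cY Jc; have [a _ aE] := Jmod_O D cY Jc; exists a => //.
  by apply/OmZ_stalkP => //; rewrite aE.
have rE x (a b : stalk x) : rho x (- fun_of phi pi f' x * a + fun_of phi pi f x * b) =
    - tofrac f' * rho x a + tofrac f * rho x b.
  by rewrite rmorphD !rmorphM rmorphN !rhoal.
split.
  move=> [/(I_P _ cZ) If /(I_P _ cZ') If' ex]; split=> // x; have [e1 e2 e3] := ex x; split.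
  - move=> _ [u _ <-]; rewrite -!(rhoal x) -!rmorphM => h h'.
    by rewrite (e1 u) ?rmorph0 //; apply: rinj.
  - move=> a b /(lift _ _ _ cZ)[a' <- Ha] /(lift _ _ _ cZ')[b' <- Hb].
    rewrite -rE => /rinj E; have [u [-> ->]] := e2 a' b' Ha Hb E.
    by exists (rho x u); split; [exists u|rewrite rmorphM rhoal|rewrite rmorphM rhoal].
  - move=> c /(lift _ _ _ cZZ)[c' <- /e3[a [b [Ha Hb ->]]]].
    exists (rho x a), (rho x b); rewrite -rE.
    by split=> //; apply/OmZ_stalkP.
move=> [If If' ex]; split; [exact/I_P|exact/I_P|] => x /=; have [e1 e2 e3] := ex x; split.
- move=> u h h'; apply: rinj; apply: e1; first by exists u.
    by rewrite -(rhoal x) -rmorphM h rmorph0.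
  by rewrite -(rhoal x) -rmorphM h' rmorph0.
- move=> a b /(OmZ_stalkP _ cZ) Ja /(OmZ_stalkP _ cZ') Jb E.
  have [|u [[u' _ <-] ua ub]] := e2 _ _ Ja Jb; first by rewrite -rE E rmorph0.
  by exists u'; split; apply: (@rinj2 x); rewrite rmorphM rhoal.
- move=> c /(OmZ_stalkP _ cZZ)/e3[a [b [/(lift _ _ _ cZ)[a' <- Ha] /(lift _ _ _ cZ')[b' <- Hb] E]]].
  by exists a', b'; split=> //; apply: (@rinj2 x); rewrite rE.
Qed.

Local Notation cadd := (fun (s t : X -> X -> forall y : X, stalk y) => fun x x' y => s x x' y + t x x' y).
Local Notation cact := (fun (a : A) (s : X -> X -> forall y : X, stalk y) => fun x x' y => al a y * s x x' y).

Let al1 y : al (-1) y = -1.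
Proof. by apply: (@rinj2 y); rewrite rhoal !rmorphN !rmorph1. Qed.

Lemma cochain_ext (s t : X -> X -> forall y : X, stalk y) : (forall x x' y, s x x' y = t x x' y) -> s = t.
Proof.
move=> h; apply/funext => x; apply/funext => x'.
by apply: functional_extensionality_dep => y.
Qed.

Lemma cochain_laws : module_laws cadd cact (fun x x' y => 0).
Proof.
split=> [s t u|s t|s|s|a s t]; apply: cochain_ext => x x' y /=.
- exact: addrA.
- exact: addrC.
- exact: add0r.
- by rewrite al1 mulN1r subrr.
- exact: mulrDr.
Qed.

Lemma OmZD Y (U : set X) s t : cyc L Y -> open U -> OmZ Y U s -> OmZ Y U t -> OmZ Y U (fun y => s y + t y).
Proof.
move=> cY oU [hs vs] [ht vt]; split; first exact: sectD.
move=> x Ux; apply/vanishingP => //; rewrite rmorphD.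
have m : is_mod (O x) (scale_set (unif x ^+ Y x) (O x)).
  by apply: scale_mod; apply: mod_subring; exact: im_subring.
by apply: (modD m); apply/vanishingP => //; [exact: vs|exact: vt].
Qed.

Lemma OmZ_act Y (U : set X) a s : cyc L Y -> open U -> OmZ Y U s -> OmZ Y U (fun y => al a y * s y).
Proof.
move=> cY oU [hs vs]; split.
  apply: ls_sectM => //; apply: (ls_res openT oU (fun _ _ => I)).
  exact: (alg_sect S_Spec pi a).
move=> x Ux; apply/vanishingP => //; rewrite rmorphM.
have m : is_mod (O x) (scale_set (unif x ^+ Y x) (O x)).
  by apply: scale_mod; apply: mod_subring; exact: im_subring.
by apply: (modM m); [exists (al a x)|apply/vanishingP => //; exact: vs].
Qed.

Lemma OmZ_res Y (U V : set X) s : open U -> open V -> V `<=` U -> OmZ Y U s -> OmZ Y V s.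
Proof. by move=> oU oV VU [hs vs]; split; [exact: ls_res hs|move=> x /VU; exact: vs]. Qed.

Lemma OmZ0 Y (U : set X) : cyc L Y -> open U -> OmZ Y U (fun=> 0).
Proof.
move=> cY oU; split; first exact: sect0.
by move=> x Ux; apply/vanishingP => //; rewrite rmorph0; exists 0; [exists 0; rewrite // rmorph0|rewrite mulr0].
Qed.

Lemma cocycles_sub Y : cyc L Y -> is_submodule cadd cact (cech_cocycles (OmZ Y)).
Proof.
move=> cY; split.
- exists (fun x x' y => 0), (fun=> setT); first by move=> x; split=> //; exact: openT.
  split=> [x x'|x x' x'' y _ _ _]; last exact: addr0.
  by apply: OmZ0 => //; apply: openI; exact: openT.
- move=> s t [U hU [hs cs]] [V hV [ht ct]]; exists (fun x => U x `&` V x); first exact: cover_meet.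
  have oUV x x' : open ((U x `&` V x) `&` (U x' `&` V x')).
    have [? _] := hU x; have [? _] := hV x; have [? _] := hU x'; have [? _] := hV x'.
    by do ?apply: openI.
  have oU x x' : open (U x `&` U x') by apply: openI; [case: (hU x)|case: (hU x')].
  have oV x x' : open (V x `&` V x') by apply: openI; [case: (hV x)|case: (hV x')].
  split=> [x x'|x x' x'' y [Ux Vx] [Ux' Vx'] [Ux'' Vx'']].
    apply: OmZD => //.
      by apply: (OmZ_res (oU x x')) (hs x x') => // y [[? _] [? _]].
    by apply: (OmZ_res (oV x x')) (ht x x') => // y [[_ ?] [_ ?]].
  by rewrite addrACA cs // ct.
- move=> a s [U hU [hs cs]]; exists U => //; split=> [x x'|x x' x'' y Ux Ux' Ux''].
    by apply: OmZ_act => //; apply: openI; [case: (hU x)|case: (hU x')].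
  by rewrite -mulrDr cs.
Qed.

Lemma coboundaries_sub Y : cyc L Y -> is_submodule cadd cact (cech_coboundaries (OmZ Y)).
Proof.
move=> cY; split.
- exists (fun x x' y => 0), (fun=> setT); first by move=> x; split=> //; exact: openT.
  exists (fun x y => 0); first by move=> x; apply: OmZ0 => //; exact: openT.
  by move=> *; rewrite subrr.
- move=> s t [U hU [a ha hs]] [V hV [b hb ht]]; exists (fun x => U x `&` V x); first exact: cover_meet.
  exists (fun x y => a x y + b x y).
    move=> x; have [oU _] := hU x; have [oV _] := hV x; have oUV : open (U x `&` V x) by exact: openI.
    apply: OmZD => //.
      by apply: (OmZ_res oU) (ha x) => // y [].
    by apply: (OmZ_res oV) (hb x) => // y [].
  by move=> x x' y [Ux Vx] [Ux' Vx']; rewrite hs // ht // opprD addrACA.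
- move=> c s [U hU [a ha hs]]; exists U => //; exists (fun x y => al c y * a x y).
    by move=> x; apply: OmZ_act => //; case: (hU x).
  by move=> x x' y Ux Ux'; rewrite hs // mulrBr.
Qed.

Lemma coboundary_cocycle Y : cyc L Y -> cech_coboundaries (OmZ Y) `<=` cech_cocycles (OmZ Y).
Proof.
move=> cY s [U hU [a ha hs]]; exists U => //; split=> [x x'|x x' x'' y Ux Ux' Ux''].
  have [oU _] := hU x; have [oU' _] := hU x'; have oUU : open (U x `&` U x') by exact: openI.
  have h1 : OmZ Y (U x `&` U x') (a x') by apply: (OmZ_res oU') (ha x') => // y [].
  have h2 : OmZ Y (U x `&` U x') (a x) by apply: (OmZ_res oU) (ha x) => // y [].
  have := OmZD cY oUU h1 (OmZ_act (-1) cY oUU h2); move=> [h h']; split.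
    by apply: ls_ext h => // y [Uy Uy']; rewrite al1 mulN1r hs.
  by move=> y Uyy; have := h' y Uyy; rewrite al1 mulN1r; case: Uyy => Uy Uy'; rewrite hs.
by rewrite !hs // addrC addrA subrK.
Qed.

(** Every member of a pointed cover contains [eta], so a cocycle can be evaluated there; by the
    cocycle relation, the rational functions obtained from the pairs [eta], [x] form a 0-cochain
    with coboundary [s]. *)
Definition cech_trivialization (s : X -> X -> forall y : X, stalk y) (x : X) : F := r (s eta x eta).

(** In the other direction a 0-cochain [v] gives the cocycle with germs [v x' - v x]. Away from the
    cover this function need not lie in the stalk, and there [el] returns some germ of no
    consequence. *)
Lemma cech_lengthP Y n : cyc L Y -> h1 phi pi Y n <->
  has_length (fun (s t : X -> F) (x : X) => s x + t x)
    (fun (a : A) (t : X -> F) (x : X) => emb a * t x) (BB O unif Y) (TT O unif Y) n.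
Proof.
move=> cY.
have covE (U : X -> set X) x : (forall x, open (U x) /\ U x x) -> U x eta.
  by move=> hU; have [oU Ux] := hU x; exact: (eta_gen oU Ux).
have embA a : AF (emb a) by exists a.
have el (c : F) (y : X) : {b : stalk y | O y c -> rho y b = c}.
  apply: cid; have [[b _ bE]|nO] := pselect (O y c); first by exists b.
  by exists 0.
apply: (has_length_iso cochain_laws (functions_laws X emb) (phi := cech_trivialization) _ _
  (cocycles_sub cY) (coboundaries_sub cY) (BB_submodule D embA cY) _ _ _ _
  (TT_submodule D embA cY) (BB_TT D cY) (coboundary_cocycle cY)).
- by move=> s t; apply/funext => x; rewrite /cech_trivialization rmorphD.
- by move=> a s; apply/funext => x; rewrite /cech_trivialization rmorphM r_al.
(* If [s] is the coboundary of [t], evaluation at [eta] gives [t x - t eta]; the constant removes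
   the second term. *)
- move=> s [U hU [t ht hs]]; exists (- r (t eta eta)), U => // x y Uxy.
  have Ue := covE U eta hU; have Uxe := covE U x hU.
  rewrite /cech_trivialization hs // rmorphB opprK subrK -rho_eta.
  have [oU _] := hU x; have [hx _] := ht x.
  by rewrite (rho_section oU Uxe Uxy hx); exact: (OmZ_Jmod cY oU (ht x) Uxy).
- move=> v [U hU hv].
  exists (fun x x' y => sval (el (v x' - v x) y)), (fun=> v eta).
  have E x x' y : U x y -> U x' y -> rho y (sval (el (v x' - v x) y)) = v x' - v x.
    by move=> Ux Ux'; case: el => b /=; apply; apply: (Jmod_O D cY); exact: hv.
  split.
  + exists U => //; split=> [x x'|x x' x'' y Ux Ux' Ux''].
      apply: (@Jmod_OmZ _ _ _ (v x' - v x)) => //.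
      * by apply: openI; [case: (hU x)|case: (hU x')].
      * by move=> y [Ux Ux']; exact: E.
      * by move=> y [Ux Ux']; exact: hv.
    by apply: (@rinj2 y); rewrite rmorphD !E // addrC addrA subrK.
  + exists (v eta), (fun=> setT); first by move=> x; split=> //; exact: openT.
    by move=> x y _; rewrite subrr; exact: (mod0 (Jmod_mod D y cY)).
  + apply/funext => x; rewrite /cech_trivialization -rho_eta E ?subrK //.
      exact: covE.
    exact: covE.
- move=> s [U hU [hs cs]]; exists U => // x x' y Ux Ux'.
  have Ue := covE U eta hU; have Uxe := covE U x hU; have Uxe' := covE U x' hU.
  rewrite /cech_trivialization -(cs eta x x' eta) // rmorphD addrC addKr -rho_eta.
  have oUU : open (U x `&` U x') by apply: openI; [case: (hU x)|case: (hU x')].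
  have [hh _] := hs x x'.
  rewrite (rho_section oUU (conj Uxe Uxe') (conj Ux Ux') hh).
  exact: (OmZ_Jmod cY oUU (hs x x') (conj Ux Ux')).
- move=> s [U hU [hs cs]] [c [V hV ht]]; exists (fun x => U x `&` V x); first exact: cover_meet.
  have E x y : V x y -> rho y (sval (el (cech_trivialization s x - c) y)) = cech_trivialization s x - c.
    by move=> Vx; case: el => b /=; apply; apply: (Jmod_O D cY); exact: ht.
  exists (fun x y => sval (el (cech_trivialization s x - c) y)).
    move=> x; have [oU _] := hU x; have [oV _] := hV x.
    apply: (@Jmod_OmZ _ _ _ (cech_trivialization s x - c)) => //; first exact: openI.
      by move=> y [_ Vy]; exact: E.
    by move=> y [_ Vy]; exact: ht.
  move=> x x' y [Ux Vx] [Ux' Vx']; apply: (@rinj2 y); rewrite rmorphB !E //.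
  have -> (v w u : F) : v - u - (w - u) = v - w by ring.
  have Ue := covE U eta hU; have Uxe := covE U x hU; have Uxe' := covE U x' hU.
  have oUU : open (U x `&` U x') by apply: openI; [case: (hU x)|case: (hU x')].
  have [hh _] := hs x x'.
  rewrite (rho_section oUU (conj Ux Ux') (conj Uxe Uxe') hh) rho_eta.
  by rewrite /cech_trivialization -(cs eta x x' eta) // rmorphD addrC addKr.
Qed.

End Translation.

Lemma add_cycle_cycle (A : comUnitRingType) (S : scheme) (phi : A -> forall s : S, stalk s)
    (X : scheme) (pi : morphism X S) (Z Z' : X -> nat) :
  is_cycle phi pi Z -> is_cycle phi pi Z' -> is_cycle phi pi (add_cycle Z Z').
Proof.
move=> [fZ hZ] [fZ' hZ'].
have split0 x : add_cycle Z Z' x != 0%N -> Z x != 0%N \/ Z' x != 0%N.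
  by rewrite /add_cycle addn_eq0 negb_and => /orP.
split; last by move=> x /split0[/hZ|/hZ'].
apply: (sub_finite_set (B := [set x | Z x != 0%N] `|` [set x | Z' x != 0%N])).
  by move=> x /split0.
by rewrite finite_setU.
Qed.

Theorem theorem3p5
  (A : idomainType)
  (A_excellent : excellent A)
  (A_local : is_local A)
  (A_dim2 : krull_dim A 2)
  (A_normal : normal_domain A)
  (* A contains the algebraically closed field k, isomorphic to A/m *)
  (k : closedFieldType)
  (iota : {rmorphism k -> A})
  (res : {rmorphism A -> k})
  (res_surj : forall c : k, exists a : A, res a = c)
  (res_ker : forall a : A, res a = 0 <-> nonunits a)
  (* the scheme S is Spec A *)
  (S : scheme) (phi : A -> forall s : S, stalk s)
  (S_Spec : is_Spec [set: S] phi)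
  (X : scheme) (pi : morphism X S)
  (pi_resolution : is_resolution pi)
  (Z : X -> nat)
  (Z_pg : pg_cycle phi pi Z)
  (Z' : X -> nat)
  (Z'_pos : positive_cycle phi pi Z')
  (Z'_gen : globally_generated Z') :
  [/\ epsilon phi pi Z Z' 0,
      pg_cycle phi pi Z' <-> pg_cycle phi pi (add_cycle Z Z')
    & pg_cycle phi pi Z' ->
      forall f f' : A, general_elements phi pi Z Z' f f' ->
        I_ phi pi (add_cycle Z Z') =
        [set f * u + f' * v | u in I_ phi pi Z' & v in I_ phi pi Z]].
Proof.
have [A_noeth A_cat _ _] := A_excellent.
have [[Z_cycle Z_pos] Z_gen [n pgn h1Z]] := Z_pg; have [Z'_cycle Z'_nz] := Z'_pos.
have [eta eta_gen [r r_al r_bij]] := generic_point_exists S_Spec pi_resolution.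
have [L [unif [D cZ cZ']]] := exceptional_data_exists A_noeth A_local A_dim2 A_normal iota
  res_surj res_ker S_Spec pi_resolution eta_gen r_al r_bij A_cat Z_cycle Z'_cycle.
have cZZ : cyc L (add_cycle Z Z').
  by move=> x; rewrite /add_cycle addn_eq0 negb_and => /orP[/cZ|/cZ'].
have c0 : cyc L (@zero_cycle X) by [].
have genP Y (cY : cyc L Y) := globally_generatedP S_Spec pi_resolution r_al D cY.
have lenP Y m (cY : cyc L Y) := cech_lengthP S_Spec pi_resolution r_al D m cY.
have IP Y a (cY : cyc L Y) := I_P S_Spec pi_resolution r_al D a cY.
have generalP f f' := general_elementsP S_Spec pi_resolution r_al D f f' cZ cZ'.
have gZ : ggen _ _ _ := (genP Z cZ).1 Z_gen.
have gZ' : ggen _ _ _ := (genP Z' cZ').1 Z'_gen.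
pose emb := @tofrac A : {rmorphism A -> {fraction A}}.
have embA a : range (@tofrac A) (emb a) by exists a.
have h0 := (lenP _ n c0).1 pgn; have hZ := (lenP _ n cZ).1 h1Z.
(* Both the vanishing of [epsilon] and the last claim come from this equality: the quotient defining
   [epsilon] becomes that of an ideal by itself. *)
have ideal_eq f f' : general_elements phi pi Z Z' f f' ->
    I_ phi pi (add_cycle Z Z') = [set f * u + f' * v | u in I_ phi pi Z' & v in I_ phi pi Z].
  move=> /generalP gf.
  have E := ideal_decomposition D embA cZ gZ Z_pos cZ' gZ' h0 hZ gf.
  apply/seteqP; split=> a.
    move=> /(IP _ _ cZZ); rewrite [Iglob _ _ _]E => -[u Iu [v Iv]].
    have [u' _ uE] := Iglob_A D cZ' Iu; have [v' _ vE] := Iglob_A D cZ Iv.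
    rewrite -uE -vE -!rmorphM -rmorphD => /eqP; rewrite tofrac_eq => /eqP <-.
    by exists u'; [apply/IP => //; rewrite uE|exists v' => //; apply/IP => //; rewrite vE].
  move=> [u Iu [v Iv <-]]; apply/IP => //; rewrite [Iglob _ _ _]E.
  exists (tofrac u); first exact/IP.
  by exists (tofrac v); [exact/IP|rewrite -!rmorphM -rmorphD].
have lenZZ m : h1 phi pi Z' m <-> h1 phi pi (add_cycle Z Z') m.
  rewrite lenP // lenP //; exact: (H1_add D embA cZ gZ Z_pos cZ' gZ' h0 hZ).
have gZZ : globally_generated (add_cycle Z Z').
  by apply/genP => //; exact: (ggen_add D cZ gZ cZ' gZ').
have cycZZ := add_cycle_cycle Z_cycle Z'_cycle.
split.
- split.
    have [f [f' gf]] := general_exists D cZ gZ Z_pos cZ' gZ'; have [If If' _] := gf.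
    have [a _ aE] := Iglob_A D cZ If; have [a' _ a'E] := Iglob_A D cZ' If'.
    by exists a, a'; apply/generalP; rewrite aE a'E.
  move=> f f' gf; rewrite /mixed_ideal -(ideal_eq f f' gf); apply: has_length0.
  have MI := Iglob_mod D cZZ.
  split.
  + by exists 0; apply: (IP _ _ cZZ).2; rewrite tofrac0; exact: (mod0 MI).
  + by move=> u v /(IP _ _ cZZ) Iu /(IP _ _ cZZ) Iv; apply: (IP _ _ cZZ).2; rewrite tofracD; exact: (modD MI).
  + by move=> a v /(IP _ _ cZZ) Iv; apply: (IP _ _ cZZ).2; rewrite tofracM; exact: (modM MI).
- split=> [[_ _ [m pgm hm]]|[_ _ [m pgm hm]]].
    split=> //; last by exists m => //; apply/lenZZ.
    split=> //; have [e Ze] := Z_pos; exists e.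
    by rewrite /add_cycle addn_eq0 negb_and Ze.
  by split=> //; exists m => //; apply/lenZZ.
- by move=> _ f f' /ideal_eq.
Qed.
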